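(* Let $\alpha\in(1,2]$ and let $f\in CO(\alpha)$ have the expansion $f(z)=z+\sum_{n=2}^\infty a_nz^n$ in $\mathbb{D}$. Then $$|a_n|\le\frac{1}{2\alpha}A_n(\alpha)\qquad\text{for all }n\ge2,$$ where $A_n(\alpha)$ is defined by $\left(\frac{1+z}{1-z}\right)^{\alpha}=1+\sum_{n=1}^\infty A_n(\alpha)z^n$. In particular, for $f\in CO(2)$ one has the sharp estimate $$\left|a_n-\frac{n+1}{2}\right|\le\frac{n-1}{2}\qquad\text{for all }n\ge2.$$
   Context: $\mathbb{D}=\{z\in\mathbb{C}:|z|<1\}$. For $\alpha\in(1,2]$, $CO(\alpha)$ is the class of analytic functions $f$ mapping $\mathbb{D}$ conformally (univalently) onto a set whose complement $\mathbb{C}\setminus f(\mathbb{D})$ is convex, with $f(1)=\infty$, $f(0)=0$, $f'(0)=1$, and with opening angle of $f(\mathbb{D})$ at $\infty$ at most $\pi\alpha$. (The opening angle at $\infty$ is $2\pi$ minus the angle of the recession cone of the unbounded closed convex set $\mathbb{C}\setminus f(\mathbb{D})$.) ''Sharp'' means that for each $n\ge2$ equality is attained by some $f\in CO(2)$. The power is the branch equal to $1$ at $z=0$. *)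

(* Defs.v *)
From Stdlib Require Import Reals ClassicalEpsilon.
From Coquelicot Require Import Coquelicot.

Open Scope R_scope.

Definition unit_disc (z : C) : Prop := Cmod z < 1.

(* Since [f] has domain [C], the scalar field of [ex_derive] is inferred to be
   [C_AbsRing], so that this is complex differentiability. *)
Definition holomorphic_on (D : C -> Prop) (f : C -> C) : Prop :=
  forall z : C, D z -> ex_derive f z.

Definition injective_on (D : C -> Prop) (f : C -> C) : Prop :=
  forall z w : C, D z -> D w -> f z = f w -> z = w.

Definition image (D : C -> Prop) (f : C -> C) (w : C) : Prop :=
  exists z : C, D z /\ f z = w.

Definition complement (S : C -> Prop) (w : C) : Prop := ~ S w.

Definition convex_set (K : C -> Prop) : Prop :=
  forall (x y : C) (t : R), K x -> K y -> 0 <= t <= 1 ->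
    K (RtoC (1 - t) * x + RtoC t * y)%C.

Definition recession_cone (K : C -> Prop) (v : C) : Prop :=
  forall (x : C) (t : R), K x -> 0 <= t -> K (x + RtoC t * v)%C.

(* The angle of a cone is the arc length of its trace on the unit circle.
   [RInt] is total, with an unspecified value off the integrable functions; the
   trace of a convex cone is an arc, a pair of antipodal points, the circle or
   empty, so its indicator is always Riemann integrable. *)
Definition cone_angle (V : C -> Prop) : R :=
  RInt (fun t : R =>
          if excluded_middle_informative (V (cos t, sin t)) then 1 else 0)
       0 (2 * PI).

(* Meaningful for a domain whose complement is a nonempty unbounded closed
   convex set. *)
Definition opening_angle_at_infinity (G : C -> Prop) : R :=
  2 * PI - cone_angle (recession_cone (complement G)).

(* [f] is a total function, but only its values on the disc matter; the
   condition f(1) = oo is the limit of f at 1 from within the disc.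
   Neither nonemptiness nor unboundedness of the complement is required: the
   complement of the image of a univalent function on the disc is nonempty and
   closed, and unbounded if it is convex. *)
Definition CO (alpha : R) (f : C -> C) : Prop :=
  holomorphic_on unit_disc f /\
  injective_on unit_disc f /\
  convex_set (complement (image unit_disc f)) /\
  filterlim (fun z : C => Cmod (f z))
    (within unit_disc (locally (RtoC 1)))
    (Rbar_locally p_infty) /\
  f (RtoC 0) = RtoC 0 /\
  is_derive f (RtoC 0) (RtoC 1) /\
  opening_angle_at_infinity (image unit_disc f) <= PI * alpha.

Definition expands_on_disc (g : C -> C) (a : nat -> C) : Prop :=
  forall z : C, unit_disc z -> is_pseries a z (g z).

(* w^alpha for Re w > 0, with the argument of w in (-PI/2, PI/2); the value at
   w = 1 is 1. *)
Definition Cpower_right_half_plane (w : C) (alpha : R) : C :=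
  (RtoC (Rpower (Cmod w) alpha) *
   (cos (alpha * atan (Im w / Re w)), sin (alpha * atan (Im w / Re w))))%C.

(* (1+z)/(1-z) maps the unit disc into the right half-plane, so this is the
   branch on the disc with value 1 at z = 0. *)
Definition half_plane_power (alpha : R) (z : C) : C :=
  Cpower_right_half_plane ((RtoC 1 + z) / (RtoC 1 - z))%C alpha.

(* The coefficients A_n(alpha) are real. *)
Definition is_half_plane_power_coeffs (alpha : R) (A : nat -> R) : Prop :=
  A 0%nat = 1 /\
  expands_on_disc (half_plane_power alpha) (fun n => RtoC (A n)).

(* Main.v *)
(* Put p = (1+z)/(1-z), F(p) = f(z), and let K be the convex complement of the image.
   For x in K and lam > 1 the dilation w -> x + lam (w - x) maps the image into itself;
   pulled back by f it is a self-map of the disc, and the Schwarz-Pick lemma along the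
   orbit of 0, in the limit lam -> 1, together with f(1) = oo yields Re F'/(F - x) >= 0.
   Letting x tend to infinity along recession directions of K, the opening angle
   confines F' to a sector of angle PI (alpha - 1). Hence u F' p^(2-alpha) has positive
   real part for some |u| = 1, Caratheodory's inequality bounds its coefficients by 2,
   and a recurrence identifies the resulting bound for f' with n A_n / (2 alpha).

   For alpha = 2, the maximum principle for exp(-N A)/(p+1), where
   A = (F(p) - F(p-s))/F'(p), gives Re A >= 0, hence Re S >= 0 for S = F''/F'. Julia's
   inequality improves this to Re p |S|^2 <= Re S, which says Re z k'/k < 1/2 for
   k = f'(z) (1-z)^3. By Jack's lemma k = 1 + z phi with |phi| <= 1, and the Fejer bound
   for the coefficients of phi gives the second estimate. *)

(* No Cauchy integral is used. The maximum principle comes from the second derivative test, which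
   needs only two complex derivatives; Schwarz's lemma, the open mapping property and f' <> 0 for
   univalent f follow by applying it to quotients such as g^(k+1)/z^k or 1/(f - w), often at a level
   slightly too high, which excludes limit points on the boundary. Coefficients are averages over
   roots of unity, and series given by recurrences are identified through differential equations.
   The obstacle is that neither a smooth boundary of K nor boundary values of f are at hand. The
   first estimate uses dilations centred at points of K, which act on the domain itself; the second
   compares F(p) with F(p - s), whose limits at Re p = Re s are points of K, where the inequality
   from the dilations applies again. The dilations only yield some boundary point t; that t = 1
   follows because |f - x| is nondecreasing along the geodesics towards t and would otherwise stay
   bounded on an approach to 1. The constant 1/2 in Re z k'/k < 1/2 is the one that Jack's lemma
   requires, as Re v/(1+v) = 1/2 for |v| = 1. *)
Require Import Defs.
From Stdlib Require Import Reals.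
From Coquelicot Require Import Coquelicot.
From Stdlib Require Import Lra Lia Psatz Arith ClassicalEpsilon Classical ClassicalChoice.

Open Scope R_scope.

(** * Complex differentiability *)

Lemma Cmod_sqr (z : C) : Cmod z ^ 2 = fst z ^ 2 + snd z ^ 2.
Proof. unfold Cmod. apply pow2_sqrt. nra. Qed.

Lemma Cmod_sub_sym (z w : C) : Cmod (z - w)%C = Cmod (w - z)%C.
Proof. rewrite <- Cmod_opp. f_equal. ring. Qed.

Lemma Cmod_le_sum (z w : C) : Cmod z <= Cmod (z - w)%C + Cmod w.
Proof.
  replace z with ((z - w) + w)%C at 1 by ring. apply Cmod_triangle.
Qed.

Lemma Re_le_Cmod (z : C) : Rabs (fst z) <= Cmod z.
Proof.
  unfold Cmod. rewrite <- sqrt_Rsqr_abs. apply sqrt_le_1_alt. unfold Rsqr. nra.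
Qed.

Lemma Im_le_Cmod (z : C) : Rabs (snd z) <= Cmod z.
Proof.
  unfold Cmod. rewrite <- sqrt_Rsqr_abs. apply sqrt_le_1_alt. unfold Rsqr. nra.
Qed.

Lemma Cmod_le_abs (z : C) : Cmod z <= Rabs (fst z) + Rabs (snd z).
Proof.
  apply Rsqr_incr_0_var.
  - unfold Rsqr. replace (Cmod z * Cmod z) with (Cmod z ^ 2) by ring.
    rewrite Cmod_sqr. unfold Rabs; destruct Rcase_abs; destruct Rcase_abs; nra.
  - pose proof (Rabs_pos (fst z)). pose proof (Rabs_pos (snd z)). lra.
Qed.

Definition ccont (g : C -> C) (z : C) : Prop :=
  forall eps, 0 < eps -> exists del, 0 < del /\
    forall w, Cmod (w - z)%C < del -> Cmod (g w - g z)%C < eps.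

(** The inequality is non-strict so that w = z is allowed, and both sides are measured with
    [Cmod]. *)
Definition cder (g : C -> C) (z d : C) : Prop :=
  forall eps, 0 < eps -> exists del, 0 < del /\
    forall w, Cmod (w - z)%C < del ->
      Cmod (g w - g z - d * (w - z))%C <= eps * Cmod (w - z)%C.

Lemma ccont_ext_loc (g h : C -> C) (z : C) (r : R) :
  0 < r -> (forall w, Cmod (w - z)%C < r -> g w = h w) -> ccont g z -> ccont h z.
Proof.
  intros Hr He Hg eps Heps. destruct (Hg eps Heps) as [d [Hd H]].
  exists (Rmin d r). split. apply Rmin_glb_lt; auto. intros w Hw.
  rewrite <- !He.
  - apply H. eapply Rlt_le_trans. apply Hw. apply Rmin_l.
  - replace (z - z)%C with (RtoC 0) by ring. rewrite Cmod_0. auto.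
  - eapply Rlt_le_trans. apply Hw. apply Rmin_r.
Qed.

Lemma cder_ext_loc (g h : C -> C) (z d : C) (r : R) :
  0 < r -> (forall w, Cmod (w - z)%C < r -> g w = h w) -> cder g z d -> cder h z d.
Proof.
  intros Hr He Hg eps Heps. destruct (Hg eps Heps) as [dl [Hd H]].
  exists (Rmin dl r). split. apply Rmin_glb_lt; auto. intros w Hw.
  rewrite <- !He.
  - apply H. eapply Rlt_le_trans. apply Hw. apply Rmin_l.
  - replace (z - z)%C with (RtoC 0) by ring. rewrite Cmod_0. auto.
  - eapply Rlt_le_trans. apply Hw. apply Rmin_r.
Qed.

Lemma ccont_const (c z : C) : ccont (fun _ => c) z.
Proof.
  intros eps He. exists 1. split. lra. intros. replace (c - c)%C with (RtoC 0) by ring.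
  rewrite Cmod_0. auto.
Qed.

Lemma ccont_id (z : C) : ccont (fun w => w) z.
Proof. intros eps He. exists eps. auto. Qed.

Lemma ccont_plus (g h : C -> C) (z : C) :
  ccont g z -> ccont h z -> ccont (fun w => g w + h w)%C z.
Proof.
  intros Hg Hh eps He. destruct (Hg (eps / 2)) as [d1 [Hd1 H1]]. lra.
  destruct (Hh (eps / 2)) as [d2 [Hd2 H2]]. lra.
  exists (Rmin d1 d2). split. apply Rmin_glb_lt; auto. intros w Hw.
  pose proof (Rmin_l d1 d2). pose proof (Rmin_r d1 d2).
  specialize (H1 w ltac:(lra)). specialize (H2 w ltac:(lra)).
  replace (g w + h w - (g z + h z))%C with ((g w - g z) + (h w - h z))%C by ring.
  eapply Rle_lt_trans. apply Cmod_triangle. lra.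
Qed.

Lemma ccont_mult (g h : C -> C) (z : C) :
  ccont g z -> ccont h z -> ccont (fun w => g w * h w)%C z.
Proof.
  intros Hg Hh eps He.
  pose proof (Cmod_ge_0 (g z)) as G0. pose proof (Cmod_ge_0 (h z)) as H0.
  set (M := Cmod (g z) + Cmod (h z) + 1).
  assert (HM : 0 < M) by (unfold M; lra).
  assert (Hq : 0 < Rmin 1 (eps / (2 * M))).
  { apply Rmin_glb_lt. lra. apply Rdiv_lt_0_compat; lra. }
  destruct (Hg _ Hq) as [d1 [Hd1 H1]]. destruct (Hh _ Hq) as [d2 [Hd2 H2]].
  exists (Rmin d1 d2). split. apply Rmin_glb_lt; auto. intros w Hw.
  pose proof (Rmin_l d1 d2). pose proof (Rmin_r d1 d2).
  specialize (H1 w ltac:(lra)). specialize (H2 w ltac:(lra)).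
  pose proof (Rmin_l 1 (eps / (2 * M))). pose proof (Rmin_r 1 (eps / (2 * M))).
  set (q := Rmin 1 (eps / (2 * M))) in *.
  replace (g w * h w - g z * h z)%C
    with ((g w - g z) * (h w - h z) + (g w - g z) * h z + g z * (h w - h z))%C by ring.
  eapply Rle_lt_trans. apply Cmod_triangle.
  eapply Rle_lt_trans. apply Rplus_le_compat_r. apply Cmod_triangle.
  rewrite !Cmod_mult.
  pose proof (Cmod_ge_0 (g w - g z)%C). pose proof (Cmod_ge_0 (h w - h z)%C).
  assert (Hqm : q * (2 * M) <= eps).
  { apply Rle_trans with (eps / (2 * M) * (2 * M)). apply Rmult_le_compat_r; lra.
    right. field. lra. }
  unfold M in *. nra.
Qed.

Lemma ccont_opp (g : C -> C) (z : C) : ccont g z -> ccont (fun w => - g w)%C z.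
Proof.
  intros Hg eps He. destruct (Hg eps He) as [d [Hd H]]. exists d. split; auto.
  intros w Hw. replace (- g w - - g z)%C with (- (g w - g z))%C by ring.
  rewrite Cmod_opp. auto.
Qed.

Lemma ccont_inv (g : C -> C) (z : C) :
  ccont g z -> g z <> 0%C -> ccont (fun w => / g w)%C z.
Proof.
  intros Hg Hz eps He. assert (Hm : 0 < Cmod (g z)) by (apply Cmod_gt_0; auto).
  set (m := Cmod (g z)) in *.
  assert (Hq : 0 < Rmin (m / 2) (eps * m * m / 4)).
  { apply Rmin_glb_lt. lra. repeat apply Rmult_lt_0_compat; lra. }
  destruct (Hg _ Hq) as [d [Hd H]]. exists d. split; auto. intros w Hw.
  specialize (H w Hw).
  pose proof (Rmin_l (m / 2) (eps * m * m / 4)). pose proof (Rmin_r (m / 2) (eps * m * m / 4)).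
  assert (Hw2 : m / 2 < Cmod (g w)).
  { pose proof (Cmod_le_sum (g z) (g w)). rewrite Cmod_sub_sym in H2. fold m in H2. lra. }
  assert (g w <> 0%C). { intro E. rewrite E, Cmod_0 in Hw2. lra. }
  replace (/ g w - / g z)%C with (- (g w - g z) * / (g w * g z))%C by (field; auto).
  rewrite Cmod_mult, Cmod_opp, Cmod_inv, Cmod_mult. fold m.
  2: { apply Cmult_neq_0; auto. }
  apply Rmult_lt_reg_r with (Cmod (g w) * m). apply Rmult_lt_0_compat; lra.
  rewrite Rmult_assoc, Rinv_l, Rmult_1_r. 2: { apply Rgt_not_eq. apply Rmult_lt_0_compat; lra. }
  apply Rlt_le_trans with (eps * m * m / 4). lra.
  replace (eps * (Cmod (g w) * m)) with (eps * m * Cmod (g w)) by ring.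
  replace (eps * m * m / 4) with (eps * m * (m / 4)) by field.
  apply Rmult_le_compat_l; nra.
Qed.

Lemma ccont_comp (g h : C -> C) (z : C) :
  ccont g z -> ccont h (g z) -> ccont (fun w => h (g w)) z.
Proof.
  intros Hg Hh eps He. destruct (Hh eps He) as [d [Hd H]].
  destruct (Hg d Hd) as [d' [Hd' H']]. exists d'. split; auto.
Qed.

(** Caratheodory's form of differentiability: the difference quotient, given the value d at z
    itself, is continuous there. Sum, product and chain rules become identities between such
    quotients. *)
Lemma cder_cara (g : C -> C) (z d : C) :
  cder g z d <->
  exists q : C -> C, ccont q z /\ q z = d /\ forall w, (g w - g z = q w * (w - z))%C.
Proof.
  split.
  - intros H.
    exists (fun w => if excluded_middle_informative (w = z) then d else ((g w - g z) / (w - z))%C).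
    split; [|split].
    + intros eps He. destruct (H (eps / 2)) as [dl [Hd Hw]]. lra.
      exists dl. split; auto. intros w Hwz.
      destruct (excluded_middle_informative (z = z)) as [_|n]; [|congruence].
      destruct (excluded_middle_informative (w = z)) as [e|n].
      * replace (d - d)%C with (RtoC 0) by ring. rewrite Cmod_0. auto.
      * assert (Hn : (w - z)%C <> 0%C).
        { intro E. apply n. replace w with ((w - z) + z)%C by ring. rewrite E. ring. }
        assert (Hp : 0 < Cmod (w - z)%C) by (apply Cmod_gt_0; auto).
        replace ((g w - g z) / (w - z) - d)%C with ((g w - g z - d * (w - z)) / (w - z))%C
          by (field; auto).
        rewrite Cmod_div; auto. specialize (Hw w Hwz).
        apply Rle_lt_trans with (eps / 2); [|lra].
        apply Rmult_le_reg_r with (Cmod (w - z)%C); auto.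
        unfold Rdiv at 1. rewrite Rmult_assoc, Rinv_l, Rmult_1_r; lra.
    + destruct (excluded_middle_informative (z = z)); congruence.
    + intros w. destruct (excluded_middle_informative (w = z)) as [e|n].
      * subst. ring.
      * field. intro E. apply n. replace w with ((w - z) + z)%C by ring. rewrite E. ring.
  - intros [q [Hq [Hd Hw]]] eps He. destruct (Hq eps He) as [dl [Hdl H]].
    exists dl. split; auto. intros w Hwz.
    rewrite Hw. replace (q w * (w - z) - d * (w - z))%C with ((q w - q z) * (w - z))%C
      by (rewrite Hd; ring).
    rewrite Cmod_mult. apply Rmult_le_compat_r. apply Cmod_ge_0. left. auto.
Qed.

Lemma cder_ccont (g : C -> C) (z d : C) : cder g z d -> ccont g z.
Proof.
  intros H. apply cder_cara in H. destruct H as [q [Hq [_ Hw]]].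
  apply ccont_ext_loc with (fun w => g z + q w * (w - z))%C 1. lra.
  - intros w _. rewrite <- Hw. ring.
  - apply ccont_plus. apply ccont_const. apply ccont_mult; auto.
    apply ccont_plus. apply ccont_id. apply ccont_const.
Qed.

Lemma cder_unique (g : C -> C) (z d d' : C) : cder g z d -> cder g z d' -> d = d'.
Proof.
  intros H1 H2. apply NNPP. intro n.
  assert (Hp : 0 < Cmod (d - d')%C).
  { apply Cmod_gt_0. intro E. apply n. replace d with ((d - d') + d')%C by ring. rewrite E. ring. }
  destruct (H1 (Cmod (d - d')%C / 4)) as [a [Ha A]]. lra.
  destruct (H2 (Cmod (d - d')%C / 4)) as [b [Hb B]]. lra.
  set (t := Rmin a b / 2). assert (Ht : 0 < t). { unfold t. assert (0 < Rmin a b) by (apply Rmin_glb_lt; auto). lra. }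
  assert (E : (z + RtoC t - z)%C = RtoC t) by ring.
  pose proof (Rmin_l a b). pose proof (Rmin_r a b).
  specialize (A (z + RtoC t)%C). specialize (B (z + RtoC t)%C).
  rewrite E, Cmod_R, Rabs_pos_eq in A by lra. rewrite E, Cmod_R, Rabs_pos_eq in B by lra.
  specialize (A ltac:(unfold t in *; lra)). specialize (B ltac:(unfold t in *; lra)).
  assert (Cmod ((d - d') * RtoC t)%C <= Cmod (d - d')%C / 2 * t).
  { replace ((d - d') * RtoC t)%C with
      ((g (z + RtoC t)%C - g z - d' * RtoC t) + - (g (z + RtoC t)%C - g z - d * RtoC t))%C by ring.
    eapply Rle_trans. apply Cmod_triangle. rewrite Cmod_opp. lra. }
  rewrite Cmod_mult, Cmod_R, Rabs_pos_eq in H3 by lra. nra.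
Qed.

Lemma cder_const (c z : C) : cder (fun _ => c) z 0%C.
Proof.
  apply cder_cara. exists (fun _ => 0%C). split. apply ccont_const. split; auto. intros; ring.
Qed.

Lemma cder_id (z : C) : cder (fun w => w) z 1%C.
Proof.
  apply cder_cara. exists (fun _ => 1%C). split. apply ccont_const. split; auto. intros; ring.
Qed.

Lemma cder_plus (g h : C -> C) (z d e : C) :
  cder g z d -> cder h z e -> cder (fun w => g w + h w)%C z (d + e)%C.
Proof.
  intros H1 H2. apply cder_cara in H1. apply cder_cara in H2. apply cder_cara.
  destruct H1 as [q [Hq [<- H1]]]. destruct H2 as [r [Hr [<- H2]]].
  exists (fun w => q w + r w)%C. split. apply ccont_plus; auto. split; auto.
  intros w. replace (g w + h w - (g z + h z))%C with ((g w - g z) + (h w - h z))%C by ring.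
  rewrite H1, H2. ring.
Qed.

Lemma cder_opp (g : C -> C) (z d : C) : cder g z d -> cder (fun w => - g w)%C z (- d)%C.
Proof.
  intros H1. apply cder_cara in H1. apply cder_cara.
  destruct H1 as [q [Hq [<- H1]]].
  exists (fun w => - q w)%C. split. apply ccont_opp; auto. split; auto.
  intros w. replace (- g w - - g z)%C with (- (g w - g z))%C by ring.
  rewrite H1. ring.
Qed.

Lemma cder_mult (g h : C -> C) (z d e : C) :
  cder g z d -> cder h z e -> cder (fun w => g w * h w)%C z (d * h z + g z * e)%C.
Proof.
  intros H1 H2. assert (Hc := cder_ccont _ _ _ H2).
  apply cder_cara in H1. apply cder_cara in H2. apply cder_cara.
  destruct H1 as [q [Hq [<- H1]]]. destruct H2 as [r [Hr [<- H2]]].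
  exists (fun w => q w * h w + g z * r w)%C. split.
  { apply ccont_plus; apply ccont_mult; auto. apply ccont_const. } split; auto.
  intros w. replace (g w * h w - g z * h z)%C with ((g w - g z) * h w + g z * (h w - h z))%C by ring.
  rewrite H1, H2. ring.
Qed.

Lemma cder_inv (g : C -> C) (z d : C) :
  cder g z d -> g z <> 0%C -> cder (fun w => / g w)%C z (- d / (g z * g z))%C.
Proof.
  intros H1 Hz. assert (Hc := cder_ccont _ _ _ H1).
  destruct (Hc (Cmod (g z))) as [r [Hr Hn]]. apply Cmod_gt_0; auto.
  assert (Hnz : forall w, Cmod (w - z)%C < r -> g w <> 0%C).
  { intros w Hw E. specialize (Hn w Hw). rewrite E in Hn.
    replace (0 - g z)%C with (- g z)%C in Hn by ring. rewrite Cmod_opp in Hn. lra. }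
  apply cder_cara in H1. destruct H1 as [q [Hq [<- H1]]].
  assert (Hcc : ccont (fun w => - q w / (g w * g z))%C z).
  { unfold Cdiv. apply ccont_mult. apply ccont_opp; auto.
    apply ccont_inv. apply ccont_mult; auto. apply ccont_const. apply Cmult_neq_0; auto. }
  intros eps He. destruct (Hcc eps He) as [dl [Hdl H]].
  exists (Rmin dl r). split. apply Rmin_glb_lt; auto. intros w Hw.
  pose proof (Rmin_l dl r). pose proof (Rmin_r dl r).
  specialize (H w ltac:(lra)). specialize (Hnz w ltac:(lra)).
  replace (/ g w - / g z - - q z / (g z * g z) * (w - z))%C
    with ((- q w / (g w * g z) - - q z / (g z * g z)) * (w - z))%C.
  - rewrite Cmod_mult. apply Rmult_le_compat_r. apply Cmod_ge_0. left. auto.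
  - assert (E : (/ g w - / g z = - q w / (g w * g z) * (w - z))%C).
    { replace (/ g w - / g z)%C with (- (g w - g z) / (g w * g z))%C by (field; auto).
      rewrite H1. field; auto. }
    rewrite E. field; auto.
Qed.

Lemma cder_comp (g h : C -> C) (z d e : C) :
  cder g z d -> cder h (g z) e -> cder (fun w => h (g w)) z (e * d)%C.
Proof.
  intros H1 H2. assert (Hc := cder_ccont _ _ _ H1).
  apply cder_cara in H1. apply cder_cara in H2. apply cder_cara.
  destruct H1 as [q [Hq [<- H1]]]. destruct H2 as [r [Hr [<- H2]]].
  exists (fun w => r (g w) * q w)%C. split.
  { apply ccont_mult; auto. apply ccont_comp with (h := r); auto. } split; auto.
  intros w. rewrite H2, H1. ring.
Qed.

Lemma cder_eq (g : C -> C) (z d e : C) : cder g z d -> d = e -> cder g z e.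
Proof. intros H <-. auto. Qed.

(** * Repeated complex differentiability on sets *)

Definition copen (U : C -> Prop) : Prop :=
  forall z, U z -> exists r, 0 < r /\ forall w, Cmod (w - z)%C < r -> U w.

(** Without the Cauchy integral one derivative does not yield the next, so the order of
    differentiability is carried explicitly through all operations. The maximum principle consumes
    two orders. *)
Fixpoint hol (n : nat) (U : C -> Prop) (g : C -> C) : Prop :=
  match n with
  | O => forall z, U z -> ccont g z
  | S m => exists g', (forall z, U z -> cder g z (g' z)) /\ hol m U g'
  end.

Lemma hol_cont (n : nat) (U : C -> Prop) (g : C -> C) :
  hol n U g -> forall z, U z -> ccont g z.
Proof.
  destruct n; simpl; auto. intros [g' [H _]] z Hz. eapply cder_ccont. apply H; auto.
Qed.

Lemma hol_pred (n : nat) : forall (U : C -> Prop) (g : C -> C), hol (S n) U g -> hol n U g.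
Proof.
  induction n; intros U g [g' [H1 H2]].
  - intros z Hz. eapply cder_ccont. apply H1; auto.
  - exists g'. split; auto.
Qed.

Lemma hol_sub (n : nat) : forall (U V : C -> Prop) (g : C -> C),
  (forall z, V z -> U z) -> hol n U g -> hol n V g.
Proof.
  induction n; intros U V g HV; simpl; auto. intros [g' [H1 H2]]. exists g'. split; auto.
  eapply IHn; eauto.
Qed.

Lemma hol_ext (n : nat) (U : C -> Prop) (g h : C -> C) :
  copen U -> (forall z, U z -> g z = h z) -> hol n U g -> hol n U h.
Proof.
  intros HU He. destruct n; simpl.
  - intros H z Hz. destruct (HU z Hz) as [r [Hr Hw]].
    apply ccont_ext_loc with g r; auto.
  - intros [g' [H1 H2]]. exists g'. split; auto. intros z Hz. destruct (HU z Hz) as [r [Hr Hw]].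
    apply cder_ext_loc with g r; auto.
Qed.

Lemma hol_const (n : nat) : forall (U : C -> Prop) (c : C), hol n U (fun _ => c).
Proof.
  induction n; intros U c; simpl.
  - intros; apply ccont_const.
  - exists (fun _ => 0%C). split; auto. intros; apply cder_const.
Qed.

Lemma hol_id (n : nat) (U : C -> Prop) : hol n U (fun z => z).
Proof.
  destruct n; simpl.
  - intros; apply ccont_id.
  - exists (fun _ => 1%C). split. intros; apply cder_id. apply hol_const.
Qed.

Lemma hol_plus (n : nat) : forall (U : C -> Prop) (g h : C -> C),
  hol n U g -> hol n U h -> hol n U (fun z => g z + h z)%C.
Proof.
  induction n; intros U g h.
  - intros H1 H2 z Hz. apply ccont_plus; auto.
  - intros [g' [H1 H1']] [h' [H2 H2']]. exists (fun z => g' z + h' z)%C. split; auto.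
    intros; apply cder_plus; auto.
Qed.

Lemma hol_opp (n : nat) : forall (U : C -> Prop) (g : C -> C),
  hol n U g -> hol n U (fun z => - g z)%C.
Proof.
  induction n; intros U g.
  - intros H1 z Hz. apply ccont_opp; auto.
  - intros [g' [H1 H1']]. exists (fun z => - g' z)%C. split; auto.
    intros; apply cder_opp; auto.
Qed.

Lemma hol_minus (n : nat) (U : C -> Prop) (g h : C -> C) :
  hol n U g -> hol n U h -> hol n U (fun z => g z - h z)%C.
Proof. intros. unfold Cminus. apply hol_plus; auto. apply hol_opp; auto. Qed.

Lemma hol_mult (n : nat) : forall (U : C -> Prop) (g h : C -> C),
  hol n U g -> hol n U h -> hol n U (fun z => g z * h z)%C.
Proof.
  induction n; intros U g h.
  - intros H1 H2 z Hz. apply ccont_mult; auto.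
  - intros H1 H2. assert (H1p := hol_pred _ _ _ H1). assert (H2p := hol_pred _ _ _ H2).
    destruct H1 as [g' [H1 H1']]. destruct H2 as [h' [H2 H2']].
    exists (fun z => g' z * h z + g z * h' z)%C. split.
    intros; apply cder_mult; auto. apply hol_plus; auto.
Qed.

Lemma hol_inv (n : nat) : forall (U : C -> Prop) (g : C -> C),
  (forall z, U z -> g z <> 0%C) -> hol n U g -> hol n U (fun z => / g z)%C.
Proof.
  induction n; intros U g Hn.
  - intros H1 z Hz. apply ccont_inv; auto.
  - intros H1. assert (H1p := hol_pred _ _ _ H1). destruct H1 as [g' [H1 H1']].
    exists (fun z => - g' z * (/ g z * / g z))%C. split.
    + intros z Hz. eapply cder_eq. apply cder_inv; auto. specialize (Hn z Hz). field. auto.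
    + apply hol_mult. apply hol_opp; auto. apply hol_mult; auto.
Qed.

Lemma hol_div (n : nat) (U : C -> Prop) (g h : C -> C) :
  (forall z, U z -> h z <> 0%C) -> hol n U g -> hol n U h -> hol n U (fun z => g z / h z)%C.
Proof. intros. unfold Cdiv. apply hol_mult; auto. apply hol_inv; auto. Qed.

Lemma hol_comp (n : nat) : forall (U V : C -> Prop) (g h : C -> C),
  (forall z, U z -> V (g z)) -> hol n U g -> hol n V h -> hol n U (fun z => h (g z)).
Proof.
  induction n; intros U V g h Hm.
  - intros H1 H2 z Hz. apply ccont_comp with (h := h); auto.
  - intros H1 H2. assert (H1p := hol_pred _ _ _ H1). destruct H1 as [g' [H1 H1']].
    destruct H2 as [h' [H2 H2']].
    exists (fun z => h' (g z) * g' z)%C. split.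
    + intros; apply cder_comp with (h := h); auto.
    + apply hol_mult; auto. eapply IHn; eauto.
Qed.

Lemma hol_pow (n : nat) (U : C -> Prop) (g : C -> C) (k : nat) :
  hol n U g -> hol n U (fun z => Cpow (g z) k).
Proof.
  intros H. induction k; simpl. apply hol_const. apply hol_mult; auto.
Qed.

Lemma hol_der (n : nat) (U : C -> Prop) (g g1 : C -> C) :
  copen U -> hol (S n) U g -> (forall z, U z -> cder g z (g1 z)) -> hol n U g1.
Proof.
  intros HU [g' [H1 H2]] H. apply hol_ext with g'; auto.
  intros z Hz. eapply cder_unique; eauto.
Qed.

(** * Sequences, compactness and the maximum modulus principle *)

Definition cvg (s : nat -> C) (l : C) : Prop :=
  forall eps, 0 < eps -> exists N, forall n, (N <= n)%nat -> Cmod (s n - l)%C < eps.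

Lemma cvg_cont (g : C -> C) (s : nat -> C) (l : C) :
  ccont g l -> cvg s l -> cvg (fun n => g (s n)) (g l).
Proof.
  intros Hg Hs eps He. destruct (Hg eps He) as [d [Hd H]]. destruct (Hs d Hd) as [N HN].
  exists N. intros n Hn. auto.
Qed.

Lemma cvg_unique (s : nat -> C) (l l' : C) : cvg s l -> cvg s l' -> l = l'.
Proof.
  intros H1 H2. apply NNPP. intro n.
  assert (Hp : 0 < Cmod (l - l')%C).
  { apply Cmod_gt_0. intro E. apply n. replace l with ((l - l') + l')%C by ring. rewrite E. ring. }
  destruct (H1 (Cmod (l - l')%C / 2)) as [a A]. lra.
  destruct (H2 (Cmod (l - l')%C / 2)) as [b B]. lra.
  specialize (A (max a b) ltac:(lia)). specialize (B (max a b) ltac:(lia)).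
  rewrite Cmod_sub_sym in A.
  assert (Cmod (l - l')%C <= Cmod (l - s (max a b))%C + Cmod (s (max a b) - l')%C).
  { replace (l - l')%C with ((l - s (max a b)) + (s (max a b) - l'))%C by ring. apply Cmod_triangle. }
  lra.
Qed.

Lemma cvg_const (c : C) : cvg (fun _ => c) c.
Proof. intros eps He. exists 0%nat. intros. replace (c - c)%C with (RtoC 0) by ring. rewrite Cmod_0. auto. Qed.

Lemma cvg_plus (s t : nat -> C) (l m : C) : cvg s l -> cvg t m -> cvg (fun n => s n + t n)%C (l + m)%C.
Proof.
  intros Hs Ht eps He. destruct (Hs (eps / 2)) as [a A]. lra. destruct (Ht (eps / 2)) as [b B]. lra.
  exists (max a b). intros n Hn. specialize (A n ltac:(lia)). specialize (B n ltac:(lia)).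
  replace (s n + t n - (l + m))%C with ((s n - l) + (t n - m))%C by ring.
  eapply Rle_lt_trans. apply Cmod_triangle. lra.
Qed.

Lemma cvg_opp (s : nat -> C) (l : C) : cvg s l -> cvg (fun n => - s n)%C (- l)%C.
Proof. intros H. apply cvg_cont with (g := fun z => (- z)%C); auto. apply ccont_opp. apply ccont_id. Qed.

Lemma cvg_bounded (s : nat -> C) (l : C) : cvg s l -> exists M, forall n, Cmod (s n) <= M.
Proof.
  intros H. destruct (H 1) as [N HN]. lra.
  assert (exists M, forall n, (n < N)%nat -> Cmod (s n) <= M) as [M HM].
  { clear HN. induction N. exists 0. intros; lia.
    destruct IHN as [M HM]. exists (Rmax M (Cmod (s N))). intros n Hn.
    destruct (Nat.eq_dec n N). subst. apply Rmax_r. eapply Rle_trans. apply HM. lia. apply Rmax_l. }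
  exists (Rmax M (1 + Cmod l)). intros n. destruct (lt_dec n N).
  - eapply Rle_trans. apply HM; auto. apply Rmax_l.
  - eapply Rle_trans; [|apply Rmax_r]. specialize (HN n ltac:(lia)). pose proof (Cmod_le_sum (s n) l). lra.
Qed.

Lemma cvg_mult (s t : nat -> C) (l m : C) : cvg s l -> cvg t m -> cvg (fun n => s n * t n)%C (l * m)%C.
Proof.
  intros Hs Ht eps He. destruct (cvg_bounded _ _ Hs) as [M HM].
  assert (HM0 : 0 <= M) by (eapply Rle_trans; [apply Cmod_ge_0|apply (HM 0%nat)]).
  pose proof (Cmod_ge_0 m) as Hm0.
  destruct (Hs (eps / 2 / (Cmod m + 1))) as [a A]. { repeat apply Rdiv_lt_0_compat; lra. }
  destruct (Ht (eps / 2 / (M + 1))) as [b B]. { repeat apply Rdiv_lt_0_compat; lra. }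
  exists (max a b). intros n Hn. specialize (A n ltac:(lia)). specialize (B n ltac:(lia)).
  replace (s n * t n - l * m)%C with (s n * (t n - m) + (s n - l) * m)%C by ring.
  eapply Rle_lt_trans. apply Cmod_triangle. rewrite !Cmod_mult.
  assert (Cmod (s n) * Cmod (t n - m)%C <= eps / 2 / (M + 1) * M).
  { rewrite Rmult_comm. apply Rmult_le_compat; try apply Cmod_ge_0; auto. lra. }
  assert (eps / 2 / (M + 1) * M < eps / 2).
  { apply Rmult_lt_reg_r with (M + 1). lra. replace (eps / 2 / (M + 1) * M * (M + 1)) with (eps / 2 * M) by (field; lra). nra. }
  assert (Cmod (s n - l)%C * Cmod m <= eps / 2 / (Cmod m + 1) * Cmod m).
  { apply Rmult_le_compat_r; auto. lra. }
  assert (eps / 2 / (Cmod m + 1) * Cmod m <= eps / 2).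
  { apply Rmult_le_reg_r with (Cmod m + 1). lra.
    replace (eps / 2 / (Cmod m + 1) * Cmod m * (Cmod m + 1)) with (eps / 2 * Cmod m) by (field; lra). nra. }
  lra.
Qed.

Lemma cvg_inv (s : nat -> C) (l : C) : l <> 0%C -> cvg s l -> cvg (fun n => / s n)%C (/ l)%C.
Proof.
  intros Hl H. apply cvg_cont with (g := fun z => (/ z)%C); auto.
  apply ccont_inv; auto. apply ccont_id.
Qed.

Lemma cvg_minus (s t : nat -> C) (l m : C) : cvg s l -> cvg t m -> cvg (fun n => s n - t n)%C (l - m)%C.
Proof. intros. unfold Cminus. apply cvg_plus; auto. apply cvg_opp; auto. Qed.

Lemma cvg_ext (s t : nat -> C) (l : C) : (forall n, s n = t n) -> cvg s l -> cvg t l.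
Proof. intros E H eps He. destruct (H eps He) as [N HN]. exists N. intros. rewrite <- E. auto. Qed.

Lemma cvg_Re (s : nat -> C) (l : C) : cvg s l -> is_lim_seq (fun n => fst (s n)) (fst l).
Proof.
  intros H. apply is_lim_seq_spec. intros eps. destruct (H eps (cond_pos eps)) as [N HN].
  exists N. intros n Hn. specialize (HN n Hn). pose proof (Re_le_Cmod (s n - l)%C). simpl in *. 
  replace (fst (s n) - fst l) with (fst (s n) + - fst l) by ring. lra.
Qed.

Lemma cvg_Cmod (s : nat -> C) (l : C) : cvg s l -> is_lim_seq (fun n => Cmod (s n)) (Cmod l).
Proof.
  intros H. apply is_lim_seq_spec. intros eps. destruct (H eps (cond_pos eps)) as [N HN].
  exists N. intros n Hn. specialize (HN n Hn). pose proof (Cmod_le_sum (s n) l).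
  pose proof (Cmod_le_sum l (s n)). rewrite Cmod_sub_sym in H1.
  unfold Rabs; destruct Rcase_abs; lra.
Qed.

Lemma is_lim_seq_le_const (u : nat -> R) (l c : R) :
  (forall n, u n <= c) -> is_lim_seq u l -> l <= c.
Proof.
  intros H1 H2. assert (Rbar_le l c).
  { apply is_lim_seq_le with u (fun _ => c); auto. apply is_lim_seq_const. }
  auto.
Qed.

Lemma is_lim_seq_ge_const (u : nat -> R) (l c : R) :
  (forall n, c <= u n) -> is_lim_seq u l -> c <= l.
Proof.
  intros H1 H2. assert (Rbar_le c l).
  { apply is_lim_seq_le with (fun _ => c) u; auto. apply is_lim_seq_const. }
  auto.
Qed.

Definition extraction (phi : nat -> nat) : Prop := forall n, (phi n < phi (S n))%nat.

Lemma extraction_mono (phi : nat -> nat) : extraction phi -> forall m n, (m < n)%nat -> (phi m < phi n)%nat.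
Proof. intros H m n Hmn. induction Hmn. apply H. eapply Nat.lt_trans; eauto. Qed.

Lemma extraction_ge (phi : nat -> nat) : extraction phi -> forall n, (n <= phi n)%nat.
Proof. intros H n. induction n. lia. specialize (H n). lia. Qed.

Lemma cvg_sub (s : nat -> C) (l : C) (phi : nat -> nat) :
  (forall n, (n <= phi n)%nat) -> cvg s l -> cvg (fun n => s (phi n)) l.
Proof.
  intros Hp H eps He. destruct (H eps He) as [N HN]. exists N. intros n Hn. apply HN.
  specialize (Hp n). lia.
Qed.

Lemma extraction_exists (P : nat -> nat -> Prop) :
  (forall k N, exists n, (N <= n)%nat /\ P k n) ->
  exists phi, extraction phi /\ forall k, P k (phi k).
Proof.
  intros H.
  pose (c := fun k N => constructive_indefinite_description _ (H k N)).
  pose (phi := fix phi k := match k with O => proj1_sig (c O O) | S j => proj1_sig (c (S j) (S (phi j))) end).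
  exists phi. split.
  - intros n. simpl. destruct (c (S n) (S (phi n))) as [m [Hm Hp]]. simpl. lia.
  - intros k. destruct k; simpl.
    + destruct (c O O) as [m [Hm Hp]]. auto.
    + destruct (c (S k) (S (phi k))) as [m [Hm Hp]]. auto.
Qed.

Lemma real_bw (u : nat -> R) (M : R) : (forall n, Rabs (u n) <= M) ->
  exists phi l, extraction phi /\ is_lim_seq (fun n => u (phi n)) l /\ is_finite l.
Proof.
  intros H. destruct (Bolzano_Weierstrass u (fun x => - M <= x <= M) (compact_P3 (- M) M)) as [l Hl].
  { intros n. specialize (H n). unfold Rabs in H. destruct Rcase_abs in H; lra. }
  destruct (extraction_exists (fun k n => Rabs (u n - l) < / (INR k + 1))) as [phi [He Hp]].
  { intros k N. assert (Hk : 0 < / (INR k + 1)). { apply Rinv_0_lt_compat. pose proof (pos_INR k). lra. }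
    destruct (Hl (disc l (mkposreal _ Hk)) N) as [n [Hn Hd]].
    { exists (mkposreal _ Hk). unfold included. auto. }
    exists n. split; auto. }
  exists phi, (Finite l). split; [|split]; auto.
  - apply is_lim_seq_spec. intros eps.
    destruct (archimed_cor1 eps (cond_pos eps)) as [N [HN HN0]].
    exists N. intros n Hn. eapply Rlt_trans. apply Hp. eapply Rle_lt_trans; [|apply HN].
    apply Rinv_le_contravar. apply lt_0_INR; auto. apply le_INR in Hn. lra.
  - reflexivity.
Qed.

Lemma bw (s : nat -> C) (M : R) : (forall n, Cmod (s n) <= M) ->
  exists phi l, extraction phi /\ cvg (fun n => s (phi n)) l.
Proof.
  intros H.
  destruct (real_bw (fun n => fst (s n)) M) as [p1 [x [E1 [L1 F1]]]].
  { intros n. eapply Rle_trans. apply Re_le_Cmod. auto. }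
  destruct (real_bw (fun n => snd (s (p1 n))) M) as [p2 [y [E2 [L2 F2]]]].
  { intros n. eapply Rle_trans. apply Im_le_Cmod. auto. }
  rewrite <- F1 in L1. rewrite <- F2 in L2.
  exists (fun n => p1 (p2 n)), (real x, real y). split.
  - intros n. apply extraction_mono; auto.
  - intros eps He. apply is_lim_seq_spec in L1. apply is_lim_seq_spec in L2.
    destruct (L1 (mkposreal (eps / 2) ltac:(lra))) as [N1 H1].
    destruct (L2 (mkposreal (eps / 2) ltac:(lra))) as [N2 H2]. simpl in *.
    exists (max N1 N2). intros n Hn.
    specialize (H1 (p2 n)). specialize (H2 n ltac:(lia)).
    pose proof (extraction_ge _ E2 n). specialize (H1 ltac:(lia)).
    eapply Rle_lt_trans. apply Cmod_le_abs. simpl. 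
    unfold Rminus in *. lra.
Qed.

Definition bounded_set (S : C -> Prop) : Prop := exists R, forall z, S z -> Cmod z <= R.
Definition closed_set (S : C -> Prop) : Prop :=
  forall s l, (forall n, S (s n)) -> cvg s l -> S l.

Lemma lim_seq_shift_le (u : nat -> R) (l : R) :
  is_lim_seq u l -> (forall n, INR n <= u n) -> False.
Proof.
  intros H1 H2. assert (is_lim_seq u p_infty).
  { apply is_lim_seq_le_p_loc with INR. exists 0%nat; auto. apply is_lim_seq_INR. }
  apply is_lim_seq_unique in H1. apply is_lim_seq_unique in H. congruence.
Qed.

(** Bolzano-Weierstrass twice, for boundedness and for a maximizing sequence. Continuity is asked
    only along sequences in S with limit in S, so [Phi] may be built from functions that are well
    behaved only on a larger open domain. *)
Lemma compact_max (S : C -> Prop) (Phi : C -> R) (z0 : C) :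
  S z0 -> bounded_set S -> closed_set S ->
  (forall s l, (forall n, S (s n)) -> S l -> cvg s l -> is_lim_seq (fun n => Phi (s n)) (Phi l)) ->
  exists z, S z /\ forall w, S w -> Phi w <= Phi z.
Proof.
  intros H0 [R HR] Hc Hcont.
  assert (Hb : exists M, forall z, S z -> Phi z <= M).
  { apply NNPP. intro Hn.
    assert (forall n, exists z, S z /\ INR n <= Phi z).
    { intros n. apply NNPP. intro Hn2. apply Hn. exists (INR n). intros z Hz.
      apply Rnot_lt_le. intro. apply Hn2. exists z. split; auto. lra. }
    apply choice in H. destruct H as [s Hs].
    destruct (bw s R) as [phi [l [He Hl]]]. intros n; apply HR; apply Hs.
    assert (S l). { apply Hc with (fun n => s (phi n)); auto. intros; apply Hs. }
    assert (L := Hcont (fun n => s (phi n)) l ltac:(intros; apply Hs) H Hl).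
    apply (lim_seq_shift_le _ _ L). intros n. eapply Rle_trans; [|apply Hs].
    apply le_INR. apply extraction_ge; auto. }
  destruct (completeness (fun y => exists z, S z /\ y = Phi z)) as [sup [Hub Hlub]].
  { destruct Hb as [M HM]. exists M. intros y [z [Hz ->]]. auto. }
  { exists (Phi z0), z0. auto. }
  assert (forall n, exists z, S z /\ sup - / (INR n + 1) <= Phi z).
  { intros n. apply NNPP. intro Hn. 
    assert (0 < / (INR n + 1)). { apply Rinv_0_lt_compat. pose proof (pos_INR n). lra. }
    assert (sup <= sup - / (INR n + 1)); [|lra]. apply Hlub. intros y [z [Hz ->]].
    apply Rnot_lt_le. intro. apply Hn. exists z. split; auto. lra. }
  apply choice in H. destruct H as [s Hs].
  destruct (bw s R) as [phi [l [He Hl]]]. intros n; apply HR; apply Hs.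
  assert (Sl : S l). { apply Hc with (fun n => s (phi n)); auto. intros; apply Hs. }
  exists l. split; auto. intros w Hw.
  assert (L := Hcont (fun n => s (phi n)) l ltac:(intros; apply Hs) Sl Hl).
  apply Rle_trans with sup. apply Hub. exists w; auto.
  assert (L2 : is_lim_seq (fun n => sup - / (INR n + 1)) sup).
  { replace (Finite sup) with (Rbar_minus sup 0) by (simpl; f_equal; ring).
    apply is_lim_seq_minus'. apply is_lim_seq_const.
    apply is_lim_seq_spec. intros eps. destruct (archimed_cor1 eps (cond_pos eps)) as [N [HN HN0]].
    exists N. intros n Hn. rewrite Rminus_0_r, Rabs_pos_eq.
    eapply Rle_lt_trans; [|apply HN]. apply Rinv_le_contravar. apply lt_0_INR; auto. apply le_INR in Hn. lra.
    left. apply Rinv_0_lt_compat. pose proof (pos_INR n). lra. }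
  assert (Rbar_le sup (Phi l)); auto.
  apply is_lim_seq_le with (fun n => sup - / (INR n + 1)) (fun n => Phi (s (phi n))); auto.
  intros n. eapply Rle_trans; [|apply Hs]. apply Rplus_le_compat_l. apply Ropp_le_contravar.
  apply Rinv_le_contravar. pose proof (pos_INR n). lra. apply Rplus_le_compat_r. apply le_INR. apply extraction_ge; auto.
Qed.

(** * Second derivatives along lines and the maximum modulus principle *)

Lemma cder_path (g : C -> C) (z c d : C) (t : R) :
  cder g (z + RtoC t * c)%C d ->
  is_derive (fun x : R => fst (g (z + RtoC x * c)%C)) t (fst (d * c)%C) /\
  is_derive (fun x : R => snd (g (z + RtoC x * c)%C)) t (snd (d * c)%C).
Proof.
  intros H.
  assert (K : forall eps, 0 < eps -> exists del, 0 < del /\ forall x, Rabs (x - t) < del ->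
     Cmod (g (z + RtoC x * c)%C - g (z + RtoC t * c)%C - RtoC (x - t) * (d * c))%C <= eps * Rabs (x - t)).
  { intros eps He. pose proof (Cmod_ge_0 c) as Hc0.
    destruct (H (eps / (Cmod c + 1))) as [dl [Hd Hw]]. apply Rdiv_lt_0_compat; lra.
    exists (dl / (Cmod c + 1)). split. apply Rdiv_lt_0_compat; lra. intros x Hx.
    assert (E : (z + RtoC x * c - (z + RtoC t * c))%C = (RtoC (x - t) * c)%C) by (rewrite RtoC_minus; ring).
    assert (Hx2 : Cmod (z + RtoC x * c - (z + RtoC t * c))%C < dl).
    { rewrite E, Cmod_mult, Cmod_R. 
      apply Rle_lt_trans with (Rabs (x - t) * (Cmod c + 1)). apply Rmult_le_compat_l. apply Rabs_pos. lra.
      apply Rmult_lt_reg_r with (/ (Cmod c + 1)). apply Rinv_0_lt_compat; lra.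
      rewrite Rmult_assoc, Rinv_r, Rmult_1_r; lra. }
    specialize (Hw _ Hx2). rewrite E in Hw.
    replace (RtoC (x - t) * (d * c))%C with (d * (RtoC (x - t) * c))%C by ring.
    eapply Rle_trans. apply Hw. rewrite Cmod_mult, Cmod_R.
    apply Rle_trans with (eps / (Cmod c + 1) * (Rabs (x - t) * (Cmod c + 1))).
    apply Rmult_le_compat_l. left; apply Rdiv_lt_0_compat; lra. apply Rmult_le_compat_l. apply Rabs_pos. lra.
    right. field. lra. }
  split; apply is_derive_Reals; intros eps He; destruct (K (eps / 2)) as [dl [Hd Hx]]; try lra;
    exists (mkposreal dl Hd); intros h Hh Hhd; simpl in Hhd;
    specialize (Hx (t + h) ltac:(replace (t + h - t) with h by ring; auto));
    replace (t + h - t) with h in Hx by ring.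
  - set (A := g (z + RtoC (t + h) * c)%C) in *. set (B := g (z + RtoC t * c)%C) in *.
    pose proof (Re_le_Cmod (A - B - RtoC h * (d * c))%C) as Q.
    assert (E1 : fst (A - B - RtoC h * (d * c))%C = fst A - fst B - h * fst (d * c)%C) by (simpl; ring).
    rewrite E1 in Q.
    replace ((fst A - fst B) / h - fst (d * c)%C) with ((fst A - fst B - h * fst (d * c)%C) / h) by (field; auto).
    unfold Rdiv. rewrite Rabs_mult, Rabs_inv.
    assert (0 < Rabs h) by (apply Rabs_pos_lt; auto).
    apply Rmult_lt_reg_r with (Rabs h); auto. rewrite Rmult_assoc, Rinv_l, Rmult_1_r; nra.
  - set (A := g (z + RtoC (t + h) * c)%C) in *. set (B := g (z + RtoC t * c)%C) in *.
    pose proof (Im_le_Cmod (A - B - RtoC h * (d * c))%C) as Q.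
    assert (E1 : snd (A - B - RtoC h * (d * c))%C = snd A - snd B - h * snd (d * c)%C) by (simpl; ring).
    rewrite E1 in Q.
    replace ((snd A - snd B) / h - snd (d * c)%C) with ((snd A - snd B - h * snd (d * c)%C) / h) by (field; auto).
    unfold Rdiv. rewrite Rabs_mult, Rabs_inv.
    assert (0 < Rabs h) by (apply Rabs_pos_lt; auto).
    apply Rmult_lt_reg_r with (Rabs h); auto. rewrite Rmult_assoc, Rinv_l, Rmult_1_r; nra.
Qed.

Lemma local_max_second_derivative (phi dphi : R -> R) (r l : R) :
  0 < r -> (forall t, Rabs t < r -> is_derive phi t (dphi t)) -> is_derive dphi 0 l ->
  (forall t, Rabs t < r -> phi t <= phi 0) -> l <= 0.
Proof.
  intros Hr H1 H2 Hmax. apply Rnot_lt_le. intro Hl.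
  assert (D0 : dphi 0 = 0).
  { assert (Hd : derivable_pt_lim phi 0 (dphi 0)). { apply is_derive_Reals. apply H1. rewrite Rabs_R0; auto. }
    apply Rle_antisym; apply Rnot_lt_le; intro Hs.
    - destruct (Hd (dphi 0 / 2)) as [dl Hdl]. lra.
      set (h := Rmin dl r / 2). assert (Hm : 0 < Rmin dl r) by (apply Rmin_glb_lt; auto; apply cond_pos).
      pose proof (Rmin_l dl r). pose proof (Rmin_r dl r). unfold h in *.
      specialize (Hdl (Rmin dl r / 2) ltac:(lra)). rewrite Rabs_pos_eq in Hdl by lra. specialize (Hdl ltac:(lra)).
      rewrite Rplus_0_l in Hdl.
      specialize (Hmax (Rmin dl r / 2)). rewrite Rabs_pos_eq in Hmax by lra. specialize (Hmax ltac:(lra)).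
      assert ((phi (Rmin dl r / 2) - phi 0) / (Rmin dl r / 2) <= 0).
      { apply Rmult_le_reg_r with (Rmin dl r / 2). lra. unfold Rdiv at 1. rewrite Rmult_assoc, Rinv_l; lra. }
      unfold Rabs in Hdl; destruct Rcase_abs in Hdl; lra.
    - destruct (Hd (- dphi 0 / 2)) as [dl Hdl]. lra.
      assert (Hm : 0 < Rmin dl r) by (apply Rmin_glb_lt; auto; apply cond_pos).
      pose proof (Rmin_l dl r). pose proof (Rmin_r dl r).
      specialize (Hdl (- (Rmin dl r / 2)) ltac:(lra)). rewrite Rabs_Ropp, Rabs_pos_eq in Hdl by lra. specialize (Hdl ltac:(lra)).
      rewrite Rplus_0_l in Hdl.
      specialize (Hmax (- (Rmin dl r / 2))). rewrite Rabs_Ropp, Rabs_pos_eq in Hmax by lra. specialize (Hmax ltac:(lra)).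
      assert (0 <= (phi (- (Rmin dl r / 2)) - phi 0) / - (Rmin dl r / 2)).
      { apply Rmult_le_reg_r with (Rmin dl r / 2). lra.
        replace ((phi (- (Rmin dl r / 2)) - phi 0) / - (Rmin dl r / 2) * (Rmin dl r / 2)) with (phi 0 - phi (- (Rmin dl r / 2))) by (field; lra). lra. }
      unfold Rabs in Hdl; destruct Rcase_abs in Hdl; lra. }
  apply is_derive_Reals in H2. destruct (H2 (l / 2)) as [dl Hdl]. lra.
  assert (Hm : 0 < Rmin dl r) by (apply Rmin_glb_lt; auto; apply cond_pos).
  pose proof (Rmin_l dl r). pose proof (Rmin_r dl r).
  assert (Hpos : forall t, 0 < t < Rmin dl r -> 0 < dphi t).
  { intros t Ht. specialize (Hdl t ltac:(lra)). rewrite Rabs_pos_eq in Hdl by lra. specialize (Hdl ltac:(lra)).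
    rewrite Rplus_0_l, D0, Rminus_0_r in Hdl.
    assert (0 < dphi t / t). { unfold Rabs in Hdl; destruct Rcase_abs in Hdl; lra. }
    replace (dphi t) with (dphi t / t * t) by (field; lra). apply Rmult_lt_0_compat; lra. }
  destruct (MVT_cor2 phi dphi 0 (Rmin dl r / 2)) as [c [Hc1 Hc2]]. lra.
  { intros c Hc. apply is_derive_Reals. apply H1. rewrite Rabs_pos_eq; lra. }
  specialize (Hpos c ltac:(lra)). specialize (Hmax (Rmin dl r / 2)). rewrite Rabs_pos_eq in Hmax by lra.
  specialize (Hmax ltac:(lra)). nra.
Qed.

Lemma sq_path_derive (g g1 : C -> C) (z c : C) (t : R) :
  cder g (z + RtoC t * c)%C (g1 (z + RtoC t * c)%C) ->
  is_derive (fun x : R => Cmod (g (z + RtoC x * c)%C) ^ 2) t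
   (2 * (fst (g (z + RtoC t * c)%C) * fst (g1 (z + RtoC t * c) * c)%C
       + snd (g (z + RtoC t * c)%C) * snd (g1 (z + RtoC t * c) * c)%C)).
Proof.
  intros H. destruct (cder_path _ _ _ _ _ H) as [A B].
  apply is_derive_ext with (fun x : R => fst (g (z + RtoC x * c)%C) ^ 2 + snd (g (z + RtoC x * c)%C) ^ 2).
  { intros x. symmetry. apply Cmod_sqr. }
  evar_last. apply @is_derive_plus; (apply is_derive_pow; [apply A || apply B]).
  unfold plus; simpl. ring.
Qed.

(** Subharmonicity: in the second derivatives along the directions 1 and i the terms with g''
    cancel, as i^2 = -1, and the sum is 4 |g'|^2 + 4 eps > 0. At a local maximum both would be
    nonpositive. *)
Lemma no_local_max (g g1 g2 : C -> C) (z : C) (eps r : R) :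
  0 < eps -> 0 < r ->
  (forall w, Cmod (w - z)%C < r -> cder g w (g1 w) /\ cder g1 w (g2 w)) ->
  (forall w, Cmod (w - z)%C < r ->
     Cmod (g w) ^ 2 + eps * Cmod w ^ 2 <= Cmod (g z) ^ 2 + eps * Cmod z ^ 2) -> False.
Proof.
  intros He Hr Hd Hmax.
  set (P := fun (c : C) (x : R) => Cmod (g (z + RtoC x * c)%C) ^ 2 + eps * Cmod (z + RtoC x * c)%C ^ 2).
  set (Q := fun (c : C) (t : R) => 2 * (fst (g (z + RtoC t * c)%C) * fst (g1 (z + RtoC t * c) * c)%C
       + snd (g (z + RtoC t * c)%C) * snd (g1 (z + RtoC t * c) * c)%C)
       + eps * (2 * (fst (z + RtoC t * c)%C * fst c + snd (z + RtoC t * c)%C * snd c))).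
  assert (Hb : forall c t, Cmod c = 1 -> Rabs t < r -> Cmod ((z + RtoC t * c) - z)%C < r).
  { intros c t Hc Ht. replace ((z + RtoC t * c) - z)%C with (RtoC t * c)%C by ring.
    rewrite Cmod_mult, Hc, Cmod_R, Rmult_1_r. auto. }
  assert (HP : forall c t, Cmod c = 1 -> Rabs t < r -> is_derive (P c) t (Q c t)).
  { intros c t Hc Ht. specialize (Hd _ (Hb c t Hc Ht)). destruct Hd as [Hd1 Hd2].
    unfold P, Q. apply @is_derive_plus. apply sq_path_derive; auto.
    apply is_derive_scal with (k := eps).
    evar_last. apply (sq_path_derive (fun w => w) (fun _ => 1%C)). apply cder_id.
    rewrite !Cmult_1_l. reflexivity. }
  assert (HQ : forall c, Cmod c = 1 -> is_derive (Q c) 0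
     (2 * (fst (g1 z * c)%C ^ 2 + snd (g1 z * c)%C ^ 2 + fst (g z) * fst (g2 z * c * c)%C + snd (g z) * snd (g2 z * c * c)%C)
      + eps * 2)).
  { intros c Hc. assert (E0 : (z + RtoC 0 * c)%C = z) by ring.
    destruct (Hd z) as [D1 D2]. { replace (z - z)%C with (RtoC 0) by ring. rewrite Cmod_0; auto. }
    destruct (cder_path g z c (g1 z) 0) as [A1 A2]. { rewrite E0; auto. }
    destruct (cder_path (fun w => g1 w * c)%C z c (g2 z * c)%C 0) as [B1 B2].
    { rewrite E0. eapply cder_eq. apply cder_mult. apply D2. apply cder_const. cbv beta. ring. }
    destruct (cder_path (fun w => w) z c 1%C 0) as [C1 C2]. { apply cder_id. }
    assert (Hc2 : fst c ^ 2 + snd c ^ 2 = 1) by (rewrite <- Cmod_sqr, Hc; ring).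
    unfold Q. evar_last.
    - apply @is_derive_plus.
      + apply is_derive_scal with (k := 2). apply @is_derive_plus; apply @is_derive_mult; try eassumption; intros; apply Rmult_comm.
      + apply is_derive_scal with (k := eps). apply is_derive_scal with (k := 2).
        apply @is_derive_plus; apply @is_derive_mult; try eassumption; try apply is_derive_const; intros; apply Rmult_comm.
    - unfold plus, mult, zero; cbn -[Cmult Cplus RtoC]. rewrite !E0, !Cmult_1_l.
      replace (2 * (fst c * fst c + 0 * 0 + (snd c * snd c + 0 * 0))) with 2 by nra.
      ring_simplify. 
      replace (eps * 2 * (fst c ^ 2)) with (2 * eps * (fst c ^ 2)) by ring. nra. }
  assert (M : forall c, Cmod c = 1 ->
     2 * (fst (g1 z * c)%C ^ 2 + snd (g1 z * c)%C ^ 2 + fst (g z) * fst (g2 z * c * c)%C + snd (g z) * snd (g2 z * c * c)%C)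
      + eps * 2 <= 0).
  { intros c Hc. apply local_max_second_derivative with (P c) (Q c) r; auto.
    intros t Ht. unfold P. replace (z + RtoC 0 * c)%C with z by ring. apply Hmax. apply Hb; auto. }
  assert (M1 := M 1%C). assert (M2 := M Ci).
  rewrite Cmod_1 in M1. specialize (M1 eq_refl).
  assert (HCi : Cmod Ci = 1). { unfold Cmod, Ci; simpl. replace (0 * (0 * 1) + 1 * (1 * 1)) with 1 by ring. apply sqrt_1. }
  specialize (M2 HCi). simpl in M1, M2. nra.
Qed.

(* The set where |g| >= m is compact, so |g|^2 + eps |z|^2 attains its maximum
   there; for small eps this happens where |g| > m, i.e. at an interior point. *)
Lemma max_modulus (U : C -> Prop) (g : C -> C) (m : R) :
  copen U -> hol 2 U g -> 0 <= m ->
  bounded_set (fun z => U z /\ m <= Cmod (g z)) ->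
  (forall s l, (forall n, U (s n) /\ m <= Cmod (g (s n))) -> cvg s l -> U l) ->
  forall z, U z -> Cmod (g z) <= m.
Proof.
  intros HU [g1 [H1 [g2 [H2 _]]]] Hm [R HR] Hc z0 Hz0. apply Rnot_lt_le. intro Hgt.
  set (S := fun z => U z /\ m <= Cmod (g z)) in *.
  assert (HS0 : S z0) by (split; auto; lra).
  assert (HR0 : 0 <= R). { eapply Rle_trans. apply Cmod_ge_0. apply HR; eauto. }
  set (eps := (Cmod (g z0) ^ 2 - m ^ 2) / (2 * (R ^ 2 + 1))).
  assert (Hgm : 0 < Cmod (g z0) ^ 2 - m ^ 2) by nra.
  assert (Heps : 0 < eps). { apply Rdiv_lt_0_compat; nra. }
  assert (HepsR : eps * R ^ 2 < Cmod (g z0) ^ 2 - m ^ 2).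
  { unfold eps. apply Rmult_lt_reg_r with (2 * (R ^ 2 + 1)). nra.
    replace ((Cmod (g z0) ^ 2 - m ^ 2) / (2 * (R ^ 2 + 1)) * R ^ 2 * (2 * (R ^ 2 + 1)))
     with ((Cmod (g z0) ^ 2 - m ^ 2) * R ^ 2) by (field; nra). nra. }
  destruct (compact_max S (fun z => Cmod (g z) ^ 2 + eps * Cmod z ^ 2) z0) as [z [Hz Hmax]]; auto.
  { exists R; auto. }
  { intros s l Hs Hl. split. eapply Hc; eauto.
    assert (Ul : U l) by (eapply Hc; eauto).
    assert (L := cvg_Cmod _ _ (cvg_cont g s l ltac:(eapply cder_ccont; apply H1; auto) Hl)).
    eapply is_lim_seq_ge_const; [|apply L]. intros n. apply Hs. }
  { intros s l Hs [Ul _] Hl.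
    assert (L := cvg_Cmod _ _ (cvg_cont g s l ltac:(eapply cder_ccont; apply H1; auto) Hl)).
    assert (L2 := cvg_Cmod _ _ Hl).
    apply is_lim_seq_ext with (fun n => Cmod (g (s n)) * Cmod (g (s n)) + eps * (Cmod (s n) * Cmod (s n))).
    { intros; ring. }
    replace (Cmod (g l) ^ 2 + eps * Cmod l ^ 2) with (Cmod (g l) * Cmod (g l) + eps * (Cmod l * Cmod l)) by ring.
    apply is_lim_seq_plus'. apply is_lim_seq_mult'; auto.
    apply is_lim_seq_mult'. apply is_lim_seq_const. apply is_lim_seq_mult'; auto. }
  assert (Hzm : m < Cmod (g z)).
  { specialize (Hmax z0 HS0). pose proof (HR z Hz). pose proof (Cmod_ge_0 z). pose proof (Cmod_ge_0 (g z)).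
    assert (eps * Cmod z ^ 2 <= eps * R ^ 2). { apply Rmult_le_compat_l. lra. apply pow_incr. lra. }
    assert (0 <= eps * Cmod z0 ^ 2). { apply Rmult_le_pos. lra. apply pow2_ge_0. }
    apply Rnot_le_lt. intro. assert (Cmod (g z) ^ 2 <= m ^ 2) by (apply pow_incr; lra). lra. }
  destruct Hz as [Uz _]. destruct (HU z Uz) as [r [Hr Hball]].
  destruct (cder_ccont _ _ _ (H1 z Uz) (Cmod (g z) - m)) as [d [Hd Hcz]]. lra.
  apply (no_local_max g g1 g2 z eps (Rmin r d)); auto. apply Rmin_glb_lt; auto.
  - intros w Hw. pose proof (Rmin_l r d). assert (U w) by (apply Hball; lra). auto.
  - intros w Hw. pose proof (Rmin_l r d). pose proof (Rmin_r r d). apply Hmax. split. apply Hball; lra.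
    specialize (Hcz w ltac:(lra)). pose proof (Cmod_le_sum (g z) (g w)). rewrite Cmod_sub_sym in H3. lra.
Qed.

(** * Exponential and logarithm *)

Lemma Re_plus (z w : C) : Re (z + w)%C = Re z + Re w.
Proof. reflexivity. Qed.
Lemma Re_opp (z : C) : Re (- z)%C = - Re z.
Proof. reflexivity. Qed.
Lemma Re_minus (z w : C) : Re (z - w)%C = Re z - Re w.
Proof. reflexivity. Qed.
Lemma Re_scal (t : R) (z : C) : Re (RtoC t * z)%C = t * Re z.
Proof. unfold Re; simpl; ring. Qed.
Lemma Re_RtoC (t : R) : Re (RtoC t) = t.
Proof. reflexivity. Qed.
Lemma Re_le (z : C) : Re z <= Cmod z.
Proof. eapply Rle_trans. apply Rle_abs. apply Re_le_Cmod. Qed.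
(** The real mean value theorem applied to t -> Re (Cconj D g(z + t (w - z))) with D = g w - g z:
    its total increment is |D|^2, and one factor |D| cancels. *)
Lemma mean_value (g g1 : C -> C) (z w : C) (M : R) :
  (forall t, 0 <= t <= 1 -> cder g (z + RtoC t * (w - z))%C (g1 (z + RtoC t * (w - z))%C)) ->
  (forall t, 0 <= t <= 1 -> Cmod (g1 (z + RtoC t * (w - z))%C) <= M) ->
  Cmod (g w - g z)%C <= M * Cmod (w - z)%C.
Proof.
  intros H1 H2. set (D := (g w - g z)%C). set (c := (w - z)%C) in *.
  set (psi := fun t : R => fst ((fun x => Cconj D * g x)%C (z + RtoC t * c)%C)).
  set (dpsi := fun t : R => fst (Cconj D * g1 (z + RtoC t * c) * c)%C).
  assert (Hd : forall t, 0 <= t <= 1 -> is_derive psi t (dpsi t)).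
  { intros t Ht. apply (cder_path (fun x => Cconj D * g x)%C). eapply cder_eq.
    apply cder_mult. apply cder_const. apply H1; auto. cbv beta. ring. }
  destruct (MVT_cor2 psi dpsi 0 1) as [t [Ht1 Ht2]]. lra.
  { intros t Ht. apply is_derive_Reals. apply Hd; auto. }
  assert (E : psi 1 - psi 0 = Cmod D ^ 2).
  { unfold psi. replace (z + RtoC 1 * c)%C with w by (unfold c; ring).
    replace (z + RtoC 0 * c)%C with z by ring. rewrite Cmod_sqr. unfold D. simpl. ring. }
  assert (B : dpsi t <= Cmod D * (M * Cmod c)).
  { unfold dpsi. eapply Rle_trans. apply Re_le. rewrite !Cmod_mult, Cmod_conj.
    rewrite Rmult_assoc. apply Rmult_le_compat_l. apply Cmod_ge_0.
    apply Rmult_le_compat_r. apply Cmod_ge_0. apply H2; lra. }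
  assert (0 <= M). { eapply Rle_trans. apply Cmod_ge_0. apply (H2 0). lra. }
  pose proof (Cmod_ge_0 D). pose proof (Cmod_ge_0 c).
  rewrite E in Ht1. destruct (Req_dec (Cmod D) 0) as [e|n].
  - rewrite e. apply Rmult_le_pos; auto.
  - apply Rmult_le_reg_l with (Cmod D). lra. nra.
Qed.

Definition cexp (z : C) : C := (exp (fst z) * cos (snd z), exp (fst z) * sin (snd z)).

Lemma cexp_plus (z w : C) : cexp (z + w)%C = (cexp z * cexp w)%C.
Proof.
  unfold cexp; simpl. rewrite exp_plus, cos_plus, sin_plus. apply injective_projections; simpl; ring.
Qed.

Lemma cexp_0 : cexp 0%C = 1%C.
Proof. unfold cexp; simpl. rewrite exp_0, cos_0, sin_0. apply injective_projections; simpl; ring. Qed.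

Lemma Cmod_cexp (z : C) : Cmod (cexp z) = exp (Re z).
Proof.
  unfold Cmod, cexp, Re; simpl.
  replace (exp (fst z) * cos (snd z) * (exp (fst z) * cos (snd z) * 1) + exp (fst z) * sin (snd z) * (exp (fst z) * sin (snd z) * 1))
   with (Rsqr (exp (fst z))).
  - rewrite sqrt_Rsqr; auto. left. apply exp_pos.
  - pose proof (sin2_cos2 (snd z)). unfold Rsqr in *.
    replace (exp (fst z) * cos (snd z) * (exp (fst z) * cos (snd z) * 1) + exp (fst z) * sin (snd z) * (exp (fst z) * sin (snd z) * 1))
    with (exp (fst z) * exp (fst z) * (sin (snd z) * sin (snd z) + cos (snd z) * cos (snd z))) by ring.
    rewrite H. ring.
Qed.

Lemma real_der_est (f : R -> R) (x l : R) : is_derive f x l ->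
  forall eps, 0 < eps -> exists d, 0 < d /\ forall h, Rabs h < d -> Rabs (f (x + h) - f x - l * h) <= eps * Rabs h.
Proof.
  intros H eps He. apply is_derive_Reals in H. destruct (H eps He) as [d Hd].
  exists d. split. apply cond_pos. intros h Hh. destruct (Req_dec h 0) as [->|n].
  - rewrite Rplus_0_r, Rmult_0_r, Rminus_0_r, Rabs_R0. unfold Rminus. rewrite Rplus_opp_r, Rabs_R0. lra.
  - specialize (Hd h n Hh). replace (f (x + h) - f x - l * h) with (((f (x + h) - f x) / h - l) * h) by (field; auto).
    rewrite Rabs_mult. apply Rmult_le_compat_r. apply Rabs_pos. lra.
Qed.

Lemma cder_cexp_0 : cder cexp 0%C 1%C.
Proof.
  intros eps He.
  assert (He2 : 0 < Rmin 1 (eps / 8)) by (apply Rmin_glb_lt; lra).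
  set (e := Rmin 1 (eps / 8)) in *.
  assert (e <= 1) by apply Rmin_l. assert (e <= eps / 8) by apply Rmin_r.
  destruct (real_der_est exp 0 1 ltac:(evar_last; [apply is_derive_exp|apply exp_0]) e He2) as [d1 [Hd1 A]].
  destruct (real_der_est cos 0 0 ltac:(evar_last; [apply is_derive_cos|rewrite sin_0; ring]) e He2) as [d2 [Hd2 B]].
  destruct (real_der_est sin 0 1 ltac:(evar_last; [apply is_derive_sin|apply cos_0]) e He2) as [d3 [Hd3 D]].
  set (d := Rmin (Rmin d1 (Rmin d2 d3)) (e / 2)).
  assert (Hm : 0 < d). { unfold d. repeat apply Rmin_glb_lt; first [assumption|lra]. }
  assert (d <= d1 /\ d <= d2 /\ d <= d3 /\ d <= e / 2) as [L1 [L2 [L3 L4]]].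
  { unfold d. repeat split.
    - eapply Rle_trans. apply Rmin_l. apply Rmin_l.
    - eapply Rle_trans. apply Rmin_l. eapply Rle_trans. apply Rmin_r. apply Rmin_l.
    - eapply Rle_trans. apply Rmin_l. eapply Rle_trans. apply Rmin_r. apply Rmin_r.
    - apply Rmin_r. }
  exists d. split; auto. intros w. replace (w - 0)%C with w by ring. intros Hw.
  rewrite cexp_0. destruct w as [x y].
  pose proof (Re_le_Cmod (x, y)) as Hx. pose proof (Im_le_Cmod (x, y)) as Hy. simpl in Hx, Hy.
  set (m := Cmod (x, y)) in *.
  specialize (A x ltac:(lra)). specialize (B y ltac:(lra)). specialize (D y ltac:(lra)).
  rewrite Rplus_0_l in A, B, D. rewrite exp_0 in A. rewrite cos_0 in B. rewrite sin_0 in D.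
  eapply Rle_trans. apply Cmod_le_abs. unfold cexp; simpl.
  assert (Hex : Rabs (exp x - 1) <= 2 * Rabs x).
  { replace (exp x - 1) with ((exp x - 1 - 1 * x) + x) by ring.
    eapply Rle_trans. apply Rabs_triang. pose proof (Rabs_pos x). nra. }
  assert (Hexb : Rabs (exp x) <= 2).
  { replace (exp x) with ((exp x - 1) + 1) by ring. eapply Rle_trans. apply Rabs_triang. rewrite Rabs_R1. lra. }
  assert (P1 : Rabs (exp x * cos y + - (1) + - (1 * x + - (0 * y))) <= e * m + 2 * (e * m)).
  { replace (exp x * cos y + - (1) + - (1 * x + - (0 * y))) with ((exp x - 1 - 1 * x) + exp x * (cos y - 1 - 0 * y)) by ring.
    eapply Rle_trans. apply Rabs_triang. rewrite Rabs_mult.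
    pose proof (Rabs_pos x). pose proof (Rabs_pos y). pose proof (Rabs_pos (exp x)). pose proof (Rabs_pos (cos y - 1 - 0 * y)).
    apply Rplus_le_compat. nra. apply Rmult_le_compat; auto. nra. }
  assert (P2 : Rabs (exp x * sin y + - (0) + - (1 * y + 0 * x)) <= 2 * (e * m) + e * m).
  { replace (exp x * sin y + - (0) + - (1 * y + 0 * x)) with (exp x * (sin y - 0 - 1 * y) + (exp x - 1) * y) by ring.
    eapply Rle_trans. apply Rabs_triang. rewrite !Rabs_mult.
    pose proof (Rabs_pos x). pose proof (Rabs_pos y). pose proof (Rabs_pos (exp x)). pose proof (Rabs_pos (sin y - 0 - 1 * y)).
    apply Rplus_le_compat. apply Rmult_le_compat; auto. nra.
    apply Rmult_le_compat; auto. apply Rabs_pos. lra. }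
  assert (0 <= m) by apply Cmod_ge_0.
  eapply Rle_trans. apply Rplus_le_compat. apply P1. apply P2. nra.
Qed.

Lemma cder_cexp (z : C) : cder cexp z (cexp z).
Proof.
  apply cder_ext_loc with (fun w => cexp z * cexp (w + - z))%C 1. lra.
  { intros w _. rewrite <- cexp_plus. f_equal. ring. }
  eapply cder_eq. apply cder_mult. apply cder_const.
  apply (cder_comp (fun w => w + - z)%C cexp). apply cder_plus. apply cder_id. apply cder_const.
  replace (z + - z)%C with (RtoC 0) by ring. apply cder_cexp_0. cbv beta. ring.
Qed.

Lemma hol_cexp (n : nat) (U : C -> Prop) : hol n U cexp.
Proof.
  induction n; simpl. intros; eapply cder_ccont; apply cder_cexp.
  exists cexp. split; auto. intros; apply cder_cexp.
Qed.

Definition clog (w : C) : C := (ln (Cmod w), atan (snd w / fst w)).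

Lemma cexp_clog (w : C) : 0 < Re w -> cexp (clog w) = w.
Proof.
  unfold Re. destruct w as [x y]. simpl. intros Hx.
  assert (Hm : 0 < Cmod (x, y)). { apply Cmod_gt_0. intro E. inversion E. lra. }
  unfold cexp, clog; simpl. rewrite exp_ln; auto.
  assert (Hs : sqrt (1 + (y / x)²) = Cmod (x, y) / x).
  { rewrite <- (sqrt_Rsqr (Cmod (x, y) / x)) by (left; apply Rdiv_lt_0_compat; auto).
    f_equal. pose proof (Cmod_sqr (x, y)) as E. simpl in E. unfold Rsqr.
    replace (Cmod (x, y) / x * (Cmod (x, y) / x)) with ((Cmod (x, y) * (Cmod (x, y) * 1)) / (x * x)) by (field; lra).
    rewrite E. field. lra. }
  rewrite cos_atan, sin_atan, Hs. f_equal; field; split; lra.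
Qed.

Lemma Rabs_atan_lt (x : R) : Rabs (atan x) < PI / 2.
Proof. pose proof (atan_bound x). unfold Rabs; destruct Rcase_abs; lra. Qed.

Lemma real_cont_est (f : R -> R) (x l : R) : is_derive f x l ->
  forall eps, 0 < eps -> exists d, 0 < d /\ forall y, Rabs (y - x) < d -> Rabs (f y - f x) < eps.
Proof.
  intros H eps He. destruct (real_der_est f x l H 1 ltac:(lra)) as [d [Hd A]].
  pose proof (Rabs_pos l).
  exists (Rmin d (eps / (2 * (Rabs l + 1)))). split.
  { apply Rmin_glb_lt; auto. apply Rdiv_lt_0_compat; lra. }
  intros y Hy. pose proof (Rmin_l d (eps / (2 * (Rabs l + 1)))). pose proof (Rmin_r d (eps / (2 * (Rabs l + 1)))).
  specialize (A (y - x) ltac:(lra)). replace (x + (y - x)) with y in A by ring.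
  replace (f y - f x) with ((f y - f x - l * (y - x)) + l * (y - x)) by ring.
  eapply Rle_lt_trans. apply Rabs_triang. rewrite Rabs_mult.
  apply Rle_lt_trans with ((Rabs l + 1) * Rabs (y - x)). lra.
  apply Rle_lt_trans with ((Rabs l + 1) * (eps / (2 * (Rabs l + 1)))). apply Rmult_le_compat_l; lra.
  replace ((Rabs l + 1) * (eps / (2 * (Rabs l + 1)))) with (eps / 2) by (field; lra). lra.
Qed.

Lemma ccont_clog (w : C) : 0 < Re w -> ccont clog w.
Proof.
  unfold Re. intros Hx eps He.
  assert (Hm : 0 < Cmod w). { apply Cmod_gt_0. intro E. rewrite E in Hx. simpl in Hx. lra. }
  destruct (real_cont_est ln (Cmod w) (/ Cmod w) (is_derive_ln _ Hm) (eps / 2)) as [d1 [Hd1 A]]. lra.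
  destruct (real_cont_est atan (snd w / fst w) (/ (1 + (snd w / fst w)²)) (is_derive_atan _) (eps / 2)) as [d2 [Hd2 B]]. lra.
  assert (Hq : exists d, 0 < d /\ forall v, Cmod (v - w)%C < d -> Rabs (snd v / fst v - snd w / fst w) < d2).
  { assert (HV : ccont (fun v => RtoC (snd v) / RtoC (fst v))%C w).
    { unfold Cdiv. apply ccont_mult.
      - intros e Hee. exists e. split; auto. intros v Hv. rewrite <- RtoC_minus, Cmod_R.
        eapply Rle_lt_trans; [|apply Hv]. apply (Im_le_Cmod (v - w)%C).
      - apply ccont_inv. intros e Hee. exists e. split; auto. intros v Hv. rewrite <- RtoC_minus, Cmod_R.
        eapply Rle_lt_trans; [|apply Hv]. apply (Re_le_Cmod (v - w)%C).
        intro E. apply RtoC_inj in E. lra. }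
    destruct (HV d2 Hd2) as [d [Hd Q]]. exists (Rmin d (fst w)). split. apply Rmin_glb_lt; auto.
    intros v Hv. pose proof (Rmin_l d (fst w)). pose proof (Rmin_r d (fst w)).
    specialize (Q v ltac:(lra)). 
    assert (fst v <> 0). { pose proof (Re_le_Cmod (v - w)%C). simpl in H1. unfold Rabs in H1; destruct Rcase_abs in H1; lra. }
    rewrite <- !RtoC_div in Q by lra. rewrite <- RtoC_minus, Cmod_R in Q. auto. }
  destruct Hq as [d3 [Hd3 Q]].
  exists (Rmin d1 d3). split. apply Rmin_glb_lt; auto. intros v Hv.
  pose proof (Rmin_l d1 d3). pose proof (Rmin_r d1 d3).
  eapply Rle_lt_trans. apply Cmod_le_abs. unfold clog; simpl.
  assert (HA : Rabs (Cmod v - Cmod w) < d1).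
  { pose proof (Cmod_le_sum v w). pose proof (Cmod_le_sum w v). rewrite Cmod_sub_sym in H2.
    unfold Rabs; destruct Rcase_abs; lra. }
  specialize (A _ HA). specialize (Q v ltac:(lra)). specialize (B _ Q). unfold Rminus in *. lra.
Qed.

(** With q the difference quotient of [cexp] at [clog w], one has clog v - clog w = (v - w)/q(clog
    v), so that continuity of [clog] is enough. *)
Lemma cder_clog (w : C) : 0 < Re w -> cder clog w (/ w)%C.
Proof.
  intros Hx. assert (Hc := ccont_clog w Hx).
  destruct (proj1 (cder_cara _ _ _) (cder_cexp (clog w))) as [q [Hq [Hq1 Hq2]]].
  rewrite cexp_clog in Hq1 by auto.
  assert (Hw : w <> 0%C). { intro E. rewrite E in Hx. unfold Re in Hx; simpl in Hx. lra. }
  assert (HQ : ccont (fun v => q (clog v)) w) by (apply ccont_comp with (h := q); auto).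
  assert (HQi : ccont (fun v => / q (clog v))%C w). { apply ccont_inv; auto. rewrite Hq1. auto. }
  destruct (HQ (Cmod w)) as [d1 [Hd1 A]]. { apply Cmod_gt_0; auto. }
  intros eps He. destruct (HQi eps He) as [d2 [Hd2 B]].
  exists (Rmin (Re w) (Rmin d1 d2)). split. { repeat apply Rmin_glb_lt; auto. }
  intros v Hv. pose proof (Rmin_l (Re w) (Rmin d1 d2)). pose proof (Rmin_r (Re w) (Rmin d1 d2)).
  pose proof (Rmin_l d1 d2). pose proof (Rmin_r d1 d2).
  assert (Hv0 : 0 < Re v). { pose proof (Re_le_Cmod (v - w)%C). unfold Re in *. simpl in H3. unfold Rabs in H3; destruct Rcase_abs in H3; lra. }
  specialize (A v ltac:(lra)). specialize (B v ltac:(lra)).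
  assert (Hqn : q (clog v) <> 0%C).
  { intro E. rewrite E, Hq1 in A. replace (0 - w)%C with (- w)%C in A by ring. rewrite Cmod_opp in A. lra. }
  specialize (Hq2 (clog v)). rewrite !cexp_clog in Hq2 by auto.
  assert (E : (clog v - clog w = / q (clog v) * (v - w))%C). { rewrite Hq2. field; auto. }
  rewrite E. rewrite Hq1 in B.
  replace (/ q (clog v) * (v - w) - / w * (v - w))%C with ((/ q (clog v) - / w) * (v - w))%C by ring.
  rewrite Cmod_mult. apply Rmult_le_compat_r. apply Cmod_ge_0. left; auto.
Qed.

(** * The maximum principle on discs *)

Definition odisc (z0 : C) (r : R) (z : C) : Prop := Cmod (z - z0)%C < r.

Lemma copen_odisc (z0 : C) (r : R) : copen (odisc z0 r).
Proof.
  intros z Hz. exists (r - Cmod (z - z0)%C). unfold odisc in *. split. lra. intros w Hw.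
  replace (w - z0)%C with ((w - z) + (z - z0))%C by ring.
  eapply Rle_lt_trans. apply Cmod_triangle. lra.
Qed.

Lemma copen_and (U V : C -> Prop) : copen U -> copen V -> copen (fun z => U z /\ V z).
Proof.
  intros HU HV z [Hu Hv]. destruct (HU z Hu) as [r [Hr A]]. destruct (HV z Hv) as [s [Hs B]].
  exists (Rmin r s). split. apply Rmin_glb_lt; auto. intros w Hw.
  pose proof (Rmin_l r s). pose proof (Rmin_r r s). split; [apply A|apply B]; lra.
Qed.

Lemma copen_neq (z0 : C) : copen (fun z => z <> z0).
Proof.
  intros z Hz. exists (Cmod (z - z0)%C). split.
  - apply Cmod_gt_0. intro E. apply Hz. replace z with ((z - z0) + z0)%C by ring. rewrite E. ring.
  - intros w Hw E. subst. rewrite Cmod_sub_sym in Hw. lra.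
Qed.

Lemma Cminus_neq (z w : C) : z <> w -> (z - w)%C <> 0%C.
Proof. intros H E. apply H. replace z with ((z - w) + w)%C by ring. rewrite E. ring. Qed.

Lemma cvg_dist_le (s : nat -> C) (l z0 : C) (r : R) :
  (forall n, Cmod (s n - z0)%C <= r) -> cvg s l -> Cmod (l - z0)%C <= r.
Proof.
  intros H1 H2. eapply is_lim_seq_le_const. apply H1.
  apply (cvg_Cmod (fun n => s n - z0)%C). apply cvg_minus; auto. apply cvg_const.
Qed.

(** If |g z| > M, the level halfway between M and |g z| is strictly above the values on the circle,
    so no sequence in the superlevel set can converge to the circle and [max_modulus] applies at
    that level. *)
Lemma max_disc (U : C -> Prop) (g : C -> C) (z0 : C) (r M : R) :
  (forall z, Cmod (z - z0)%C <= r -> U z) -> hol 2 U g ->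
  (forall z, Cmod (z - z0)%C = r -> Cmod (g z) <= M) -> 0 <= M ->
  forall z, Cmod (z - z0)%C < r -> Cmod (g z) <= M.
Proof.
  intros HU Hg HM HM0 z Hz. apply Rnot_lt_le. intro Hgt.
  assert (Hm : Cmod (g z) <= (M + Cmod (g z)) / 2); [|lra].
  apply max_modulus with (U := odisc z0 r); auto.
  - apply copen_odisc.
  - eapply hol_sub; [|apply Hg]. intros w Hw. apply HU. unfold odisc in Hw. lra.
  - lra.
  - exists (r + Cmod z0). intros w [Hw _]. unfold odisc in Hw. pose proof (Cmod_le_sum w z0). lra.
  - intros s l Hs Hl. unfold odisc.
    assert (Hle : Cmod (l - z0)%C <= r).
    { apply cvg_dist_le with s; auto. intros n. destruct (Hs n) as [A _]. unfold odisc in A. lra. }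
    destruct Hle; auto. exfalso. specialize (HM l H).
    assert ((M + Cmod (g z)) / 2 <= Cmod (g l)); [|lra].
    eapply is_lim_seq_ge_const. intros n. apply (Hs n). apply cvg_Cmod. apply cvg_cont; auto.
    eapply hol_cont. apply Hg. apply HU. lra.
Qed.

Lemma bounded_on_disc (g : C -> C) (z0 : C) (r : R) : 0 <= r ->
  (forall z, Cmod (z - z0)%C <= r -> ccont g z) ->
  exists M, 0 <= M /\ forall z, Cmod (z - z0)%C <= r -> Cmod (g z) <= M.
Proof.
  intros Hr Hg. destruct (compact_max (fun z => Cmod (z - z0)%C <= r) (fun z => Cmod (g z)) z0) as [z [Hz Hm]].
  - replace (z0 - z0)%C with (RtoC 0) by ring. rewrite Cmod_0; auto.
  - exists (r + Cmod z0). intros w Hw. pose proof (Cmod_le_sum w z0). lra.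
  - intros s l Hs Hl. apply cvg_dist_le with s; auto.
  - intros s l Hs Sl Hl. apply cvg_Cmod. apply cvg_cont; auto.
  - exists (Cmod (g z)). split; auto. apply Cmod_ge_0.
Qed.

Lemma min_on_circle (g : C -> C) (z0 : C) (r : R) : 0 <= r ->
  (forall z, Cmod (z - z0)%C = r -> ccont g z) -> (forall z, Cmod (z - z0)%C = r -> g z <> 0%C) ->
  exists m, 0 < m /\ forall z, Cmod (z - z0)%C = r -> m <= Cmod (g z).
Proof.
  intros Hr Hg Hn. destruct (compact_max (fun z => Cmod (z - z0)%C = r) (fun z => - Cmod (g z)) (z0 + RtoC r)%C) as [z [Hz Hm]].
  - replace (z0 + RtoC r - z0)%C with (RtoC r) by ring. rewrite Cmod_R. apply Rabs_pos_eq; auto.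
  - exists (r + Cmod z0). intros w Hw. pose proof (Cmod_le_sum w z0). lra.
  - intros s l Hs Hl. 
    assert (L : is_lim_seq (fun n => Cmod (s n - z0)%C) (Cmod (l - z0)%C)).
    { apply (cvg_Cmod (fun n => s n - z0)%C). apply cvg_minus; auto. apply cvg_const. }
    assert (L2 : is_lim_seq (fun n => Cmod (s n - z0)%C) r).
    { apply is_lim_seq_ext with (fun _ => r). intros; symmetry; apply Hs. apply is_lim_seq_const. }
    apply is_lim_seq_unique in L. apply is_lim_seq_unique in L2. rewrite L in L2. injection L2; auto.
  - intros s l Hs Sl Hl. apply (is_lim_seq_opp _ (Cmod (g l))). apply cvg_Cmod. apply cvg_cont; auto.
  - exists (Cmod (g z)). split. apply Cmod_gt_0; auto. intros w Hw. specialize (Hm w Hw). lra.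
Qed.

Lemma zero_derivative_const (U : C -> Prop) (g : C -> C) (z w : C) :
  (forall t, 0 <= t <= 1 -> U (z + RtoC t * (w - z))%C) ->
  (forall x, U x -> cder g x 0%C) -> g w = g z.
Proof.
  intros H1 H2. assert (Cmod (g w - g z)%C <= 0 * Cmod (w - z)%C).
  { apply mean_value with (fun _ => 0%C). intros; apply H2; auto. intros. rewrite Cmod_0. lra. }
  apply NNPP. intro n. assert (0 < Cmod (g w - g z)%C). apply Cmod_gt_0. apply Cminus_neq; auto. lra.
Qed.

(** * Univalent functions *)

Definition analytic (U : C -> Prop) (g : C -> C) : Prop := forall n, hol n U g.

Lemma analytic_der (U : C -> Prop) (g : C -> C) : copen U -> analytic U g ->
  exists g1, (forall z, U z -> cder g z (g1 z)) /\ analytic U g1.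
Proof.
  intros HU Hg. destruct (Hg 1%nat) as [g1 [H1 _]]. exists g1. split; auto.
  intros n. apply hol_der with g; auto.
Qed.

Lemma analytic_sub (U V : C -> Prop) (g : C -> C) : (forall z, V z -> U z) -> analytic U g -> analytic V g.
Proof. intros H Hg n. eapply hol_sub; eauto. Qed.

Lemma Cmod_diff_0 (z : C) : Cmod (z - z)%C = 0.
Proof. replace (z - z)%C with (RtoC 0) by ring. apply Cmod_0. Qed.

(** Induction on k through the derivative: by the mean value inequality a leading term c (w - z0)^j
    of g' integrates to c/(j+1) (w - z0)^(j+1), and a flat bound for g' gains one power. This takes
    the place of a Taylor expansion at z0. *)
Lemma zero_order (k : nat) : forall (z0 : C) (r : R) (g : C -> C), 0 < r -> analytic (odisc z0 r) g ->
  (exists (j : nat) (c : C), c <> 0%C /\ forall eps, 0 < eps -> exists d, 0 < d /\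
     forall w, Cmod (w - z0)%C < d -> Cmod (g w - c * (w - z0) ^ j)%C <= eps * Cmod (w - z0)%C ^ j) \/
  (exists M d, 0 < d /\ forall w, Cmod (w - z0)%C < d -> Cmod (g w) <= M * Cmod (w - z0)%C ^ k).
Proof.
  induction k; intros z0 r g Hr Hg.
  - right. assert (Hc : ccont g z0). { apply (Hg 0%nat). unfold odisc. rewrite Cmod_diff_0; auto. }
    destruct (Hc 1) as [d [Hd H]]. lra. exists (Cmod (g z0) + 1), d. split; auto.
    intros w Hw. specialize (H w Hw). pose proof (Cmod_le_sum (g w) (g z0)). simpl. lra.
  - assert (Hz0 : odisc z0 r z0). { unfold odisc. rewrite Cmod_diff_0; auto. }
    destruct (classic (g z0 = 0%C)) as [H0|H0].
    2: { left. exists 0%nat, (g z0). split; auto. intros eps He.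
      destruct (Hg 0%nat z0 Hz0 eps He) as [d [Hd H]]. exists d. split; auto. intros w Hw.
      specialize (H w Hw). simpl. replace (g w - g z0 * 1)%C with (g w - g z0)%C by ring. lra. }
    destruct (analytic_der _ g (copen_odisc z0 r) Hg) as [g1 [D1 A1]].
    assert (Hseg : forall w t, 0 <= t <= 1 -> Cmod (z0 + RtoC t * (w - z0) - z0)%C <= Cmod (w - z0)%C).
    { intros w t Ht. replace (z0 + RtoC t * (w - z0) - z0)%C with (RtoC t * (w - z0))%C by ring.
      rewrite Cmod_mult, Cmod_R, Rabs_pos_eq by lra. pose proof (Cmod_ge_0 (w - z0)%C). nra. }
    destruct (IHk z0 r g1 Hr A1) as [[j [c [Hc H]]]|[M [d [Hd H]]]].
    + left. exists (S j), (c / RtoC (INR (S j)))%C.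
      assert (Hj : 0 < INR (S j)) by (apply lt_0_INR; lia).
      assert (HjC : RtoC (INR (S j)) <> 0%C). { intro E. apply RtoC_inj in E. lra. }
      split. { unfold Cdiv. apply Cmult_neq_0; auto. intro E. apply HjC.
        rewrite <- (Cmult_1_r (RtoC (INR (S j)))). rewrite <- (Cinv_r (RtoC (INR (S j)))) by auto.
        rewrite E. ring. }
      intros eps He. destruct (H eps He) as [d [Hd Hw]]. exists (Rmin d r). split. apply Rmin_glb_lt; auto.
      intros w Hwd. pose proof (Rmin_l d r). pose proof (Rmin_r d r).
      assert (Hpow : forall (n : nat) (x : C), cder (fun v => (v - z0) ^ (S n))%C x (RtoC (INR (S n)) * (x - z0) ^ n)%C).
      { induction n; intros x.
        - eapply cder_eq. apply cder_mult. apply cder_plus. apply cder_id. apply cder_const. apply cder_const.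
          cbv beta. simpl. ring.
        - eapply cder_eq. apply (cder_mult (fun v => v - z0)%C (fun v => (v - z0) ^ S n)%C). apply cder_plus. apply cder_id. apply cder_const. apply IHn.
          cbv beta. rewrite (S_INR (S n)). rewrite RtoC_plus. simpl. ring. }
      assert (MV := mean_value (fun v => g v - (c / RtoC (INR (S j))) * (v - z0) ^ S j)%C
        (fun v => g1 v - c * (v - z0) ^ j)%C z0 w (eps * Cmod (w - z0)%C ^ j)).
      cbv beta in MV. rewrite H0 in MV.
      replace (g w - c / RtoC (INR (S j)) * (w - z0) ^ S j - (0 - c / RtoC (INR (S j)) * (z0 - z0) ^ S j))%C
        with (g w - c / RtoC (INR (S j)) * (w - z0) ^ S j)%C in MV.
      2: { rewrite (Cpow_S (z0 - z0)%C). replace (z0 - z0)%C with (RtoC 0) by ring. ring. }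
      simpl pow. rewrite (Rmult_comm (Cmod (w - z0)%C)), <- Rmult_assoc. apply MV.
      * intros t Ht. specialize (Hseg w t Ht). eapply cder_eq. apply cder_plus. apply D1. unfold odisc. lra.
        apply cder_opp. apply cder_mult. apply cder_const. apply Hpow.
        cbv beta. unfold Cminus. f_equal. f_equal. field. auto.
      * intros t Ht. specialize (Hseg w t Ht).
        eapply Rle_trans. apply Hw. lra. apply Rmult_le_compat_l. lra. apply pow_incr. split; auto. apply Cmod_ge_0.
    + right. exists M, (Rmin d r). split. apply Rmin_glb_lt; auto. intros w Hw.
      pose proof (Rmin_l d r). pose proof (Rmin_r d r).
      replace (g w) with (g w - g z0)%C by (rewrite H0; ring).
      simpl pow. rewrite (Rmult_comm (Cmod (w - z0)%C)), <- Rmult_assoc.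
      assert (HM0 : 0 <= M \/ Cmod (w - z0)%C = 0).
      { destruct (Req_dec (Cmod (w - z0)%C) 0); auto. left. specialize (H w ltac:(lra)).
        assert (0 < Cmod (w - z0)%C ^ k). { apply pow_lt. pose proof (Cmod_ge_0 (w - z0)%C). lra. }
        pose proof (Cmod_ge_0 (g1 w)). apply Rnot_lt_le. intro. nra. }
      destruct HM0 as [HM0|HM0].
      2: { apply Cmod_eq_0 in HM0. replace w with z0. rewrite Cmod_diff_0. replace (z0 - z0)%C with (RtoC 0) by ring. rewrite Cmod_0. rewrite Rmult_0_r. lra.
        replace w with ((w - z0) + z0)%C by ring. rewrite HM0. ring. }
      apply mean_value with g1.
      * intros t Ht. specialize (Hseg w t Ht). apply D1. unfold odisc. lra.
      * intros t Ht. specialize (Hseg w t Ht). eapply Rle_trans. apply H. lra.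
        apply Rmult_le_compat_l; auto. apply pow_incr. split; auto. apply Cmod_ge_0.
Qed.

Lemma pow_small (q A eps : R) : 0 <= q < 1 -> 0 < eps -> exists n, A * q ^ n < eps.
Proof.
  intros Hq He. destruct (pow_lt_1_zero q) with (y := eps / (Rabs A + 1)) as [N HN].
  rewrite Rabs_pos_eq; lra. apply Rdiv_lt_0_compat; auto. pose proof (Rabs_pos A); lra.
  exists N. specialize (HN N ltac:(lia)). pose proof (Rabs_pos A).
  rewrite Rabs_pos_eq in HN by (apply pow_le; lra).
  assert (0 <= q ^ N) by (apply pow_le; lra).
  apply Rle_lt_trans with (Rabs A * q ^ N). apply Rmult_le_compat_r; auto. apply Rle_abs.
  apply Rle_lt_trans with ((Rabs A + 1) * q ^ N). nra.
  apply Rmult_lt_reg_r with (/ (Rabs A + 1)). apply Rinv_0_lt_compat; lra.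
  replace ((Rabs A + 1) * q ^ N * / (Rabs A + 1)) with (q ^ N) by (field; lra). auto.
Qed.

(* For every k the maximum modulus principle on the punctured disc applies to
   g(w)/(w-z0)^k, which tends to 0 at z0. *)
Lemma flat_zero (z0 : C) (r : R) (g : C -> C) : 0 < r ->
  (forall z, Cmod (z - z0)%C <= r -> ccont g z) -> analytic (odisc z0 r) g ->
  (forall k : nat, exists M d, 0 < d /\ forall w, Cmod (w - z0)%C < d -> Cmod (g w) <= M * Cmod (w - z0)%C ^ k) ->
  forall w, Cmod (w - z0)%C < r -> g w = 0%C.
Proof.
  intros Hr Hc Hg Hk.
  assert (Hk0 : forall k : nat, exists M d, 0 <= M /\ 0 < d /\ forall w, Cmod (w - z0)%C < d -> Cmod (g w) <= M * Cmod (w - z0)%C ^ k).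
  { intros k. destruct (Hk k) as [M [d [Hd H]]]. exists (Rabs M), d. split. apply Rabs_pos. split; auto.
    intros w Hw. eapply Rle_trans. apply H; auto. apply Rmult_le_compat_r. apply pow_le. apply Cmod_ge_0. apply Rle_abs. }
  clear Hk. rename Hk0 into Hk.
  destruct (bounded_on_disc g z0 r) as [B [HB0 HB]]; auto. lra.
  assert (key : forall k w, w <> z0 -> Cmod (w - z0)%C < r -> Cmod (g w) <= (B + 1) / r ^ k * Cmod (w - z0)%C ^ k).
  { intros k w Hwn Hw.
    assert (Hrk : 0 < r ^ k) by (apply pow_lt; auto).
    assert (Hw0 : 0 < Cmod (w - z0)%C) by (apply Cmod_gt_0; apply Cminus_neq; auto).
    assert (Hq : Cmod (g w / (w - z0) ^ k)%C <= (B + 1) / r ^ k).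
    { apply max_modulus with (U := fun z => odisc z0 r z /\ z <> z0) (g := fun z => (g z / (z - z0) ^ k)%C).
      - apply copen_and. apply copen_odisc. apply copen_neq.
      - apply hol_div. intros z [_ Hz]. apply Cpow_nz. apply Cminus_neq; auto.
        eapply hol_sub; [|apply Hg]. tauto.
        apply hol_pow. apply hol_minus. apply hol_id. apply hol_const.
      - left. apply Rdiv_lt_0_compat; lra.
      - exists (r + Cmod z0). intros z [[Hz _] _]. unfold odisc in Hz. pose proof (Cmod_le_sum z z0). lra.
      - intros s l Hs Hl.
        assert (Hle : Cmod (l - z0)%C <= r). { apply cvg_dist_le with s; auto. intros n. destruct (Hs n) as [[A _] _]. unfold odisc in A. lra. }
        assert (Hgl : forall n, (B + 1) / r ^ k * Cmod (s n - z0)%C ^ k <= Cmod (g (s n))).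
        { intros n. destruct (Hs n) as [[_ A] D]. rewrite Cmod_div in D. rewrite Cmod_pow in D.
          assert (0 < Cmod (s n - z0)%C ^ k). { apply pow_lt. apply Cmod_gt_0. apply Cminus_neq; auto. }
          apply Rmult_le_compat_r with (r := Cmod (s n - z0)%C ^ k) in D; [|lra].
          unfold Rdiv in D at 2. rewrite Rmult_assoc, Rinv_l, Rmult_1_r in D; lra.
          apply Cpow_nz. apply Cminus_neq; auto. }
        split.
        + destruct Hle as [|E]; auto. exfalso.
          assert (L1 : is_lim_seq (fun n => Cmod (g (s n)) - (B + 1) / r ^ k * Cmod (s n - z0)%C ^ k) (Cmod (g l) - (B + 1) / r ^ k * Cmod (l - z0)%C ^ k)).
          { apply is_lim_seq_minus'. apply cvg_Cmod. apply cvg_cont; auto. apply Hc. lra.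
            apply is_lim_seq_mult'. apply is_lim_seq_const. rewrite <- Cmod_pow.
            apply is_lim_seq_ext with (fun n => Cmod ((s n - z0) ^ k)%C). intros; apply Cmod_pow.
            apply (cvg_Cmod (fun n => (s n - z0) ^ k)%C). apply (cvg_cont (fun z => (z - z0) ^ k)%C); auto.
            eapply hol_cont with (U := fun _ => True) (n := 0%nat); auto. apply hol_pow. apply hol_minus. apply hol_id. apply hol_const. }
          apply is_lim_seq_ge_const with (c := 0) in L1.
          2: { intros n. specialize (Hgl n). lra. }
          rewrite E in L1. unfold Rdiv in L1. rewrite Rmult_assoc, Rinv_l in L1 by lra.
          assert (Cmod (g l) <= B) by (apply HB; lra). lra.
        (* Order [S k] rather than [k]: the quotient must tend to 0 at z0, not merely stay
           bounded. *)
        + intros ->. destruct (Hk (S k)) as [M [d [HM [Hd H]]]].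
          destruct (Hl (Rmin d ((B + 1) / r ^ k / (M + 1)))) as [N HN].
          { apply Rmin_glb_lt; auto. repeat apply Rdiv_lt_0_compat; lra. }
          specialize (HN N ltac:(lia)). pose proof (Rmin_l d ((B + 1) / r ^ k / (M + 1))). pose proof (Rmin_r d ((B + 1) / r ^ k / (M + 1))).
          specialize (H (s N) ltac:(lra)). specialize (Hgl N). destruct (Hs N) as [[_ A] _].
          assert (P : 0 < Cmod (s N - z0)%C) by (apply Cmod_gt_0; apply Cminus_neq; auto).
          assert (P2 : 0 < Cmod (s N - z0)%C ^ k) by (apply pow_lt; auto).
          simpl in H. set (x := Cmod (s N - z0)%C) in *. set (K := (B + 1) / r ^ k) in *.
          assert (K * x ^ k <= M * x * x ^ k) by lra.
          apply Rmult_le_reg_r in H2; auto.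
          assert (K / (M + 1) * (M + 1) = K) by (field; lra). nra.
      - split; auto. }
    rewrite Cmod_div, Cmod_pow in Hq. 2: { apply Cpow_nz. apply Cminus_neq; auto. }
    assert (0 < Cmod (w - z0)%C ^ k) by (apply pow_lt; auto).
    apply Rmult_le_compat_r with (r := Cmod (w - z0)%C ^ k) in Hq; [|lra].
    unfold Rdiv in Hq at 1. rewrite Rmult_assoc, Rinv_l, Rmult_1_r in Hq; lra. }
  intros w Hw. apply NNPP. intro Hn.
  assert (Hwn : w <> z0).
  { intros ->. destruct (Hk 1%nat) as [M [d [_ [Hd H]]]]. specialize (H z0). rewrite Cmod_diff_0 in H.
    specialize (H Hd). simpl in H. assert (0 < Cmod (g z0)) by (apply Cmod_gt_0; auto). lra. }
  destruct (pow_small (Cmod (w - z0)%C / r) (B + 1) (Cmod (g w))) as [n Hnn].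
  { split. apply Rdiv_le_0_compat; auto. apply Cmod_ge_0. apply Rmult_lt_reg_r with r; auto.
    unfold Rdiv. rewrite Rmult_assoc, Rinv_l; lra. }
  apply Cmod_gt_0; auto.
  specialize (key n w Hwn Hw). unfold Rdiv in Hnn, key. rewrite Rpow_mult_distr, pow_inv in Hnn. lra.
Qed.

(** Either f' has a leading term at z0, which dominates near z0, or f' is flat to all orders there.
    In the second case [flat_zero] makes f' vanish on a disc, so f takes equal values at z0 and z0 +
    r/4, against injectivity. *)
Lemma univalent_isolated (U : C -> Prop) (f f1 : C -> C) (z0 : C) :
  copen U -> analytic U f -> injective_on U f -> (forall z, U z -> cder f z (f1 z)) -> U z0 ->
  exists r, 0 < r /\ forall z, Cmod (z - z0)%C < r -> z <> z0 -> f1 z <> 0%C.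
Proof.
  intros HU Hf Hi Hd Hz. destruct (HU z0 Hz) as [r [Hr Hb]].
  assert (Hf1 : analytic U f1) by (intros n; apply hol_der with f; auto).
  assert (Hf1r : analytic (odisc z0 (r / 2)) f1). { eapply analytic_sub; [|apply Hf1]. intros z Q. apply Hb. unfold odisc in Q. lra. }
  assert (D : (exists (j : nat) (c : C), c <> 0%C /\ forall eps, 0 < eps -> exists d, 0 < d /\
     forall w, Cmod (w - z0)%C < d -> Cmod (f1 w - c * (w - z0) ^ j)%C <= eps * Cmod (w - z0)%C ^ j) \/
    forall k : nat, exists M d, 0 < d /\ forall w, Cmod (w - z0)%C < d -> Cmod (f1 w) <= M * Cmod (w - z0)%C ^ k).
  { apply NNPP. intro Hn. apply not_or_and in Hn. destruct Hn as [Hn1 Hn2]. apply Hn2. intros k.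
    destruct (zero_order k z0 (r / 2) f1 ltac:(lra) Hf1r); auto. tauto. }
  destruct D as [[j [c [Hc H]]]|H].
  - assert (Hcp : 0 < Cmod c) by (apply Cmod_gt_0; auto).
    destruct (H (Cmod c / 2)) as [d [Hdp Hw]]. lra. exists d. split; auto. intros z Hzd Hn E.
    specialize (Hw z Hzd). rewrite E in Hw. replace (0 - c * (z - z0) ^ j)%C with (- (c * (z - z0) ^ j))%C in Hw by ring.
    rewrite Cmod_opp, Cmod_mult, Cmod_pow in Hw.
    assert (0 < Cmod (z - z0)%C ^ j). { apply pow_lt. apply Cmod_gt_0. apply Cminus_neq; auto. } nra.
  - exfalso. assert (Z : forall w, Cmod (w - z0)%C < r / 2 -> f1 w = 0%C).
    { apply flat_zero; auto. lra. intros z Hzr. apply (Hf1 0%nat). apply Hb. lra. }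
    assert (E : f (z0 + RtoC (r / 4))%C = f z0).
    { apply zero_derivative_const with (fun z => Cmod (z - z0)%C < r / 2).
      - intros t Ht. replace (z0 + RtoC t * (z0 + RtoC (r / 4) - z0) - z0)%C with (RtoC (t * (r / 4))) by (rewrite RtoC_mult; ring).
        rewrite Cmod_R, Rabs_pos_eq; nra.
      - intros x Hx. rewrite <- (Z x Hx). apply Hd. apply Hb. lra. }
    apply Hi in E; auto.
    + assert (E2 : RtoC (r / 4) = 0%C). { replace (RtoC (r / 4)) with (z0 + RtoC (r / 4) - z0)%C by ring. rewrite E. ring. }
      apply RtoC_inj in E2. lra.
    + apply Hb. replace (z0 + RtoC (r / 4) - z0)%C with (RtoC (r / 4)) by ring. rewrite Cmod_R, Rabs_pos_eq; lra.
Qed.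

(* Hurwitz's argument: the difference quotients of f have no zeros, so the
   maximum principle applies to their inverses. *)
Lemma univalent_der_neq_0 (U : C -> Prop) (f f1 : C -> C) (z0 : C) :
  copen U -> analytic U f -> injective_on U f -> (forall z, U z -> cder f z (f1 z)) -> U z0 -> f1 z0 <> 0%C.
Proof.
  intros HU Hf Hi Hd Hz H0. destruct (HU z0 Hz) as [r [Hr Hb]].
  destruct (univalent_isolated U f f1 z0) as [r1 [Hr1 Hiso]]; auto.
  set (q := Rmin r r1 / 2). assert (Hq : 0 < q). { unfold q. assert (0 < Rmin r r1) by (apply Rmin_glb_lt; auto). lra. }
  pose proof (Rmin_l r r1). pose proof (Rmin_r r r1).
  assert (Hf1 : analytic U f1) by (intros n; apply hol_der with f; auto).
  destruct (analytic_der U f1 HU Hf1) as [f2 [Hd2 Hf2]].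
  destruct (min_on_circle f1 z0 q) as [m [Hm Hmin]]. lra.
  { intros z E. apply (Hf1 0%nat). apply Hb. unfold q in *; lra. }
  { intros z E. apply Hiso. unfold q in *; lra. intros ->. rewrite Cmod_diff_0 in E. lra. }
  destruct (bounded_on_disc f2 z0 (3 / 2 * q)) as [B [HB0 HB]]. lra.
  { intros z E. apply (Hf2 0%nat). apply Hb. unfold q in *; lra. }
  (* h <= q/2 keeps the translates in the disc of radius 3q/2 where |f''| <= B; B h <= m/4 makes the
     difference quotient G differ from f' by at most m/4. Hence |G| >= m/2 on the circle, but |G z0|
     <= m/4, and 1/G violates the maximum principle. *)
  set (h := Rmin (q / 2) (m / (4 * (B + 1)))).
  assert (Hh : 0 < h). { unfold h. apply Rmin_glb_lt. lra. apply Rdiv_lt_0_compat; lra. }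
  assert (Hh1 : h <= q / 2) by apply Rmin_l.
  assert (Hh2 : B * h <= m / 4).
  { assert (h <= m / (4 * (B + 1))) by apply Rmin_r. apply Rle_trans with ((B + 1) * (m / (4 * (B + 1)))).
    apply Rmult_le_compat; lra. right. field. lra. }
  assert (HhC : RtoC h <> 0%C). { intro E. apply RtoC_inj in E. lra. }
  pose (G := fun z : C => ((f (z + RtoC h) - f z) / RtoC h)%C).
  assert (Hsh : forall z t, Cmod (z - z0)%C <= q -> 0 <= t <= h -> Cmod (z + RtoC t - z0)%C <= 3 / 2 * q).
  { intros z t Hzq Ht. replace (z + RtoC t - z0)%C with ((z - z0) + RtoC t)%C by ring.
    eapply Rle_trans. apply Cmod_triangle. rewrite Cmod_R, Rabs_pos_eq; lra. }
  assert (HG : forall z, Cmod (z - z0)%C <= q -> Cmod (G z - f1 z)%C <= m / 4).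
  { intros z Hzq.
    assert (MV1 : forall t, 0 <= t <= h -> Cmod (f1 (z + RtoC t) - f1 z)%C <= B * h).
    { intros t Ht. eapply Rle_trans. apply (mean_value f1 f2 z (z + RtoC t)%C B).
      - intros s Hs. apply Hd2. apply Hb. replace (z + RtoC s * (z + RtoC t - z))%C with (z + RtoC (s * t))%C by (rewrite RtoC_mult; ring).
        specialize (Hsh z (s * t) Hzq ltac:(nra)). unfold q in *; lra.
      - intros s Hs. apply HB. replace (z + RtoC s * (z + RtoC t - z))%C with (z + RtoC (s * t))%C by (rewrite RtoC_mult; ring).
        apply Hsh; auto; nra.
      - replace (z + RtoC t - z)%C with (RtoC t) by ring. rewrite Cmod_R, Rabs_pos_eq by lra. nra. }
    assert (MV2 : Cmod ((f (z + RtoC h) - f1 z * (z + RtoC h)) - (f z - f1 z * z))%C <= B * h * Cmod (z + RtoC h - z)%C).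
    { apply (mean_value (fun x => f x - f1 z * x)%C (fun x => f1 x - f1 z)%C).
      - intros s Hs. replace (z + RtoC s * (z + RtoC h - z))%C with (z + RtoC (s * h))%C by (rewrite RtoC_mult; ring).
        eapply cder_eq. apply cder_plus. apply Hd. apply Hb. specialize (Hsh z (s * h) Hzq ltac:(nra)). unfold q in *; lra.
        apply cder_opp. apply cder_mult. apply cder_const. apply cder_id. cbv beta. ring.
      - intros s Hs. replace (z + RtoC s * (z + RtoC h - z))%C with (z + RtoC (s * h))%C by (rewrite RtoC_mult; ring).
        apply MV1. nra. }
    replace (z + RtoC h - z)%C with (RtoC h) in MV2 by ring. rewrite Cmod_R, Rabs_pos_eq in MV2 by lra.
    replace (G z - f1 z)%C with ((f (z + RtoC h) - f1 z * (z + RtoC h) - (f z - f1 z * z)) / RtoC h)%C by (unfold G; field; auto).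
    rewrite Cmod_div, Cmod_R, Rabs_pos_eq; auto; try lra.
    apply Rmult_le_reg_r with h; auto. unfold Rdiv at 1. rewrite Rmult_assoc, Rinv_l; nra. }
  assert (HV : forall z, Cmod (z - z0)%C <= q -> odisc z0 r z /\ odisc z0 r (z + RtoC h)%C).
  { intros z Q. unfold odisc. pose proof (Hsh z h Q ltac:(lra)). unfold q in *. split; lra. }
  assert (HVo : copen (fun z => odisc z0 r z /\ odisc z0 r (z + RtoC h)%C)).
  { apply copen_and. apply copen_odisc. intros z Q. destruct (copen_odisc z0 r _ Q) as [d [Hdp A]].
    exists d. split; auto. intros w Hw. apply A. replace (w + RtoC h - (z + RtoC h))%C with (w - z)%C by ring. auto. }
  assert (Fin : Cmod (/ G z0)%C <= 2 / m).
  { apply max_disc with (U := fun z => odisc z0 r z /\ odisc z0 r (z + RtoC h)%C) (g := fun z => (/ G z)%C) (z0 := z0) (r := q); auto.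
    - apply hol_inv.
      + intros z [Q1 Q2] E. unfold G in E.
        assert (Hfe : f (z + RtoC h)%C = f z).
        { apply NNPP. intro n. apply Cminus_neq in n. apply n.
          replace (f (z + RtoC h) - f z)%C with ((f (z + RtoC h) - f z) / RtoC h * RtoC h)%C by (field; auto). rewrite E. ring. }
        apply Hi in Hfe. apply HhC. replace (RtoC h) with (z + RtoC h - z)%C by ring. rewrite Hfe. ring.
        apply Hb; apply Q2. apply Hb; apply Q1.
      + unfold G. apply hol_div. auto. apply hol_minus. apply hol_comp with (V := U) (h := f).
        intros z [_ Q]. apply Hb; apply Q. apply hol_plus. apply hol_id. apply hol_const. apply Hf.
        eapply hol_sub; [|apply Hf]. intros z [Q _]. apply Hb; apply Q. apply hol_const.
    - intros z E. specialize (Hmin z E). specialize (HG z ltac:(lra)).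
      assert (HGm : m / 2 <= Cmod (G z)). { pose proof (Cmod_le_sum (f1 z) (G z)) as Q. rewrite Cmod_sub_sym in Q. lra. }
      rewrite Cmod_inv. apply Rmult_le_reg_r with (Cmod (G z)). lra. rewrite Rinv_l by lra.
      apply Rmult_le_reg_l with m. auto. replace (m * (2 / m * Cmod (G z))) with (2 * Cmod (G z)) by (field; lra). lra.
      intro E2. rewrite E2, Cmod_0 in HGm. lra.
    - left. apply Rdiv_lt_0_compat; lra.
    - rewrite Cmod_diff_0. auto. }
  specialize (HG z0 ltac:(rewrite Cmod_diff_0; lra)). rewrite H0 in HG. replace (G z0 - 0)%C with (G z0) in HG by ring.
  assert (G z0 <> 0%C).
  { intro E. unfold G in E.
    assert (Hfe : f (z0 + RtoC h)%C = f z0).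
    { apply NNPP. intro n. apply Cminus_neq in n. apply n.
      replace (f (z0 + RtoC h) - f z0)%C with ((f (z0 + RtoC h) - f z0) / RtoC h * RtoC h)%C by (field; auto). rewrite E. ring. }
    apply Hi in Hfe; auto. apply HhC. replace (RtoC h) with (z0 + RtoC h - z0)%C by ring. rewrite Hfe. ring.
    apply Hb. apply (HV z0). rewrite Cmod_diff_0; lra. }
  assert (HGp : 0 < Cmod (G z0)) by (apply Cmod_gt_0; auto).
  rewrite Cmod_inv in Fin by auto. 
  assert (HGi : / (m / 4) <= / Cmod (G z0)) by (apply Rinv_le_contravar; lra).
  replace (/ (m / 4)) with (4 / m) in HGi by (field; lra). unfold Rdiv in *. 
  assert (0 < / m) by (apply Rinv_0_lt_compat; auto). lra.
Qed.

(** With m the minimum of |f - f z0| on the circle, a value w within m/2 of f z0 that is omitted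
    makes 1/(f - w) holomorphic, at most 2/m on the circle, yet larger than 2/m at the centre. *)
Lemma open_mapping (U : C -> Prop) (f : C -> C) (z0 : C) (r : R) :
  copen U -> analytic U f -> injective_on U f -> 0 < r -> (forall z, Cmod (z - z0)%C <= r -> U z) ->
  exists d, 0 < d /\ forall w, Cmod (w - f z0)%C < d -> exists z, Cmod (z - z0)%C < r /\ f z = w.
Proof.
  intros HU Hf Hi Hr Hb.
  assert (Hz0 : U z0). { apply Hb. rewrite Cmod_diff_0. lra. }
  destruct (min_on_circle (fun z => f z - f z0)%C z0 r) as [m [Hm Hmin]]. lra.
  { intros z E. apply ccont_plus. apply (Hf 0%nat). apply Hb. lra. apply ccont_const. }
  { intros z E. apply Cminus_neq. intro E2. apply Hi in E2; auto. rewrite E2, Cmod_diff_0 in E. lra. apply Hb. lra. }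
  exists (m / 2). split. lra. intros w Hw. apply NNPP. intro Hn.
  assert (Hc : forall z, Cmod (z - z0)%C = r -> m / 2 <= Cmod (f z - w)%C).
  { intros z E. specialize (Hmin z E). simpl in Hmin. 
    pose proof (Cmod_triangle (f z - w)%C (w - f z0)%C). replace (f z - w + (w - f z0))%C with (f z - f z0)%C in H by ring. lra. }
  assert (Fin : Cmod (/ (f z0 - w))%C <= 2 / m).
  { apply max_disc with (U := fun z => U z /\ f z <> w) (g := fun z => (/ (f z - w))%C) (z0 := z0) (r := r); auto.
    - intros z Q. split; auto. intro E. destruct Q as [Q|Q]. apply Hn; exists z; auto.
      specialize (Hc z Q). rewrite E, Cmod_diff_0 in Hc. lra.
    - apply hol_inv. intros z [_ Q]. apply Cminus_neq; auto. apply hol_minus. eapply hol_sub; [|apply Hf]. tauto. apply hol_const.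
    - intros z E. specialize (Hc z E). rewrite Cmod_inv.
      + replace (2 / m) with (/ (m / 2)) by (field; lra). apply Rinv_le_contravar; lra.
      + intro E2. rewrite E2, Cmod_0 in Hc. lra.
    - left. apply Rdiv_lt_0_compat; lra.
    - rewrite Cmod_diff_0; auto. }
  assert (f z0 <> w). { intro E. apply Hn. exists z0. rewrite Cmod_diff_0. auto. }
  assert (0 < Cmod (f z0 - w)%C) by (apply Cmod_gt_0; apply Cminus_neq; auto).
  rewrite Cmod_inv in Fin by (apply Cminus_neq; auto). rewrite Cmod_sub_sym in Hw.
  assert (/ (m / 2) < / Cmod (f z0 - w)%C) by (apply Rinv_lt_contravar; nra).
  replace (/ (m / 2)) with (2 / m) in H1 by (field; lra). lra.
Qed.

Lemma copen_image (U : C -> Prop) (f : C -> C) : copen U -> analytic U f -> injective_on U f -> copen (image U f).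
Proof.
  intros HU Hf Hi w [z [Hz <-]]. destruct (HU z Hz) as [r [Hr Hb]].
  destruct (open_mapping U f z (r / 2)) as [d [Hd H]]; auto. lra. intros; apply Hb; lra.
  exists d. split; auto. intros w Hw. destruct (H w Hw) as [x [Hx <-]]. exists x. split; auto. apply Hb. lra.
Qed.

(** Continuity of the inverse is the open mapping property. Its derivative comes from the reciprocal
    of the difference quotient of f, which is legitimate since f' has no zero, and the formula
    1/f'(g) then raises the order of differentiability step by step. *)
Lemma inverse_exists (U : C -> Prop) (f f1 : C -> C) :
  copen U -> analytic U f -> injective_on U f -> (forall z, U z -> cder f z (f1 z)) ->
  exists g, (forall w, image U f w -> U (g w) /\ f (g w) = w) /\ (forall z, U z -> g (f z) = z) /\
    analytic (image U f) g /\ forall w, image U f w -> cder g w (/ f1 (g w))%C.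
Proof.
  intros HU Hf Hi Hd.
  assert (E : exists g, forall w, image U f w -> U (g w) /\ f (g w) = w).
  { destruct (choice (fun w z => image U f w -> U z /\ f z = w)) as [g Hg].
    - intros w. destruct (classic (image U f w)) as [[z Hz]|n]. exists z; auto. exists 0%C. tauto.
    - exists g; auto. }
  destruct E as [g Hg]. exists g.
  assert (Hgf : forall z, U z -> g (f z) = z).
  { intros z Hz. destruct (Hg (f z)) as [A B]. exists z; auto. apply Hi; auto. }
  assert (Hgc : forall w, image U f w -> ccont g w).
  { intros w [z [Hz <-]]. rename z into z0. intros eps He. destruct (HU z0 Hz) as [r [Hr Hb]].
    pose proof (Rmin_l (r / 2) eps). pose proof (Rmin_r (r / 2) eps).
    destruct (open_mapping U f z0 (Rmin (r / 2) eps)) as [d [Hdp H1]]; auto. apply Rmin_glb_lt; lra. intros; apply Hb; lra.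
    exists d. split; auto. intros w Hw. destruct (H1 w Hw) as [x [Hx <-]].
    rewrite !Hgf; auto. lra. apply Hb. lra. }
  assert (Hgd : forall w, image U f w -> cder g w (/ f1 (g w))%C).
  { intros w Hw. destruct (Hg w Hw) as [A B].
    assert (Hn : f1 (g w) <> 0%C) by (apply (univalent_der_neq_0 U f f1 (g w)); auto).
    destruct (proj1 (cder_cara _ _ _) (Hd (g w) A)) as [q [Hq [Hq1 Hq2]]].
    assert (HQ : ccont (fun v => q (g v)) w) by (apply ccont_comp with (h := q); auto).
    assert (HQi : ccont (fun v => / q (g v))%C w). { apply ccont_inv; auto. rewrite Hq1. auto. }
    destruct (HQ (Cmod (f1 (g w)))) as [d1 [Hd1 H1]]. { apply Cmod_gt_0; auto. }
    destruct (copen_image U f HU Hf Hi w Hw) as [d3 [Hd3 H3]].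
    intros eps He. destruct (HQi eps He) as [d2 [Hd2 H2]].
    exists (Rmin d3 (Rmin d1 d2)). split. { repeat apply Rmin_glb_lt; auto. }
    intros v Hv. pose proof (Rmin_l d3 (Rmin d1 d2)). pose proof (Rmin_r d3 (Rmin d1 d2)).
    pose proof (Rmin_l d1 d2). pose proof (Rmin_r d1 d2).
    specialize (H1 v ltac:(lra)). specialize (H2 v ltac:(lra)). specialize (H3 v ltac:(lra)).
    assert (Hqn : q (g v) <> 0%C).
    { intro E. rewrite E, Hq1 in H1. replace (0 - f1 (g w))%C with (- f1 (g w))%C in H1 by ring. rewrite Cmod_opp in H1. lra. }
    specialize (Hq2 (g v)). rewrite B, (proj2 (Hg v H3)) in Hq2.
    assert (E : (g v - g w = / q (g v) * (v - w))%C). { rewrite Hq2. field; auto. }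
    rewrite E. rewrite Hq1 in H2.
    replace (/ q (g v) * (v - w) - / f1 (g w) * (v - w))%C with ((/ q (g v) - / f1 (g w)) * (v - w))%C by ring.
    rewrite Cmod_mult. apply Rmult_le_compat_r. apply Cmod_ge_0. left; auto. }
  split; auto. split; auto. split; auto.
  assert (Hf1 : analytic U f1) by (intros n; apply hol_der with f; auto).
  intros n. induction n; simpl; auto.
  exists (fun w => / f1 (g w))%C. split; auto. apply hol_inv.
  intros w Hw. destruct (Hg w Hw) as [A B]. apply (univalent_der_neq_0 U f f1 (g w)); auto.
  apply hol_comp with (V := U) (h := f1); auto. intros w Hw. apply Hg; auto.
Qed.

(** * Schwarz and Schwarz-Pick lemmas *)

Lemma unit_disc_0 : unit_disc 0%C.
Proof. unfold unit_disc. rewrite Cmod_0. lra. Qed.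

Lemma copen_unit_disc : copen unit_disc.
Proof.
  intros z Hz. destruct (copen_odisc 0%C 1 z) as [r [Hr H]].
  { unfold odisc. replace (z - 0)%C with z by ring. auto. }
  exists r. split; auto. intros w Hw. specialize (H w Hw). unfold odisc in H. replace (w - 0)%C with w in H by ring. auto.
Qed.

Lemma cder_bound (g : C -> C) (z d : C) : cder g z d ->
  exists r, 0 < r /\ forall w, Cmod (w - z)%C < r -> Cmod (g w - g z)%C <= (Cmod d + 1) * Cmod (w - z)%C.
Proof.
  intros H. destruct (H 1) as [r [Hr Hw]]. lra. exists r. split; auto. intros w Q. specialize (Hw w Q).
  pose proof (Cmod_le_sum (g w - g z)%C (d * (w - z))%C). rewrite Cmod_mult in H0. lra.
Qed.

Lemma pow_unbounded (q A : R) : 1 < q -> exists n, A < q ^ n.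
Proof.
  intros Hq. destruct (Pow_x_infinity q ltac:(rewrite Rabs_pos_eq; lra) (A + 1)) as [N HN].
  exists N. specialize (HN N ltac:(lia)). rewrite Rabs_pos_eq in HN. lra. apply pow_le; lra.
Qed.

(** The constant K disappears on taking k-th roots; this lets a sharp inequality be derived from
    maximum principles with a slack factor. *)
Lemma le_of_pow_le (a b K : R) : 0 <= a -> 0 < b -> (forall k : nat, a ^ S k <= K * b ^ k) -> a <= b.
Proof.
  intros Ha Hb H. apply Rnot_lt_le. intro Hlt.
  destruct (pow_unbounded (a / b) (K / a)) as [n Hn].
  { apply Rmult_lt_reg_r with b; auto. unfold Rdiv. rewrite Rmult_assoc, Rinv_l; lra. }
  specialize (H n). unfold Rdiv in Hn. rewrite Rpow_mult_distr, pow_inv in Hn.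
  assert (0 < b ^ n) by (apply pow_lt; auto). simpl in H.
  assert (K * / a * (a * b ^ n) < a ^ n * / b ^ n * (a * b ^ n)) by (apply Rmult_lt_compat_r; nra).
  replace (K * / a * (a * b ^ n)) with (K * b ^ n) in H1 by (field; lra).
  replace (a ^ n * / b ^ n * (a * b ^ n)) with (a * a ^ n) in H1 by (field; lra). lra.
Qed.

(** The maximum principle for g^(k+1)/z^k on the punctured disc: as |g| <= const |z| near 0, the
    surplus factor g makes the quotient vanish at 0, so no removable singularity has to be filled.
    The level 2 is strictly above the bound 1 approached at the circle, and the factor 2 is lost as
    k grows. *)
Lemma schwarz (g : C -> C) :
  hol 2 unit_disc g -> (forall z, unit_disc z -> Cmod (g z) <= 1) -> g 0%C = 0%C ->
  forall z, unit_disc z -> Cmod (g z) <= Cmod z.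
Proof.
  intros Hg H1 H0 z Hz. destruct (classic (z = 0%C)) as [->|Hn]. rewrite H0. lra.
  apply le_of_pow_le with 2. apply Cmod_ge_0. apply Cmod_gt_0; auto. intros k.
  assert (Hzk : 0 < Cmod z ^ k) by (apply pow_lt; apply Cmod_gt_0; auto).
  assert (Q : Cmod (g z ^ S k / z ^ k)%C <= 2).
  { apply max_modulus with (U := fun w => unit_disc w /\ w <> 0%C) (g := fun w => (g w ^ S k / w ^ k)%C).
    - apply copen_and. apply copen_unit_disc. apply copen_neq.
    - apply hol_div. intros w [_ Q]. apply Cpow_nz; auto. apply hol_pow. eapply hol_sub; [|apply Hg]. tauto.
      apply hol_pow. apply hol_id.
    - lra.
    - exists 1. intros w [[Q _] _]. unfold unit_disc in Q. lra.
    - intros s l Hs Hl.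
      assert (Hle : Cmod l <= 1).
      { eapply is_lim_seq_le_const; [|apply cvg_Cmod; apply Hl]. intros n. destruct (Hs n) as [[Q _] _]. unfold unit_disc in Q. simpl. lra. }
      assert (Hgl : forall n, 2 * Cmod (s n) ^ k <= Cmod (g (s n)) ^ S k).
      { intros n. destruct (Hs n) as [[_ A] D]. rewrite Cmod_div in D by (apply Cpow_nz; auto). rewrite !Cmod_pow in D.
        assert (0 < Cmod (s n) ^ k). { apply pow_lt. apply Cmod_gt_0; auto. }
        apply Rmult_le_compat_r with (r := Cmod (s n) ^ k) in D; [|lra].
        unfold Rdiv in D. rewrite (Rmult_assoc (Cmod (g (s n)) ^ S k)), Rinv_l, Rmult_1_r in D; lra. }
      assert (L : is_lim_seq (fun n => Cmod (s n) ^ k) (Cmod l ^ k)).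
      { rewrite <- Cmod_pow.
        apply is_lim_seq_ext with (fun n => Cmod (s n ^ k)%C). intros; apply Cmod_pow.
        apply (cvg_Cmod (fun n => s n ^ k)%C). apply (cvg_cont (fun z => z ^ k)%C); auto.
        eapply hol_cont with (U := fun _ => True) (n := 0%nat); auto. apply hol_pow. apply hol_id. }
      split.
      + destruct Hle as [|E]; auto. exfalso. rewrite E, pow1 in L.
        apply is_lim_seq_le_const with (c := / 2) in L. lra. intros n. specialize (Hgl n).
        destruct (Hs n) as [[A _] _]. specialize (H1 _ A).
        assert (Cmod (g (s n)) ^ S k <= 1). { rewrite <- (pow1 (S k)). apply pow_incr. split; auto. apply Cmod_ge_0. } lra.
      + intros ->. destruct Hg as [g1 [D _]].
        destruct (cder_bound g 0%C (g1 0%C) (D _ unit_disc_0)) as [r [Hr B]].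
        set (K := Cmod (g1 0%C) + 1) in *. assert (HK : 0 < K). { unfold K. pose proof (Cmod_ge_0 (g1 0%C)). lra. }
        assert (HKp : 0 < K ^ S k) by (apply pow_lt; auto).
        destruct (Hl (Rmin r (/ K ^ S k))) as [N HN]. apply Rmin_glb_lt; auto. apply Rinv_0_lt_compat; auto.
        specialize (HN N ltac:(lia)). pose proof (Rmin_l r (/ K ^ S k)). pose proof (Rmin_r r (/ K ^ S k)).
        specialize (B (s N) ltac:(lra)). rewrite H0 in B.
        replace (g (s N) - 0)%C with (g (s N)) in B by ring. replace (s N - 0)%C with (s N) in * by ring.
        specialize (Hgl N). destruct (Hs N) as [[_ A] _].
        assert (0 < Cmod (s N) ^ k). { apply pow_lt. apply Cmod_gt_0; auto. }
        assert (Cmod (g (s N)) ^ S k <= (K * Cmod (s N)) ^ S k) by (apply pow_incr; split; auto; apply Cmod_ge_0).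
        rewrite Rpow_mult_distr in H4. 
        assert (K ^ S k * Cmod (s N) < 1). { rewrite <- (Rinv_r (K ^ S k)) by lra. apply Rmult_lt_compat_l; lra. }
        replace (Cmod (s N) ^ S k) with (Cmod (s N) * Cmod (s N) ^ k) in H4 by (simpl; ring).
        assert (K ^ S k * (Cmod (s N) * Cmod (s N) ^ k) <= 1 * Cmod (s N) ^ k).
        { rewrite <- Rmult_assoc. apply Rmult_le_compat_r; lra. } lra.
    - auto. }
  rewrite Cmod_div, !Cmod_pow in Q by (apply Cpow_nz; auto).
  apply Rmult_le_compat_r with (r := Cmod z ^ k) in Q; [|lra].
  unfold Rdiv in Q. rewrite (Rmult_assoc (Cmod (g z) ^ S k)), Rinv_l, Rmult_1_r in Q; lra.
Qed.

Lemma cder_quotient_bound (g : C -> C) (z d : C) (B : R) : cder g z d ->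
  (exists r, 0 < r /\ forall w, Cmod (w - z)%C < r -> Cmod (g w - g z)%C <= B * Cmod (w - z)%C) -> Cmod d <= B.
Proof.
  intros H [r [Hr HB]]. apply Rnot_lt_le. intro Hlt.
  destruct (H ((Cmod d - B) / 2)) as [r' [Hr' Hw]]. lra.
  set (t := Rmin r r' / 2). assert (Hm : 0 < Rmin r r') by (apply Rmin_glb_lt; auto).
  pose proof (Rmin_l r r'). pose proof (Rmin_r r r').
  assert (E : (z + RtoC t - z)%C = RtoC t) by ring.
  specialize (HB (z + RtoC t)%C). specialize (Hw (z + RtoC t)%C). rewrite E, Cmod_R, Rabs_pos_eq in HB, Hw by (unfold t; lra).
  specialize (HB ltac:(unfold t; lra)). specialize (Hw ltac:(unfold t; lra)).
  pose proof (Cmod_le_sum (d * RtoC t)%C (g (z + RtoC t)%C - g z)%C). rewrite Cmod_sub_sym in H2.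
  rewrite Cmod_mult, Cmod_R, Rabs_pos_eq in H2 by (unfold t; lra). assert (0 < t) by (unfold t; lra). nra.
Qed.

(** * Schwarz-Pick inequalities on the half-plane and on the disc *)

Definition rhp (p : C) : Prop := 0 < Re p.

Lemma copen_rhp : copen rhp.
Proof.
  intros z Hz. exists (Re z). split; auto. intros w Hw. unfold rhp in *.
  pose proof (Re_le_Cmod (w - z)%C). unfold Re in *. simpl in H. unfold Rabs in H; destruct Rcase_abs in H; lra.
Qed.

Lemma Cmod_plus_conj_sqr (a b : C) : Cmod (a + Cconj b)%C ^ 2 - Cmod (a - b)%C ^ 2 = 4 * Re a * Re b.
Proof. rewrite !Cmod_sqr. unfold Re; simpl. ring. Qed.

Lemma Cmod_le_of_sqr (a b : C) : Cmod a ^ 2 <= Cmod b ^ 2 -> Cmod a <= Cmod b.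
Proof. intros H. apply Rnot_lt_le. intro. pose proof (Cmod_ge_0 a). pose proof (Cmod_ge_0 b). nra. Qed.

Lemma Cmod_lt_of_sqr (a b : C) : Cmod a ^ 2 < Cmod b ^ 2 -> Cmod a < Cmod b.
Proof. intros H. apply Rnot_le_lt. intro. assert (Cmod b ^ 2 <= Cmod a ^ 2). apply pow_incr. split; auto. apply Cmod_ge_0. lra. Qed.

Lemma Re_pos_neq_0 (z : C) : 0 < Re z -> z <> 0%C.
Proof. intros H E. rewrite E in H. unfold Re in H. simpl in H. lra. Qed.

(** Schwarz's lemma for (N - b)/(N + Cconj b + e), b = N 0. The positive e keeps the denominator
    away from 0 even if Re N vanishes, and is removed at the end. *)
Lemma schwarz_to_rhp (N : C -> C) :
  hol 2 unit_disc N -> (forall z, unit_disc z -> 0 <= Re (N z)) ->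
  forall z, unit_disc z -> Cmod (N z - N 0%C)%C <= Cmod z * Cmod (N z + Cconj (N 0%C))%C.
Proof.
  intros HN Hp z Hz. apply le_epsilon. intros e He.
  set (b := N 0%C). set (ep := RtoC e).
  assert (Hpos : forall w, unit_disc w -> 0 < Re (N w + Cconj b + ep)%C).
  { intros w Hw. rewrite !Re_plus. specialize (Hp w Hw) as A. specialize (Hp 0%C unit_disc_0) as B.
    fold b in B. unfold Re in *. simpl. lra. }
  assert (S := schwarz (fun w => (N w - b) / (N w + Cconj b + ep))%C). cbv beta in S.
  assert (Q : Cmod ((N z - b) / (N z + Cconj b + ep))%C <= Cmod z).
  { apply S; auto.
    - apply hol_div. intros w Hw. apply Re_pos_neq_0. auto. apply hol_minus; auto. apply hol_const.
      apply hol_plus. apply hol_plus; auto. apply hol_const. apply hol_const.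
    - intros w Hw. rewrite Cmod_div by (apply Re_pos_neq_0; auto).
      apply Rmult_le_reg_r with (Cmod (N w + Cconj b + ep)%C). apply Cmod_gt_0. apply Re_pos_neq_0; auto.
      unfold Rdiv. rewrite Rmult_assoc, Rinv_l, Rmult_1_r, Rmult_1_l.
      2: { apply Rgt_not_eq. apply Cmod_gt_0. apply Re_pos_neq_0; auto. }
      apply Cmod_le_of_sqr. specialize (Hp w Hw) as A. specialize (Hp 0%C unit_disc_0) as B. fold b in B.
      rewrite !Cmod_sqr. unfold Re in *. simpl. nra.
    - unfold b. replace (N 0%C - N 0%C)%C with (RtoC 0) by ring. unfold Cdiv. ring. }
  assert (P : 0 < Cmod (N z + Cconj b + ep)%C). { apply Cmod_gt_0. apply Re_pos_neq_0; auto. }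
  rewrite Cmod_div in Q by (apply Re_pos_neq_0; auto).
  apply Rmult_le_compat_r with (r := Cmod (N z + Cconj b + ep)%C) in Q; [|lra].
  unfold Rdiv in Q. rewrite Rmult_assoc, Rinv_l, Rmult_1_r in Q by lra.
  pose proof (Cmod_triangle (N z + Cconj b)%C ep). unfold ep in H at 2. rewrite Cmod_R, Rabs_pos_eq in H by lra.
  unfold unit_disc in Hz. pose proof (Cmod_ge_0 z). fold b in Q. nra.
Qed.

Lemma schwarz_to_rhp_der (N : C -> C) (d : C) :
  hol 2 unit_disc N -> (forall z, unit_disc z -> 0 <= Re (N z)) -> cder N 0%C d ->
  Cmod d <= 2 * Re (N 0%C).
Proof.
  intros HN Hp Hd. apply le_epsilon. intros e He.
  apply cder_quotient_bound with N (RtoC 0); auto.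
  destruct (cder_ccont _ _ _ Hd e He) as [r [Hr Hc]]. exists (Rmin r 1). split. apply Rmin_glb_lt; lra.
  intros w Hw. pose proof (Rmin_l r 1). pose proof (Rmin_r r 1). specialize (Hc w ltac:(lra)).
  replace (w - 0)%C with w in * by ring.
  eapply Rle_trans. apply schwarz_to_rhp; auto. unfold unit_disc; lra.
  rewrite Rmult_comm. apply Rmult_le_compat_r. apply Cmod_ge_0.
  replace (N w + Cconj (N 0%C))%C with ((N w - N 0%C) + RtoC (2 * Re (N 0%C)))%C.
  2: { apply injective_projections; unfold Re; simpl; ring. }
  eapply Rle_trans. apply Cmod_triangle. rewrite Cmod_R, Rabs_pos_eq. lra. specialize (Hp _ unit_disc_0). lra.
Qed.

Lemma one_minus_neq_0 (z : C) : unit_disc z -> (1 - z)%C <> 0%C.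
Proof.
  intros H E. unfold unit_disc in H. assert (z = 1%C). { replace z with (1 - (1 - z))%C by ring. rewrite E. ring. }
  rewrite H0, Cmod_1 in H. lra.
Qed.

(** The Moebius map from the disc to the half-plane with 0 going to q and 1 to infinity. It moves
    statements centred at 0 to an arbitrary centre q. *)
Lemma disc_to_rhp (q z : C) : rhp q -> unit_disc z -> rhp ((q + Cconj q * z) / (1 - z))%C.
Proof.
  unfold rhp. intros Hq Hz. assert (Hn := one_minus_neq_0 z Hz).
  assert (P : 0 < Cmod (1 - z)%C ^ 2) by (apply pow_lt; apply Cmod_gt_0; auto).
  assert (E : Re ((q + Cconj q * z) / (1 - z))%C * Cmod (1 - z)%C ^ 2 = Re q * (1 - Cmod z ^ 2)).
  { rewrite !Cmod_sqr in *. unfold Re, Cdiv, Cinv in *. simpl in *. field. nra. }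
  unfold unit_disc in Hz. pose proof (Cmod_ge_0 z).
  assert (0 < Re q * (1 - Cmod z ^ 2)) by (apply Rmult_lt_0_compat; nra). rewrite <- E in H0.
  apply Rmult_lt_reg_r with (Cmod (1 - z)%C ^ 2); lra.
Qed.

Lemma hol_disc_to_rhp (n : nat) (q : C) : hol n unit_disc (fun z => (q + Cconj q * z) / (1 - z))%C.
Proof.
  apply hol_div. apply one_minus_neq_0. apply hol_plus. apply hol_const. apply hol_mult. apply hol_const. apply hol_id.
  apply hol_minus. apply hol_const. apply hol_id.
Qed.

Lemma schwarz_pick_rhp (M : C -> C) (p q : C) :
  hol 2 rhp M -> (forall p, rhp p -> 0 <= Re (M p)) -> rhp p -> rhp q ->
  Cmod (M p - M q)%C * Cmod (p + Cconj q)%C <= Cmod (p - q)%C * Cmod (M p + Cconj (M q))%C.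
Proof.
  intros HM Hr Hp Hq. unfold rhp in *.
  set (z := ((p - q) / (p + Cconj q))%C).
  assert (Hpq : (p + Cconj q)%C <> 0%C). { apply Re_pos_neq_0. rewrite Re_plus. unfold Re in *; simpl. lra. }
  assert (Ppq : 0 < Cmod (p + Cconj q)%C) by (apply Cmod_gt_0; auto).
  assert (Hz : unit_disc z).
  { unfold unit_disc, z. rewrite Cmod_div by auto. apply Rmult_lt_reg_r with (Cmod (p + Cconj q)%C); auto.
    unfold Rdiv. rewrite Rmult_assoc, Rinv_l, Rmult_1_r, Rmult_1_l by lra. apply Cmod_lt_of_sqr.
    pose proof (Cmod_plus_conj_sqr p q). assert (0 < Re p * Re q) by (apply Rmult_lt_0_compat; auto). lra. }
  assert (Ez : ((q + Cconj q * z) / (1 - z))%C = p).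
  { assert (E1 : (1 - z)%C = ((q + Cconj q) / (p + Cconj q))%C) by (unfold z; field; auto).
    assert (E2 : (q + Cconj q * z)%C = (p * (q + Cconj q) / (p + Cconj q))%C) by (unfold z; field; auto).
    rewrite E1, E2. field. split; auto. apply Re_pos_neq_0. rewrite Re_plus. unfold Re in *; simpl; lra. }
  assert (S := schwarz_to_rhp (fun z => M ((q + Cconj q * z) / (1 - z))%C)). cbv beta in S.
  specialize (S ltac:(apply hol_comp with (V := rhp) (h := M); auto; [intros; apply disc_to_rhp; auto|apply hol_disc_to_rhp])).
  specialize (S ltac:(intros; apply Hr; apply disc_to_rhp; auto) z Hz).
  rewrite Ez in S. replace ((q + Cconj q * 0) / (1 - 0))%C with q in S by field.
  unfold z in S. rewrite Cmod_div in S by auto. 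
  apply Rmult_le_compat_r with (r := Cmod (p + Cconj q)%C) in S; [|lra].
  eapply Rle_trans. apply S. right. field. lra.
Qed.

(** The infinitesimal Schwarz-Pick inequality: the parametrization of the half-plane centred at q
    has derivative q + Cconj q = 2 Re q at 0. *)
Lemma harnack_rhp (M : C -> C) (q d : C) :
  hol 2 rhp M -> (forall p, rhp p -> 0 <= Re (M p)) -> rhp q -> cder M q d ->
  Cmod d * Re q <= Re (M q).
Proof.
  intros HM Hr Hq Hd.
  assert (E0 : ((q + Cconj q * 0) / (1 - 0))%C = q) by field.
  assert (S := schwarz_to_rhp_der (fun z => M ((q + Cconj q * z) / (1 - z))%C) (d * (q + Cconj q))%C). cbv beta in S.
  rewrite E0 in S. rewrite Cmod_mult in S.
  replace (Cmod (q + Cconj q)%C) with (2 * Re q) in S.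
  2: { replace (q + Cconj q)%C with (RtoC (2 * Re q)). rewrite Cmod_R, Rabs_pos_eq; auto. unfold rhp in Hq; lra.
    apply injective_projections; unfold Re; simpl; ring. }
  assert (Cmod d * (2 * Re q) <= 2 * Re (M q)); [|lra]. apply S.
  - apply hol_comp with (V := rhp) (h := M); auto. intros; apply disc_to_rhp; auto. apply hol_disc_to_rhp.
  - intros; apply Hr; apply disc_to_rhp; auto.
  - apply (cder_comp (fun z => (q + Cconj q * z) / (1 - z))%C M). 2: { rewrite E0. auto. }
    eapply cder_eq. apply (cder_mult (fun z => q + Cconj q * z)%C (fun z => / (1 - z))%C).
    apply cder_plus. apply cder_const. apply cder_mult. apply cder_const. apply cder_id.
    apply (cder_inv (fun z => 1 - z)%C). apply cder_plus. apply cder_const. apply cder_opp. apply cder_id.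
    replace (1 - 0)%C with (RtoC 1) by ring. intro E; apply RtoC_inj in E; lra.
    cbv beta. field. 
Qed.

Lemma Cmod_disc_id (a z : C) : Cmod (1 - Cconj a * z)%C ^ 2 - Cmod (z - a)%C ^ 2 = (1 - Cmod a ^ 2) * (1 - Cmod z ^ 2).
Proof. rewrite !Cmod_sqr. simpl. ring. Qed.

Lemma disc_denominator (a z : C) : unit_disc a -> unit_disc z -> (1 - Cconj a * z)%C <> 0%C.
Proof.
  intros Ha Hz. apply one_minus_neq_0. unfold unit_disc in *. rewrite Cmod_mult, Cmod_conj.
  pose proof (Cmod_ge_0 a). pose proof (Cmod_ge_0 z). nra.
Qed.

Lemma disc_automorphism (a z : C) : unit_disc a -> unit_disc z -> unit_disc ((z - a) / (1 - Cconj a * z))%C.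
Proof.
  intros Ha Hz. assert (Hn := disc_denominator a z Ha Hz). unfold unit_disc in *. rewrite Cmod_div by auto.
  assert (P : 0 < Cmod (1 - Cconj a * z)%C) by (apply Cmod_gt_0; auto).
  apply Rmult_lt_reg_r with (Cmod (1 - Cconj a * z)%C); auto.
  unfold Rdiv. rewrite Rmult_assoc, Rinv_l, Rmult_1_r, Rmult_1_l by lra. apply Cmod_lt_of_sqr.
  pose proof (Cmod_disc_id a z). pose proof (Cmod_ge_0 a). pose proof (Cmod_ge_0 z).
  assert (0 < (1 - Cmod a ^ 2) * (1 - Cmod z ^ 2)) by (apply Rmult_lt_0_compat; nra). lra.
Qed.

Lemma schwarz_pick_disc (g : C -> C) (a z : C) :
  hol 2 unit_disc g -> (forall z, unit_disc z -> unit_disc (g z)) -> unit_disc a -> unit_disc z ->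
  Cmod (g z - g a)%C * Cmod (1 - Cconj a * z)%C <= Cmod (z - a)%C * Cmod (1 - Cconj (g a) * g z)%C.
Proof.
  intros Hg Hm Ha Hz.
  set (phi := fun x => ((x - - a) / (1 - Cconj (- a) * x))%C).
  assert (Hma : unit_disc (- a)%C) by (unfold unit_disc in *; rewrite Cmod_opp; auto).
  assert (Hphi : forall x, unit_disc x -> unit_disc (phi x)) by (intros; apply disc_automorphism; auto).
  set (x := ((z - a) / (1 - Cconj a * z))%C).
  assert (Hx : unit_disc x) by (apply disc_automorphism; auto).
  assert (Hn := disc_denominator a z Ha Hz).
  assert (Ex : phi x = z).
  { assert (Hn2 := disc_denominator (- a) x Hma Hx).
    assert (Hn3 := disc_denominator a a Ha Ha).
    assert (Ec : Cconj (- a)%C = (- Cconj a)%C) by (apply injective_projections; simpl; ring).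
    unfold phi. rewrite Ec in *.
    assert (E1 : (1 - - Cconj a * x)%C = ((1 - Cconj a * a) / (1 - Cconj a * z))%C) by (unfold x; field; auto).
    assert (E2 : (x - - a)%C = (z * (1 - Cconj a * a) / (1 - Cconj a * z))%C) by (unfold x; field; auto).
    rewrite E1, E2. field. auto. }
  assert (E0 : phi 0%C = a). { unfold phi. rewrite Cmult_0_r. field. }
  assert (Hpn : forall x, unit_disc x -> (1 - Cconj (g a) * g (phi x))%C <> 0%C).
  { intros y Hy. apply disc_denominator; auto. }
  assert (S := schwarz (fun x => (g (phi x) - g a) / (1 - Cconj (g a) * g (phi x)))%C). cbv beta in S.
  assert (Hgp : hol 2 unit_disc (fun x => g (phi x))).
  { apply hol_comp with (V := unit_disc) (h := g); auto. unfold phi. apply hol_div.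
    intros; apply disc_denominator; auto. apply hol_minus. apply hol_id. apply hol_const.
    apply hol_minus. apply hol_const. apply hol_mult. apply hol_const. apply hol_id. }
  assert (Q : Cmod ((g (phi x) - g a) / (1 - Cconj (g a) * g (phi x)))%C <= Cmod x).
  { apply S; auto.
    - apply hol_div; auto. apply hol_minus; auto. apply hol_const. apply hol_minus. apply hol_const. apply hol_mult; auto. apply hol_const.
    - intros y Hy. left. apply disc_automorphism; auto.
    - rewrite E0. replace (g a - g a)%C with (RtoC 0) by ring. unfold Cdiv. ring. }
  rewrite Ex in Q. unfold x in Q. specialize (Hpn x Hx). rewrite Ex in Hpn. rewrite !Cmod_div in Q by auto.
  assert (P1 : 0 < Cmod (1 - Cconj a * z)%C) by (apply Cmod_gt_0; auto).
  assert (P2 : 0 < Cmod (1 - Cconj (g a) * g z)%C) by (apply Cmod_gt_0; auto).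
  apply Rmult_le_compat_r with (r := Cmod (1 - Cconj a * z)%C * Cmod (1 - Cconj (g a) * g z)%C) in Q.
  2: { left. apply Rmult_lt_0_compat; auto. }
  replace (Cmod (g z - g a)%C * Cmod (1 - Cconj a * z)%C) with
   (Cmod (g z - g a)%C / Cmod (1 - Cconj (g a) * g z)%C * (Cmod (1 - Cconj a * z)%C * Cmod (1 - Cconj (g a) * g z)%C)) by (field; lra).
  eapply Rle_trans. apply Q. right. field. lra.
Qed.

(** * Concave maps *)

(** Working form of [CO]: the derivative is named, the limit at 1 is spelled out with moduli, and
    the opening angle is left to the lemmas that depend on it. *)
Definition concave_map (f f1 : C -> C) : Prop :=
  analytic unit_disc f /\ (forall z, unit_disc z -> cder f z (f1 z)) /\ injective_on unit_disc f /\
  convex_set (complement (image unit_disc f)) /\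
  (forall M, exists d, 0 < d /\ forall z, unit_disc z -> Cmod (z - 1)%C < d -> M < Cmod (f z)) /\
  f 0%C = 0%C /\ f1 0%C = 1%C.

Notation cpl f := (complement (image unit_disc f)).

(** Liouville's argument: if the image were the whole plane, the inverse g would map every disc of
    radius N into the unit disc, so |g w| <= |w|/N by Schwarz for all large N, and g 1 = 0 = g 0. *)
Lemma complement_nonempty (f f1 : C -> C) : concave_map f f1 -> exists x, cpl f x.
Proof.
  intros [Hf [Hd [Hi [_ [_ [H0 _]]]]]]. apply NNPP. intro Hn.
  assert (HG : forall w, image unit_disc f w).
  { intros w. apply NNPP. intro. apply Hn. exists w. auto. }
  destruct (inverse_exists unit_disc f f1 copen_unit_disc Hf Hi Hd) as [g [G1 [G2 [G3 _]]]].
  assert (Hsmall : forall w N, Cmod w < N -> Cmod (g w) <= Cmod w / N).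
  { intros w N Hw. assert (HN : 0 < N) by (pose proof (Cmod_ge_0 w); lra).
    assert (HNC : RtoC N <> 0%C) by (intro E; apply RtoC_inj in E; lra).
    assert (S := schwarz (fun z => g (RtoC N * z)%C)). cbv beta in S.
    assert (E : (RtoC N * (w / RtoC N))%C = w) by (field; auto).
    assert (Em : Cmod (w / RtoC N)%C = Cmod w / N) by (rewrite Cmod_div, Cmod_R, Rabs_pos_eq; auto; lra).
    rewrite <- Em. rewrite <- E at 1. apply S.
    - apply hol_comp with (V := image unit_disc f) (h := g); auto. apply hol_mult. apply hol_const. apply hol_id.
    - intros z _. left. apply G1. auto.
    - rewrite Cmult_0_r. transitivity (g (f 0%C)). rewrite H0; auto. apply G2. apply unit_disc_0.
    - unfold unit_disc. rewrite Em. apply Rmult_lt_reg_r with N; auto. unfold Rdiv. rewrite Rmult_assoc, Rinv_l; lra. }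
  assert (Z : g 1%C = 0%C).
  { apply NNPP. intro n. apply Cmod_gt_0 in n. 
    destruct (archimed_cor1 (Cmod (g 1%C)) n) as [N [HN HN0]].
    specialize (Hsmall 1%C (INR (S N))). rewrite Cmod_1 in Hsmall. rewrite S_INR in Hsmall. apply lt_0_INR in HN0.
    specialize (Hsmall ltac:(lra)). 
    assert (1 / (INR N + 1) <= / INR N). { unfold Rdiv. rewrite Rmult_1_l. apply Rinv_le_contravar; lra. } lra. }
  destruct (G1 1%C (HG 1%C)) as [_ E]. rewrite Z, H0 in E. apply RtoC_inj in E. lra.
Qed.

(** By contraposition: w is the convex combination of x and its dilate with weight 1/lam on the
    dilate. *)
Lemma image_dilation (f : C -> C) (x w : C) (lam : R) :
  convex_set (cpl f) -> cpl f x -> image unit_disc f w -> 1 <= lam ->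
  image unit_disc f (x + RtoC lam * (w - x))%C.
Proof.
  intros Hc Hx Hw Hl. apply NNPP. intro Hn.
  assert (K := Hc x (x + RtoC lam * (w - x))%C (/ lam) Hx Hn).
  assert (RtoC lam <> 0%C) by (intro E; apply RtoC_inj in E; lra).
  replace (RtoC (1 - / lam) * x + RtoC (/ lam) * (x + RtoC lam * (w - x)))%C with w in K.
  - apply K; auto. split. left. apply Rinv_0_lt_compat; lra. rewrite <- Rinv_1. apply Rinv_le_contravar; lra.
  - rewrite RtoC_minus, RtoC_inv by lra. field. auto.
Qed.

Lemma Cmod_1_minus_conj (t w : C) : Cmod t = 1 -> Cmod (1 - Cconj t * w)%C = Cmod (t - w)%C.
Proof.
  intros H. replace (1 - Cconj t * w)%C with (Cconj t * (t - w))%C.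
  rewrite Cmod_mult, Cmod_conj, H. ring.
  pose proof (Cmod2_conj t) as E. rewrite H in E.
  replace (Cconj t * (t - w))%C with (t * Cconj t - Cconj t * w)%C by ring. rewrite <- E. simpl. f_equal.
  replace (1 * (1 * 1)) with 1 by ring. auto.
Qed.

(* The orbit of 0 under w: points z_k with |z_{k+1}| >= |z_k| can be inserted in
   the invariant form of the Schwarz-Pick inequality. *)
Lemma boundary_point (w : C -> C) :
  hol 2 unit_disc w -> (forall z, unit_disc z -> unit_disc (w z)) ->
  (forall r, r < 1 -> exists N, forall k, (N <= k)%nat -> r < Cmod (Nat.iter k w 0%C)) ->
  exists t, Cmod t = 1 /\ forall z, unit_disc z ->
    (1 - Cmod z ^ 2) * Cmod (t - w z)%C ^ 2 <= (1 - Cmod (w z) ^ 2) * Cmod (t - z)%C ^ 2.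
Proof.
  intros Hw Hm Ho. set (s := fun k => Nat.iter k w (RtoC 0)) in *.
  assert (Hs : forall k, unit_disc (s k)).
  { induction k; simpl. apply unit_disc_0. apply Hm. auto. }
  assert (HsS : forall k, s (S k) = w (s k)) by reflexivity.
  (* Otherwise the moduli would decrease from some index on, although they tend to 1 from below. *)
  assert (Hinf : forall (k N : nat), exists n, (N <= n)%nat /\ (Cmod (s n) <= Cmod (s (S n)) /\ 1 - / (INR k + 1) < Cmod (s n))).
  { intros k N. destruct (Ho (1 - / (INR k + 1))) as [N1 HN1].
    { assert (0 < / (INR k + 1)). { apply Rinv_0_lt_compat. pose proof (pos_INR k). lra. } lra. }
    apply NNPP. intro Hn.
    assert (D : forall n, (max N N1 <= n)%nat -> Cmod (s (S n)) < Cmod (s n)).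
    { intros n Hnn. apply Rnot_le_lt. intro. apply Hn. exists n. split. lia. split; auto. apply HN1. lia. }
    assert (D2 : forall n, Cmod (s (max N N1 + n)%nat) <= Cmod (s (max N N1))).
    { induction n. rewrite Nat.add_0_r. lra. rewrite Nat.add_succ_r. specialize (D (max N N1 + n)%nat ltac:(lia)). lra. }
    destruct (Ho (Cmod (s (max N N1)))) as [N2 HN2]. apply Hs.
    specialize (HN2 (max N N1 + N2)%nat ltac:(lia)). specialize (D2 N2). unfold s in *. lra. }
  destruct (extraction_exists _ Hinf) as [phi [He Hp]].
  destruct (bw (fun n => s (phi n)) 1) as [psi [t [He2 Ht]]].
  { intros n. left. apply Hs. }
  destruct (bw (fun n => s (S (phi (psi n)))) 1) as [chi [t' [He3 Ht']]].
  { intros n. left. apply Hs. }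
  set (a := fun n => phi (psi (chi n))).
  assert (La : cvg (fun n => s (a n)) t).
  { apply (cvg_sub (fun n => s (phi (psi n)))); auto. apply extraction_ge; auto. }
  assert (Lb : cvg (fun n => s (S (a n))) t') by auto.
  assert (Ha : forall n, Cmod (s (a n)) <= Cmod (s (S (a n)))). { intros; apply Hp. }
  assert (Ht1 : Cmod t = 1).
  { apply Rle_antisym. eapply is_lim_seq_le_const; [|apply (cvg_Cmod _ _ La)]. intros n. left; apply Hs.
    apply le_epsilon. intros e Hee. 
    assert (1 - e <= Cmod t); [|lra].
    destruct (archimed_cor1 e Hee) as [N [HN HN0]]. 
    apply is_lim_seq_ge_const with (fun n => Cmod (s (a (n + N)%nat))).
    - intros n. destruct (Hp (psi (chi (n + N)%nat))) as [_ Q]. unfold a.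
      assert (INR N <= INR (psi (chi (n + N)%nat))). { apply le_INR. pose proof (extraction_ge _ He2 (chi (n + N)%nat)). pose proof (extraction_ge _ He3 (n + N)%nat). lia. }
      assert (/ (INR (psi (chi (n + N)%nat)) + 1) <= / INR N). { apply Rinv_le_contravar. apply lt_0_INR; auto. lra. } lra.
    - apply (is_lim_seq_incr_n (fun n => Cmod (s (a n)))). apply cvg_Cmod; auto. }
  (* By Schwarz-Pick the pseudohyperbolic length of a step never exceeds that of the first one, c =
     |s 1| < 1. In the limit |t' - t| <= c |t' - t|, so consecutive points of the orbit have the
     same limit. *)
  assert (Hq : exists c, c < 1 /\ 0 <= c /\ forall k, Cmod (s (S k) - s k)%C <= c * Cmod (1 - Cconj (s k) * s (S k))%C).
  { exists (Cmod (s 1%nat)). split. apply Hs. split. apply Cmod_ge_0.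
    induction k.
    - assert (E0 : s 0%nat = RtoC 0) by reflexivity. rewrite E0.
      replace (1 - Cconj 0 * s 1%nat)%C with (RtoC 1) by (apply injective_projections; simpl; ring).
      rewrite Cmod_1. replace (s 1%nat - 0)%C with (s 1%nat) by ring. lra.
    - assert (P := schwarz_pick_disc w (s k) (s (S k)) Hw Hm (Hs _) (Hs _)). rewrite <- !HsS in P.
      assert (Q : 0 < Cmod (1 - Cconj (s k) * s (S k))%C) by (apply Cmod_gt_0; apply disc_denominator; auto).
      apply Rmult_le_reg_r with (Cmod (1 - Cconj (s k) * s (S k))%C); auto.
      eapply Rle_trans. apply P. pose proof (Cmod_ge_0 (1 - Cconj (s (S k)) * s (S (S k)))%C). nra. }
  assert (Hconj : forall u v : nat -> C, forall l m, cvg u l -> cvg v m -> cvg (fun n => 1 - Cconj (u n) * v n)%C (1 - Cconj l * m)%C).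
  { intros u v l m Hu Hv. apply cvg_minus. apply cvg_const. apply cvg_mult; auto. intros e Hee. destruct (Hu e Hee) as [N HN].
    exists N. intros n Hn. specialize (HN n Hn). rewrite <- Cmod_conj in HN. 
    replace (Cconj (u n) - Cconj l)%C with (Cconj (u n - l)%C); auto. apply injective_projections; simpl; ring. }
  assert (Htt : t' = t).
  { destruct Hq as [c [Hc1 [Hc0 Hq]]].
    assert (Q : 0 <= c * Cmod (1 - Cconj t * t')%C - Cmod (t' - t)%C).
    { apply is_lim_seq_ge_const with (fun n => c * Cmod (1 - Cconj (s (a n)) * s (S (a n)))%C - Cmod (s (S (a n)) - s (a n))%C).
      intros n. specialize (Hq (a n)). lra. apply is_lim_seq_minus'. apply is_lim_seq_mult'. apply is_lim_seq_const.
      apply (cvg_Cmod (fun n => 1 - Cconj (s (a n)) * s (S (a n)))%C). apply Hconj; auto.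
      apply (cvg_Cmod (fun n => s (S (a n)) - s (a n))%C). apply cvg_minus; auto. }
    rewrite Cmod_1_minus_conj in Q by auto. rewrite Cmod_sub_sym in Q. pose proof (Cmod_ge_0 (t' - t)%C).
    assert (E : Cmod (t' - t)%C = 0) by nra.
    apply Cmod_eq_0 in E. replace t' with ((t' - t) + t)%C by ring. rewrite E. ring. }
  subst t'. exists t. split; auto. intros z Hz.
  assert (Hwz : unit_disc (w z)) by auto.
  rewrite <- (Cmod_1_minus_conj t z), <- (Cmod_1_minus_conj t (w z)) by auto.
  assert (0 <= (1 - Cmod (w z) ^ 2) * Cmod (1 - Cconj t * z)%C ^ 2 - (1 - Cmod z ^ 2) * Cmod (1 - Cconj t * w z)%C ^ 2); [|lra].
  apply is_lim_seq_ge_const with (fun n => (1 - Cmod (w z) ^ 2) * Cmod (1 - Cconj (s (a n)) * z)%C ^ 2 - (1 - Cmod z ^ 2) * Cmod (1 - Cconj (s (S (a n))) * w z)%C ^ 2).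
  - intros n. assert (P := schwarz_pick_disc w (s (a n)) z Hw Hm (Hs _) Hz). rewrite <- HsS in P.
    assert (E1 := Cmod_disc_id (s (a n)) z). assert (E2 := Cmod_disc_id (s (S (a n))) (w z)).
    specialize (Ha n). pose proof (Hs (a n)) as U1. pose proof (Hs (S (a n))) as U2. unfold unit_disc in *.
    pose proof (Cmod_ge_0 (s (a n))). pose proof (Cmod_ge_0 (w z)). pose proof (Cmod_ge_0 z).
    set (A := Cmod (1 - Cconj (s (a n)) * z)%C) in *. set (B := Cmod (1 - Cconj (s (S (a n))) * w z)%C) in *.
    set (P1 := Cmod (w z - s (S (a n)))%C) in *. set (P2 := Cmod (z - s (a n))%C) in *.
    assert (HA : 0 <= A) by apply Cmod_ge_0. assert (HB : 0 <= B) by apply Cmod_ge_0.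
    assert (HP1 : 0 <= P1) by apply Cmod_ge_0. assert (HP2 : 0 <= P2) by apply Cmod_ge_0.
    assert (SQ : (P1 * A) ^ 2 <= (P2 * B) ^ 2). { apply pow_incr. split; auto. apply Rmult_le_pos; auto. }
    rewrite !Rpow_mult_distr in SQ.
    assert (V1 : 0 < 1 - Cmod (s (a n)) ^ 2) by nra.
    assert (V2 : 1 - Cmod (s (S (a n))) ^ 2 <= 1 - Cmod (s (a n)) ^ 2) by nra.
    assert (V3 : 0 <= 1 - Cmod z ^ 2) by nra. assert (V4 : 0 <= 1 - Cmod (w z) ^ 2) by nra.
    apply Rmult_le_reg_l with (1 - Cmod (s (a n)) ^ 2); auto. rewrite Rmult_0_r.
    assert (R1 : (1 - Cmod (s (a n)) ^ 2) * (1 - Cmod z ^ 2) * B ^ 2 <= (1 - Cmod (s (S (a n))) ^ 2) * (1 - Cmod (w z) ^ 2) * A ^ 2).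
    { rewrite <- E1, <- E2. ring_simplify. ring_simplify in SQ. lra. }
    assert (R2 : (1 - Cmod (s (S (a n))) ^ 2) * ((1 - Cmod (w z) ^ 2) * A ^ 2) <= (1 - Cmod (s (a n)) ^ 2) * ((1 - Cmod (w z) ^ 2) * A ^ 2)).
    { apply Rmult_le_compat_r; auto. apply Rmult_le_pos; auto. apply pow2_ge_0. }
    lra.
  - assert (Lsq : forall u l, cvg u l -> is_lim_seq (fun n => Cmod (u n) ^ 2) (Cmod l ^ 2)).
    { intros u l Hu. apply is_lim_seq_ext with (fun n => Cmod (u n) * Cmod (u n)). intros; ring.
      replace (Cmod l ^ 2) with (Cmod l * Cmod l) by ring. apply is_lim_seq_mult'; apply cvg_Cmod; auto. }
    apply is_lim_seq_minus'; apply is_lim_seq_mult'; try apply is_lim_seq_const.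
    + apply (Lsq (fun n => 1 - Cconj (s (a n)) * z)%C). apply Hconj; auto. apply cvg_const.
    + apply (Lsq (fun n => 1 - Cconj (s (S (a n))) * w z)%C). apply Hconj; auto. apply cvg_const.
Qed.

Lemma concave_map_der_neq_0 (f f1 : C -> C) : concave_map f f1 -> forall z, unit_disc z -> f1 z <> 0%C.
Proof.
  intros [Hf [Hd [Hi _]]] z Hz. apply (univalent_der_neq_0 unit_disc f f1 z); auto. apply copen_unit_disc.
Qed.

Lemma complement_neq (f : C -> C) (x z : C) : cpl f x -> unit_disc z -> f z <> x.
Proof. intros Hx Hz E. apply Hx. exists z. auto. Qed.

Lemma affine_scale_arg (x w : C) (lam : R) (n : nat) :
  (x + RtoC lam * (x + RtoC (lam ^ n) * (w - x) - x))%C = (x + RtoC (lam ^ S n) * (w - x))%C.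
Proof. simpl pow. rewrite RtoC_mult. ring. Qed.

(** The orbit of 0 satisfies f(z_k) = (1 - lam^k) x, which is unbounded since x <> 0 = f 0. As f is
    bounded on every smaller disc, the orbit leaves each of them, as [boundary_point] demands. *)
Lemma dilation_point (f f1 : C -> C) (x : C) (lam : R) (g : C -> C) :
  concave_map f f1 -> cpl f x -> 1 < lam ->
  (forall w, image unit_disc f w -> unit_disc (g w) /\ f (g w) = w) -> analytic (image unit_disc f) g ->
  exists t, Cmod t = 1 /\ forall z, unit_disc z ->
    let w := g (x + RtoC lam * (f z - x))%C in
    (1 - Cmod z ^ 2) * Cmod (t - w)%C ^ 2 <= (1 - Cmod w ^ 2) * Cmod (t - z)%C ^ 2.
Proof.
  intros [Hf [Hd [Hi [Hc [_ [H0 _]]]]]] Hx Hl Hg Ag.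
  set (om := fun z => g (x + RtoC lam * (f z - x))%C).
  assert (HG : forall z, unit_disc z -> image unit_disc f (x + RtoC lam * (f z - x))%C).
  { intros z Hz. apply image_dilation; auto. exists z; auto. lra. }
  assert (Hm : forall z, unit_disc z -> unit_disc (om z)) by (intros z Hz; apply Hg; auto).
  apply (boundary_point om); auto.
  - apply hol_comp with (V := image unit_disc f) (h := g); auto. apply hol_plus. apply hol_const.
    apply hol_mult. apply hol_const. apply hol_minus; auto. apply hol_const.
  - assert (Hs : forall k, unit_disc (Nat.iter k om 0%C) /\ f (Nat.iter k om 0%C) = (x + RtoC (lam ^ k) * (0 - x))%C).
    { induction k. simpl. split. apply unit_disc_0. rewrite H0. ring.
      destruct IHk as [A B]. split. apply Hm; auto. rewrite <- affine_scale_arg, <- B. apply Hg. apply HG; auto. }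
    assert (Hx0 : 0 < Cmod x).
    { apply Cmod_gt_0. intros ->. apply Hx. exists 0%C. split; auto. apply unit_disc_0. }
    intros r Hr. destruct (Rlt_dec r 0) as [Hr0|Hr0].
    { exists 0%nat. intros. eapply Rlt_le_trans. apply Hr0. apply Cmod_ge_0. }
    destruct (bounded_on_disc f 0%C r) as [M [HM0 HM]]. lra.
    { intros z Q. apply (Hf 0%nat). replace (z - 0)%C with z in Q by ring. unfold unit_disc. lra. }
    destruct (Pow_x_infinity lam ltac:(rewrite Rabs_pos_eq; lra) ((M + 1) / Cmod x + 1)) as [N HN].
    exists N. intros k Hk. apply Rnot_le_lt. intro Hle. destruct (Hs k) as [A B].
    specialize (HM (Nat.iter k om 0%C)). replace (Nat.iter k om 0 - 0)%C with (Nat.iter k om 0)%C in HM by ring.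
    specialize (HM Hle). rewrite B in HM. specialize (HN k ltac:(lia)). rewrite Rabs_pos_eq in HN by (apply pow_le; lra).
    replace (x + RtoC (lam ^ k) * (0 - x))%C with (RtoC (1 - lam ^ k) * x)%C in HM by (rewrite RtoC_minus; ring).
    rewrite Cmod_mult, Cmod_R in HM.
    assert (P : 0 < (M + 1) / Cmod x) by (apply Rdiv_lt_0_compat; lra).
    rewrite Rabs_left1 in HM by lra.
    assert ((M + 1) / Cmod x * Cmod x <= - (1 - lam ^ k) * Cmod x) by (apply Rmult_le_compat_r; lra).
    replace ((M + 1) / Cmod x * Cmod x) with (M + 1) in H by (field; lra). lra.
Qed.

Lemma Re_div_sign (a b : C) : b <> 0%C -> 0 <= Re (a / b)%C -> 0 <= Re (Cconj a * b)%C.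
Proof.
  intros Hb H. assert (P : 0 < Cmod b ^ 2) by (apply pow_lt; apply Cmod_gt_0; auto).
  replace (Re (Cconj a * b)%C) with (Re (a / b)%C * Cmod b ^ 2). apply Rmult_le_pos; lra.
  rewrite Cmod_sqr in *. unfold Re, Cdiv, Cinv in *. simpl in *. field. lra.
Qed.

(** Re (t+z)/(t-z) is the Poisson kernel (1 - |z|^2)/|t-z|^2, so the hypothesis says that it does
    not decrease from z to w. The increment of (t+z)/(t-z) from z to w is 2 t (w-z)/((t-z)(t-w)). *)
Lemma Re_boundary_kernel (t z w : C) : Cmod t = 1 -> unit_disc z -> unit_disc w ->
  (1 - Cmod z ^ 2) * Cmod (t - w)%C ^ 2 <= (1 - Cmod w ^ 2) * Cmod (t - z)%C ^ 2 ->
  0 <= Re (t * (w - z) / ((t - z) * (t - w)))%C.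
Proof.
  intros Ht Hz Hw H.
  assert (Hn : forall v, unit_disc v -> (t - v)%C <> 0%C).
  { intros v Hv E. unfold unit_disc in Hv. replace v with (t - (t - v))%C in Hv by ring. rewrite E in Hv.
    replace (t - 0)%C with t in Hv by ring. lra. }
  assert (Pz : 0 < Cmod (t - z)%C ^ 2) by (apply pow_lt; apply Cmod_gt_0; auto).
  assert (Pw : 0 < Cmod (t - w)%C ^ 2) by (apply pow_lt; apply Cmod_gt_0; auto).
  assert (K : forall v, unit_disc v -> Re ((t + v) / (t - v))%C * Cmod (t - v)%C ^ 2 = 1 - Cmod v ^ 2).
  { intros v Hv. assert (P : 0 < Cmod (t - v)%C ^ 2) by (apply pow_lt; apply Cmod_gt_0; auto).
    assert (Ht2 : Cmod t ^ 2 = 1) by (rewrite Ht; ring). rewrite <- Ht2.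
    rewrite !Cmod_sqr in *. unfold Re, Cdiv, Cinv in *. simpl in *. field. lra. }
  assert (E : (t * (w - z) / ((t - z) * (t - w)))%C = (RtoC (/ 2) * ((t + w) / (t - w) - (t + z) / (t - z)))%C).
  { rewrite RtoC_inv by lra. field. split; auto. }
  rewrite E, Re_scal, Re_minus. specialize (K z Hz) as Kz. specialize (K w Hw) as Kw. rewrite <- Kz, <- Kw in H.
  set (A := Re ((t + z) / (t - z))%C) in *. set (B := Re ((t + w) / (t - w))%C) in *.
  assert (A <= B); [|lra]. apply Rmult_le_reg_r with (Cmod (t - z)%C ^ 2 * Cmod (t - w)%C ^ 2).
  apply Rmult_lt_0_compat; auto. lra.
Qed.

(* Differentiating the dilations z |-> f^-1(x + lam (f z - x)) at lam = 1. *)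
Lemma starlike_boundary_point (f f1 : C -> C) (x : C) :
  concave_map f f1 -> cpl f x ->
  exists t, Cmod t = 1 /\ forall z, unit_disc z -> 0 <= Re (Cconj (t * (f z - x)) * (f1 z * ((t - z) * (t - z))))%C.
Proof.
  intros HC Hx. assert (HC' := HC). destruct HC' as [Hf [Hd [Hi [Hc [_ [H0 _]]]]]].
  destruct (inverse_exists unit_disc f f1 copen_unit_disc Hf Hi Hd) as [g [G1 [G2 [G3 G4]]]].
  set (e := fun n : nat => / (INR n + 1)).
  assert (He : forall n, 0 < e n). { intros n. apply Rinv_0_lt_compat. pose proof (pos_INR n). lra. }
  assert (HP : forall n, exists t, Cmod t = 1 /\ forall z, unit_disc z ->
    let w := g (x + RtoC (1 + e n) * (f z - x))%C in
    (1 - Cmod z ^ 2) * Cmod (t - w)%C ^ 2 <= (1 - Cmod w ^ 2) * Cmod (t - z)%C ^ 2).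
  { intros n. apply dilation_point with f1; auto. specialize (He n). lra. }
  apply choice in HP. destruct HP as [tn Htn].
  destruct (bw tn 1) as [phi [t [Ephi Ht]]]. { intros n. destruct (Htn n) as [-> _]. lra. }
  assert (Ht1 : Cmod t = 1).
  { assert (L := cvg_Cmod _ _ Ht). assert (L2 : is_lim_seq (fun n => Cmod (tn (phi n))) 1).
    { apply is_lim_seq_ext with (fun _ => 1). intros n. symmetry. apply Htn. apply is_lim_seq_const. }
    apply is_lim_seq_unique in L. apply is_lim_seq_unique in L2. rewrite L in L2. injection L2; auto. }
  exists t. split; auto. intros z Hz.
  assert (Hzx : f z <> x) by (eapply complement_neq; eauto).
  assert (Hf1 : f1 z <> 0%C) by (eapply concave_map_der_neq_0; eauto).
  assert (HtzU : forall s v, Cmod s = 1 -> unit_disc v -> (s - v)%C <> 0%C).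
  { intros s v Hs Hv E. unfold unit_disc in Hv. replace v with (s - (s - v))%C in Hv by ring. rewrite E in Hv.
    replace (s - 0)%C with s in Hv by ring. lra. }
  assert (Htz := HtzU t z Ht1 Hz).
  assert (HGz : image unit_disc f (f z)) by (exists z; auto).
  destruct (proj1 (cder_cara _ _ _) (G4 (f z) HGz)) as [q [Q1 [Q2 Q3]]]. rewrite G2 in Q2 by auto.
  set (y := fun n => (x + RtoC (1 + e (phi n)) * (f z - x))%C).
  assert (Hy : forall n, image unit_disc f (y n)).
  { intros n. apply image_dilation; auto. specialize (He (phi n)). lra. }
  assert (Ly : cvg y (f z)).
  { intros eps Heps. assert (Pz : 0 < Cmod (f z - x)%C) by (apply Cmod_gt_0; apply Cminus_neq; auto).
    destruct (archimed_cor1 (eps / Cmod (f z - x)%C)) as [N [HN HN0]]. apply Rdiv_lt_0_compat; auto.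
    exists N. intros n Hn. unfold y. replace (x + RtoC (1 + e (phi n)) * (f z - x) - f z)%C with (RtoC (e (phi n)) * (f z - x))%C by (rewrite RtoC_plus; ring).
    rewrite Cmod_mult, Cmod_R, Rabs_pos_eq by (left; apply He).
    apply Rlt_le_trans with (eps / Cmod (f z - x)%C * Cmod (f z - x)%C). 2: { right; field; lra. }
    apply Rmult_lt_compat_r; auto. eapply Rle_lt_trans; [|apply HN]. unfold e. apply Rinv_le_contravar. apply lt_0_INR; auto.
    pose proof (extraction_ge _ Ephi n). apply Rle_trans with (INR n). apply le_INR; auto. apply le_INR in H. lra. }
  assert (Lw : cvg (fun n => g (y n)) z).
  { rewrite <- (G2 z Hz). apply cvg_cont; auto. eapply cder_ccont. apply G4; auto. }
  assert (Lq : cvg (fun n => q (y n)) (/ f1 z)%C). { rewrite <- Q2. apply cvg_cont; auto. }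
  (* The displacement of z is e (f z - x) times a difference quotient of the inverse; the positive
     factor e divides out, and the quotient tends to 1/f'(z). *)
  assert (Hterm : forall n, 0 <= Re (tn (phi n) * (q (y n) * (f z - x)) / ((tn (phi n) - z) * (tn (phi n) - g (y n))))%C).
  { intros n. destruct (Htn (phi n)) as [T1 T2]. specialize (T2 z Hz). cbv zeta in T2. fold (y n) in T2.
    assert (K := Re_boundary_kernel (tn (phi n)) z (g (y n)) T1 Hz (proj1 (G1 _ (Hy n))) T2).
    assert (E : (g (y n) - z = RtoC (e (phi n)) * (q (y n) * (f z - x)))%C).
    { rewrite <- (G2 z Hz) at 1. rewrite Q3. unfold y at 2. rewrite RtoC_plus. ring. }
    rewrite E in K.
    assert (N1 := HtzU _ _ T1 Hz). assert (N2 := HtzU _ _ T1 (proj1 (G1 _ (Hy n)))).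
    replace (tn (phi n) * (RtoC (e (phi n)) * (q (y n) * (f z - x))) / ((tn (phi n) - z) * (tn (phi n) - g (y n))))%C
      with (RtoC (e (phi n)) * (tn (phi n) * (q (y n) * (f z - x)) / ((tn (phi n) - z) * (tn (phi n) - g (y n)))))%C in K by (field; auto).
    rewrite Re_scal in K. apply Rmult_le_reg_l with (e (phi n)); auto. lra. }
  assert (Fin : 0 <= Re (t * (/ f1 z * (f z - x)) / ((t - z) * (t - z)))%C).
  { eapply is_lim_seq_ge_const. apply Hterm. apply cvg_Re. apply cvg_mult. apply cvg_mult; auto. apply cvg_mult; auto. apply cvg_const.
    apply cvg_inv. apply Cmult_neq_0; auto. apply cvg_mult; apply cvg_minus; auto; apply cvg_const. }
  apply Re_div_sign. apply Cmult_neq_0; auto. apply Cmult_neq_0; auto.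
  replace (t * (f z - x) / (f1 z * ((t - z) * (t - z))))%C with (t * (/ f1 z * (f z - x)) / ((t - z) * (t - z)))%C; auto.
  field; auto.
Qed.

(** Along a horizontal ray |F - x|^2 has derivative 2 Re (Cconj (F - x) F'). This serves to locate
    the boundary point t and, later, to bound F near the imaginary axis by its values further to the
    right. *)
Lemma Cmod_nondecreasing (F F1 : C -> C) (x p : C) (t : R) :
  (forall p, rhp p -> cder F p (F1 p)) -> (forall p, rhp p -> 0 <= Re (Cconj (F p - x) * F1 p)%C) ->
  rhp p -> 0 <= t -> Cmod (F p - x)%C <= Cmod (F (p + RtoC t) - x)%C.
Proof.
  intros Hd Hr Hp Ht.
  assert (Hin : forall s, 0 <= s -> rhp (p + RtoC s * 1)%C).
  { intros s Hs. unfold rhp in *. rewrite Re_plus. unfold Re in *; simpl. lra. }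
  set (ps := fun s : R => Cmod (F (p + RtoC s * 1) - x)%C ^ 2).
  set (dps := fun s : R => 2 * Re (Cconj (F (p + RtoC s * 1) - x) * F1 (p + RtoC s * 1))%C).
  assert (D : forall s, 0 <= s <= t -> derivable_pt_lim ps s (dps s)).
  { intros s Hs. apply is_derive_Reals. evar_last.
    apply (sq_path_derive (fun p => F p - x)%C F1). eapply cder_eq. apply cder_plus. apply Hd. apply Hin. lra. apply cder_const. ring.
    cbv beta. unfold dps, Re. rewrite Cmult_1_r. simpl. ring. }
  assert (Q : ps 0 <= ps t).
  { destruct Ht as [Ht|<-]; [|lra]. destruct (MVT_cor2 ps dps 0 t Ht D) as [c [E Hc]].
    assert (0 <= dps c). { unfold dps. specialize (Hr _ (Hin c ltac:(lra))). lra. } nra. }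
  unfold ps in Q. replace (p + RtoC 0 * 1)%C with p in Q by ring. rewrite Cmult_1_r in Q. apply Cmod_le_of_sqr; auto.
Qed.

(** The half-plane coordinate of the disc in which the boundary point t sits at infinity. *)
Definition cayley_inv (t p : C) : C := (t * (p - 1) / (p + 1))%C.

Lemma rhp_plus_1 (p : C) : rhp p -> (p + 1)%C <> 0%C.
Proof. intros H. apply Re_pos_neq_0. unfold rhp, Re in *. simpl. lra. Qed.

Lemma cayley_inv_disc (t p : C) : Cmod t = 1 -> rhp p -> unit_disc (cayley_inv t p).
Proof.
  intros Ht Hp. assert (Hn := rhp_plus_1 p Hp). unfold unit_disc, cayley_inv. rewrite Cmod_div, Cmod_mult, Ht, Rmult_1_l by auto.
  assert (0 < Cmod (p + 1)%C) by (apply Cmod_gt_0; auto).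
  apply Rmult_lt_reg_r with (Cmod (p + 1)%C); auto. unfold Rdiv. rewrite Rmult_assoc, Rinv_l, Rmult_1_l, Rmult_1_r by lra.
  apply Cmod_lt_of_sqr. rewrite !Cmod_sqr. unfold rhp, Re in Hp. simpl. nra.
Qed.

Lemma cder_cayley_inv (t p : C) : rhp p -> cder (cayley_inv t) p (t * 2 / ((p + 1) * (p + 1)))%C.
Proof.
  intros Hp. assert (Hn := rhp_plus_1 p Hp). unfold cayley_inv. eapply cder_eq.
  apply (cder_mult (fun p => t * (p - 1))%C (fun p => / (p + 1))%C).
  apply cder_mult. apply cder_const. apply cder_plus. apply cder_id. apply cder_const.
  apply cder_inv; auto. apply cder_plus. apply cder_id. apply cder_const. cbv beta. field. auto.
Qed.

(** It remains to see that the boundary point t is 1. In the coordinate with t at infinity |f - x|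
    is nondecreasing along horizontal rays. If t <> 1, then 1 corresponds to a finite point of the
    imaginary axis, and approaching it from the right keeps f bounded, against f(1) = oo. *)
Lemma starlike_ineq (f f1 : C -> C) (x z : C) :
  concave_map f f1 -> cpl f x -> unit_disc z -> 0 <= Re (Cconj (f z - x) * (f1 z * ((1 - z) * (1 - z))))%C.
Proof.
  intros HC Hx. destruct (starlike_boundary_point f f1 x HC Hx) as [t [Ht H]].
  assert (E : t = 1%C).
  2: { subst t. intros Hz. specialize (H z Hz). rewrite Cmult_1_l in H. auto. }
  apply NNPP. intro Hn. destruct HC as [Hf [Hd [_ [_ [Hinf _]]]]].
  assert (Hn1 : (t - 1)%C <> 0%C) by (apply Cminus_neq; auto).
  (* The point of the imaginary axis that [cayley_inv t] sends to 1. *)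
  set (p0 := ((t + 1) / (t - 1))%C).
  assert (Hp0 : Re p0 = 0).
  { assert (P : 0 < Cmod (t - 1)%C ^ 2) by (apply pow_lt; apply Cmod_gt_0; auto).
    assert (Ht2 : Cmod t ^ 2 = 1) by (rewrite Ht; ring).
    apply Rmult_eq_reg_r with (Cmod (t - 1)%C ^ 2); [|lra]. rewrite Rmult_0_l.
    transitivity (Cmod t ^ 2 - 1); [|lra]. unfold p0. rewrite !Cmod_sqr in *. unfold Re, Cdiv, Cinv in *. simpl in *. field. lra. }
  assert (HT2 : (t * Cconj t = 1)%C). { pose proof (Cmod2_conj t) as E. rewrite Ht in E. rewrite <- E. simpl. f_equal. ring. }
  assert (Htn : t <> 0%C) by (intros ->; rewrite Cmod_0 in Ht; lra).
  assert (M := Cmod_nondecreasing (fun p => f (cayley_inv t p)) (fun p => f1 (cayley_inv t p) * (t * 2 / ((p + 1) * (p + 1))))%C x).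
  cbv beta in M.
  assert (Hrp : forall s, 0 < s -> rhp (p0 + RtoC s)%C). { intros s Hs. unfold rhp. rewrite Re_plus, Hp0, Re_RtoC. lra. }
  assert (Mon : forall s, 0 < s <= 1 -> Cmod (f (cayley_inv t (p0 + RtoC s)) - x)%C <= Cmod (f (cayley_inv t (p0 + RtoC 1)) - x)%C).
  { intros s Hs. replace (p0 + RtoC 1)%C with ((p0 + RtoC s) + RtoC (1 - s))%C by (rewrite RtoC_minus; ring).
    apply M; try lra.
    - intros p Hp. apply cder_comp with (h := f). apply cder_cayley_inv; auto. apply Hd. apply cayley_inv_disc; auto.
    - intros p Hp. specialize (H (cayley_inv t p) (cayley_inv_disc t p Ht Hp)). assert (Hp1 := rhp_plus_1 p Hp).
      assert (E : (t - cayley_inv t p = t * 2 / (p + 1))%C) by (unfold cayley_inv; field; auto). rewrite E in H.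
      replace (Cconj (t * (f (cayley_inv t p) - x)) * (f1 (cayley_inv t p) * (t * 2 / (p + 1) * (t * 2 / (p + 1)))))%C
       with ((t * Cconj t) * (2 * (Cconj (f (cayley_inv t p) - x) * (f1 (cayley_inv t p) * (t * 2 / ((p + 1) * (p + 1)))))))%C in H.
      rewrite HT2, Cmult_1_l, Re_scal in H. lra.
      rewrite Cmult_conj. field. auto.
    - apply Hrp. lra. }
  destruct (Hinf (Cmod (f (cayley_inv t (p0 + RtoC 1)) - x)%C + Cmod x)) as [d [Hdp HI]].
  assert (Hc1 : cayley_inv t p0 = 1%C).
  { unfold cayley_inv, p0. assert (N2 : ((t + 1) / (t - 1) + 1)%C <> 0%C).
    { replace ((t + 1) / (t - 1) + 1)%C with (2 * t * / (t - 1))%C by (field; auto).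
      apply Cmult_neq_0. apply Cmult_neq_0; auto. intro E; apply RtoC_inj in E; lra.
      intro E. assert (E2 := Cinv_r _ Hn1). rewrite E, Cmult_0_r in E2. apply RtoC_inj in E2. lra. }
    assert (N3 : (t + 1 + (t - 1))%C <> 0%C).
    { replace (t + 1 + (t - 1))%C with (2 * t)%C by ring. apply Cmult_neq_0; auto. intro E; apply RtoC_inj in E; lra. }
    field. split; auto. }
  assert (Hcc : ccont (cayley_inv t) p0).
  { assert (N2 : (p0 + 1)%C <> 0%C). { apply Re_pos_neq_0. rewrite Re_plus, Hp0. unfold Re; simpl; lra. }
    unfold cayley_inv, Cdiv. apply ccont_mult. apply ccont_mult. apply ccont_const. apply ccont_plus. apply ccont_id. apply ccont_const.
    apply ccont_inv; auto. apply ccont_plus. apply ccont_id. apply ccont_const. }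
  destruct (Hcc d Hdp) as [r [Hr Hcr]]. set (s := Rmin (r / 2) 1).
  assert (Hs : 0 < s). { unfold s. apply Rmin_glb_lt; lra. }
  assert (Hs1 : s <= 1) by apply Rmin_r. assert (Hs2 : s <= r / 2) by apply Rmin_l.
  specialize (Hcr (p0 + RtoC s)%C). replace (p0 + RtoC s - p0)%C with (RtoC s) in Hcr by ring.
  rewrite Cmod_R, Rabs_pos_eq, Hc1 in Hcr by lra. specialize (Hcr ltac:(lra)).
  specialize (HI _ (cayley_inv_disc t _ Ht (Hrp s Hs)) Hcr). specialize (Mon s ltac:(lra)).
  pose proof (Cmod_le_sum (f (cayley_inv t (p0 + RtoC s))) x). lra.
Qed.

(** * Recession cone and opening angle *)

Lemma exp_le (x y : R) : x <= y -> exp x <= exp y.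
Proof. intros [H| ->]. left. apply exp_increasing; auto. lra. Qed.

Lemma affine_nonneg (a b : R) : (forall t, 0 <= t -> 0 <= a + t * b) -> 0 <= b.
Proof.
  intros H. apply Rnot_lt_le. intro Hb. pose proof (H 0 ltac:(lra)).
  specialize (H ((a + 1) / - b)). assert (0 <= (a + 1) / - b). { apply Rdiv_le_0_compat; lra. }
  specialize (H H1). replace ((a + 1) / - b * b) with (- (a + 1)) in H by (field; lra). lra.
Qed.

(** The complement contains x + t v for every t >= 0, and [starlike_ineq] at this point is affine in
    t; its slope cannot be negative. *)
Lemma recession_ineq (f f1 : C -> C) (v z : C) :
  concave_map f f1 -> recession_cone (cpl f) v -> unit_disc z ->
  0 <= Re (- Cconj v * (f1 z * ((1 - z) * (1 - z))))%C.
Proof.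
  intros HC Hv Hz. destruct (complement_nonempty f f1 HC) as [x Hx].
  apply affine_nonneg with (Re (Cconj (f z - x) * (f1 z * ((1 - z) * (1 - z))))%C).
  intros t Ht. assert (S := starlike_ineq f f1 _ z HC (Hv x t Hx Ht) Hz).
  eapply Rle_trans. apply S. right. set (H := (f1 z * ((1 - z) * (1 - z)))%C). unfold Re. simpl. ring.
Qed.

(** [recession_ineq] at z = 0, where f' = 1. Consequently the arc of recession directions stays away
    from the angles 0 and 2 PI at which [cone_angle] cuts the circle. *)
Lemma recession_Re (f f1 : C -> C) (v : C) : concave_map f f1 -> recession_cone (cpl f) v -> Re v <= 0.
Proof.
  intros HC Hv. assert (H := recession_ineq f f1 v 0%C HC Hv unit_disc_0).
  destruct HC as [_ [_ [_ [_ [_ [_ H1]]]]]]. rewrite H1 in H. unfold Re in *. simpl in H. lra.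
Qed.

Lemma recession_comb (K : C -> Prop) (v w : C) (a b : R) :
  0 <= a -> 0 <= b -> recession_cone K v -> recession_cone K w -> recession_cone K (RtoC a * v + RtoC b * w)%C.
Proof.
  intros Ha Hb Hv Hw x t Hx Ht.
  replace (x + RtoC t * (RtoC a * v + RtoC b * w))%C with ((x + RtoC (t * a) * v) + RtoC (t * b) * w)%C.
  apply Hw. apply Hv; auto. apply Rmult_le_pos; auto. apply Rmult_le_pos; auto. rewrite !RtoC_mult. ring.
Qed.

(** The direction r is the combination of the directions a and b with weights sin(b-r)/sin(b-a) and
    sin(r-a)/sin(b-a), positive as long as the arc is shorter than PI. *)
Lemma arc_between (V : C -> Prop) (a r b : R) :
  (forall v w s t, 0 <= s -> 0 <= t -> V v -> V w -> V (RtoC s * v + RtoC t * w)%C) ->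
  a < r < b -> b - a < PI -> V (cos a, sin a) -> V (cos b, sin b) -> V (cos r, sin r).
Proof.
  intros HV Hr Hab Ha Hb.
  assert (S1 : 0 < sin (b - a)) by (apply sin_gt_0; lra).
  assert (S2 : 0 < sin (b - r)) by (apply sin_gt_0; lra).
  assert (S3 : 0 < sin (r - a)) by (apply sin_gt_0; lra).
  assert (Q := HV _ _ (sin (b - r) / sin (b - a)) (sin (r - a) / sin (b - a)) ltac:(left; apply Rdiv_lt_0_compat; lra) ltac:(left; apply Rdiv_lt_0_compat; lra) Ha Hb).
  assert (T := sin2_cos2 r). unfold Rsqr in T.
  match goal with H : V ?x |- V ?y => replace y with x; auto end.
  apply injective_projections; cbn -[sin cos].
  - replace (sin (b - r) / sin (b - a) * cos a - 0 * sin a + (sin (r - a) / sin (b - a) * cos b - 0 * sin b))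
      with ((sin (b - r) * cos a + sin (r - a) * cos b) / sin (b - a)) by (field; lra).
    replace (sin (b - r) * cos a + sin (r - a) * cos b) with (cos r * sin (b - a)). field. lra.
    rewrite !sin_minus. ring.
  - replace (sin (b - r) / sin (b - a) * sin a + 0 * cos a + (sin (r - a) / sin (b - a) * sin b + 0 * cos b))
      with ((sin (b - r) * sin a + sin (r - a) * sin b) / sin (b - a)) by (field; lra).
    replace (sin (b - r) * sin a + sin (r - a) * sin b) with (sin r * sin (b - a)). field. lra.
    rewrite !sin_minus. ring.
Qed.

Lemma RInt_step (h : R -> R) (l a b r c : R) : l <= a -> a <= b -> b <= r ->
  (forall x, l < x < a -> h x = 0) -> (forall x, a < x < b -> h x = c) -> (forall x, b < x < r -> h x = 0) ->
  RInt h l r = c * (b - a).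
Proof.
  intros Hl Hab Hr H1 H2 H3. apply is_RInt_unique.
  assert (I1 : is_RInt h l a 0).
  { apply is_RInt_ext with (fun _ => 0). intros x. rewrite Rmin_left, Rmax_right by auto. intros; symmetry; auto.
    evar_last. apply @is_RInt_const. unfold scal; simpl; unfold mult; simpl. ring. }
  assert (I2 : is_RInt h a b (c * (b - a))).
  { apply is_RInt_ext with (fun _ => c). intros x. rewrite Rmin_left, Rmax_right by auto. intros; symmetry; auto.
    evar_last. apply @is_RInt_const. unfold scal; simpl; unfold mult; simpl. ring. }
  assert (I3 : is_RInt h b r 0).
  { apply is_RInt_ext with (fun _ => 0). intros x. rewrite Rmin_left, Rmax_right by auto. intros; symmetry; auto.
    evar_last. apply @is_RInt_const. unfold scal; simpl; unfold mult; simpl. ring. }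
  evar_last. apply @is_RInt_Chasles with b. apply @is_RInt_Chasles with a. apply I1. apply I2. apply I3.
  unfold plus; simpl. ring.
Qed.

Lemma cos_pos_outside (t : R) : 0 <= t <= 2 * PI -> cos t <= 0 -> PI / 2 <= t <= 3 * (PI / 2).
Proof.
  intros Ht Hc. pose proof PI_RGT_0. split; apply Rnot_lt_le; intro.
  - assert (0 < cos t) by (apply cos_gt_0; lra). lra.
  - assert (0 < cos (t - 2 * PI)) by (apply cos_gt_0; lra).
    rewrite cos_minus, cos_2PI, sin_2PI in H1. lra.
Qed.

(* The case of two antipodal directions PI/2 and 3 PI/2 is excluded by the positive angle. *)
Lemma cone_arc (V : C -> Prop) :
  (forall v w s t, 0 <= s -> 0 <= t -> V v -> V w -> V (RtoC s * v + RtoC t * w)%C) ->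
  (forall v, V v -> Re v <= 0) -> 0 < cone_angle V ->
  exists a b, b - a = cone_angle V /\ forall t, a < t < b -> V (cos t, sin t).
Proof.
  intros HV Hre Hpos. pose proof PI_RGT_0 as HPI.
  set (h := fun t : R => if excluded_middle_informative (V (cos t, sin t)) then 1 else 0).
  assert (Econe : cone_angle V = RInt h 0 (2 * PI)) by reflexivity. rewrite Econe in *.
  assert (h1 : forall t, V (cos t, sin t) -> h t = 1). { intros t Ht. unfold h. destruct excluded_middle_informative; tauto. }
  assert (h0 : forall t, ~ V (cos t, sin t) -> h t = 0). { intros t Ht. unfold h. destruct excluded_middle_informative; tauto. }
  assert (Hin : forall t, 0 <= t <= 2 * PI -> V (cos t, sin t) -> PI / 2 <= t <= 3 * (PI / 2)).
  { intros t Ht Hv. apply cos_pos_outside; auto. apply (Hre _ Hv). }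
  assert (Hout : forall t, 0 <= t <= 2 * PI -> ~ (PI / 2 <= t <= 3 * (PI / 2)) -> h t = 0).
  { intros t Ht Hn. apply h0. intro. apply Hn. auto. }
  destruct (classic (exists c, PI / 2 < c < 3 * (PI / 2) /\ V (cos c, sin c))) as [[c [Hc Vc]]|Hn].
  2: { exfalso. assert (E : RInt h 0 (2 * PI) = 0 * (3 * (PI / 2) - PI / 2)); [|rewrite E in Hpos; lra].
    apply RInt_step; try lra.
    - intros x Hx. apply Hout; lra.
    - intros x Hx. apply h0. intro. apply Hn. exists x. auto.
    - intros x Hx. apply Hout; lra. }
  (* If a and b are antipodal, their positive combinations do not reach r; the interior direction c
     splits the arc into two shorter ones. *)
  assert (Hconv : forall a r b, PI / 2 <= a -> b <= 3 * (PI / 2) -> a < r < b -> V (cos a, sin a) -> V (cos b, sin b) -> V (cos r, sin r)).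
  { intros a r b Ha Hb Hr Va Vb. destruct (Rlt_dec (b - a) PI).
    - apply (arc_between V a r b); auto.
    - destruct (Rtotal_order r c) as [Q|[->|Q]]; auto.
      + apply (arc_between V a r c); auto; lra.
      + apply (arc_between V c r b); auto; lra. }
  set (E := fun t => PI / 2 <= t <= 3 * (PI / 2) /\ V (cos t, sin t)).
  destruct (completeness E) as [b [Hb1 Hb2]].
  { exists (3 * (PI / 2)). intros t [Ht _]. lra. } { exists c. split; auto. lra. }
  (* The infimum of E is taken as the supremum of its reflection, so the arc found is the one from -
     a to b. *)
  destruct (completeness (fun t => E (- t))) as [a [Ha1 Ha2]].
  { exists (- (PI / 2)). intros t [Ht _]. lra. } { exists (- c). split; rewrite Ropp_involutive; auto. lra. }
  assert (Hcb : c <= b). { apply Hb1. split; auto; lra. }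
  assert (Hca : - c <= a). { apply Ha1. split; rewrite Ropp_involutive; auto; lra. }
  assert (Hb3 : b <= 3 * (PI / 2)). { apply Hb2. intros t [Ht _]. lra. }
  assert (Ha3 : a <= - (PI / 2)). { apply Ha2. intros t [Ht _]. lra. }
  assert (Hmid : forall t, - a < t < b -> V (cos t, sin t)).
  { intros t Ht.
    assert (X1 : exists y, E y /\ t < y).
    { apply NNPP. intro Hno. assert (b <= t); [|lra]. apply Hb2. intros y Hy. apply Rnot_lt_le. intro. apply Hno. exists y; auto. }
    assert (X2 : exists y, E y /\ y < t).
    { apply NNPP. intro Hno. assert (a <= - t); [|lra]. apply Ha2. intros y Hy. apply Rnot_lt_le. intro. apply Hno. exists (- y); split; auto; lra. }
    destruct X1 as [y1 [[Hy1 Vy1] L1]]. destruct X2 as [y2 [[Hy2 Vy2] L2]].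
    apply Hconv with y2 y1; auto; lra. }
  exists (- a), b. split; auto.
  symmetry. rewrite <- (Rmult_1_l (b - - a)). apply RInt_step; try lra.
  - intros x Hx. apply h0. intro Hv. assert (Hx2 := Hin x ltac:(lra) Hv).
    assert (- x <= a); [|lra]. apply Ha1. split; rewrite Ropp_involutive; auto.
  - intros x Hx. apply h1. auto.
  - intros x Hx. apply h0. intro Hv. assert (Hx2 := Hin x ltac:(lra) Hv).
    assert (x <= b); [|lra]. apply Hb1. split; auto.
Qed.

Lemma complement_closed (f f1 : C -> C) : concave_map f f1 -> closed_set (cpl f).
Proof.
  intros [Hf [_ [Hi _]]] s l Hs Hl Hn.
  destruct (copen_image unit_disc f copen_unit_disc Hf Hi l Hn) as [r [Hr H]].
  destruct (Hl r Hr) as [N HN]. apply (Hs N). apply H. apply HN. lia.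
Qed.

(* If K were bounded, exp(-N(1-z))/f would be small on the boundary of {|f| > R}
   for every N, so Re(1-z) would be bounded below on that set, which accumulates
   at 1. *)
Lemma complement_unbounded (f f1 : C -> C) (R0 : R) :
  concave_map f f1 -> (forall x, cpl f x -> Cmod x <= R0) -> False.
Proof.
  intros HC HK. assert (HC' := HC). destruct HC' as [Hf [Hd [Hi [Hc [Hinf [H0 _]]]]]].
  destruct (inverse_exists unit_disc f f1 copen_unit_disc Hf Hi Hd) as [g [G1 [G2 [G3 G4]]]].
  destruct (complement_nonempty f f1 HC) as [x0 Hx0].
  assert (HR0 : 0 <= R0). { eapply Rle_trans. apply Cmod_ge_0. apply HK; eauto. }
  (* The margin gives R > R0 and R - 1 > 0; the level exp(-N m0)/(R-1) used below is then strictly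
     above the largest boundary value exp(-N m0)/R. *)
  set (R := R0 + 2).
  assert (HG : forall w, R0 < Cmod w -> image unit_disc f w).
  { intros w Hw. apply NNPP. intro Hn. specialize (HK w Hn). lra. }
  (* f is proper over the closed annulus R <= |w| <= M, because the annulus lies in the image: the
     limit of preimages is the preimage of a limit point. *)
  assert (Hlim : forall s l M, (forall n, unit_disc (s n) /\ R <= Cmod (f (s n)) <= M) -> cvg s l -> unit_disc l).
  { intros s l M Hs Hl. destruct (bw (fun n => f (s n)) M) as [phi [w [Ep Hw]]]. { intros n. apply Hs. }
    assert (R <= Cmod w). { eapply is_lim_seq_ge_const; [|apply cvg_Cmod; apply Hw]. intros n. apply Hs. }
    assert (Hwi : image unit_disc f w) by (apply HG; unfold R in *; lra).
    replace l with (g w). apply G1; auto.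
    apply cvg_unique with (fun n => g (f (s (phi n)))). apply cvg_cont; auto. eapply cder_ccont. apply G4; auto.
    apply cvg_ext with (fun n => s (phi n)). intros; symmetry; apply G2; apply Hs. apply cvg_sub; auto. apply extraction_ge; auto. }
  assert (Hcont : forall z, unit_disc z -> ccont f z) by (intros; eapply cder_ccont; apply Hd; auto).
  destruct (compact_max (fun z => unit_disc z /\ Cmod (f z) = R) (fun z => Re z) (g (RtoC R))) as [zm [[Hzm1 Hzm2] Hzm3]].
  { assert (image unit_disc f (RtoC R)). { apply HG. rewrite Cmod_R, Rabs_pos_eq; unfold R; lra. }
    split. apply G1; auto. rewrite (proj2 (G1 _ H)). rewrite Cmod_R, Rabs_pos_eq; unfold R; lra. }
  { exists 1. intros z [Hz _]. unfold unit_disc in Hz. lra. }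
  { intros s l Hs Hl. assert (unit_disc l). { apply Hlim with s R; auto. intros n. destruct (Hs n). split; auto. lra. }
    split; auto. assert (L := cvg_Cmod _ _ (cvg_cont f s l (Hcont l H) Hl)).
    assert (L2 : is_lim_seq (fun n => Cmod (f (s n))) R).
    { apply is_lim_seq_ext with (fun _ => R). intros n. symmetry. apply Hs. apply is_lim_seq_const. }
    apply is_lim_seq_unique in L. apply is_lim_seq_unique in L2. rewrite L in L2. injection L2; auto. }
  { intros s l _ _ Hl. apply cvg_Re; auto. }
  set (m0 := 1 - Re zm). assert (Hm0 : 0 < m0). { unfold m0. pose proof (Re_le zm). unfold unit_disc in Hzm1. lra. }
  assert (key : forall (N : nat) z, unit_disc z -> R < Cmod (f z) ->
    Cmod (cexp (- (RtoC (INR N) * (1 - z))) / f z)%C <= exp (- (INR N * m0)) / (R - 1)).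
  { intros N z Hz HRz.
    assert (Hcm : forall v, Cmod (cexp (- (RtoC (INR N) * (1 - v))))%C = exp (- (INR N * (1 - Re v)))).
    { intros v. rewrite Cmod_cexp. f_equal. unfold Re. simpl. ring. }
    assert (Hnz : forall v, R <= Cmod (f v) -> f v <> 0%C). { intros v Hv E. rewrite E, Cmod_0 in Hv. unfold R in Hv. lra. }
    assert (Pm : 0 < exp (- (INR N * m0)) / (R - 1)). { apply Rdiv_lt_0_compat. apply exp_pos. unfold R. lra. }
    apply max_modulus with (U := fun z => unit_disc z /\ R < Cmod (f z)) (g := fun z => (cexp (- (RtoC (INR N) * (1 - z))) / f z)%C); auto.
    - intros v [Hv1 Hv2]. destruct (copen_unit_disc v Hv1) as [r [Hr Hb]].
      destruct (Hcont v Hv1 (Cmod (f v) - R)) as [d [Hdp Hw]]. lra. exists (Rmin r d). split. apply Rmin_glb_lt; auto.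
      intros w Hwv. pose proof (Rmin_l r d). pose proof (Rmin_r r d). split. apply Hb; lra.
      specialize (Hw w ltac:(lra)). pose proof (Cmod_le_sum (f v) (f w)). rewrite Cmod_sub_sym in H2. lra.
    - apply hol_div. intros v [_ Hv]. apply Hnz. lra. apply hol_comp with (V := fun _ => True) (h := cexp); auto.
      apply hol_opp. apply hol_mult. apply hol_const. apply hol_minus. apply hol_const. apply hol_id. apply hol_cexp.
      eapply hol_sub; [|apply Hf]. tauto.
    - lra.
    - exists 1. intros v [[Hv _] _]. unfold unit_disc in Hv. lra.
    - intros s l Hs Hl.
      (* The exponential has modulus at most 1 on the disc, so a lower bound for the quotient is an
         upper bound for |f|, and [Hlim] keeps the limit inside the disc. *)
      assert (Hsb : forall n, unit_disc (s n) /\ R <= Cmod (f (s n)) <= exp 0 / (exp (- (INR N * m0)) / (R - 1))).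
      { intros n. destruct (Hs n) as [[A B] D]. split; auto. split. lra.
        rewrite Cmod_div, Hcm in D by (apply Hnz; lra).
        apply Rmult_le_reg_r with (exp (- (INR N * m0)) / (R - 1)); auto.
        unfold Rdiv at 2. rewrite Rmult_assoc, Rinv_l, Rmult_1_r by lra.
        apply Rmult_le_compat_l with (r := Cmod (f (s n))) in D; [|apply Cmod_ge_0].
        eapply Rle_trans. apply D. replace (Cmod (f (s n)) * (exp (- (INR N * (1 - Re (s n)))) / Cmod (f (s n)))) with (exp (- (INR N * (1 - Re (s n))))).
        2: { field. unfold R in B. lra. }
        apply exp_le. pose proof (Re_le (s n)). unfold unit_disc in A. pose proof (pos_INR N). nra. }
      assert (Ul : unit_disc l) by (eapply Hlim; eauto). split; auto.
      assert (L := cvg_Cmod _ _ (cvg_cont f s l (Hcont l Ul) Hl)).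
      assert (HRl : R <= Cmod (f l)). { eapply is_lim_seq_ge_const; [|apply L]. intros n. apply Hsb. }
      destruct HRl as [|E]; auto. exfalso.
      assert (L2 : is_lim_seq (fun n => Cmod (cexp (- (RtoC (INR N) * (1 - s n))) / f (s n))%C) (Cmod (cexp (- (RtoC (INR N) * (1 - l))) / f l)%C)).
      { apply (cvg_Cmod (fun n => cexp (- (RtoC (INR N) * (1 - s n))) / f (s n))%C). apply cvg_mult. 
        apply (cvg_cont cexp). eapply cder_ccont; apply cder_cexp. apply cvg_opp. apply cvg_mult. apply cvg_const. apply cvg_minus; auto. apply cvg_const.
        apply cvg_inv. apply Hnz; lra. apply cvg_cont; auto. }
      apply is_lim_seq_ge_const with (c := exp (- (INR N * m0)) / (R - 1)) in L2. 2: { intros n. apply (Hs n). }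
      rewrite Cmod_div, Hcm, <- E in L2 by (apply Hnz; lra).
      assert (exp (- (INR N * (1 - Re l))) <= exp (- (INR N * m0))).
      { apply exp_le. specialize (Hzm3 l ltac:(auto)). simpl in Hzm3. unfold m0. pose proof (pos_INR N). nra. }
      assert (HRp : 0 < R - 1) by (unfold R; lra).
      assert (exp (- (INR N * (1 - Re l))) / R <= exp (- (INR N * m0)) / R). { apply Rmult_le_compat_r; auto. left; apply Rinv_0_lt_compat; lra. }
      assert (exp (- (INR N * m0)) / R < exp (- (INR N * m0)) / (R - 1)).
      { apply Rmult_lt_compat_l. apply exp_pos. apply Rinv_lt_contravar; nra. }
      lra. }
  destruct (Hinf R) as [d [Hdp HI]].
  set (e := Rmin (Rmin (d / 2) (m0 / 2)) (/ 2)).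
  assert (He : 0 < e). { unfold e. repeat apply Rmin_glb_lt; lra. }
  assert (He1 : e <= d / 2). { unfold e. eapply Rle_trans. apply Rmin_l. apply Rmin_l. }
  assert (He2 : e <= m0 / 2). { unfold e. eapply Rle_trans. apply Rmin_l. apply Rmin_r. }
  assert (He3 : e <= / 2) by apply Rmin_r.
  set (z := RtoC (1 - e)).
  assert (Hz : unit_disc z). { unfold unit_disc, z. rewrite Cmod_R, Rabs_pos_eq; lra. }
  assert (HRz : R < Cmod (f z)).
  { apply HI; auto. unfold z. rewrite <- RtoC_minus, Cmod_R, Rabs_left; lra. }
  assert (HfR : 0 < Cmod (f z) / (R - 1)). { apply Rdiv_lt_0_compat. unfold R in *; lra. unfold R; lra. }
  destruct (pow_unbounded (exp (m0 - e)) (Cmod (f z) / (R - 1))) as [N HN].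
  { rewrite <- exp_0. apply exp_increasing. lra. }
  assert (key2 := key N z Hz HRz).
  rewrite Cmod_div, Cmod_cexp in key2. 2: { intro E. rewrite E, Cmod_0 in HRz. unfold R in HRz. lra. }
  replace (Re (- (RtoC (INR N) * (1 - z)))%C) with (- (INR N * e)) in key2 by (unfold z, Re; simpl; ring).
  assert (Epow : exp (m0 - e) ^ N = exp (INR N * (m0 - e))).
  { clear. induction N. simpl. rewrite Rmult_0_l, exp_0. auto. rewrite S_INR. simpl pow. rewrite IHN, <- exp_plus. f_equal. ring. }
  rewrite Epow in HN.
  assert (P1 := exp_pos (- (INR N * e))). assert (P2 := exp_pos (INR N * m0)).
  apply Rmult_le_compat_r with (r := Cmod (f z) * exp (INR N * m0)) in key2. 2: { apply Rmult_le_pos. apply Cmod_ge_0. lra. }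
  replace (exp (- (INR N * e)) / Cmod (f z) * (Cmod (f z) * exp (INR N * m0))) with (exp (INR N * (m0 - e))) in key2.
  2: { replace (INR N * (m0 - e)) with (- (INR N * e) + INR N * m0) by ring. rewrite exp_plus. field. unfold R in HRz. lra. }
  replace (exp (- (INR N * m0)) / (R - 1) * (Cmod (f z) * exp (INR N * m0))) with (Cmod (f z) / (R - 1)) in key2.
  2: { rewrite exp_Ropp. field. repeat split; first [lra | unfold R; lra]. }
  lra.
Qed.

(** Take a limit v of x_n/|x_n| for points x_n of the complement tending to infinity. Then y + t v
    is the limit of the convex combinations (1-c) y + c x_n with c = t/|x_n|, and the complement is
    closed. *)
Lemma recession_exists (f f1 : C -> C) : concave_map f f1 ->
  exists v, Cmod v = 1 /\ recession_cone (cpl f) v.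
Proof.
  intros HC. assert (Hc : convex_set (cpl f)) by apply HC. assert (Hcl := complement_closed f f1 HC).
  assert (Hx : forall n, exists x, cpl f x /\ INR n + 1 <= Cmod x).
  { intros n. apply NNPP. intro Hn. apply (complement_unbounded f f1 (INR n + 1) HC). intros x Hx.
    apply Rnot_lt_le. intro. apply Hn. exists x. split; auto. lra. }
  apply choice in Hx. destruct Hx as [x Hx].
  assert (Hxp : forall n, 0 < Cmod (x n)). { intros n. destruct (Hx n). pose proof (pos_INR n). lra. }
  assert (HxC : forall n, RtoC (Cmod (x n)) <> 0%C). { intros n E. apply RtoC_inj in E. specialize (Hxp n). lra. }
  assert (Hu : forall n, Cmod (x n / RtoC (Cmod (x n)))%C = 1).
  { intros n. rewrite Cmod_div, Cmod_R, Rabs_pos_eq; auto. field. specialize (Hxp n); lra. left; auto. }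
  destruct (bw (fun n => x n / RtoC (Cmod (x n)))%C 1) as [phi [v [Ep Hv]]]. { intros n. rewrite Hu. lra. }
  exists v. split.
  { assert (L := cvg_Cmod _ _ Hv). assert (L2 : is_lim_seq (fun n => Cmod (x (phi n) / RtoC (Cmod (x (phi n))))%C) 1).
    { apply is_lim_seq_ext with (fun _ => 1). intros n. symmetry. apply Hu. apply is_lim_seq_const. }
    apply is_lim_seq_unique in L. apply is_lim_seq_unique in L2. rewrite L in L2. injection L2; auto. }
  intros y t Hy Ht.
  assert (Hinv : cvg (fun n => RtoC (/ Cmod (x (phi n)))) 0%C).
  { intros eps He. destruct (archimed_cor1 eps He) as [N [HN HN0]]. exists N. intros n Hn.
    replace (RtoC (/ Cmod (x (phi n))) - 0)%C with (RtoC (/ Cmod (x (phi n)))) by ring. rewrite Cmod_R, Rabs_pos_eq.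
    2: { left. apply Rinv_0_lt_compat. auto. }
    eapply Rle_lt_trans; [|apply HN]. apply Rinv_le_contravar. apply lt_0_INR; auto.
    destruct (Hx (phi n)) as [_ Q]. pose proof (extraction_ge _ Ep n). apply le_INR in Hn. apply le_INR in H. lra. }
  (* The indices are shifted by [S N0] so that |x_n| >= t and the weight c is at most 1. *)
  destruct (nfloor_ex t Ht) as [N0 HN0]. 
  apply Hcl with (fun n => y + RtoC t * (x (phi (n + S N0)%nat) / RtoC (Cmod (x (phi (n + S N0)%nat))) - RtoC (/ Cmod (x (phi (n + S N0)%nat))) * y))%C.
  - intros n. set (m := (n + S N0)%nat). set (X := x (phi m)). set (c := t / Cmod X).
    assert (HX : t <= Cmod X). { destruct (Hx (phi m)) as [_ Q]. pose proof (extraction_ge _ Ep m). assert (INR (S N0) <= INR (phi m)). { apply le_INR. unfold m in *. lia. } rewrite S_INR in H0. unfold X. lra. }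
    replace (y + RtoC t * (X / RtoC (Cmod X) - RtoC (/ Cmod X) * y))%C with (RtoC (1 - c) * y + RtoC c * X)%C.
    + apply Hc; auto. apply Hx. unfold c. split. apply Rdiv_le_0_compat; auto. apply Hxp.
      apply Rmult_le_reg_r with (Cmod X). apply Hxp. unfold Rdiv. rewrite Rmult_assoc, Rinv_l, Rmult_1_l, Rmult_1_r; auto. apply Rgt_not_eq. apply Hxp.
    + unfold c. assert (Cmod X <> 0) by (apply Rgt_not_eq; apply Hxp). rewrite RtoC_minus, RtoC_div, RtoC_inv by auto. field. apply HxC.
  - replace (y + RtoC t * v)%C with (y + RtoC t * (v - 0 * y))%C by ring.
    apply cvg_plus. apply cvg_const. apply cvg_mult. apply cvg_const. 
    apply (cvg_sub (fun n => x (phi n) / RtoC (Cmod (x (phi n))) - RtoC (/ Cmod (x (phi n))) * y)%C _ (fun n => (n + S N0)%nat)).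
    intros; lia. apply cvg_minus; auto. apply cvg_mult; auto. apply cvg_const.
Qed.

(** For alpha < 2 the recession directions contain an open arc of length at least PI (2 - alpha); u
    comes from its bisector, and turning the bisector by (2 - alpha) th with |th| < PI/2 does not
    leave the arc. For alpha = 2 the arc may shrink to a point, but no turning occurs and one
    recession direction suffices. *)
Lemma sector (f f1 : C -> C) (alpha : R) : concave_map f f1 -> 1 < alpha <= 2 ->
  opening_angle_at_infinity (image unit_disc f) <= PI * alpha ->
  exists u, Cmod u = 1 /\ forall z th, unit_disc z -> Rabs th < PI / 2 ->
    0 <= Re (u * ((cos ((2 - alpha) * th), sin ((2 - alpha) * th)) * (f1 z * ((1 - z) * (1 - z)))))%C.
Proof.
  intros HC Ha Hop. unfold opening_angle_at_infinity in Hop. pose proof PI_RGT_0 as HPI.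
  destruct (Req_dec alpha 2) as [->|Hn].
  - destruct (recession_exists f f1 HC) as [v [Hv1 Hv]]. exists (- Cconj v)%C. split.
    rewrite Cmod_opp, Cmod_conj; auto. intros z th Hz _. replace ((2 - 2) * th) with 0 by ring. rewrite cos_0, sin_0.
    assert (Q := recession_ineq f f1 v z HC Hv Hz). 
    replace (- Cconj v * ((1, 0) * (f1 z * ((1 - z) * (1 - z)))))%C with (- Cconj v * (f1 z * ((1 - z) * (1 - z))))%C; auto.
    change (1, 0) with (RtoC 1). ring.
  - destruct (cone_arc (recession_cone (cpl f))) as [a [b [Hab HV]]].
    + intros; apply recession_comb; auto.
    + intros v Hv. eapply recession_Re; eauto.
    + nra.
    + exists (- Cconj (cos ((a + b) / 2), sin ((a + b) / 2)))%C. split.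
      { rewrite Cmod_opp, Cmod_conj. unfold Cmod; simpl. 
        replace (cos ((a + b) / 2) * (cos ((a + b) / 2) * 1) + sin ((a + b) / 2) * (sin ((a + b) / 2) * 1)) with 1. apply sqrt_1.
        pose proof (sin2_cos2 ((a + b) / 2)). unfold Rsqr in H. lra. }
      intros z th Hz Hth.
      assert (Hr : a < (a + b) / 2 - (2 - alpha) * th < b). { unfold Rabs in Hth; destruct Rcase_abs in Hth; nra. }
      assert (Q := recession_ineq f f1 _ z HC (HV _ Hr) Hz).
      eapply Rle_trans. apply Q. right. f_equal. set (H := (f1 z * ((1 - z) * (1 - z)))%C).
    apply injective_projections; simpl; rewrite ?cos_minus, ?sin_minus; ring.
Qed.

(** * Power series on the disc *)

Fixpoint csum (u : nat -> C) (n : nat) : C :=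
  match n with O => RtoC 0 | S m => (csum u m + u m)%C end.
Fixpoint rsum (u : nat -> R) (n : nat) : R :=
  match n with O => 0 | S m => rsum u m + u m end.

Lemma csum_last (u : nat -> C) (n : nat) : csum u (S n) = (csum u n + u n)%C.
Proof. reflexivity. Qed.
Lemma csum_ext (u v : nat -> C) (n : nat) : (forall i, (i < n)%nat -> u i = v i) -> csum u n = csum v n.
Proof. induction n; intros H; simpl; auto. rewrite IHn, H; auto. Qed.
Lemma csum_plus (u v : nat -> C) (n : nat) : csum (fun i => u i + v i)%C n = (csum u n + csum v n)%C.
Proof. induction n; simpl. ring. rewrite IHn. ring. Qed.
Lemma csum_scal (c : C) (u : nat -> C) (n : nat) : csum (fun i => c * u i)%C n = (c * csum u n)%C.
Proof. induction n; simpl. ring. rewrite IHn. ring. Qed.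
Lemma csum_const0 (n : nat) : csum (fun _ => 0%C) n = 0%C.
Proof. induction n; simpl; auto. rewrite IHn. ring. Qed.
Lemma csum_S (u : nat -> C) (n : nat) : csum u (S n) = (u O + csum (fun i => u (S i)) n)%C.
Proof. induction n. simpl. ring. change (csum u (S (S n))) with (csum u (S n) + u (S n))%C. rewrite IHn. simpl. ring. Qed.
Lemma Cmod_csum (u : nat -> C) (b : nat -> R) (n : nat) :
  (forall i, (i < n)%nat -> Cmod (u i) <= b i) -> Cmod (csum u n) <= rsum b n.
Proof.
  induction n; intros H; simpl. rewrite Cmod_0; lra. eapply Rle_trans. apply Cmod_triangle.
  apply Rplus_le_compat; auto.
Qed.
Lemma rsum_scal (c : R) (u : nat -> R) (n : nat) : rsum (fun i => c * u i) n = c * rsum u n.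
Proof. induction n; simpl. ring. rewrite IHn. ring. Qed.
Lemma rsum_S (u : nat -> R) (n : nat) : rsum u (S n) = u O + rsum (fun i => u (S i)) n.
Proof. induction n. simpl. ring. change (rsum u (S (S n))) with (rsum u (S n) + u (S n)). rewrite IHn. simpl. ring. Qed.
Lemma rsum_geom (M q : R) (n : nat) : 0 <= M -> 0 <= q < 1 -> rsum (fun i => M * q ^ i) n <= M / (1 - q).
Proof.
  intros HM Hq. assert (E : rsum (fun i => M * q ^ i) n = M * (1 - q ^ n) / (1 - q)).
  { induction n; simpl. field. lra. rewrite IHn. field. lra. }
  rewrite E. apply Rmult_le_compat_r. left; apply Rinv_0_lt_compat; lra.
  assert (0 <= q ^ n) by (apply pow_le; lra). nra.
Qed.

(** The n terms of degree below n, so that [sum_n] up to n corresponds to [S n] here. *)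
Definition taylor_sum (a : nat -> C) (z : C) (n : nat) : C := csum (fun i => a i * z ^ i)%C n.

Definition taylor (a : nat -> C) (g : C -> C) : Prop := forall z, unit_disc z -> cvg (taylor_sum a z) (g z).

Lemma is_pseries_taylor_sum (a : nat -> C) (z l : C) :
  @is_pseries C_AbsRing C_NormedModule a z l <-> cvg (taylor_sum a z) l.
Proof.
  assert (E : forall n, sum_n (fun k => scal (pow_n (z : C_AbsRing) k) (a k : C_NormedModule)) n = taylor_sum a z (S n)).
  { intros n. unfold taylor_sum. induction n.
    - rewrite sum_O. simpl. unfold scal; simpl. unfold mult, one; simpl. ring.
    - rewrite sum_Sn, IHn. assert (P : forall k, pow_n (z : C_AbsRing) k = (z ^ k)%C).
      { induction k; simpl; auto. }
      rewrite P. unfold plus, scal; simpl. unfold mult; simpl. ring. }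
  unfold is_pseries, is_series. split.
  - intros H eps He. pose proof (proj1 (filterlim_locally _ _) H (mkposreal (eps / 2) ltac:(lra))) as [N HN].
    exists (S N). intros n Hn. destruct n as [|n]; [lia|]. specialize (HN n ltac:(lia)). rewrite E in HN.
    set (S0 := taylor_sum a z (S n)) in *. clearbody S0.
    destruct HN as [B1 B2]. change (Rabs (fst S0 - fst l) < eps / 2) in B1. change (Rabs (snd S0 - snd l) < eps / 2) in B2.
    eapply Rle_lt_trans. apply Cmod_le_abs. simpl. unfold Rminus in *. lra.
  - intros H. apply (proj2 (filterlim_locally _ _)). intros eps. destruct (H eps (cond_pos eps)) as [N HN].
    exists N. intros n Hn. rewrite E. specialize (HN (S n) ltac:(lia)).
    split; [change (Rabs (fst (taylor_sum a z (S n)) - fst l) < eps)|change (Rabs (snd (taylor_sum a z (S n)) - snd l) < eps)].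
    eapply Rle_lt_trans. apply (Re_le_Cmod (taylor_sum a z (S n) - l)%C). auto.
    eapply Rle_lt_trans. apply (Im_le_Cmod (taylor_sum a z (S n) - l)%C). auto.
Qed.

Lemma expands_taylor (g : C -> C) (a : nat -> C) : expands_on_disc g a <-> taylor a g.
Proof. split; intros H z Hz; apply is_pseries_taylor_sum; auto. Qed.

(** Radius of convergence at least 1, in Abel's form. Comparison with a larger radius turns the
    bound into geometric decay. *)
Definition disc_summable (a : nat -> C) : Prop := forall r, 0 < r < 1 -> exists M, 0 <= M /\ forall n, Cmod (a n) * r ^ n <= M.

Lemma taylor_disc_summable (a : nat -> C) (g : C -> C) : taylor a g -> disc_summable a.
Proof.
  intros H r Hr. assert (Hz : unit_disc (RtoC r)) by (unfold unit_disc; rewrite Cmod_R, Rabs_pos_eq; lra).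
  destruct (cvg_bounded _ _ (H _ Hz)) as [M HM]. exists (2 * M). split.
  { assert (0 <= M). eapply Rle_trans. apply Cmod_ge_0. apply (HM O). lra. }
  intros n. replace (Cmod (a n) * r ^ n) with (Cmod (a n * RtoC r ^ n)%C).
  2: { rewrite Cmod_mult, Cmod_pow, Cmod_R, Rabs_pos_eq by lra. auto. }
  replace (a n * RtoC r ^ n)%C with (taylor_sum a (RtoC r) (S n) - taylor_sum a (RtoC r) n)%C by (unfold taylor_sum; simpl; ring).
  unfold Cminus. eapply Rle_trans. apply Cmod_triangle. rewrite Cmod_opp. specialize (HM n) as A. specialize (HM (S n)). lra.
Qed.

Lemma between_1 (r : R) : 0 <= r < 1 -> r < (r + 1) / 2 < 1 /\ 0 < (r + 1) / 2 /\ 0 <= r / ((r + 1) / 2) < 1.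
Proof.
  intros H. assert (0 < (r + 1) / 2) by lra. repeat split; try lra. apply Rdiv_le_0_compat; lra.
  apply Rmult_lt_reg_r with ((r + 1) / 2); auto. unfold Rdiv at 1. rewrite Rmult_assoc, Rinv_l; lra.
Qed.

Lemma disc_summable_geom (a : nat -> C) (r : R) : disc_summable a -> 0 <= r < 1 ->
  exists M q, 0 <= M /\ 0 <= q < 1 /\ forall n, Cmod (a n) * r ^ n <= M * q ^ n.
Proof.
  intros Ha Hr. destruct (between_1 r Hr) as [H1 [H2 H3]].
  destruct (Ha ((r + 1) / 2) ltac:(lra)) as [M [HM H]].
  exists M, (r / ((r + 1) / 2)). split; auto. split; auto. intros n. specialize (H n).
  replace (r ^ n) with (((r + 1) / 2) ^ n * (r / ((r + 1) / 2)) ^ n).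
  2: { rewrite <- Rpow_mult_distr. f_equal. field. lra. }
  rewrite <- Rmult_assoc. apply Rmult_le_compat_r; auto. apply pow_le; lra.
Qed.

Lemma csum_geom_tail (u : nat -> C) (M q : R) (n m : nat) : 0 <= M -> 0 <= q < 1 ->
  (forall i, Cmod (u i) <= M * q ^ i) -> Cmod (csum u (n + m) - csum u n)%C <= M / (1 - q) * q ^ n.
Proof.
  intros HM Hq H. assert (E : (csum u (n + m) - csum u n)%C = csum (fun i => u (n + i)%nat) m).
  { induction m. rewrite Nat.add_0_r. simpl. ring. rewrite Nat.add_succ_r. simpl. rewrite <- IHm. ring. }
  rewrite E. eapply Rle_trans. apply Cmod_csum with (b := fun i => q ^ n * (M * q ^ i)).
  intros i _. eapply Rle_trans. apply H. rewrite pow_add. lra.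
  rewrite rsum_scal. rewrite Rmult_comm. apply Rmult_le_compat_r. apply pow_le; lra. apply rsum_geom; auto.
Qed.

Lemma csum_cvg (u : nat -> C) (M q : R) : 0 <= M -> 0 <= q < 1 ->
  (forall i, Cmod (u i) <= M * q ^ i) -> exists l, cvg (csum u) l.
Proof.
  intros HM Hq H. set (B := M / (1 - q)).
  destruct (bw (csum u) B) as [phi [l [Ep Hl]]].
  { intros n. eapply Rle_trans. apply Cmod_csum. intros; apply H. apply rsum_geom; auto. }
  exists l. intros eps He. destruct (pow_small q B (eps / 2) Hq ltac:(lra)) as [N0 HN0].
  destruct (Hl (eps / 2) ltac:(lra)) as [N1 HN1].
  exists (max N0 N1). intros n Hn. specialize (HN1 n ltac:(lia)).
  pose proof (extraction_ge _ Ep n).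
  assert (T := csum_geom_tail u M q n (phi n - n) HM Hq H). replace (n + (phi n - n))%nat with (phi n) in T by lia. fold B in T.
  assert (HB : 0 <= B) by (apply Rdiv_le_0_compat; lra).
  assert (q ^ n <= q ^ N0).
  { replace n with (N0 + (n - N0))%nat by lia. rewrite pow_add. rewrite <- (Rmult_1_r (q ^ N0)) at 2.
    apply Rmult_le_compat_l. apply pow_le; lra. rewrite <- (pow1 (n - N0)). apply pow_incr. lra. }
  replace (csum u n - l)%C with ((csum u (phi n) - l) - (csum u (phi n) - csum u n))%C by ring.
  eapply Rle_lt_trans. apply Cmod_triangle. rewrite Cmod_opp. nra.
Qed.

Lemma disc_summable_taylor (a : nat -> C) : disc_summable a -> exists g, taylor a g.
Proof.
  intros Ha. destruct (choice (fun z l => unit_disc z -> cvg (taylor_sum a z) l)) as [g Hg].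
  - intros z. destruct (classic (unit_disc z)) as [Hz|Hz].
    + destruct (disc_summable_geom a (Cmod z) Ha) as [M [q [HM [Hq H]]]]. split. apply Cmod_ge_0. auto.
      destruct (csum_cvg (fun i => a i * z ^ i)%C M q HM Hq) as [l Hl]. intros i. rewrite Cmod_mult, Cmod_pow. auto.
      exists l. auto.
    + exists 0%C. tauto.
  - exists g. auto.
Qed.

Definition deriv_coef (a : nat -> C) (n : nat) : C := (RtoC (INR (S n)) * a (S n))%C.

(** Bernoulli's inequality for 1/q = 1 + d. *)
Lemma INR_pow_bounded (q : R) : 0 < q < 1 -> exists M, 0 <= M /\ forall n, INR (S n) * q ^ n <= M.
Proof.
  intros Hq. set (d := / q - 1).
  assert (Hd : 0 < d). { unfold d. assert (/ 1 < / q) by (apply Rinv_lt_contravar; lra). rewrite Rinv_1 in H. lra. }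
  exists (/ d / q). split. left. apply Rdiv_lt_0_compat. apply Rinv_0_lt_compat; auto. lra.
  intros n. pose proof (poly (S n) d Hd) as P. replace (1 + d) with (/ q) in P by (unfold d; ring).
  rewrite pow_inv in P. assert (0 < q ^ S n) by (apply pow_lt; lra).
  assert (INR (S n) * d * q ^ S n <= 1).
  { apply Rle_trans with (/ q ^ S n * q ^ S n). apply Rmult_le_compat_r; lra. rewrite Rinv_l; lra. }
  simpl pow in H0. apply Rmult_le_reg_r with (d * q). nra.
  replace (/ d / q * (d * q)) with 1 by (field; lra). lra.
Qed.

Lemma disc_summable_deriv_coef (a : nat -> C) : disc_summable a -> disc_summable (deriv_coef a).
Proof.
  intros Ha r Hr. destruct (between_1 r ltac:(lra)) as [H1 [H2 H3]]. set (s := (r + 1) / 2) in *.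
  destruct (Ha s ltac:(lra)) as [M [HM H]].
  destruct (INR_pow_bounded (r / s)) as [B [HB HBn]]. { split; try lra. apply Rdiv_lt_0_compat; lra. }
  exists (M / s * B). split. apply Rmult_le_pos; auto. apply Rdiv_le_0_compat; lra.
  intros n. unfold deriv_coef. rewrite Cmod_mult, Cmod_R, Rabs_pos_eq by apply pos_INR.
  replace (r ^ n) with (s ^ n * (r / s) ^ n).
  2: { rewrite <- Rpow_mult_distr. f_equal. field. lra. }
  specialize (H (S n)). simpl pow in H.
  assert (Cmod (a (S n)) * s ^ n <= M / s).
  { apply Rmult_le_reg_r with s; auto. unfold Rdiv. rewrite (Rmult_assoc M), Rinv_l; lra. }
  replace (INR (S n) * Cmod (a (S n)) * (s ^ n * (r / s) ^ n)) with ((Cmod (a (S n)) * s ^ n) * (INR (S n) * (r / s) ^ n)) by ring.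
  apply Rmult_le_compat; auto. apply Rmult_le_pos. apply Cmod_ge_0. apply pow_le; lra.
  apply Rmult_le_pos. apply pos_INR. apply pow_le. lra.
Qed.

Lemma cder_pow (k : nat) (z : C) : cder (fun v => v ^ S k)%C z (RtoC (INR (S k)) * z ^ k)%C.
Proof.
  induction k.
  - eapply cder_eq. apply (cder_mult (fun v => v) (fun v => 1)%C). apply cder_id. apply cder_const. simpl. ring.
  - eapply cder_eq. apply (cder_mult (fun v => v) (fun v => v ^ S k)%C). apply cder_id. apply IHk.
    rewrite (S_INR (S k)), RtoC_plus. simpl. ring.
Qed.

Lemma cder_taylor_sum (a : nat -> C) (n : nat) (z : C) : cder (fun w => taylor_sum a w (S n)) z (taylor_sum (deriv_coef a) z n).
Proof.
  induction n.
  - unfold taylor_sum; simpl. eapply cder_eq. apply cder_plus. apply cder_const. apply cder_const. ring.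
  - eapply cder_eq. apply (cder_plus (fun w => taylor_sum a w (S n)) (fun w => a (S n) * w ^ S n)%C). apply IHn.
    apply cder_mult. apply cder_const. apply cder_pow. cbv beta.
    change (taylor_sum (deriv_coef a) z (S n)) with (taylor_sum (deriv_coef a) z n + RtoC (INR (S n)) * a (S n) * z ^ n)%C. ring.
Qed.

Lemma taylor_sum_bound (a : nat -> C) (r : R) : disc_summable a -> 0 <= r < 1 ->
  exists B, 0 <= B /\ forall z n, Cmod z <= r -> Cmod (taylor_sum a z n) <= B.
Proof.
  intros Ha Hr. destruct (disc_summable_geom a r Ha Hr) as [M [q [HM [Hq H]]]].
  exists (M / (1 - q)). split. apply Rdiv_le_0_compat; lra. intros z n Hz.
  eapply Rle_trans. apply Cmod_csum with (b := fun i => M * q ^ i).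
  intros i _. rewrite Cmod_mult, Cmod_pow. eapply Rle_trans; [|apply H]. apply Rmult_le_compat_l. apply Cmod_ge_0.
  apply pow_incr. split; auto. apply Cmod_ge_0. apply rsum_geom; auto.
Qed.

(** The partial sums satisfy a first-order expansion with remainder B |w - z|^2, where B bounds all
    partial sums of the second derived series on a slightly larger disc. Being uniform in n, the
    estimate survives the limit. *)
Lemma taylor_der (a : nat -> C) (g g1 : C -> C) : taylor a g -> taylor (deriv_coef a) g1 -> forall z, unit_disc z -> cder g z (g1 z).
Proof.
  intros Hg Hg1 z Hz. assert (Ra := taylor_disc_summable _ _ Hg).
  set (r := (Cmod z + 1) / 2). unfold unit_disc in Hz. pose proof (Cmod_ge_0 z).
  destruct (taylor_sum_bound (deriv_coef (deriv_coef a)) r) as [B [HB HBz]]. apply disc_summable_deriv_coef. apply disc_summable_deriv_coef; auto. unfold r; lra.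
  assert (K : forall w, Cmod (w - z)%C <= (1 - Cmod z) / 2 -> Cmod (g w - g z - g1 z * (w - z))%C <= B * Cmod (w - z)%C * Cmod (w - z)%C).
  { intros w Hw.
    assert (Hseg : forall v t, Cmod (v - z)%C <= (1 - Cmod z) / 2 -> 0 <= t <= 1 ->
      Cmod (z + RtoC t * (v - z))%C <= r /\ Cmod (z + RtoC t * (v - z) - z)%C <= Cmod (v - z)%C).
    { intros v t Hv Ht. assert (E : Cmod (RtoC t * (v - z))%C <= Cmod (v - z)%C).
      { rewrite Cmod_mult, Cmod_R, Rabs_pos_eq by lra. pose proof (Cmod_ge_0 (v - z)%C). nra. }
      split. eapply Rle_trans. apply Cmod_triangle. unfold r. lra.
      replace (z + RtoC t * (v - z) - z)%C with (RtoC t * (v - z))%C by ring. auto. }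
    assert (P : forall n, Cmod (taylor_sum a w (S (S n)) - taylor_sum a z (S (S n)) - taylor_sum (deriv_coef a) z (S n) * (w - z))%C <= B * Cmod (w - z)%C * Cmod (w - z)%C).
    { intros n. replace (taylor_sum a w (S (S n)) - taylor_sum a z (S (S n)) - taylor_sum (deriv_coef a) z (S n) * (w - z))%C
       with ((taylor_sum a w (S (S n)) - taylor_sum (deriv_coef a) z (S n) * w) - (taylor_sum a z (S (S n)) - taylor_sum (deriv_coef a) z (S n) * z))%C by ring.
      apply (mean_value (fun v => taylor_sum a v (S (S n)) - taylor_sum (deriv_coef a) z (S n) * v)%C (fun v => taylor_sum (deriv_coef a) v (S n) - taylor_sum (deriv_coef a) z (S n))%C).
      - intros t Ht. eapply cder_eq. apply cder_plus. apply cder_taylor_sum. apply cder_opp. apply cder_mult. apply cder_const. apply cder_id.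
        cbv beta. ring.
      - intros t Ht. destruct (Hseg w t Hw Ht) as [A1 A2]. eapply Rle_trans.
        apply (mean_value (fun v => taylor_sum (deriv_coef a) v (S n)) (fun v => taylor_sum (deriv_coef (deriv_coef a)) v n) z (z + RtoC t * (w - z))%C B).
        intros; apply cder_taylor_sum. intros s Hs. apply HBz. apply (Hseg (z + RtoC t * (w - z))%C s); auto. lra.
        apply Rmult_le_compat_l; auto. }
    eapply is_lim_seq_le_const. apply P.
    apply (cvg_Cmod (fun n => taylor_sum a w (S (S n)) - taylor_sum a z (S (S n)) - taylor_sum (deriv_coef a) z (S n) * (w - z))%C).
    assert (Hww : unit_disc w). { unfold unit_disc. pose proof (Cmod_le_sum w z). lra. }
    apply cvg_minus. apply cvg_minus. 
    apply (cvg_sub (taylor_sum a w) _ (fun n => S (S n))); auto. 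
    apply (cvg_sub (taylor_sum a z) _ (fun n => S (S n))); auto. 
    apply cvg_mult. apply (cvg_sub (taylor_sum (deriv_coef a) z) _ (fun n => S n)); auto. apply cvg_const. }
  intros eps He. exists (Rmin ((1 - Cmod z) / 2) (eps / (B + 1))). split. apply Rmin_glb_lt. lra. apply Rdiv_lt_0_compat; lra.
  intros w Hw. pose proof (Rmin_l ((1 - Cmod z) / 2) (eps / (B + 1))). pose proof (Rmin_r ((1 - Cmod z) / 2) (eps / (B + 1))).
  eapply Rle_trans. apply K. lra. apply Rmult_le_compat_r. apply Cmod_ge_0.
  apply Rle_trans with ((B + 1) * (eps / (B + 1))). apply Rmult_le_compat; try lra. apply Cmod_ge_0. right. field. lra.
Qed.

Lemma taylor_analytic (a : nat -> C) (g : C -> C) : taylor a g -> analytic unit_disc g.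
Proof.
  intros H n. revert a g H. induction n; intros a g H; destruct (disc_summable_taylor (deriv_coef a)) as [g1 Hg1]; try (apply disc_summable_deriv_coef; eapply taylor_disc_summable; eauto).
  - intros z Hz. eapply cder_ccont. eapply taylor_der; eauto.
  - exists g1. split. intros; eapply taylor_der; eauto. eapply IHn; eauto.
Qed.

Lemma taylor_at_0 (a : nat -> C) (g : C -> C) : taylor a g -> g 0%C = a O.
Proof.
  intros H. apply cvg_unique with (taylor_sum a 0%C). apply H. apply unit_disc_0.
  intros eps He. exists 1%nat. intros n Hn. replace (taylor_sum a 0%C n) with (a O).
  replace (a O - a O)%C with (RtoC 0) by ring. rewrite Cmod_0. auto.
  destruct n; [lia|]. unfold taylor_sum. rewrite csum_S. rewrite (csum_ext _ (fun _ => 0%C)).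
  rewrite csum_const0. simpl. ring. intros i _. simpl. ring.
Qed.

Lemma taylor_unique (n : nat) : forall (a b : nat -> C) (g h : C -> C), taylor a g -> taylor b h ->
  (forall z, unit_disc z -> g z = h z) -> a n = b n.
Proof.
  induction n; intros a b g h Ha Hb E.
  - rewrite <- (taylor_at_0 a g), <- (taylor_at_0 b h); auto. apply E. apply unit_disc_0.
  - destruct (disc_summable_taylor (deriv_coef a)) as [g1 Hg1]. apply disc_summable_deriv_coef; eapply taylor_disc_summable; eauto.
    destruct (disc_summable_taylor (deriv_coef b)) as [h1 Hh1]. apply disc_summable_deriv_coef; eapply taylor_disc_summable; eauto.
    assert (Q : deriv_coef a n = deriv_coef b n).
    { apply IHn with g1 h1; auto. intros z Hz. apply cder_unique with g z. eapply taylor_der; eauto.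
      destruct (copen_unit_disc z Hz) as [r [Hr Hw]].
      apply cder_ext_loc with h r; auto. intros; symmetry; auto. eapply taylor_der; eauto. }
    unfold deriv_coef in Q. assert (RtoC (INR (S n)) <> 0%C). { intro F. apply RtoC_inj in F. pose proof (lt_0_INR (S n) ltac:(lia)). lra. }
    rewrite <- (Cmult_1_l (a (S n))), <- (Cmult_1_l (b (S n))), <- (Cinv_l (RtoC (INR (S n)))) by auto.
    rewrite <- !Cmult_assoc, Q. auto.
Qed.

Lemma taylor_ext (a b : nat -> C) (g h : C -> C) : taylor a g -> (forall n, a n = b n) -> (forall z, unit_disc z -> g z = h z) -> taylor b h.
Proof.
  intros H E1 E2 z Hz. rewrite <- E2 by auto. eapply cvg_ext; [|apply H; auto]. intros n. apply csum_ext. intros; rewrite E1; auto.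
Qed.

Lemma taylor_plus (a b : nat -> C) (g h : C -> C) : taylor a g -> taylor b h -> taylor (fun n => a n + b n)%C (fun z => g z + h z)%C.
Proof.
  intros Ha Hb z Hz. eapply cvg_ext; [|apply cvg_plus; [apply Ha; auto|apply Hb; auto]].
  intros n. unfold taylor_sum. rewrite <- csum_plus. apply csum_ext. intros; ring.
Qed.

Lemma taylor_scal (c : C) (a : nat -> C) (g : C -> C) : taylor a g -> taylor (fun n => c * a n)%C (fun z => c * g z)%C.
Proof.
  intros Ha z Hz. eapply cvg_ext; [|apply cvg_mult; [apply cvg_const|apply Ha; auto]].
  intros n. unfold taylor_sum. cbv beta. rewrite <- csum_scal. apply csum_ext. intros; ring.
Qed.

Definition shift (a : nat -> C) (n : nat) : C := match n with O => 0%C | S m => a m end.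

Lemma taylor_shift (a : nat -> C) (g : C -> C) : taylor a g -> taylor (shift a) (fun z => z * g z)%C.
Proof.
  intros Ha z Hz. assert (E : forall n, taylor_sum (shift a) z (S n) = (z * taylor_sum a z n)%C).
  { intros n. unfold taylor_sum. rewrite csum_S. simpl. rewrite <- csum_scal.
    replace (0 * 1)%C with (RtoC 0) by ring. rewrite Cplus_0_l. apply csum_ext. intros; ring. }
  intros eps He. destruct (cvg_mult _ _ _ _ (cvg_const z) (Ha z Hz) eps He) as [N HN].
  exists (S N). intros n Hn. destruct n; [lia|]. rewrite E. apply HN. lia.
Qed.

Definition cauchy_prod (a b : nat -> C) (n : nat) : C := csum (fun i => a i * b (n - i)%nat)%C (S n).

Lemma taylor_sum_cauchy_prod (a b : nat -> C) (z : C) (n : nat) :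
  taylor_sum (cauchy_prod a b) z n = csum (fun i => (a i * z ^ i) * taylor_sum b z (n - i))%C n.
Proof.
  induction n. auto.
  change (taylor_sum (cauchy_prod a b) z (S n)) with (taylor_sum (cauchy_prod a b) z n + cauchy_prod a b n * z ^ n)%C. rewrite IHn.
  transitivity (csum (fun i => a i * z ^ i * taylor_sum b z (n - i) + a i * z ^ i * (b (n - i)%nat * z ^ (n - i)))%C n + a n * z ^ n * b O)%C.
  - rewrite csum_plus, <- Cplus_assoc. f_equal. unfold cauchy_prod. rewrite csum_last, Nat.sub_diag, Cmult_plus_distr_r.
    f_equal. 2: ring. rewrite Cmult_comm, <- csum_scal. apply csum_ext. intros i Hi.
    replace (z ^ n)%C with (z ^ i * z ^ (n - i))%C. ring. rewrite <- Cpow_add_r. f_equal. lia.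
  - rewrite csum_last. f_equal.
    + apply csum_ext. intros i Hi. replace (S n - i)%nat with (S (n - i)) by lia. change (taylor_sum b z (S (n - i))) with (taylor_sum b z (n - i) + b (n - i)%nat * z ^ (n - i))%C. ring.
    + replace (S n - n)%nat with 1%nat by lia. unfold taylor_sum. simpl. ring.
Qed.

Lemma rsum_le_const (u : nat -> R) (c : R) (n : nat) : (forall i, (i < n)%nat -> u i <= c) -> rsum u n <= INR n * c.
Proof.
  induction n; intros H. simpl. lra. rewrite S_INR. simpl. specialize (IHn ltac:(auto)). specialize (H n ltac:(lia)). lra.
Qed.

(** The product of the partial sums and the partial sum of the Cauchy product differ by n terms,
    each O(q^n) as a product of a term of degree i and a tail from degree n - i; and n q^n tends to
    0. *)
Lemma taylor_mult (a b : nat -> C) (g h : C -> C) : taylor a g -> taylor b h -> taylor (cauchy_prod a b) (fun z => g z * h z)%C.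
Proof.
  intros Ha Hb z Hz. pose proof (Cmod_ge_0 z) as Hz0. assert (Hz' := Hz). unfold unit_disc in Hz.
  destruct (disc_summable_geom a (Cmod z) (taylor_disc_summable _ _ Ha) ltac:(lra)) as [M1 [q1 [HM1 [Hq1 H1]]]].
  destruct (disc_summable_geom b (Cmod z) (taylor_disc_summable _ _ Hb) ltac:(lra)) as [M2 [q2 [HM2 [Hq2 H2]]]].
  set (q := Rmax q1 q2). pose proof (Rmax_l q1 q2). pose proof (Rmax_r q1 q2).
  assert (Hq : 0 <= q < 1). { unfold q. split. lra. apply Rmax_lub_lt; lra. }
  assert (D : forall n, Cmod (taylor_sum a z n * taylor_sum b z n - taylor_sum (cauchy_prod a b) z n)%C <= INR n * (M1 * (M2 / (1 - q) * q ^ n))).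
  { intros n. rewrite taylor_sum_cauchy_prod. unfold taylor_sum at 1. rewrite Cmult_comm, <- csum_scal.
    assert (E : (csum (fun i => taylor_sum b z n * (a i * z ^ i)) n - csum (fun i => a i * z ^ i * taylor_sum b z (n - i)) n)%C
      = csum (fun i => (a i * z ^ i) * (taylor_sum b z n - taylor_sum b z (n - i)))%C n).
    { rewrite (csum_ext (fun i => (a i * z ^ i) * (taylor_sum b z n - taylor_sum b z (n - i)))%C (fun i => taylor_sum b z n * (a i * z ^ i) + (- (1)) * (a i * z ^ i * taylor_sum b z (n - i)))%C).
      rewrite csum_plus, !csum_scal. ring. intros; ring. }
    rewrite E. eapply Rle_trans. apply Cmod_csum with (b := fun i => M1 * (M2 / (1 - q) * q ^ n)).
    - intros i Hi. rewrite Cmod_mult. 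
      assert (T := csum_geom_tail (fun i => b i * z ^ i)%C M2 q (n - i) i HM2 Hq).
      replace (n - i + i)%nat with n in T by lia. fold (taylor_sum b z n) (taylor_sum b z (n - i)) in T.
      assert (Q1 : Cmod (a i * z ^ i)%C <= M1 * q ^ i).
      { rewrite Cmod_mult, Cmod_pow. eapply Rle_trans. apply H1. apply Rmult_le_compat_l; auto. apply pow_incr. unfold q in *; lra. }
      assert (Q2 : Cmod (taylor_sum b z n - taylor_sum b z (n - i))%C <= M2 / (1 - q) * q ^ (n - i)).
      { apply T. intros j. rewrite Cmod_mult, Cmod_pow. eapply Rle_trans. apply H2. apply Rmult_le_compat_l; auto. apply pow_incr. unfold q in *; lra. }
      replace (M1 * (M2 / (1 - q) * q ^ n)) with ((M1 * q ^ i) * (M2 / (1 - q) * q ^ (n - i))).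
      apply Rmult_le_compat; auto; apply Cmod_ge_0.
      replace (q ^ n) with (q ^ i * q ^ (n - i)). ring. rewrite <- pow_add. f_equal. lia.
    - apply rsum_le_const. intros; lra. }
  destruct (between_1 q Hq) as [B1 [B2 B3]]. set (s := (q + 1) / 2) in *.
  destruct (INR_pow_bounded s ltac:(lra)) as [B [HB HBn]].
  set (K := M1 * (M2 / (1 - q)) * B).
  assert (D2 : forall n, Cmod (taylor_sum a z n * taylor_sum b z n - taylor_sum (cauchy_prod a b) z n)%C <= K * (q / s) ^ n).
  { intros n. eapply Rle_trans. apply D. 
    replace (q ^ n) with (s ^ n * (q / s) ^ n). 2: { rewrite <- Rpow_mult_distr. f_equal. field. lra. }
    specialize (HBn n). rewrite S_INR in HBn. assert (0 <= s ^ n) by (apply pow_le; lra).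
    assert (0 <= (q / s) ^ n) by (apply pow_le; lra).
    assert (P : 0 <= M1 * (M2 / (1 - q))) by (apply Rmult_le_pos; auto; apply Rdiv_le_0_compat; lra).
    replace (INR n * (M1 * (M2 / (1 - q) * (s ^ n * (q / s) ^ n)))) with (M1 * (M2 / (1 - q)) * (INR n * s ^ n) * (q / s) ^ n) by ring.
    unfold K. apply Rmult_le_compat_r; auto. apply Rmult_le_compat_l; auto. lra. }
  assert (L0 : cvg (fun n => taylor_sum a z n * taylor_sum b z n - taylor_sum (cauchy_prod a b) z n)%C 0%C).
  { intros eps He. assert (HK : 0 <= K). { unfold K. apply Rmult_le_pos; auto. apply Rmult_le_pos; auto; apply Rdiv_le_0_compat; lra. }
    destruct (pow_small (q / s) K eps B3 He) as [N HN]. exists N. intros n Hn.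
    replace (taylor_sum a z n * taylor_sum b z n - taylor_sum (cauchy_prod a b) z n - 0)%C with (taylor_sum a z n * taylor_sum b z n - taylor_sum (cauchy_prod a b) z n)%C by ring.
    eapply Rle_lt_trans. apply D2. eapply Rle_lt_trans; [|apply HN]. apply Rmult_le_compat_l; auto.
    replace n with (N + (n - N))%nat by lia. rewrite pow_add. rewrite <- (Rmult_1_r ((q / s) ^ N)) at 2.
    apply Rmult_le_compat_l. apply pow_le; lra. rewrite <- (pow1 (n - N)). apply pow_incr. lra. }
  apply cvg_ext with (fun n => taylor_sum a z n * taylor_sum b z n - (taylor_sum a z n * taylor_sum b z n - taylor_sum (cauchy_prod a b) z n))%C. intros; ring.
  replace (g z * h z)%C with (g z * h z - 0)%C by ring. apply cvg_minus; auto. apply cvg_mult; auto.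
Qed.

(** * Averages over roots of unity *)

Definition root (M k : nat) : C := cexp (0, 2 * PI * INR k / INR M).

Lemma Cmod_root (M k : nat) : Cmod (root M k) = 1.
Proof. unfold root. rewrite Cmod_cexp. unfold Re; simpl. apply exp_0. Qed.

Lemma cexp_pow (z : C) (n : nat) : (cexp z ^ n)%C = cexp (RtoC (INR n) * z)%C.
Proof.
  induction n. simpl. rewrite Cmult_0_l, cexp_0. auto.
  rewrite S_INR, RtoC_plus. simpl Cpow. rewrite IHn, <- cexp_plus. f_equal. ring.
Qed.

Lemma root_pow (M k : nat) : root M k = (root M 1 ^ k)%C.
Proof. unfold root. rewrite cexp_pow. f_equal. apply injective_projections; simpl; unfold Rdiv; ring. Qed.

Lemma root_1_pow_neq (M d : nat) : (0 < d < M)%nat -> (root M 1 ^ d)%C <> 1%C.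
Proof.
  intros Hd E. rewrite <- root_pow in E. unfold root, cexp in E. simpl in E. rewrite exp_0 in E. injection E as E1 E2.
  pose proof PI_RGT_0. assert (H1 : 0 < INR d) by (apply lt_0_INR; lia). assert (H2 : INR d < INR M) by (apply lt_INR; lia).
  replace (2 * PI * INR d / INR M) with (2 * (PI * (INR d / INR M))) in E1 by (field; lra).
  rewrite cos_2a_sin in E1.
  assert (H3 : 0 < INR d / INR M < 1).
  { split. apply Rdiv_lt_0_compat; lra. apply Rmult_lt_reg_r with (INR M). lra. unfold Rdiv. rewrite Rmult_assoc, Rinv_l; lra. }
  assert (0 < sin (PI * (INR d / INR M))) by (apply sin_gt_0; nra). nra.
Qed.

Lemma root_1_pow_M (M : nat) : (0 < M)%nat -> (root M 1 ^ M)%C = 1%C.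
Proof.
  intros HM. rewrite <- root_pow. unfold root, cexp. simpl. apply lt_0_INR in HM. rewrite exp_0.
  replace (2 * PI * INR M / INR M) with (2 * PI) by (field; lra). rewrite cos_2PI, sin_2PI.
  apply injective_projections; simpl; ring.
Qed.

Lemma csum_pow_root (y : C) (M : nat) : y <> 1%C -> (y ^ M)%C = 1%C -> csum (fun k => y ^ k)%C M = 0%C.
Proof.
  intros Hy HM. assert (E : (csum (fun k => y ^ k)%C M * (y - 1) = y ^ M - 1)%C).
  { clear. induction M. simpl. ring. rewrite csum_last, Cmult_plus_distr_r, IHM. simpl. ring. }
  rewrite HM in E. assert (Hn : (y - 1)%C <> 0%C) by (apply Cminus_neq; auto).
  replace (csum (fun k => y ^ k)%C M) with ((csum (fun k => y ^ k)%C M * (y - 1)) / (y - 1))%C by (field; auto).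
  rewrite E. field. auto.
Qed.

Definition mean (M : nat) (u : nat -> C) : C := (RtoC (/ INR M) * csum u M)%C.

Lemma mean_ext (M : nat) (u v : nat -> C) : (forall k, u k = v k) -> mean M u = mean M v.
Proof. intros H. unfold mean. f_equal. apply csum_ext; auto. Qed.
Lemma mean_plus (M : nat) (u v : nat -> C) : mean M (fun k => u k + v k)%C = (mean M u + mean M v)%C.
Proof. unfold mean. rewrite csum_plus. ring. Qed.
Lemma mean_scal (M : nat) (c : C) (u : nat -> C) : mean M (fun k => c * u k)%C = (c * mean M u)%C.
Proof. unfold mean. rewrite csum_scal. ring. Qed.
Lemma mean_csum (M m : nat) (u : nat -> nat -> C) : mean M (fun k => csum (fun i => u i k) m) = csum (fun i => mean M (u i)) m.
Proof.
  induction m; simpl. unfold mean. rewrite csum_const0. ring.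
  rewrite mean_plus, IHm. auto.
Qed.

Lemma Cmod_mean (M : nat) (u : nat -> C) (b : R) : (0 < M)%nat -> (forall k, Cmod (u k) <= b) -> Cmod (mean M u) <= b.
Proof.
  intros HM H. unfold mean. apply lt_0_INR in HM. rewrite Cmod_mult, Cmod_R, Rabs_pos_eq.
  2: { left. apply Rinv_0_lt_compat; auto. }
  apply Rmult_le_reg_l with (INR M); auto. rewrite <- Rmult_assoc, Rinv_r, Rmult_1_l by lra.
  eapply Rle_trans. apply Cmod_csum with (b := fun _ => b). auto. apply rsum_le_const. intros; lra.
Qed.

Lemma Re_mean_nonneg (M : nat) (u : nat -> C) : (forall k, 0 <= Re (u k)) -> (0 < M)%nat -> 0 <= Re (mean M u).
Proof.
  intros H HM. unfold mean. rewrite Re_scal. apply Rmult_le_pos. left; apply Rinv_0_lt_compat; apply lt_0_INR; auto.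
  clear HM. induction M. unfold Re; simpl; lra. rewrite csum_last, Re_plus. specialize (H M). lra.
Qed.

Lemma root_conj (M k : nat) : (root M k * Cconj (root M k))%C = 1%C.
Proof. rewrite <- Cmod2_conj, Cmod_root. f_equal. ring. Qed.

(** Discrete orthogonality of characters. Exponents below M exclude aliasing, that is, distinct
    exponents congruent modulo M. *)
Lemma mean_root (M n j : nat) : (n < M)%nat -> (j < M)%nat ->
  mean M (fun k => root M k ^ n * Cconj (root M k) ^ j)%C = if Nat.eq_dec n j then 1%C else 0%C.
Proof.
  intros Hn Hj. set (w := root M 1). set (y := (w ^ n * Cconj w ^ j)%C).
  assert (HM : 0 < INR M) by (apply lt_0_INR; lia).
  assert (Hw : (w * Cconj w)%C = 1%C) by apply root_conj.
  assert (Hww : forall d, (w ^ d * Cconj w ^ d)%C = 1%C). { intros d. rewrite <- Cpow_mult_l, Hw. apply Cpow_1_l. }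
  assert (E : mean M (fun k => root M k ^ n * Cconj (root M k) ^ j)%C = mean M (fun k => y ^ k)%C).
  { apply mean_ext. intros k. rewrite root_pow. fold w. unfold y. rewrite Cpow_conj, Cpow_mult_l, <- !Cpow_mult_r.
    rewrite (Nat.mul_comm k n), (Nat.mul_comm k j). auto. }
  rewrite E. destruct (Nat.eq_dec n j) as [->|Hnj].
  - assert (Hy : y = 1%C) by apply Hww. rewrite Hy. unfold mean.
    assert (E1 : forall m, csum (fun k => 1 ^ k)%C m = RtoC (INR m)).
    { induction m. auto. rewrite csum_last, IHm, Cpow_1_l, S_INR, RtoC_plus. auto. }
    rewrite E1, <- RtoC_mult. f_equal. field. lra.
  - unfold mean. rewrite csum_pow_root. ring.
    + intros Hy. assert (HMn : forall d, (0 < d < M)%nat -> (w ^ d)%C <> 1%C) by (intros; apply root_1_pow_neq; auto).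
      destruct (lt_dec j n).
      * apply (HMn (n - j)%nat). lia. unfold y in Hy. replace n with (n - j + j)%nat in Hy by lia.
        rewrite Cpow_add_r, <- Cmult_assoc, Hww in Hy. rewrite Cmult_1_r in Hy. auto.
      * apply (HMn (j - n)%nat). lia. unfold y in Hy. replace j with (n + (j - n))%nat in Hy by lia.
        rewrite Cpow_add_r, Cmult_assoc, Hww, Cmult_1_l, <- Cpow_conj in Hy.
        rewrite <- (Cconj_conj (w ^ (j - n))%C), Hy. apply injective_projections; simpl; ring.
    + unfold y. rewrite Cpow_mult_l, <- !Cpow_mult_r, !(Nat.mul_comm _ M), !Cpow_mult_r, <- Cpow_conj.
      unfold w. rewrite root_1_pow_M by lia. replace (Cconj 1) with (RtoC 1) by (apply injective_projections; simpl; ring).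
      rewrite !Cpow_1_l. ring.
Qed.

Lemma csum_single (u : nat -> C) (n j : nat) : csum (fun i => if Nat.eq_dec i j then u i else 0%C) n = if lt_dec j n then u j else 0%C.
Proof.
  induction n. simpl. auto.
  rewrite csum_last, IHn. destruct (Nat.eq_dec n j) as [->|H].
  - destruct (lt_dec j j); try lia. destruct (lt_dec j (S j)); try lia. ring.
  - destruct (lt_dec j n); destruct (lt_dec j (S n)); try lia; ring.
Qed.

(** The Fourier coefficient of index j - i of the function on the circle of radius r; for i > j the
    index is negative and the coefficient is 0. *)
Definition trunc_coef (a : nat -> C) (r : R) (i j : nat) : C :=
  if le_dec i j then (a (j - i)%nat * RtoC r ^ (j - i))%C else 0%C.

(** The substitute for Cauchy's coefficient formula: a partial sum of the series is averaged exactly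
    by [mean_root] once M is large, and the tail is uniformly small on the circle of radius r. *)
Lemma mean_coef (a : nat -> C) (g : C -> C) (r : R) (i j : nat) : taylor a g -> 0 <= r < 1 ->
  cvg (fun M => mean M (fun k => g (RtoC r * root M k) * (root M k ^ i * Cconj (root M k) ^ j))%C) (trunc_coef a r i j).
Proof.
  intros Hg Hr eps He. destruct (disc_summable_geom a r (taylor_disc_summable _ _ Hg) Hr) as [B [q [HB [Hq H]]]].
  destruct (pow_small q (B / (1 - q)) (eps / 2) Hq ltac:(lra)) as [N0 HN0].
  (* At least [S j] terms, so that the coefficient of index j - i is among those averaged exactly; M
     beyond N + i + j then keeps all exponents in the range of [mean_root]. *)
  set (N := (S j + N0)%nat). 
  assert (HN : B / (1 - q) * q ^ N < eps / 2).
  { eapply Rle_lt_trans; [|apply HN0]. apply Rmult_le_compat_l. apply Rdiv_le_0_compat; lra.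
    unfold N. rewrite Nat.add_comm, pow_add. rewrite <- (Rmult_1_r (q ^ N0)) at 2.
    apply Rmult_le_compat_l. apply pow_le; lra. rewrite <- (pow1 (S j)). apply pow_incr. lra. }
  assert (Hz : forall M k, Cmod (RtoC r * root M k)%C = r). { intros. rewrite Cmod_mult, Cmod_root, Cmod_R, Rabs_pos_eq; lra. }
  exists (S (N + i + j)). intros M HM.
  assert (P : mean M (fun k => taylor_sum a (RtoC r * root M k) N * (root M k ^ i * Cconj (root M k) ^ j))%C = trunc_coef a r i j).
  { transitivity (mean M (fun k => csum (fun l => (a l * RtoC r ^ l) * (root M k ^ (l + i) * Cconj (root M k) ^ j)) N)%C).
    { apply mean_ext. intros k. rewrite Cmult_comm. unfold taylor_sum. rewrite <- csum_scal. apply csum_ext. intros l _.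
      rewrite Cpow_mult_l, Cpow_add_r. ring. }
    rewrite (mean_csum M N (fun l k => (a l * RtoC r ^ l) * (root M k ^ (l + i) * Cconj (root M k) ^ j))%C).
    rewrite (csum_ext _ (fun l => if Nat.eq_dec l (j - i) then if le_dec i j then (a l * RtoC r ^ l)%C else 0%C else 0%C)).
    - rewrite (csum_single (fun l => if le_dec i j then (a l * RtoC r ^ l)%C else 0%C)).
      destruct (lt_dec (j - i) N); [|unfold N in *; lia]. reflexivity.
    - intros l Hl. rewrite mean_scal, mean_root by lia.
      destruct (Nat.eq_dec (l + i) j); destruct (Nat.eq_dec l (j - i)); destruct (le_dec i j); try lia; ring. }
  rewrite <- P. 
  replace (mean M (fun k => g (RtoC r * root M k) * (root M k ^ i * Cconj (root M k) ^ j)) - mean M (fun k => taylor_sum a (RtoC r * root M k) N * (root M k ^ i * Cconj (root M k) ^ j)))%C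
   with (mean M (fun k => (g (RtoC r * root M k) - taylor_sum a (RtoC r * root M k) N) * (root M k ^ i * Cconj (root M k) ^ j)))%C.
  2: { rewrite (mean_ext M _ (fun k => g (RtoC r * root M k) * (root M k ^ i * Cconj (root M k) ^ j) + (- (1)) * (taylor_sum a (RtoC r * root M k) N * (root M k ^ i * Cconj (root M k) ^ j)))%C) by (intros; ring).
    rewrite mean_plus, mean_scal. ring. }
  apply Rle_lt_trans with (eps / 2); [|lra]. apply Cmod_mean. lia. intros k.
  rewrite !Cmod_mult, !Cmod_pow, Cmod_conj, Cmod_root, !pow1, !Rmult_1_r.
  apply Rle_trans with (B / (1 - q) * q ^ N); [|lra].
  eapply is_lim_seq_le_const with (u := fun m => Cmod (taylor_sum a (RtoC r * root M k) (N + m) - taylor_sum a (RtoC r * root M k) N)%C).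
  - intros m. unfold taylor_sum. apply csum_geom_tail; auto. intros l. rewrite Cmod_mult, Cmod_pow, Hz. auto.
  - apply (cvg_Cmod (fun m => taylor_sum a (RtoC r * root M k) (N + m) - taylor_sum a (RtoC r * root M k) N)%C).
    apply cvg_minus. 2: apply cvg_const. apply (cvg_sub (taylor_sum a (RtoC r * root M k)) _ (fun m => (N + m)%nat)). intros; lia.
    apply Hg. unfold unit_disc. rewrite Hz. lra.
Qed.

Lemma Cmod_1_plus_sqr (w : C) : Cmod w = 1 -> RtoC (Cmod (1 + w)%C ^ 2) = (2 + w + Cconj w)%C.
Proof.
  intros H. pose proof (Cmod_sqr w) as E. rewrite H in E. rewrite Cmod_sqr.
  apply injective_projections; simpl in *; nra.
Qed.

(* |a_n| <= 2 Re a_0 for a function with positive real part: integrate it against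
   |1 + c w^n|^2 over the circle. *)
Lemma caratheodory (a : nat -> C) (g : C -> C) (n : nat) : taylor a g -> (forall z, unit_disc z -> 0 <= Re (g z)) ->
  (1 <= n)%nat -> Cmod (a n) <= 2 * Re (a O).
Proof.
  intros Hg Hp Hn.
  assert (K : forall r, 0 <= r < 1 -> Cmod (a n) * r ^ n <= 2 * Re (a O)).
  { intros r Hr. destruct (classic (a n = 0%C)) as [E|E].
    { rewrite E, Cmod_0. specialize (Hp 0%C unit_disc_0). rewrite (taylor_at_0 a g Hg) in Hp. lra. }
    assert (Pa : 0 < Cmod (a n)) by (apply Cmod_gt_0; auto).
    assert (PaC : RtoC (Cmod (a n)) <> 0%C) by (intro Q; apply RtoC_inj in Q; lra).
    (* Unimodular with Cconj c a_n = -|a_n|. In |1 + c w^n|^2 = 2 + c w^n + Cconj (c w^n) the middle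
       term contributes nothing, as g has no negative frequencies. *)
    set (c := (- a n / RtoC (Cmod (a n)))%C).
    assert (Hc : Cmod c = 1). { unfold c. rewrite Cmod_div, Cmod_opp, Cmod_R, Rabs_pos_eq; auto. field. lra. lra. }
    assert (Hca : (Cconj c * a n)%C = RtoC (- Cmod (a n))).
    { replace (Cconj c) with (- Cconj (a n) / RtoC (Cmod (a n)))%C.
      replace (- Cconj (a n) / RtoC (Cmod (a n)) * a n)%C with (- (a n * Cconj (a n)) / RtoC (Cmod (a n)))%C by (field; auto).
      rewrite <- Cmod2_conj, RtoC_opp, RtoC_pow. field. auto.
      unfold c, Cdiv. rewrite Cmult_conj. rewrite <- RtoC_inv by lra. apply injective_projections; simpl; ring. }
    assert (L : cvg (fun M => mean M (fun k => g (RtoC r * root M k) * RtoC (Cmod (1 + c * root M k ^ n)%C ^ 2))%C)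
      (2 * trunc_coef a r 0 0 + c * trunc_coef a r n 0 + Cconj c * trunc_coef a r 0 n)%C).
    { eapply cvg_ext.
      2: { apply cvg_plus. apply cvg_plus. apply cvg_mult. apply cvg_const. apply (mean_coef a g r 0 0 Hg Hr).
        apply cvg_mult. apply cvg_const. apply (mean_coef a g r n 0 Hg Hr). apply cvg_mult. apply cvg_const. apply (mean_coef a g r 0 n Hg Hr). }
      intros M. cbv beta. rewrite <- !mean_scal, <- !mean_plus. apply mean_ext. intros k. rewrite Cmod_1_plus_sqr.
      rewrite Cmult_conj, Cpow_conj. simpl. ring. rewrite Cmod_mult, Cmod_pow, Hc, Cmod_root, pow1. ring. }
    apply cvg_Re in L. 
    assert (Q : 0 <= Re (2 * trunc_coef a r 0 0 + c * trunc_coef a r n 0 + Cconj c * trunc_coef a r 0 n)%C).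
    { assert (L2 := proj1 (is_lim_seq_incr_n _ 1 _) L). eapply is_lim_seq_ge_const; [|apply L2]. intros M. simpl.
      apply Re_mean_nonneg; [|lia]. intros k. rewrite Cmult_comm, Re_scal. apply Rmult_le_pos. apply pow2_ge_0. apply Hp.
      unfold unit_disc. rewrite Cmod_mult, Cmod_root, Cmod_R, Rabs_pos_eq; lra. }
    unfold trunc_coef in Q. destruct (le_dec 0 0); [|lia]. destruct (le_dec n 0); [lia|]. destruct (le_dec 0 n); [|lia].
    rewrite !Nat.sub_0_r in Q. rewrite (Cmult_assoc (Cconj c)), Hca in Q.
    replace (2 * (a 0%nat * RtoC r ^ 0) + c * 0 + RtoC (- Cmod (a n)) * RtoC r ^ n)%C with (RtoC 2 * a 0%nat + RtoC (- (Cmod (a n) * r ^ n)))%C in Q.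
    2: { rewrite RtoC_opp, RtoC_opp, RtoC_mult, RtoC_pow. simpl. ring. }
    rewrite (Re_plus (RtoC 2 * a O)%C), Re_scal, Re_RtoC in Q. lra. }
  apply Rnot_lt_le. intro Hlt.
  assert (P0 : 0 <= 2 * Re (a O)). { specialize (K 0 ltac:(lra)). destruct n; [lia|]. simpl in K. lra. }
  assert (Hq : 0 <= 2 * Re (a O) / Cmod (a n) < 1).
  { split. apply Rdiv_le_0_compat; lra. apply Rmult_lt_reg_r with (Cmod (a n)). lra. unfold Rdiv. rewrite Rmult_assoc, Rinv_l; lra. }
  destruct (between_1 _ Hq) as [B1 [B2 _]]. set (t := (2 * Re (a O) / Cmod (a n) + 1) / 2) in *.
  (* The passage r -> 1 by contradiction: t is the midpoint of 2 Re a_0/|a_n| and 1, and a radius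
     with r^n > t violates [K]. *)
  assert (Ht : exists r, 0 <= r < 1 /\ t < r ^ n).
  { assert (C1 : forall m, exists d, 0 < d < 1 /\ t < (1 - d) ^ m).
    { induction m. exists (/ 2). split. lra. simpl. lra.
      destruct IHm as [d [Hd Hm]]. set (u := (1 - d) ^ m) in *.
      assert (Hu : 0 < u) by (apply pow_lt; lra).
      set (e := Rmin d ((u - t) / (2 * u))). 
      assert (He : 0 < e). { apply Rmin_glb_lt. lra. apply Rdiv_lt_0_compat; lra. }
      assert (He1 : e <= d) by apply Rmin_l. assert (He2 : e * (2 * u) <= u - t).
      { apply Rle_trans with ((u - t) / (2 * u) * (2 * u)). apply Rmult_le_compat_r. lra. apply Rmin_r. right. field. lra. }
      exists e. split. lra. simpl. assert (u <= (1 - e) ^ m). { unfold u. apply pow_incr. lra. }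
      assert ((1 - e) * u <= (1 - e) * (1 - e) ^ m) by (apply Rmult_le_compat_l; lra). nra. }
    destruct (C1 n) as [d [Hd Hm]]. exists (1 - d). split; auto. lra. }
  destruct Ht as [r [Hr Hrt]]. specialize (K r Hr).
  assert (2 * Re (a O) < Cmod (a n) * t).
  { replace (2 * Re (a O)) with (Cmod (a n) * (2 * Re (a O) / Cmod (a n))) at 1 by (field; lra). apply Rmult_lt_compat_l; lra. }
  nra.
Qed.

Lemma csum_rev (u : nat -> C) (n : nat) : csum (fun i => u (n - i)%nat) (S n) = csum u (S n).
Proof.
  revert u. induction n; intros u. auto.
  rewrite csum_S. rewrite (csum_ext (fun i => u (S n - S i)%nat) (fun i => u (n - i)%nat)) by auto.
  rewrite IHn, Nat.sub_0_r, (csum_last u (S n)). ring.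
Qed.

Lemma trunc_coef_sum (a : nat -> C) (r : R) (m j : nat) : (j < m)%nat ->
  csum (fun i => trunc_coef a r i j) m = taylor_sum a (RtoC r) (S j).
Proof.
  intros Hj. assert (E : forall n, csum (fun i => trunc_coef a r i j) (S j + n) = csum (fun i => trunc_coef a r i j) (S j)).
  { induction n. rewrite Nat.add_0_r; auto. rewrite Nat.add_succ_r, csum_last, IHn. unfold trunc_coef at 2.
    destruct (le_dec (S j + n) j); try lia. ring. }
  specialize (E (m - S j)%nat). replace (S j + (m - S j))%nat with m in E by lia. rewrite E.
  unfold taylor_sum. rewrite <- (csum_rev (fun i => a i * RtoC r ^ i)%C). apply csum_ext. intros i Hi. unfold trunc_coef. destruct (le_dec i j); [reflexivity|lia].
Qed.

Lemma csum_RtoC (u : nat -> R) (n : nat) : csum (fun i => RtoC (u i)) n = RtoC (rsum u n).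
Proof. induction n. auto. rewrite csum_last, IHn. simpl rsum. rewrite RtoC_plus. auto. Qed.

Lemma cvg_csum (s : nat -> nat -> C) (l : nat -> C) (m : nat) : (forall i, cvg (s i) (l i)) -> cvg (fun M => csum (fun i => s i M) m) (csum l m).
Proof. intros H. induction m; simpl. apply cvg_const. apply cvg_plus; auto. Qed.

Lemma csum_mult (u v : nat -> C) (m : nat) : (csum u m * csum v m)%C = csum (fun j => csum (fun i => u i * v j) m)%C m.
Proof.
  rewrite <- csum_scal. apply csum_ext. intros j _. rewrite Cmult_comm, <- csum_scal. apply csum_ext. intros; ring.
Qed.

Lemma csum_conj (u : nat -> C) (m : nat) : Cconj (csum u m) = csum (fun i => Cconj (u i)) m.
Proof. induction m; simpl. apply injective_projections; simpl; ring. rewrite Cplus_conj, IHm. auto. Qed.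

(* The weight is the Fejer kernel |1 + w + ... + w^(m-1)|^2. *)
Lemma fejer (a : nat -> C) (g : C -> C) (m : nat) : taylor a g -> (forall z, unit_disc z -> z <> 0%C -> Cmod (g z) <= 1) ->
  Cmod (csum (fun j => csum a (S j)) m) <= INR m.
Proof.
  intros Hg Hb.
  set (Q := fun w : C => csum (fun i => w ^ i)%C m).
  assert (HQ : forall w, RtoC (Cmod (Q w) ^ 2) = csum (fun j => csum (fun i => w ^ i * Cconj w ^ j)%C m) m).
  { intros w. rewrite Cmod2_conj. unfold Q. rewrite csum_conj, csum_mult. apply csum_ext. intros j _. apply csum_ext. intros i _. rewrite Cpow_conj. auto. }
  (* Only the m diagonal terms survive the average, so the kernel has mean m, and so has the bound
     for any function of modulus at most 1 weighted by it. *)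
  assert (HQm : forall M, (m < M)%nat -> mean M (fun k => RtoC (Cmod (Q (root M k)) ^ 2)) = RtoC (INR m)).
  { intros M HM. rewrite (mean_ext M _ (fun k => csum (fun j => csum (fun i => root M k ^ i * Cconj (root M k) ^ j)%C m) m)) by (intros; apply HQ).
    rewrite (mean_csum M m (fun j k => csum (fun i => root M k ^ i * Cconj (root M k) ^ j)%C m)).
    rewrite (csum_ext _ (fun _ => 1%C)).
    - clear. induction m. auto. rewrite csum_last, IHm, S_INR, RtoC_plus. auto.
    - intros j Hj. rewrite (mean_csum M m (fun i k => root M k ^ i * Cconj (root M k) ^ j)%C).
      rewrite (csum_ext _ (fun i => if Nat.eq_dec i j then 1%C else 0%C)).
      rewrite (csum_single (fun _ => 1%C)). destruct (lt_dec j m); [auto|lia].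
      intros i Hi. apply mean_root; lia. }
  assert (K : forall r, 0 < r < 1 -> Cmod (csum (fun j => taylor_sum a (RtoC r) (S j)) m) <= INR m).
  { intros r Hr.
    assert (L : cvg (fun M => mean M (fun k => g (RtoC r * root M k) * RtoC (Cmod (Q (root M k)) ^ 2))%C) (csum (fun j => taylor_sum a (RtoC r) (S j)) m)).
    { rewrite (csum_ext (fun j => taylor_sum a (RtoC r) (S j)) (fun j => csum (fun i => trunc_coef a r i j) m)).
      2: { intros j Hj. symmetry. apply trunc_coef_sum; auto. }
      eapply cvg_ext.
      2: { apply (cvg_csum (fun j M => csum (fun i => mean M (fun k => g (RtoC r * root M k) * (root M k ^ i * Cconj (root M k) ^ j))%C) m)).
        intros j. apply (cvg_csum (fun i M => mean M (fun k => g (RtoC r * root M k) * (root M k ^ i * Cconj (root M k) ^ j))%C)).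
        intros i. apply mean_coef; auto. lra. }
      intros M. cbv beta. symmetry.
      transitivity (mean M (fun k => csum (fun j => csum (fun i => g (RtoC r * root M k) * (root M k ^ i * Cconj (root M k) ^ j))%C m) m)).
      { apply mean_ext. intros k. rewrite HQ, <- csum_scal. apply csum_ext. intros j _. rewrite <- csum_scal. auto. }
      rewrite (mean_csum M m (fun j k => csum (fun i => g (RtoC r * root M k) * (root M k ^ i * Cconj (root M k) ^ j))%C m)).
      apply csum_ext. intros j _. rewrite (mean_csum M m (fun i k => g (RtoC r * root M k) * (root M k ^ i * Cconj (root M k) ^ j))%C). auto. }
    apply cvg_Cmod in L. apply (is_lim_seq_incr_n _ (S m)) in L.
    eapply is_lim_seq_le_const; [|apply L]. intros M0. cbv beta. set (M := (M0 + S m)%nat).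
    assert (HM : (m < M)%nat) by (unfold M; lia). assert (HM2 : 0 < INR M) by (apply lt_0_INR; lia).
    assert (E : INR m = / INR M * rsum (fun k => Cmod (Q (root M k)) ^ 2) M).
    { apply RtoC_inj. rewrite <- (HQm M HM). unfold mean. rewrite RtoC_mult. f_equal.
      apply csum_RtoC. }
    rewrite E. unfold mean. rewrite Cmod_mult, Cmod_R, Rabs_pos_eq. 2: { left. apply Rinv_0_lt_compat; auto. }
    apply Rmult_le_compat_l. left. apply Rinv_0_lt_compat; auto.
    apply Cmod_csum. intros k _. rewrite Cmod_mult, Cmod_R, (Rabs_pos_eq (_ ^ 2)) by apply pow2_ge_0.
    rewrite <- (Rmult_1_l (_ ^ 2)) at 2. apply Rmult_le_compat_r. apply pow2_ge_0.
    assert (Er : Cmod (RtoC r * root M k)%C = r) by (rewrite Cmod_mult, Cmod_root, Cmod_R, Rabs_pos_eq; lra).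
    apply Hb. unfold unit_disc. lra. intro F. rewrite F, Cmod_0 in Er. lra. }
  assert (Hc : ccont (fun z => csum (fun j => taylor_sum a z (S j)) m) 1%C).
  { apply (hol_cont 0 (fun _ => True)); auto.
    assert (Hs : forall (u : nat -> C -> C) n, (forall i, hol 0 (fun _ => True) (u i)) -> hol 0 (fun _ => True) (fun z => csum (fun i => u i z) n)).
    { intros u n Hu. induction n. simpl. apply (hol_const 0). apply (hol_plus 0 _ (fun z => csum (fun i => u i z) n) (u n)); auto. }
    apply Hs. intros j. apply (Hs (fun i z => a i * z ^ i)%C). intros i. apply hol_mult. apply hol_const. apply hol_pow. apply hol_id. }
  assert (L1 : cvg (fun k => RtoC (1 - / (INR k + 2))) 1%C).
  { intros eps He. destruct (archimed_cor1 eps He) as [N [HN HN0]]. exists N. intros k Hk.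
    rewrite <- RtoC_minus, Cmod_R. replace (1 - / (INR k + 2) - 1) with (- / (INR k + 2)) by ring. rewrite Rabs_Ropp, Rabs_pos_eq.
    eapply Rle_lt_trans; [|apply HN]. apply Rinv_le_contravar. apply lt_0_INR; auto. apply le_INR in Hk. lra.
    left. apply Rinv_0_lt_compat. pose proof (pos_INR k). lra. }
  assert (L2 := cvg_Cmod _ _ (cvg_cont _ _ _ Hc L1)).
  replace (csum (fun j => csum a (S j)) m) with (csum (fun j => taylor_sum a 1%C (S j)) m).
  - eapply is_lim_seq_le_const; [|apply L2]. intros k. apply K. pose proof (pos_INR k).
    assert (0 < / (INR k + 2) < 1). { split. apply Rinv_0_lt_compat; lra. rewrite <- Rinv_1. apply Rinv_lt_contravar; lra. } lra.
  - apply csum_ext. intros j _. unfold taylor_sum. apply csum_ext. intros i _. rewrite Cpow_1_l. ring.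
Qed.

(** * The bound by the coefficients of the half-plane power *)

Definition cayley (z : C) : C := ((1 + z) / (1 - z))%C.
(** The same branch as [half_plane_power], written so that the chain rule and the addition law of
    [cexp] apply. *)
Definition hp_power (s : R) (z : C) : C := cexp (RtoC s * clog (cayley z))%C.

Lemma cayley_rhp (z : C) : unit_disc z -> 0 < Re (cayley z).
Proof.
  intros Hz. assert (H := disc_to_rhp 1%C z). replace (1 + Cconj 1 * z)%C with (1 + z)%C in H.
  apply H; auto. unfold rhp, Re; simpl; lra. apply injective_projections; simpl; ring.
Qed.

Lemma one_plus_neq_0 (z : C) : unit_disc z -> (1 + z)%C <> 0%C.
Proof.
  intros H. replace (1 + z)%C with (1 - - z)%C by ring. apply one_minus_neq_0. unfold unit_disc in *. rewrite Cmod_opp. auto.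
Qed.

Lemma half_plane_power_eq (alpha : R) (z : C) : half_plane_power alpha z = hp_power alpha z.
Proof.
  unfold half_plane_power, Cpower_right_half_plane, hp_power, cayley. generalize ((1 + z) / (1 - z))%C. intros w.
  unfold cexp, clog, Rpower, Re, Im. set (l := ln (Cmod w)). set (t := atan (snd w / fst w)).
  simpl. replace (alpha * l - 0 * t) with (alpha * l) by ring. replace (alpha * t + 0 * l) with (alpha * t) by ring.
  apply injective_projections; simpl; ring.
Qed.

Lemma hp_power_opp (s : R) (z : C) : (hp_power s z * hp_power (- s) z)%C = 1%C.
Proof. unfold hp_power. rewrite <- cexp_plus, RtoC_opp. rewrite <- cexp_0. f_equal. ring. Qed.

Lemma hp_power_0 (s : R) : hp_power s 0%C = 1%C.
Proof.
  unfold hp_power, cayley. replace ((1 + 0) / (1 - 0))%C with (RtoC 1) by field.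
  replace (clog 1%C) with (RtoC 0). rewrite Cmult_0_r, cexp_0. auto.
  unfold clog. rewrite Cmod_1, ln_1. simpl. unfold Rdiv. rewrite Rmult_0_l, atan_0. auto.
Qed.

Lemma cder_hp_power (s : R) (z : C) : unit_disc z -> cder (hp_power s) z (hp_power s z * (2 * RtoC s / ((1 - z) * (1 + z))))%C.
Proof.
  intros Hz. assert (N1 := one_minus_neq_0 z Hz). assert (N2 := one_plus_neq_0 z Hz).
  unfold hp_power. eapply cder_eq. apply (cder_comp (fun z => RtoC s * clog (cayley z))%C cexp). 2: apply cder_cexp.
  apply cder_mult. apply cder_const. apply (cder_comp cayley clog). 2: { apply cder_clog. apply cayley_rhp; auto. }
  unfold cayley. apply (cder_mult (fun z => 1 + z)%C (fun z => / (1 - z))%C). apply cder_plus. apply cder_const. apply cder_id.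
  apply (cder_inv (fun z => 1 - z)%C); auto. apply cder_plus. apply cder_const. apply cder_opp. apply cder_id.
  cbv beta. unfold cayley. field. auto.
Qed.

Lemma disc_segment (z : C) (t : R) : unit_disc z -> 0 <= t <= 1 -> unit_disc (0 + RtoC t * (z - 0))%C.
Proof.
  intros Hz Ht. unfold unit_disc in *. replace (0 + RtoC t * (z - 0))%C with (RtoC t * z)%C by ring.
  rewrite Cmod_mult, Cmod_R, Rabs_pos_eq by lra. pose proof (Cmod_ge_0 z). nra.
Qed.

Lemma disc_const (g : C -> C) (z : C) : (forall x, unit_disc x -> cder g x 0%C) -> unit_disc z -> g z = g 0%C.
Proof. intros H Hz. apply zero_derivative_const with unit_disc; auto. intros; apply disc_segment; auto. Qed.

(** The equation says that y times the power of exponent -s has derivative 0; the product is 1 at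
    0. *)
Lemma hp_power_ode (s : R) (y y1 : C -> C) : (forall z, unit_disc z -> cder y z (y1 z)) ->
  (forall z, unit_disc z -> (1 - z) * (1 + z) * y1 z = 2 * RtoC s * y z)%C -> y 0%C = 1%C ->
  forall z, unit_disc z -> y z = hp_power s z.
Proof.
  intros Hd Ho H0 z Hz. assert (E : (y z * hp_power (- s) z = 1)%C).
  { transitivity (y 0%C * hp_power (- s) 0%C)%C. 2: { rewrite H0, hp_power_0. ring. }
    apply (disc_const (fun z => y z * hp_power (- s) z)%C); auto. intros x Hx. eapply cder_eq. apply cder_mult. apply Hd; auto. apply cder_hp_power; auto.
    assert (N1 := one_minus_neq_0 x Hx). assert (N2 := one_plus_neq_0 x Hx). specialize (Ho x Hx).
    replace (y1 x) with (2 * RtoC s * y x / ((1 - x) * (1 + x)))%C. rewrite RtoC_opp. field. auto.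
    rewrite <- Ho. field. auto. }
  transitivity (y z * hp_power (- s) z * hp_power s z)%C. rewrite <- Cmult_assoc, (Cmult_comm (hp_power (- s) z)), hp_power_opp. ring.
  rewrite E. ring.
Qed.

Lemma taylor_val (a b : nat -> C) (g h : C -> C) (z : C) : taylor a g -> taylor b h -> (forall n, a n = b n) -> unit_disc z -> g z = h z.
Proof.
  intros Ha Hb E Hz. apply cvg_unique with (taylor_sum a z). apply Ha; auto. eapply cvg_ext; [|apply Hb; auto].
  intros n. apply csum_ext. intros; rewrite E; auto.
Qed.

Lemma taylor_der_exists (a : nat -> C) (g : C -> C) : taylor a g -> exists g1, taylor (deriv_coef a) g1 /\ forall z, unit_disc z -> cder g z (g1 z).
Proof.
  intros H. destruct (disc_summable_taylor (deriv_coef a)) as [g1 Hg1]. apply disc_summable_deriv_coef; eapply taylor_disc_summable; eauto. exists g1. split; auto.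
  intros; eapply taylor_der; eauto.
Qed.

Lemma taylor_minus_shift (a : nat -> C) (g : C -> C) : taylor a g -> taylor (fun n => a n - shift a n)%C (fun z => (1 - z) * g z)%C.
Proof.
  intros H. eapply taylor_ext. apply (taylor_plus _ _ _ _ H (taylor_scal (- (1))%C _ _ (taylor_shift _ _ H))).
  intros; cbv beta; ring. intros; cbv beta; ring.
Qed.

Lemma taylor_plus_shift (a : nat -> C) (g : C -> C) : taylor a g -> taylor (fun n => a n + shift a n)%C (fun z => (1 + z) * g z)%C.
Proof.
  intros H. eapply taylor_ext. apply (taylor_plus _ _ _ _ H (taylor_shift _ _ H)).
  intros; cbv beta; ring. intros; cbv beta; ring.
Qed.

(** * Coefficients defined by two-term recurrences *)

Fixpoint pairseq (F : nat -> R -> R -> R) (x0 x1 : R) (n : nat) : R * R :=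
  match n with O => (x0, x1) | S m => let p := pairseq F x0 x1 m in (snd p, F m (fst p) (snd p)) end.
Definition seq2 (F : nat -> R -> R -> R) (x0 x1 : R) (n : nat) : R := fst (pairseq F x0 x1 n).

Lemma seq2_rec (F : nat -> R -> R -> R) (x0 x1 : R) (n : nat) :
  seq2 F x0 x1 (S (S n)) = F n (seq2 F x0 x1 n) (seq2 F x0 x1 (S n)).
Proof. reflexivity. Qed.

Lemma two_step_ind (P : nat -> Prop) : P O -> P 1%nat -> (forall n, P n -> P (S n) -> P (S (S n))) -> forall n, P n.
Proof. intros H0 H1 HS n. assert (P n /\ P (S n)) as [H _]; auto. induction n; intuition. Qed.

(** The recurrence is the equation (1 - z^2) y' = 2 s y read off at z^(n+1). *)
Definition hp_power_coef (s : R) : nat -> R := seq2 (fun n x y => (2 * s * y + INR n * x) / INR (n + 2)) 1 (2 * s).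

Lemma hp_power_coef_rec (s : R) (n : nat) : INR (n + 2) * hp_power_coef s (S (S n)) = 2 * s * hp_power_coef s (S n) + INR n * hp_power_coef s n.
Proof. unfold hp_power_coef. rewrite seq2_rec. field. rewrite plus_INR. pose proof (pos_INR n). simpl; lra. Qed.

Lemma hp_power_coef_bound (s : R) : 0 <= s <= 1 -> forall n, Rabs (hp_power_coef s n) <= 2.
Proof.
  intros Hs. apply two_step_ind.
  - unfold hp_power_coef, seq2; simpl. rewrite Rabs_R1. lra.
  - unfold hp_power_coef, seq2; simpl. rewrite Rabs_pos_eq; lra.
  - intros n H1 H2. pose proof (hp_power_coef_rec s n) as E. rewrite plus_INR in E. simpl (INR 2) in E. pose proof (pos_INR n).
    apply Rabs_le_between in H1. apply Rabs_le_between in H2. apply Rabs_le_between.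
    split; apply Rmult_le_reg_l with (INR n + 2); try lra; replace (INR n + (1 + 1)) with (INR n + 2) in E by ring; rewrite E; nra.
Qed.

Lemma linear_disc_summable (a : nat -> C) (M : R) : (forall n, Cmod (a n) <= M * INR (S n)) -> disc_summable a.
Proof.
  intros H r Hr. destruct (INR_pow_bounded r Hr) as [B [HB HBn]].
  assert (HM : 0 <= M). { specialize (H O). simpl in H. pose proof (Cmod_ge_0 (a O)). lra. }
  exists (M * B). split. apply Rmult_le_pos; auto. intros n. apply Rle_trans with (M * (INR (S n) * r ^ n)).
  rewrite <- Rmult_assoc. apply Rmult_le_compat_r; auto. apply pow_le; lra. apply Rmult_le_compat_l; auto.
Qed.

(** The series with these coefficients converges, since they are bounded, and solves the
    differential equation; [hp_power_ode] identifies its sum. The range of s covers the exponent 2 -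
    alpha. *)
Lemma taylor_hp_power (s : R) : 0 <= s <= 1 -> taylor (fun n => RtoC (hp_power_coef s n)) (hp_power s).
Proof.
  intros Hs. destruct (disc_summable_taylor (fun n => RtoC (hp_power_coef s n))) as [y Hy].
  { apply linear_disc_summable with 2. intros n. rewrite Cmod_R. pose proof (hp_power_coef_bound s Hs n). rewrite S_INR. pose proof (pos_INR n). lra. }
  destruct (taylor_der_exists _ _ Hy) as [y1 [Hy1 Hd]].
  assert (E : forall z, unit_disc z -> y z = hp_power s z).
  { apply (hp_power_ode s y y1 Hd).
    - intros z Hz. rewrite <- Cmult_assoc. apply (taylor_val _ _ (fun z => (1 - z) * ((1 + z) * y1 z))%C (fun z => 2 * RtoC s * y z)%C z (taylor_minus_shift _ _ (taylor_plus_shift _ _ Hy1)) (taylor_scal (2 * RtoC s)%C _ _ Hy)); auto.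
      intros n. destruct n as [|[|n]]; simpl shift; unfold deriv_coef.
      + replace (hp_power_coef s 0) with 1 by reflexivity. replace (hp_power_coef s 1) with (2 * s) by reflexivity. simpl INR. rewrite RtoC_mult. ring.
      + pose proof (hp_power_coef_rec s 0) as R. simpl (0 + 2)%nat in R. simpl INR in *. 
        replace (2 * RtoC s * RtoC (hp_power_coef s 1))%C with (RtoC ((1 + 1) * hp_power_coef s 2)). 2: { rewrite R, RtoC_plus, !RtoC_mult. ring. }
        rewrite RtoC_mult. ring.
      + pose proof (hp_power_coef_rec s (S n)) as R. replace (S n + 2)%nat with (S (S (S n))) in R by lia.
        replace (2 * RtoC s * RtoC (hp_power_coef s (S (S n))))%C with (RtoC (INR (S (S (S n))) * hp_power_coef s (S (S (S n))) - INR (S n) * hp_power_coef s (S n))).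
        2: { rewrite R. rewrite <- !RtoC_mult. f_equal. ring. }
        rewrite RtoC_minus, !RtoC_mult. ring.
    - rewrite (taylor_at_0 _ _ Hy). auto. }
  intros z Hz. rewrite <- E by auto. apply Hy; auto.
Qed.

(* The coefficients of (1-z)^-2 ((1+z)/(1-z))^(b-1). *)
Definition extremal_coef (b : R) : nat -> R := seq2 (fun n x y => (2 * b * y + INR (n + 2) * x) / INR (n + 2)) 1 (2 * b).

Lemma extremal_coef_rec (b : R) (n : nat) : INR (n + 2) * extremal_coef b (S (S n)) = 2 * b * extremal_coef b (S n) + INR (n + 2) * extremal_coef b n.
Proof. unfold extremal_coef. rewrite seq2_rec. field. rewrite plus_INR. pose proof (pos_INR n). simpl; lra. Qed.

Lemma extremal_coef_bound (b : R) : 0 <= b <= 1 -> forall n, 0 <= extremal_coef b n <= INR (S n).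
Proof.
  intros Hs. apply two_step_ind.
  - unfold extremal_coef, seq2; simpl. lra.
  - unfold extremal_coef, seq2; simpl. lra.
  - intros n H1 H2. pose proof (extremal_coef_rec b n) as E. rewrite plus_INR in E. simpl (INR 2) in E. pose proof (pos_INR n).
    rewrite !S_INR in *. replace (INR n + (1 + 1)) with (INR n + 2) in E by ring.
    split; apply Rmult_le_reg_l with (INR n + 2); try lra; rewrite E; nra.
Qed.

(** The recurrence of [extremal_coef] is (1 - z^2) y' = 2 (b + z) y, which says that the product of
    y with (1-z)^2 and the power of exponent 1 - b is constant. *)
Lemma taylor_extremal (b : R) : 0 <= b <= 1 -> exists g, taylor (fun n => RtoC (extremal_coef b n)) g /\
  forall z, unit_disc z -> (g z * ((1 - z) * (1 - z) * hp_power (1 - b) z) = 1)%C.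
Proof.
  intros Hs. destruct (disc_summable_taylor (fun n => RtoC (extremal_coef b n))) as [y Hy].
  { apply linear_disc_summable with 1. intros n. destruct (extremal_coef_bound b Hs n). rewrite Cmod_R, Rabs_pos_eq; lra. }
  destruct (taylor_der_exists _ _ Hy) as [y1 [Hy1 Hd]]. exists y. split; auto.
  assert (Ho : forall z, unit_disc z -> ((1 - z) * ((1 + z) * y1 z) = 2 * RtoC b * y z + 2 * (z * y z))%C).
  { intros z Hz. apply (taylor_val _ _ (fun z => (1 - z) * ((1 + z) * y1 z))%C (fun z => 2 * RtoC b * y z + 2 * (z * y z))%C z (taylor_minus_shift _ _ (taylor_plus_shift _ _ Hy1)) (taylor_plus _ _ _ _ (taylor_scal (2 * RtoC b)%C _ _ Hy) (taylor_scal 2%C _ _ (taylor_shift _ _ Hy)))); auto.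
    intros n. destruct n as [|[|n]]; simpl shift; unfold deriv_coef.
    + replace (extremal_coef b 0) with 1 by reflexivity. replace (extremal_coef b 1) with (2 * b) by reflexivity. simpl INR. rewrite RtoC_mult. ring.
    + pose proof (extremal_coef_rec b 0) as R. simpl (0 + 2)%nat in R. simpl INR in *.
      replace (2 * RtoC b * RtoC (extremal_coef b 1))%C with (RtoC ((1 + 1) * extremal_coef b 2 - (1 + 1) * extremal_coef b 0)). 2: { rewrite R, RtoC_minus, RtoC_plus, !RtoC_mult. ring. }
      replace (extremal_coef b 0) with 1 by reflexivity. 
      rewrite RtoC_minus, !RtoC_mult, !RtoC_plus. ring.
    + pose proof (extremal_coef_rec b (S n)) as R. replace (S n + 2)%nat with (S (S (S n))) in R by lia.
      replace (2 * RtoC b * RtoC (extremal_coef b (S (S n))))%C with (RtoC (INR (S (S (S n))) * extremal_coef b (S (S (S n))) - INR (S (S (S n))) * extremal_coef b (S n))).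
      2: { rewrite R. rewrite <- !RtoC_mult. f_equal. ring. }
      rewrite !S_INR. rewrite RtoC_minus, !RtoC_mult, !RtoC_plus. ring. }
  intros z Hz. transitivity (y 0%C * ((1 - 0) * (1 - 0) * hp_power (1 - b) 0))%C.
  2: { rewrite hp_power_0, (taylor_at_0 _ _ Hy). replace (extremal_coef b 0) with 1 by reflexivity. ring. }
  apply (disc_const (fun z => y z * ((1 - z) * (1 - z) * hp_power (1 - b) z))%C); auto. intros x Hx. eapply cder_eq. apply cder_mult. apply Hd; auto.
  apply cder_mult. apply cder_mult; apply cder_plus; try apply cder_const; apply cder_opp; apply cder_id. apply cder_hp_power; auto.
  assert (N1 := one_minus_neq_0 x Hx). assert (N2 := one_plus_neq_0 x Hx). specialize (Ho x Hx). cbv beta.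
  replace (y1 x) with ((2 * RtoC b * y x + 2 * (x * y x)) / ((1 - x) * (1 + x)))%C. rewrite RtoC_minus. field. auto.
  rewrite <- Ho. field. auto.
Qed.

(** The coefficient form of (1+z) y' + 2 y = 2 (b+1) y/(1-z), which is the differential equation of
    y divided by 1-z. It brings the partial sums of [extremal_coef] under a recurrence. *)
Lemma extremal_sum_identity (b : R) (n : nat) :
  INR (n + 1) * extremal_coef b (S n) + INR (n + 2) * extremal_coef b n = 2 * (b + 1) * rsum (extremal_coef b) (S n).
Proof.
  induction n.
  - simpl. replace (extremal_coef b 0) with 1 by reflexivity. replace (extremal_coef b 1) with (2 * b) by reflexivity. ring.
  - pose proof (extremal_coef_rec b n) as R. simpl rsum in *. rewrite !plus_INR, !S_INR in *. simpl (INR 2) in *. simpl (INR 1) in *. nra.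
Qed.

Lemma rec_unique (c : R) (u v : nat -> R) : u O = v O -> u 1%nat = v 1%nat ->
  (forall n, INR (n + 2) * (u (S (S n)) - u n) = c * u (S n)) ->
  (forall n, INR (n + 2) * (v (S (S n)) - v n) = c * v (S n)) -> forall n, u n = v n.
Proof.
  intros H0 H1 Hu Hv. apply two_step_ind; auto. intros n E1 E2. specialize (Hu n). specialize (Hv n).
  rewrite E1, E2 in Hu. assert (0 < INR (n + 2)) by (apply lt_0_INR; lia).
  assert (INR (n + 2) * (u (S (S n)) - v n) = INR (n + 2) * (v (S (S n)) - v n)) by lra.
  apply Rmult_eq_reg_l in H2; lra.
Qed.

(** Here the expansion is given, and comparing coefficients in (1 - z^2) y' = 2 alpha y yields the
    recurrence, which together with A 0 = 1 determines A. *)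
Lemma half_plane_coef_rec (alpha : R) (A : nat -> R) : is_half_plane_power_coeffs alpha A ->
  A 1%nat = 2 * alpha /\ forall n, INR (n + 2) * A (S (S n)) = 2 * alpha * A (S n) + INR n * A n.
Proof.
  intros [HA0 HA]. apply expands_taylor in HA.
  assert (Hy : taylor (fun n => RtoC (A n)) (hp_power alpha)). { intros z Hz. rewrite <- half_plane_power_eq. apply HA; auto. }
  destruct (taylor_der_exists _ _ Hy) as [y1 [Hy1 Hd]].
  assert (E : forall z, unit_disc z -> ((1 - z) * ((1 + z) * y1 z) = 2 * RtoC alpha * hp_power alpha z)%C).
  { intros z Hz. rewrite (cder_unique _ _ _ _ (Hd z Hz) (cder_hp_power alpha z Hz)).
    assert (N1 := one_minus_neq_0 z Hz). assert (N2 := one_plus_neq_0 z Hz). field. auto. }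
  assert (Q := fun n => taylor_unique n _ _ _ _ (taylor_minus_shift _ _ (taylor_plus_shift _ _ Hy1)) (taylor_scal (2 * RtoC alpha)%C _ _ Hy) E).
  split.
  - specialize (Q O). simpl in Q. unfold deriv_coef in Q. simpl INR in Q. rewrite HA0 in Q. apply RtoC_inj.
    replace (RtoC (A 1%nat)) with (RtoC 1 * RtoC (A 1%nat) + 0 - 0)%C by ring. rewrite Q, RtoC_mult. ring.
  - intros n. specialize (Q (S n)). apply RtoC_inj.
    rewrite RtoC_plus, !RtoC_mult. destruct n as [|n]; simpl shift in Q; unfold deriv_coef in Q.
    + simpl (0 + 2)%nat. simpl (INR 0).
      replace (RtoC (INR 2) * RtoC (A 2%nat))%C with (RtoC (INR 2) * RtoC (A 2%nat) + RtoC (INR 1) * RtoC (A 1%nat) - (RtoC (INR 1) * RtoC (A 1%nat) + 0))%C by ring.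
      rewrite Q. ring.
    + replace (S n + 2)%nat with (S (S (S n))) by lia.
      replace (RtoC (INR (S (S (S n)))) * RtoC (A (S (S (S n)))))%C with (RtoC (INR (S (S (S n)))) * RtoC (A (S (S (S n)))) + RtoC (INR (S (S n))) * RtoC (A (S (S n))) - (RtoC (INR (S (S n))) * RtoC (A (S (S n))) + RtoC (INR (S n)) * RtoC (A (S n))) + RtoC (INR (S n)) * RtoC (A (S n)))%C by ring.
      rewrite Q. ring.
Qed.

Lemma hp_power_polar (s : R) (z : C) : exists r th, 0 < r /\ Rabs th < PI / 2 /\ hp_power s z = (RtoC r * (cos (s * th), sin (s * th)))%C.
Proof.
  exists (exp (s * ln (Cmod (cayley z)))), (atan (snd (cayley z) / fst (cayley z))). split. apply exp_pos. split. apply Rabs_atan_lt.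
  unfold hp_power, cexp, clog. set (l := ln (Cmod (cayley z))). set (t := atan (snd (cayley z) / fst (cayley z))).
  simpl. replace (s * l - 0 * t) with (s * l) by ring. replace (s * t + 0 * l) with (s * t) by ring. apply injective_projections; simpl; ring.
Qed.

(* The sector condition says that u (1-z)^2 f'(z) ((1+z)/(1-z))^(2-alpha) has
   nonnegative real part, so its coefficients have modulus at most 2; dividing by the
   other factors multiplies its series by one with nonnegative coefficients. *)
Lemma coef_bound (f f1 : C -> C) (a : nat -> C) (alpha : R) : concave_map f f1 -> taylor (deriv_coef a) f1 -> 1 < alpha <= 2 ->
  opening_angle_at_infinity (image unit_disc f) <= PI * alpha ->
  forall n, Cmod (deriv_coef a n) <= extremal_coef (alpha - 1) n + 2 * rsum (extremal_coef (alpha - 1)) n.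
Proof.
  intros HC Hf1 Ha Hop n. destruct (sector f f1 alpha HC Ha Hop) as [u [Hu HS]].
  destruct (taylor_extremal (alpha - 1) ltac:(lra)) as [g [Hg Hg1]]. replace (1 - (alpha - 1)) with (2 - alpha) in Hg1 by ring.
  set (Pi := fun z => (u * (((1 - z) * ((1 - z) * f1 z)) * hp_power (2 - alpha) z))%C).
  assert (HPi := taylor_scal u _ _ (taylor_mult _ _ _ _ (taylor_minus_shift _ _ (taylor_minus_shift _ _ Hf1)) (taylor_hp_power (2 - alpha) ltac:(lra)))).
  cbv beta in HPi. fold Pi in HPi.
  match type of HPi with taylor ?p _ => set (pc := p) in * end.
  assert (HRe : forall z, unit_disc z -> 0 <= Re (Pi z)).
  { intros z Hz. destruct (hp_power_polar (2 - alpha) z) as [r [th [Hr [Hth E]]]]. specialize (HS z th Hz Hth). unfold Pi. rewrite E.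
    replace (u * ((1 - z) * ((1 - z) * f1 z) * (RtoC r * (cos ((2 - alpha) * th), sin ((2 - alpha) * th)))))%C
      with (RtoC r * (u * ((cos ((2 - alpha) * th), sin ((2 - alpha) * th)) * (f1 z * ((1 - z) * (1 - z))))))%C.
    rewrite Re_scal. apply Rmult_le_pos; lra.
    set (cs := (cos ((2 - alpha) * th), sin ((2 - alpha) * th)) : C). ring. }
  assert (H10 : f1 0%C = 1%C) by apply HC.
  assert (Hpc0 : Cmod (pc O) = 1).
  { rewrite <- (taylor_at_0 _ _ HPi). unfold Pi. rewrite hp_power_0, H10. replace (u * ((1 - 0) * ((1 - 0) * 1) * 1))%C with u by ring. auto. }
  assert (Hpc : forall k, (1 <= k)%nat -> Cmod (pc k) <= 2).
  { intros k Hk. eapply Rle_trans. apply (caratheodory pc Pi k); auto. pose proof (Re_le (pc O)). lra. }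
  assert (E := taylor_unique n _ _ _ _ (taylor_scal u _ _ Hf1) (taylor_mult _ _ _ _ Hg HPi)).
  cbv beta in E. assert (E2 : (u * deriv_coef a n)%C = cauchy_prod (fun n => RtoC (extremal_coef (alpha - 1) n)) pc n).
  { apply E. intros z Hz. unfold Pi. specialize (Hg1 z Hz).
    transitivity (u * f1 z * (g z * ((1 - z) * (1 - z) * hp_power (2 - alpha) z)))%C. rewrite Hg1. ring. ring. }
  replace (Cmod (deriv_coef a n)) with (Cmod (u * deriv_coef a n)%C) by (rewrite Cmod_mult, Hu; ring).
  assert (Hk := extremal_coef_bound (alpha - 1) ltac:(lra)).
  rewrite E2. unfold cauchy_prod. rewrite csum_last, Nat.sub_diag. rewrite Rplus_comm.
  eapply Rle_trans. apply Cmod_triangle. apply Rplus_le_compat.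
  - rewrite <- rsum_scal. apply Cmod_csum. intros i Hi. rewrite Cmod_mult, Cmod_R, Rabs_pos_eq by apply Hk.
    rewrite Rmult_comm. apply Rmult_le_compat_r. apply Hk. apply Hpc. lia.
  - rewrite Cmod_mult, Cmod_R, Hpc0, Rabs_pos_eq by apply Hk. lra.
Qed.

Lemma coef_bound_half_plane (f f1 : C -> C) (a : nat -> C) (A : nat -> R) (alpha : R) : concave_map f f1 -> taylor (deriv_coef a) f1 -> 1 < alpha <= 2 ->
  opening_angle_at_infinity (image unit_disc f) <= PI * alpha -> is_half_plane_power_coeffs alpha A ->
  forall n, (1 <= n)%nat -> Cmod (a n) <= 1 / (2 * alpha) * A n.
Proof.
  intros HC Hf1 Ha Hop HA n Hn. destruct (half_plane_coef_rec alpha A HA) as [HA1 HA2].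
  (* The left side is the series of [extremal_coef] multiplied by (1+z)/(1-z), so both sides are the
     coefficients of (1-z)^-2 ((1+z)/(1-z))^(alpha-1), the derivative of ((1+z)/(1-z))^alpha divided
     by 2 alpha. They are matched by their common recurrence. *)
  assert (E : forall n, extremal_coef (alpha - 1) n + 2 * rsum (extremal_coef (alpha - 1)) n = INR (S n) * A (S n) / (2 * alpha)).
  { apply (rec_unique (2 * alpha)).
    - replace (extremal_coef (alpha - 1) 0) with 1 by reflexivity. simpl rsum. simpl INR. rewrite HA1. field. lra.
    - pose proof (HA2 O) as Q. simpl in Q. simpl. replace (extremal_coef (alpha - 1) 1) with (2 * (alpha - 1)) by reflexivity.
      replace (extremal_coef (alpha - 1) 0) with 1 by reflexivity. replace ((1 + 1) * A 2%nat) with (2 * alpha * A 1%nat) by lra. rewrite HA1. field. lra.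
    - intros m. pose proof (extremal_coef_rec (alpha - 1) m). pose proof (extremal_sum_identity (alpha - 1) m). simpl rsum in *.
      rewrite !plus_INR in *. simpl (INR 2) in *. simpl (INR 1) in *. nra.
    - intros m. pose proof (HA2 m) as Q1. pose proof (HA2 (S m)) as Q2. 
      replace (S m + 2)%nat with (S (S (S m))) in Q2 by lia. rewrite Q2. replace (m + 2)%nat with (S (S m)) by lia. field. lra. }
  destruct n as [|n]; [lia|]. assert (B := coef_bound f f1 a alpha HC Hf1 Ha Hop n). rewrite E in B.
  unfold deriv_coef in B. rewrite Cmod_mult, Cmod_R, Rabs_pos_eq in B by apply pos_INR.
  assert (HnP : 0 < INR (S n)) by (apply lt_0_INR; lia).
  apply Rmult_le_reg_l with (INR (S n)); auto. eapply Rle_trans. apply B. right. field. lra.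
Qed.

(** * Concave maps on the half-plane *)

(* A concave map in the coordinate p = (1+z)/(1-z), which sends 1 to oo; the last two
   clauses are what f(1) = oo and the convexity and unboundedness of K amount to. *)
Definition rhp_map (F F1 F2 : C -> C) (K : C -> Prop) : Prop :=
  analytic rhp F /\ (forall p, rhp p -> cder F p (F1 p)) /\ (forall p, rhp p -> cder F1 p (F2 p)) /\
  injective_on rhp F /\ (forall w, K w <-> ~ image rhp F w) /\ (exists x, K x) /\
  (forall x p, K x -> rhp p -> 0 <= Re (Cconj (F p - x) * F1 p)%C) /\
  (exists u, Cmod u = 1 /\ forall p, rhp p -> 0 <= Re (u * F1 p)%C).

Lemma hol_cayley_inv (n : nat) (t : C) : hol n rhp (cayley_inv t).
Proof.
  unfold cayley_inv. apply hol_div. apply rhp_plus_1. apply hol_mult. apply hol_const. apply hol_minus. apply hol_id. apply hol_const.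
  apply hol_plus. apply hol_id. apply hol_const.
Qed.

Lemma cayley_inv_inj (p q : C) : rhp p -> rhp q -> cayley_inv 1 p = cayley_inv 1 q -> p = q.
Proof.
  intros Hp Hq E. assert (H1 := rhp_plus_1 p Hp). assert (H2 := rhp_plus_1 q Hq).
  assert (E1 : (1 - cayley_inv 1 p = 2 / (p + 1))%C) by (unfold cayley_inv; field; auto).
  assert (E2 : (1 - cayley_inv 1 q = 2 / (q + 1))%C) by (unfold cayley_inv; field; auto).
  rewrite E in E1. rewrite E1 in E2.
  assert (N2 : RtoC 2 <> 0%C) by (intro F; apply RtoC_inj in F; lra).
  replace p with ((2 / (2 / (p + 1))) - 1)%C by (field; auto).
  replace q with ((2 / (2 / (q + 1))) - 1)%C by (field; auto). rewrite E2. auto.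
Qed.

(** The factor 2/(p+1)^2 is dz/dp. As 1 - z = 2/(p+1), the expression (1-z)^2 f'(z) in the
    inequalities on the disc is 2 F'(p), so they lose their weight in the coordinate p. *)
Lemma concave_rhp_map (f f1 : C -> C) : concave_map f f1 -> 
  exists F2, rhp_map (fun p => f (cayley_inv 1 p)) (fun p => f1 (cayley_inv 1 p) * (2 / ((p + 1) * (p + 1))))%C F2 (cpl f).
Proof.
  intros HC. assert (HC' := HC). destruct HC' as [Hf [Hd [Hi [Hc [Hinf [H0 H1]]]]]].
  assert (Hcay : forall p, rhp p -> unit_disc (cayley_inv 1 p)) by (intros; apply cayley_inv_disc; auto; apply Cmod_1).
  set (F := fun p => f (cayley_inv 1 p)). set (F1 := fun p => (f1 (cayley_inv 1 p) * (2 / ((p + 1) * (p + 1))))%C).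
  assert (HF : analytic rhp F). { intros n. apply hol_comp with (V := unit_disc) (h := f); auto. apply hol_cayley_inv. }
  assert (HFd : forall p, rhp p -> cder F p (F1 p)).
  { intros p Hp. eapply cder_eq. apply (cder_comp (cayley_inv 1) f). apply cder_cayley_inv; auto. apply Hd; auto. unfold F1.
    assert (N := rhp_plus_1 p Hp). field. auto. }
  assert (HF1 : analytic rhp F1) by (intros n; apply hol_der with F; auto; apply copen_rhp).
  destruct (analytic_der rhp F1 copen_rhp HF1) as [F2 [HF2 _]]. exists F2.
  split; [|split; [|split; [|split; [|split; [|split; [|split]]]]]]; auto.
  - intros p q Hp Hq E. apply cayley_inv_inj; auto.
  - intros w. split; intros Hw Hn; apply Hw.
    + destruct Hn as [p [Hp E]]. exists (cayley_inv 1 p). auto.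
    + destruct Hn as [z [Hz E]]. exists ((1 + z) / (1 - z))%C.
      assert (N1 := one_minus_neq_0 z Hz). split.
      * assert (Q := disc_to_rhp 1%C z). replace (1 + Cconj 1 * z)%C with (1 + z)%C in Q. apply Q; auto. unfold rhp, Re; simpl; lra.
        apply injective_projections; simpl; ring.
      * unfold F. replace (cayley_inv 1 ((1 + z) / (1 - z))) with z; auto. unfold cayley_inv.
        assert (N2 : RtoC 2 <> 0%C) by (intro G; apply RtoC_inj in G; lra).
        replace (1 * ((1 + z) / (1 - z) - 1))%C with (2 * z / (1 - z))%C by (field; auto).
        replace ((1 + z) / (1 - z) + 1)%C with (2 / (1 - z))%C by (field; auto). field. auto.
  - eapply complement_nonempty; eauto.
  - intros x p Hx Hp. assert (Q := starlike_ineq f f1 x _ HC Hx (Hcay p Hp)). assert (N := rhp_plus_1 p Hp).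
    assert (E : (1 - cayley_inv 1 p = 2 / (p + 1))%C) by (unfold cayley_inv; field; auto). rewrite E in Q.
    replace (Cconj (F p - x) * F1 p)%C with (RtoC (/ 2) * (Cconj (f (cayley_inv 1 p) - x) * (f1 (cayley_inv 1 p) * (2 / (p + 1) * (2 / (p + 1))))))%C.
    rewrite Re_scal. lra. unfold F, F1. rewrite RtoC_inv by lra. field. auto.
  - destruct (recession_exists f f1 HC) as [v [Hv1 Hv]]. exists (- Cconj v)%C. split. rewrite Cmod_opp, Cmod_conj. auto.
    intros p Hp. assert (Q := recession_ineq f f1 v _ HC Hv (Hcay p Hp)). assert (N := rhp_plus_1 p Hp).
    assert (E : (1 - cayley_inv 1 p = 2 / (p + 1))%C) by (unfold cayley_inv; field; auto). rewrite E in Q.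
    replace (- Cconj v * F1 p)%C with (RtoC (/ 2) * (- Cconj v * (f1 (cayley_inv 1 p) * (2 / (p + 1) * (2 / (p + 1))))))%C.
    rewrite Re_scal. lra. unfold F1. rewrite RtoC_inv by lra. field. auto.
Qed.

Lemma rhp_der_neq_0 (F F1 F2 : C -> C) (K : C -> Prop) : rhp_map F F1 F2 K -> forall p, rhp p -> F1 p <> 0%C.
Proof.
  intros [HF [Hd [_ [Hi _]]]] p Hp. apply (univalent_der_neq_0 rhp F F1 p); auto. apply copen_rhp.
Qed.

(** Harnack's inequality for u F', whose real part is nonnegative. The bound |F''/F'| <= 1/Re p
    drives the growth estimates below and supplies the decay that [julia] asks for. *)
Lemma rhp_second_der_bound (F F1 F2 : C -> C) (K : C -> Prop) (p : C) : rhp_map F F1 F2 K -> rhp p ->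
  Cmod (F2 p) * Re p <= Cmod (F1 p).
Proof.
  intros [HF [Hd [Hd2 [_ [_ [_ [_ [u [Hu HR]]]]]]]]] Hp.
  assert (HF1 : analytic rhp F1) by (intros n; apply hol_der with F; auto; apply copen_rhp).
  assert (Q := harnack_rhp (fun p => u * F1 p)%C p (u * F2 p)%C). cbv beta in Q.
  rewrite Cmod_mult, Hu, Rmult_1_l in Q. eapply Rle_trans. apply Q; auto.
  - apply hol_mult. apply hol_const. auto.
  - eapply cder_eq. apply cder_mult. apply cder_const. apply Hd2; auto. cbv beta. ring.
  - eapply Rle_trans. apply Re_le. rewrite Cmod_mult, Hu. lra.
Qed.

(** A Gronwall argument: |F''/F'| <= 1/sg on the segment, so |F'|^2 exp(-c t) with c = 2 |v|/sg is
    nonincreasing in t. *)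
Lemma rhp_der_growth (F F1 F2 : C -> C) (K : C -> Prop) (p v : C) (sg : R) : rhp_map F F1 F2 K -> 0 < sg ->
  (forall t, 0 <= t <= 1 -> sg <= Re (p + RtoC t * v)%C) -> Cmod (F1 (p + v)%C) <= exp (Cmod v / sg) * Cmod (F1 p).
Proof.
  intros HM Hsg Hs. assert (HM' := HM). destruct HM' as [HF [Hd [Hd2 _]]].
  set (c := 2 * (Cmod v / sg)).
  set (ps := fun t : R => Cmod (F1 (p + RtoC t * v)%C) ^ 2 * exp (- c * t)).
  set (dps := fun t : R => (2 * Re (Cconj (F1 (p + RtoC t * v)) * (F2 (p + RtoC t * v) * v))%C - c * Cmod (F1 (p + RtoC t * v)%C) ^ 2) * exp (- c * t)).
  assert (D : forall t, 0 <= t <= 1 -> derivable_pt_lim ps t (dps t)).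
  { intros t Ht. apply is_derive_Reals. unfold ps, dps. evar_last. apply @is_derive_mult.
    apply (sq_path_derive F1 F2). apply Hd2. unfold rhp. specialize (Hs t Ht). lra.
    apply is_derive_comp with (f := exp). apply is_derive_exp. apply is_derive_scal. apply is_derive_id. intros; apply Rmult_comm.
    unfold plus, mult, scal; simpl. unfold mult; simpl. unfold one; simpl.
    set (g := F1 (p + RtoC t * v)%C). set (g2 := (F2 (p + RtoC t * v) * v)%C).
    replace (2 * (fst g * fst g2 + snd g * snd g2)) with (2 * Re (Cconj g * g2)%C) by (unfold Re; simpl; ring).
    ring. }
  destruct (MVT_cor2 ps dps 0 1 ltac:(lra) D) as [t [E Ht]].
  assert (Hle : dps t <= 0).
  { unfold dps. assert (P := exp_pos (- c * t)). specialize (Hs t ltac:(lra)).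
    assert (Hr : rhp (p + RtoC t * v)%C) by (unfold rhp; lra).
    assert (B := rhp_second_der_bound F F1 F2 K _ HM Hr).
    set (g := F1 (p + RtoC t * v)%C) in *. set (g2 := F2 (p + RtoC t * v)%C) in *.
    assert (B2 : Cmod g2 <= Cmod g / sg).
    { apply Rmult_le_reg_r with sg; auto. unfold Rdiv. rewrite Rmult_assoc, Rinv_l by lra. pose proof (Cmod_ge_0 g2). nra. }
    assert (B3 : Re (Cconj g * (g2 * v))%C <= Cmod g * (Cmod g / sg * Cmod v)).
    { eapply Rle_trans. apply Re_le. rewrite !Cmod_mult, Cmod_conj. apply Rmult_le_compat_l. apply Cmod_ge_0. apply Rmult_le_compat_r; auto. apply Cmod_ge_0. }
    assert (2 * Re (Cconj g * (g2 * v))%C - c * Cmod g ^ 2 <= 0).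
    { unfold c. replace (2 * (Cmod v / sg) * Cmod g ^ 2) with (2 * (Cmod g * (Cmod g / sg * Cmod v))) by (field; lra). lra. }
    nra. }
  assert (Q : ps 1 <= ps 0) by nra. unfold ps in Q.
  replace (p + RtoC 1 * v)%C with (p + v)%C in Q by ring. replace (p + RtoC 0 * v)%C with p in Q by ring.
  rewrite Rmult_0_r, exp_0, Rmult_1_r, Rmult_1_r in Q.
  assert (Ec : exp (- c) * (exp (Cmod v / sg) * exp (Cmod v / sg)) = 1). { rewrite <- !exp_plus. unfold c. replace (- (2 * (Cmod v / sg)) + (Cmod v / sg + Cmod v / sg)) with 0 by ring. apply exp_0. }
  assert (P := exp_pos (Cmod v / sg)). assert (Pc := exp_pos (- c)).
  apply Rnot_lt_le. intro Hlt. pose proof (Cmod_ge_0 (F1 p)).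
  set (y := Cmod (F1 (p + v)%C)) in *. set (x := Cmod (F1 p)) in *. set (E1 := exp (Cmod v / sg)) in *.
  assert (0 <= E1 * x) by (apply Rmult_le_pos; lra).
  assert ((E1 * x) ^ 2 < y ^ 2) by nra.
  assert ((E1 * x) ^ 2 * exp (- c) = x ^ 2). { replace ((E1 * x) ^ 2 * exp (- c)) with (x ^ 2 * (exp (- c) * (E1 * E1))) by ring. rewrite Ec. ring. }
  nra.
Qed.

(* The disc about F p of radius 3 Re p |F' p| cannot lie in the image of F, by the
   Schwarz lemma for the inverse function. *)
Lemma rhp_koebe (F F1 F2 : C -> C) (K : C -> Prop) (p : C) : rhp_map F F1 F2 K -> rhp p ->
  exists x, K x /\ Cmod (F p - x)%C <= 3 * Re p * Cmod (F1 p).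
Proof.
  intros HM Hp. assert (Hn := rhp_der_neq_0 F F1 F2 K HM p Hp). destruct HM as [HF [Hd [_ [Hi [HK _]]]]].
  (* Schwarz's lemma for the inverse gives R <= 2 Re p |F'(p)|; any constant above 2 contradicts
     it. *)
  apply NNPP. intro Hno. unfold rhp in Hp. set (R := 3 * Re p * Cmod (F1 p)) in *.
  assert (Pf : 0 < Cmod (F1 p)) by (apply Cmod_gt_0; auto).
  assert (HR : 0 < R) by (unfold R; apply Rmult_lt_0_compat; lra).
  destruct (inverse_exists rhp F F1 copen_rhp HF Hi Hd) as [g [G1 [G2 [G3 G4]]]].
  assert (Hin : forall z, unit_disc z -> image rhp F (F p + RtoC R * z)%C).
  { intros z Hz. apply NNPP. intro Hz2. apply Hno. exists (F p + RtoC R * z)%C. split. apply HK; auto.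
    replace (F p - (F p + RtoC R * z))%C with (- (RtoC R * z))%C by ring. rewrite Cmod_opp, Cmod_mult, Cmod_R, Rabs_pos_eq by lra.
    unfold unit_disc in Hz. nra. }
  assert (E0 : (F p + RtoC R * 0)%C = F p) by ring.
  assert (Q := schwarz_to_rhp_der (fun z => g (F p + RtoC R * z)%C) (/ F1 p * RtoC R)%C). cbv beta in Q.
  rewrite E0, G2, Cmod_mult, Cmod_inv, Cmod_R, (Rabs_pos_eq R) in Q by (auto; lra).
  assert (B : / Cmod (F1 p) * R <= 2 * Re p).
  { apply Q.
    - apply hol_comp with (V := image rhp F) (h := g); auto. apply hol_plus. apply hol_const. apply hol_mult. apply hol_const. apply hol_id.
    - intros z Hz. left. apply (G1 _ (Hin z Hz)).
    - apply (cder_comp (fun z => F p + RtoC R * z)%C g). eapply cder_eq. apply cder_plus. apply cder_const. apply cder_mult. apply cder_const. apply cder_id.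
      cbv beta; ring. rewrite E0. eapply cder_eq. apply G4. exists p; auto. rewrite G2; auto. }
  unfold R in B. replace (/ Cmod (F1 p) * (3 * Re p * Cmod (F1 p))) with (3 * Re p) in B by (field; lra). lra.
Qed.

Lemma rhp_increment (F F1 F2 : C -> C) (K : C -> Prop) (p v : C) (sg : R) : rhp_map F F1 F2 K -> 0 < sg ->
  (forall t, 0 <= t <= 1 -> sg <= Re (p + RtoC t * v)%C) ->
  Cmod (F (p + v) - F p)%C <= exp (Cmod v / sg) * Cmod (F1 p) * Cmod v.
Proof.
  intros HM Hsg Hs. assert (HM' := HM). destruct HM' as [HF [Hd _]].
  assert (Q := mean_value F F1 p (p + v)%C (exp (Cmod v / sg) * Cmod (F1 p))).
  replace (p + v - p)%C with v in Q by ring. apply Q.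
  - intros t Ht. apply Hd. unfold rhp. specialize (Hs t Ht). lra.
  - intros t Ht. eapply Rle_trans. apply (rhp_der_growth F F1 F2 K p (RtoC t * v)%C sg HM Hsg).
    + intros r Hr. replace (p + RtoC r * (RtoC t * v))%C with (p + RtoC (r * t) * v)%C by (rewrite RtoC_mult; ring).
      apply Hs. nra.
    + apply Rmult_le_compat_r. apply Cmod_ge_0. apply exp_le. apply Rmult_le_compat_r. left; apply Rinv_0_lt_compat; auto.
      rewrite Cmod_mult, Cmod_R, Rabs_pos_eq by lra. pose proof (Cmod_ge_0 v). nra.
Qed.

(** For Re p >= 2 Re s the segment from p to p - s stays away from the imaginary axis and the growth
    estimate is enough. Otherwise p - s may be close to the axis, and F(p - s) is reached through a
    point x of K: [rhp_koebe] places x near F(p') for p' = p - s + Re s, and |F - x| does not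
    increase when going left from p' to p - s. *)
Lemma backward_difference_bound (F F1 F2 : C -> C) (K : C -> Prop) (s : C) : rhp_map F F1 F2 K -> 0 < Re s ->
  exists B, forall p, Re s < Re p -> Cmod (F p - F (p - s))%C <= B * Cmod (F1 p).
Proof.
  intros HM Hs. set (sg := Re s) in *. assert (HM' := HM). destruct HM' as [HF [Hd [_ [_ [_ [_ [HS _]]]]]]].
  set (E := exp ((Cmod s + sg) / sg)). pose proof (Cmod_ge_0 s) as Hs0.
  assert (HE : 0 < E) by apply exp_pos.
  assert (HEle : forall a, 0 <= a <= Cmod s + sg -> exp (a / sg) <= E).
  { intros a Ha. apply exp_le. apply Rmult_le_compat_r; [|lra]. left; apply Rinv_0_lt_compat; auto. }
  (* 13 = 1 + 6 + 6: the move from p to p' costs |s| + sg, and each of the distances from F(p') and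
     F(p - s) to x costs 3 Re p' <= 6 sg, all times E |F'(p)|. *)
  exists ((Cmod s + 13 * sg) * E). intros p Hp. pose proof (Cmod_ge_0 (F1 p)) as Hf0.
  destruct (Rle_lt_dec (2 * sg) (Re p)) as [Hb|Hb].
  - assert (Q := rhp_increment F F1 F2 K p (- s)%C sg HM Hs).
    rewrite Cmod_sub_sym. rewrite Cmod_opp in Q. replace (p + - s)%C with (p - s)%C in Q by ring.
    eapply Rle_trans. apply Q.
    + intros t Ht. rewrite Re_plus, Re_scal, Re_opp. fold sg. nra.
    + specialize (HEle (Cmod s) ltac:(lra)).
      apply Rle_trans with (E * Cmod (F1 p) * (Cmod s + 13 * sg)). apply Rmult_le_compat; try lra.
      apply Rmult_le_pos; auto. left; apply exp_pos. apply Rmult_le_compat_r; auto. lra.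
  - set (v := (RtoC sg - s)%C). set (p' := (p + v)%C).
    assert (Hv : Cmod v <= Cmod s + sg). { unfold v, Cminus. eapply Rle_trans. apply Cmod_triangle. rewrite Cmod_opp, Cmod_R, Rabs_pos_eq; lra. }
    assert (Hrev : forall t, Re (p + RtoC t * v)%C = Re p).
    { intros t. rewrite Re_plus, Re_scal. unfold v. rewrite Re_minus, Re_RtoC. fold sg. ring. }
    assert (Hp' : Re p' = Re p). { unfold p'. rewrite <- (Hrev 1). f_equal. ring. }
    assert (Hseg : forall t, 0 <= t <= 1 -> sg <= Re (p + RtoC t * v)%C). { intros t _. rewrite Hrev. lra. }
    assert (I1 := rhp_increment F F1 F2 K p v sg HM Hs Hseg). fold p' in I1.
    assert (I2 := rhp_der_growth F F1 F2 K p v sg HM Hs Hseg). fold p' in I2.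
    pose proof (Cmod_ge_0 v) as Hv0. specialize (HEle (Cmod v) ltac:(lra)).
    destruct (rhp_koebe F F1 F2 K p' HM) as [x [Kx Hx]]. unfold rhp; lra.
    assert (Hps : rhp (p - s)%C). { unfold rhp. rewrite Re_minus. fold sg. lra. }
    assert (Hmono := Cmod_nondecreasing F F1 x (p - s)%C sg Hd (fun q Hq => HS x q Kx Hq) Hps ltac:(lra)).
    replace (p - s + RtoC sg)%C with p' in Hmono by (unfold p', v; ring).
    assert (J1 : Cmod (F1 p') <= E * Cmod (F1 p)). { eapply Rle_trans. apply I2. apply Rmult_le_compat_r; auto. }
    assert (J2 : Cmod (F p' - F p)%C <= E * Cmod (F1 p) * (Cmod s + sg)).
    { eapply Rle_trans. apply I1. apply Rmult_le_compat; auto. apply Rmult_le_pos; auto. left; apply exp_pos. apply Rmult_le_compat_r; auto. }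
    assert (J3 : Cmod (F p' - x)%C <= 6 * sg * (E * Cmod (F1 p))).
    { eapply Rle_trans. apply Hx. apply Rmult_le_compat; try lra. apply Cmod_ge_0. }
    replace (F p - F (p - s))%C with ((F p - F p') + ((F p' - x) - (F (p - s) - x)))%C by ring.
    eapply Rle_trans. apply Cmod_triangle.
    pose proof (Cmod_triangle (F p' - x)%C (- (F (p - s) - x))%C). rewrite Cmod_opp in H.
    change (F p' - x + - (F (p - s) - x))%C with (F p' - x - (F (p - s) - x))%C in H.
    rewrite (Cmod_sub_sym (F p)). nra.
Qed.

(* Maximum principle for exp(-N A)/(p+1), A = (F(p) - F(p-s))/F'(p): at the boundary
   Re p = Re s the values F(p-s) tend to points of K. *)
Lemma backward_difference_nonneg (F F1 F2 : C -> C) (K : C -> Prop) (s p : C) : rhp_map F F1 F2 K -> 0 < Re s -> Re s < Re p ->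
  0 <= Re ((F p - F (p - s)) / F1 p)%C.
Proof.
  intros HM Hs. set (sg := Re s) in *.
  assert (Hnz := rhp_der_neq_0 F F1 F2 K HM).
  destruct (backward_difference_bound F F1 F2 K s HM Hs) as [B HB].
  assert (HM' := HM). destruct HM' as [HF [Hd [Hd2 [Hi [HK [[x0 Hx0] [HS _]]]]]]].
  destruct (inverse_exists rhp F F1 copen_rhp HF Hi Hd) as [g [G1 [G2 [G3 G4]]]].
  set (A := fun p => ((F p - F (p - s)) / F1 p)%C).
  assert (HAb : forall p, sg < Re p -> - B <= Re (A p)).
  { intros q Hq. assert (Nq := Hnz q ltac:(unfold rhp; lra)). assert (0 < Cmod (F1 q)) by (apply Cmod_gt_0; auto).
    pose proof (Re_le (- A q)%C) as R. rewrite Re_opp, Cmod_opp in R. unfold A in R at 2. rewrite Cmod_div in R by auto.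
    assert (Cmod (F q - F (q - s))%C / Cmod (F1 q) <= B); [|lra].
    apply Rmult_le_reg_r with (Cmod (F1 q)); auto. unfold Rdiv. rewrite Rmult_assoc, Rinv_l, Rmult_1_r by lra. apply HB; auto. }
  assert (HW : copen (fun p => sg < Re p)).
  { intros z Hz. exists (Re z - sg). split. lra. intros w Hw. pose proof (Re_le_Cmod (w - z)%C) as Q. unfold Re in *. simpl in Q.
    unfold Rabs in Q; destruct Rcase_abs in Q; lra. }
  assert (key : forall (N : nat) eta q, 0 < eta -> sg < Re q -> Cmod (cexp (- (RtoC (INR N) * A q)) / (q + 1))%C <= exp (INR N * eta)).
  { intros N eta q Heta Hq.
    assert (Hcm : forall v, sg < Re v -> Cmod (cexp (- (RtoC (INR N) * A v)) / (v + 1))%C * Cmod (v + 1)%C = exp (- (INR N * Re (A v)))).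
    { intros v Hv. assert (Hv1 : (v + 1)%C <> 0%C) by (apply rhp_plus_1; unfold rhp; lra).
      rewrite <- Cmod_mult. replace (cexp (- (RtoC (INR N) * A v)) / (v + 1) * (v + 1))%C with (cexp (- (RtoC (INR N) * A v))) by (field; auto).
      rewrite Cmod_cexp. f_equal. rewrite Re_opp, Re_scal. auto. }
    assert (Hp1 : forall v, sg < Re v -> 1 < Cmod (v + 1)%C).
    { intros v Hv. pose proof (Re_le (v + 1)%C) as R. rewrite Re_plus in R. unfold Re in *; simpl in *. lra. }
    assert (PN := pos_INR N).
    assert (Hset : forall v, sg < Re v -> exp (INR N * eta) <= Cmod (cexp (- (RtoC (INR N) * A v)) / (v + 1))%C -> Re (A v) < - eta \/ INR N = 0).
    { intros v Hv Hge. destruct PN as [PN|PN]; auto. left. specialize (Hcm v Hv). specialize (Hp1 v Hv).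
      assert (exp (INR N * eta) < exp (- (INR N * Re (A v)))). { rewrite <- Hcm. pose proof (exp_pos (INR N * eta)). nra. }
      apply exp_lt_inv in H. nra. }
    apply max_modulus with (U := fun p => sg < Re p) (g := fun q => (cexp (- (RtoC (INR N) * A q)) / (q + 1))%C); auto.
    - apply hol_div. intros v Hv. apply rhp_plus_1. unfold rhp; lra.
      apply hol_comp with (V := fun _ => True) (h := cexp); auto. 2: apply hol_cexp.
      apply hol_opp. apply hol_mult. apply hol_const. apply hol_div. intros v Hv; apply Hnz; unfold rhp; lra.
      apply hol_minus. eapply hol_sub; [|apply HF]. intros; unfold rhp; lra.
      apply hol_comp with (V := rhp) (h := F). intros v Hv. unfold rhp. rewrite Re_minus. fold sg. lra.
      apply hol_minus. apply hol_id. apply hol_const. apply HF.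
      apply hol_sub with rhp. intros; unfold rhp; lra. apply hol_der with F; auto. apply copen_rhp.
      apply hol_plus. apply hol_id. apply hol_const.
    - left. apply exp_pos.
    (* The denominator p + 1 bounds the set: exp(-N A) alone is only known to have modulus at most
       exp(N B), and the level is at least 1, so |p + 1| <= exp(N B). *)
    - exists (exp (INR N * B) + 1). intros v [Hv Hge].
      specialize (Hcm v Hv). specialize (Hp1 v Hv).
      assert (exp (- (INR N * Re (A v))) <= exp (INR N * B)). { apply exp_le. specialize (HAb v Hv). nra. }
      assert (1 <= exp (INR N * eta)). { rewrite <- exp_0. apply exp_le. nra. }
      assert (Cmod (v + 1)%C <= exp (INR N * B)) by nra.
      replace v with (v + 1 - 1)%C by ring. unfold Cminus. eapply Rle_trans. apply Cmod_triangle. rewrite Cmod_opp, Cmod_1. lra.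
    - intros sq l Hsq Hl.
      assert (LR := cvg_Re _ _ Hl).
      assert (Hle : sg <= Re l). { eapply is_lim_seq_ge_const; [|apply LR]. intros n. left. apply (Hsq n). }
      destruct Hle as [|E]; auto. exfalso.
      assert (Lq : cvg (fun n => sq n - s)%C (l - s)%C) by (apply cvg_minus; auto; apply cvg_const).
      assert (Hql : Re (l - s)%C = 0). { rewrite Re_minus. fold sg. lra. }
      assert (Hqr : forall n, rhp (sq n - s)%C). { intros n. destruct (Hsq n) as [R _]. unfold rhp. rewrite Re_minus. fold sg. lra. }
      assert (Lq2 : cvg (fun n => F (sq n - s + RtoC sg))%C (F (l - s + RtoC sg))%C).
      { apply cvg_cont. eapply cder_ccont. apply Hd. unfold rhp. rewrite Re_plus, Hql, Re_RtoC. lra. apply cvg_plus; auto. apply cvg_const. }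
      destruct (cvg_bounded _ _ Lq2) as [M HM2].
      (* The values F(p - s) stay bounded near Re p = Re s, because |F - x0| is controlled by its
         value at distance sg to the right. A limit w lies in K: otherwise the inverse would send it
         to l - s, which is on the imaginary axis. For N > 0 the inequality for w at l then
         contradicts Re A < -eta. *)
      destruct (bw (fun n => F (sq n - s)%C) (M + 2 * Cmod x0)) as [phi [w [Ep Hw]]].
      { intros n. assert (Q := Cmod_nondecreasing F F1 x0 (sq n - s)%C sg Hd (fun q Hq => HS x0 q Hx0 Hq) (Hqr n) ltac:(lra)).
        specialize (HM2 n). cbv beta in HM2. pose proof (Cmod_le_sum (F (sq n - s)%C) x0).
        pose proof (Cmod_triangle (F (sq n - s + RtoC sg)%C) (- x0)%C). rewrite Cmod_opp in H0.
        change (F (sq n - s + RtoC sg) + - x0)%C with (F (sq n - s + RtoC sg) - x0)%C in H0. lra. }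
      assert (Hep := extraction_ge _ Ep).
      assert (HKw : K w).
      { apply HK. intros Hwi. destruct (G1 w Hwi) as [R _].
        assert (g w = (l - s)%C).
        { apply cvg_unique with (fun n => g (F (sq (phi n) - s)%C)). apply cvg_cont; auto. eapply cder_ccont. apply G4; auto.
          apply cvg_ext with (fun n => sq (phi n) - s)%C. intros n. symmetry. apply G2. auto. apply (cvg_sub (fun n => sq n - s)%C); auto. }
        rewrite H in R. unfold rhp in R. lra. }
      assert (Hlr : rhp l) by (unfold rhp; lra).
      assert (LA : cvg (fun n => A (sq (phi n))) ((F l - w) / F1 l)%C).
      { unfold A. unfold Cdiv. apply cvg_mult. apply cvg_minus; auto. apply (cvg_sub (fun n => F (sq n))); auto. apply cvg_cont; auto. eapply cder_ccont; apply Hd; auto.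
        apply cvg_inv; auto. apply (cvg_sub (fun n => F1 (sq n))); auto. apply cvg_cont; auto. eapply cder_ccont; apply Hd2; auto. }
      assert (Hge0 : 0 <= Re ((F l - w) / F1 l)%C).
      { assert (Q := HS w l HKw Hlr). assert (P : 0 < Cmod (F1 l) ^ 2) by (apply pow_lt; apply Cmod_gt_0; auto).
        apply Rmult_le_reg_r with (Cmod (F1 l) ^ 2); auto. rewrite Rmult_0_l. eapply Rle_trans. apply Q. right.
        set (a := (F l - w)%C). rewrite Cmod_sqr in *. unfold Re, Cdiv, Cinv in *. simpl in *. field. lra. }
      destruct PN as [PN|PN].
      + assert (Re ((F l - w) / F1 l)%C <= - eta); [|lra].
        eapply is_lim_seq_le_const; [|apply (cvg_Re _ _ LA)]. intros n. destruct (Hsq (phi n)) as [R1 R2].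
        destruct (Hset _ R1 R2). left; auto. lra.
      + destruct (Hsq O) as [R1 R2]. specialize (Hcm _ R1). specialize (Hp1 _ R1). rewrite <- PN in *.
        rewrite !Rmult_0_l in *. rewrite Ropp_0, exp_0 in *. nra. }
  intros Hp. fold (A p). apply Rnot_lt_le. intro Hneg.
  set (eta := - Re (A p) / 2). assert (Heta : 0 < eta) by (unfold eta; lra).
  assert (Hp1 : (p + 1)%C <> 0%C) by (apply rhp_plus_1; unfold rhp; lra).
  assert (P1 : 0 < Cmod (p + 1)%C) by (apply Cmod_gt_0; auto).
  destruct (pow_unbounded (exp eta) (Cmod (p + 1)%C)) as [N HN]. { rewrite <- exp_0. apply exp_increasing; auto. }
  assert (Q := key N eta p Heta Hp).
  rewrite Cmod_div, Cmod_cexp, Re_opp, Re_scal in Q by auto.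
  assert (Epow : exp eta ^ N = exp (INR N * eta)).
  { clear. induction N. simpl. rewrite Rmult_0_l, exp_0. auto. rewrite S_INR. simpl pow. rewrite IHN, <- exp_plus. f_equal. ring. }
  rewrite Epow in HN.
  replace (- (INR N * Re (A p))) with (INR N * eta + INR N * eta) in Q by (unfold eta; field). rewrite exp_plus in Q.
  assert (PE := exp_pos (INR N * eta)).
  apply Rmult_le_compat_r with (r := Cmod (p + 1)%C) in Q; [|lra]. unfold Rdiv in Q. rewrite Rmult_assoc, Rinv_l in Q by lra. nra.
Qed.

(* Letting Re s -> 0, the function t |-> Re((F(p) - F(p - it))/F'(p)) is minimal at t = 0. *)
Lemma rhp_S_nonneg (F F1 F2 : C -> C) (K : C -> Prop) (p : C) : rhp_map F F1 F2 K -> rhp p -> 0 <= Re (F2 p / F1 p)%C.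
Proof.
  intros HM Hp. assert (Hnz := rhp_der_neq_0 F F1 F2 K HM p Hp). assert (HM' := HM). destruct HM' as [HF [Hd [Hd2 _]]].
  assert (Him : forall t, rhp (p + RtoC t * - Ci)%C). { intros t. unfold rhp in *. rewrite Re_plus, Re_scal. unfold Re in *; simpl. lra. }
  assert (Q : forall t, 0 <= Re ((F p - F (p + RtoC t * - Ci)) / F1 p)%C).
  { intros t. eapply is_lim_seq_ge_const with (u := fun n => Re ((F p - F (p - (RtoC (Re p / (INR n + 2)) + RtoC t * Ci))) / F1 p)%C).
    - intros n. pose proof (pos_INR n). unfold rhp in Hp. assert (Q2 : 0 < Re p / (INR n + 2)) by (apply Rdiv_lt_0_compat; lra).
      assert (Q3 : Re p / (INR n + 2) < Re p). { apply Rmult_lt_reg_r with (INR n + 2). lra. unfold Rdiv. rewrite Rmult_assoc, Rinv_l; nra. }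
      assert (E : Re (RtoC (Re p / (INR n + 2)) + RtoC t * Ci)%C = Re p / (INR n + 2)). { rewrite Re_plus, Re_scal, Re_RtoC. unfold Re; simpl; ring. }
      apply (backward_difference_nonneg F F1 F2 K); auto; rewrite E; auto.
    - apply (cvg_Re (fun n => (F p - F (p - (RtoC (Re p / (INR n + 2)) + RtoC t * Ci))) / F1 p)%C).
      apply cvg_mult. 2: apply cvg_const. apply cvg_minus. apply cvg_const. apply cvg_cont. eapply cder_ccont. apply Hd. auto.
      replace (p + RtoC t * - Ci)%C with (p - (0 + RtoC t * Ci))%C by ring. apply cvg_minus. apply cvg_const.
      apply cvg_plus. 2: apply cvg_const. intros eps He. destruct (archimed_cor1 (eps / (Re p + 1))) as [N [HN HN0]]. unfold rhp in Hp; apply Rdiv_lt_0_compat; lra.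
      exists N. intros n Hn. replace (RtoC (Re p / (INR n + 2)) - 0)%C with (RtoC (Re p / (INR n + 2))) by ring. unfold rhp in Hp. pose proof (pos_INR n).
      assert (0 < / (INR n + 2)) by (apply Rinv_0_lt_compat; lra).
      assert (/ (INR n + 2) <= / INR N). { apply Rinv_le_contravar. apply lt_0_INR; auto. apply le_INR in Hn. lra. }
      rewrite Cmod_R, Rabs_pos_eq. 2: { apply Rmult_le_pos; lra. }
      apply Rle_lt_trans with ((Re p + 1) * / INR N). apply Rmult_le_compat; lra.
      apply Rlt_le_trans with ((Re p + 1) * (eps / (Re p + 1))). apply Rmult_lt_compat_l; lra. right; field; lra. }
  set (G := fun q => (F q * / F1 p)%C). set (G1 := fun q => (F1 q * / F1 p)%C).
  assert (L := local_max_second_derivative (fun t => Re (G (p + RtoC t * - Ci))%C) (fun t => Re (G1 (p + RtoC t * - Ci) * - Ci)%C) 1).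
  specialize (L (fst (F2 p * / F1 p * - Ci * - Ci)%C)).
  assert (E0 : (p + RtoC 0 * - Ci)%C = p) by ring.
  (* By [Q] the image of the vertical line through p stays on one side of its tangent at F(p). The
     second derivative in the direction -i carries the factor (-i)^2 = -1, whence the sign of
     Re(F''/F'). *)
  assert (Fin : fst (F2 p * / F1 p * - Ci * - Ci)%C <= 0).
  { apply L. lra.
    - intros t Ht. apply (cder_path G). eapply cder_eq. apply cder_mult. apply Hd. auto. apply cder_const. unfold G1. cbv beta. ring.
    - apply (cder_path (fun q => G1 q * - Ci)%C p (- Ci)%C (F2 p * / F1 p * - Ci)%C 0). rewrite E0.
      eapply cder_eq. unfold G1. apply cder_mult. apply cder_mult. apply Hd2; auto. apply cder_const. apply cder_const. cbv beta. ring.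
    - intros t Ht. rewrite E0. specialize (Q t). unfold G, Cdiv in *.
      replace ((F p - F (p + RtoC t * - Ci)) * / F1 p)%C with (F p * / F1 p - F (p + RtoC t * - Ci) * / F1 p)%C in Q by ring. rewrite Re_minus in Q. lra. }
  replace (F2 p * / F1 p * - Ci * - Ci)%C with (- (F2 p / F1 p))%C in Fin.
  change (Re (- (F2 p / F1 p))%C <= 0) in Fin. rewrite Re_opp in Fin. unfold Re in *. lra.
  unfold Cdiv. set (a := (F2 p * / F1 p)%C). apply injective_projections; simpl; ring.
Qed.

(* Julia's inequality at oo, for a function S with |S(q)| <= 1/q on the positive axis. *)
Lemma julia (S : C -> C) (p : C) : hol 2 rhp S -> (forall p, rhp p -> 0 <= Re (S p)) ->
  (forall q, 0 < q -> Cmod (S (RtoC q)) <= / q) -> rhp p -> Re p * Cmod (S p) ^ 2 <= Re (S p).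
Proof.
  intros HS Hre Hb Hp.
  set (q := fun n : nat => INR n + 1).
  assert (Hq : forall n, 0 < q n). { intros n. unfold q. pose proof (pos_INR n). lra. }
  set (X := fun n => (S p + Cconj (S (RtoC (q n))))%C).
  (* Schwarz-Pick for the points p and q, squared and simplified by [Cmod_plus_conj_sqr], reads Re p
     |X|^2 <= Re S(p) (q Re S(q)) |p/q + 1|^2, and q Re S(q) <= 1. As q grows, X tends to S(p) and
     p/q + 1 to 1. *)
  assert (T : forall n, Re p * Cmod (X n) ^ 2 <= Re (S p) * (Cmod (p * RtoC (/ q n) + 1)%C ^ 2)).
  { intros n. specialize (Hq n). specialize (Hb (q n) Hq).
    assert (Hr : rhp (RtoC (q n))) by (unfold rhp; rewrite Re_RtoC; auto).
    assert (SP := schwarz_pick_rhp S p (RtoC (q n)) HS Hre Hp Hr). fold (X n) in SP.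
    assert (I1 := Cmod_plus_conj_sqr (S p) (S (RtoC (q n)))). fold (X n) in I1.
    assert (I2 := Cmod_plus_conj_sqr p (RtoC (q n))). rewrite Re_RtoC in I2.
    assert (SQ : (Cmod (S p - S (RtoC (q n)))%C * Cmod (p + Cconj (RtoC (q n)))%C) ^ 2 <= (Cmod (p - RtoC (q n))%C * Cmod (X n)) ^ 2).
    { apply pow_incr. split; auto. apply Rmult_le_pos; apply Cmod_ge_0. }
    rewrite !Rpow_mult_distr in SQ.
    assert (Ec : (p + Cconj (RtoC (q n)))%C = (RtoC (q n) * (p * RtoC (/ q n) + 1))%C).
    { replace (Cconj (RtoC (q n))) with (RtoC (q n)) by (apply injective_projections; simpl; ring). rewrite RtoC_inv by lra. field. intro E; apply RtoC_inj in E; lra. }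
    assert (E2 : Cmod (p + Cconj (RtoC (q n)))%C ^ 2 = q n ^ 2 * Cmod (p * RtoC (/ q n) + 1)%C ^ 2).
    { rewrite Ec, Cmod_mult, Cmod_R, Rabs_pos_eq by lra. ring. }
    assert (Hbq : Re (S (RtoC (q n))) * q n <= 1).
    { apply Rle_trans with (/ q n * q n). apply Rmult_le_compat_r. lra. pose proof (Re_le (S (RtoC (q n)))). lra. rewrite Rinv_l; lra. }
    set (Y := Cmod (p * RtoC (/ q n) + 1)%C ^ 2) in *. assert (HY : 0 <= Y) by apply pow2_ge_0.
    set (a := Re (S p)) in *. set (b := Re (S (RtoC (q n)))) in *. set (Z := Cmod (X n) ^ 2) in *.
    assert (Ha : 0 <= a) by (apply Hre; auto). assert (Hb0 : 0 <= b) by (apply Hre; auto).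
    assert (M : Re p * q n * Z <= a * b * (q n ^ 2 * Y)). {
      assert (HU : Cmod (S p - S (RtoC (q n)))%C ^ 2 = Z - 4 * a * b) by lra.
      assert (HD : Cmod (p - RtoC (q n))%C ^ 2 = q n ^ 2 * Y - 4 * Re p * q n) by lra.
      rewrite HU, HD, E2 in SQ. lra. }
    apply Rmult_le_reg_l with (q n); auto.
    apply Rle_trans with (a * b * (q n ^ 2 * Y)). lra.
    replace (a * b * (q n ^ 2 * Y)) with (b * q n * (q n * (a * Y))) by ring.
    rewrite <- (Rmult_1_l (q n * (a * Y))) at 2. apply Rmult_le_compat_r; auto. apply Rmult_le_pos. lra. apply Rmult_le_pos; auto. }
  assert (Lq : is_lim_seq (fun n => / q n) 0).
  { apply is_lim_seq_spec. intros eps. destruct (archimed_cor1 eps (cond_pos eps)) as [N [HN HN0]]. exists N. intros n Hn.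
    specialize (Hq n). rewrite Rminus_0_r, Rabs_pos_eq. 2: left; apply Rinv_0_lt_compat; auto.
    eapply Rle_lt_trans; [|apply HN]. apply Rinv_le_contravar. apply lt_0_INR; auto. unfold q. apply le_INR in Hn. lra. }
  assert (Lsmall : forall u : nat -> C, (forall n, Cmod (u n) <= / q n) -> cvg u 0%C).
  { intros u Hu eps He. apply is_lim_seq_spec in Lq. destruct (Lq (mkposreal eps He)) as [N HN]. exists N. intros n Hn. specialize (HN n Hn). simpl in HN.
    rewrite Rminus_0_r, Rabs_pos_eq in HN. 2: left; apply Rinv_0_lt_compat; auto. replace (u n - 0)%C with (u n) by ring. specialize (Hu n). lra. }
  assert (LX : cvg X (S p + 0)%C).
  { apply cvg_plus. apply cvg_const. apply Lsmall. intros n. rewrite Cmod_conj. apply Hb; auto. }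
  assert (LY : cvg (fun n => p * RtoC (/ q n) + 1)%C (p * 0 + 1)%C).
  { apply cvg_plus. apply cvg_mult. apply cvg_const. apply Lsmall. intros n. rewrite Cmod_R, Rabs_pos_eq. lra. left; apply Rinv_0_lt_compat; auto. apply cvg_const. }
  apply cvg_Cmod in LX. apply cvg_Cmod in LY. replace (S p + 0)%C with (S p) in LX by ring. replace (p * 0 + 1)%C with (RtoC 1) in LY by ring.
  rewrite Cmod_1 in LY.
  assert (Lsq : forall u l, is_lim_seq u (Finite l) -> is_lim_seq (fun n => u n ^ 2) (l ^ 2)).
  { intros u l Hu. apply is_lim_seq_ext with (fun n => u n * u n). intros; ring. replace (l ^ 2) with (l * l) by ring. apply is_lim_seq_mult'; auto. }
  assert (0 <= Re (S p) * 1 ^ 2 - Re p * Cmod (S p) ^ 2); [|lra].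
  eapply is_lim_seq_ge_const with (u := fun n => Re (S p) * Cmod (p * RtoC (/ q n) + 1)%C ^ 2 - Re p * Cmod (X n) ^ 2).
  intros n. specialize (T n). lra.
  apply is_lim_seq_minus'; apply is_lim_seq_mult'; try apply is_lim_seq_const; apply Lsq; auto.
Qed.

Lemma rhp_julia (F F1 F2 : C -> C) (K : C -> Prop) (p : C) : rhp_map F F1 F2 K -> rhp p ->
  Re p * Cmod (F2 p / F1 p)%C ^ 2 <= Re (F2 p / F1 p)%C.
Proof.
  intros HM Hp. assert (Hnz := rhp_der_neq_0 F F1 F2 K HM). assert (HM' := HM). destruct HM' as [HF [Hd [Hd2 _]]].
  assert (HF1 : analytic rhp F1) by (intros n; apply hol_der with F; auto; apply copen_rhp).
  assert (HF2 : analytic rhp F2) by (intros n; apply hol_der with F1; auto; apply copen_rhp).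
  apply (julia (fun p => F2 p / F1 p)%C); auto.
  - apply hol_div; auto.
  - intros; eapply rhp_S_nonneg; eauto.
  - intros q Hq. assert (Hr : rhp (RtoC q)) by (unfold rhp; rewrite Re_RtoC; auto).
    assert (B := rhp_second_der_bound F F1 F2 K _ HM Hr). rewrite Re_RtoC in B. specialize (Hnz _ Hr).
    assert (P : 0 < Cmod (F1 (RtoC q))) by (apply Cmod_gt_0; auto). rewrite Cmod_div by auto.
    apply Rmult_le_reg_r with (q * Cmod (F1 (RtoC q))). nra.
    replace (Cmod (F2 (RtoC q)) / Cmod (F1 (RtoC q)) * (q * Cmod (F1 (RtoC q)))) with (Cmod (F2 (RtoC q)) * q) by (field; lra).
    replace (/ q * (q * Cmod (F1 (RtoC q)))) with (Cmod (F1 (RtoC q))) by (field; lra). auto.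
Qed.

(** With p = a + ib and S = x + iy the claim is Re ((p^2 - 1) S) < a. Multiplied by x > 0, and with
    a x >= a^2 (x^2 + y^2), the difference of the two sides is at least (b x + a y)^2 + x^2 > 0. If
    x = 0, then S = 0. *)
Lemma log_der_half (p S : C) : 0 < Re p -> Re p * Cmod S ^ 2 <= Re S -> Re ((p - 1) * ((p + 1) * S - 1))%C < 1.
Proof.
  destruct p as [a b]. destruct S as [x y]. rewrite Cmod_sqr. unfold Re; simpl fst; simpl snd. intros Ha H.
  cut ((a ^ 2 - b ^ 2 - 1) * x - 2 * a * b * y < a). { intros Q. simpl. lra. }
  destruct (Req_dec x 0) as [->|Hx].
  - assert (y = 0) as ->.
    { apply Rsqr_0_uniq. apply Rle_antisym; [|apply Rle_0_sqr]. unfold Rsqr. apply Rmult_le_reg_l with a; auto. lra. }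
    lra.
  - assert (Hx0 : 0 < x) by nra. apply Rmult_lt_reg_r with x; auto.
    assert (0 <= (b * x + a * y) ^ 2) by apply pow2_ge_0.
    assert (a * (a * (x ^ 2 + y ^ 2)) <= a * x) by (apply Rmult_le_compat_l; lra). nra.
Qed.

(** The fraction is k'/k for k = f' (1-z)^3. In the coordinate p = (1+z)/(1-z), with S = F''/F', one
    has (p-1)((p+1) S - 1) = 2 z k'/k, so [log_der_half] applies to the conclusion of
    [rhp_julia]. *)
Lemma disc_map_der (f f1 : C -> C) : concave_map f f1 -> exists f2, (forall z, unit_disc z -> cder f1 z (f2 z)) /\ analytic unit_disc f1 /\
  forall z, unit_disc z -> Re (z * ((f2 z * (1 - z) - 3 * f1 z) / ((1 - z) * f1 z)))%C < 1 / 2.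
Proof.
  intros HC. assert (HC' := HC). destruct HC' as [Hf [Hd _]].
  assert (Hf1 : analytic unit_disc f1) by (intros n; apply hol_der with f; auto; apply copen_unit_disc).
  destruct (analytic_der unit_disc f1 copen_unit_disc Hf1) as [f2 [Hf2 _]]. exists f2. split; auto. split; auto.
  intros z Hz. destruct (concave_rhp_map f f1 HC) as [F2 HM].
  assert (N1 := one_minus_neq_0 z Hz). assert (Nf := concave_map_der_neq_0 f f1 HC z Hz).
  set (p := cayley z). assert (Hp : rhp p) by (apply cayley_rhp; auto).
  assert (N2 : RtoC 2 <> 0%C) by (intro G; apply RtoC_inj in G; lra).
  assert (Ep1 : (p + 1 = 2 / (1 - z))%C) by (unfold p, cayley; field; auto).
  assert (Ep2 : (p - 1 = 2 * z / (1 - z))%C) by (unfold p, cayley; field; auto).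
  assert (Ecay : cayley_inv 1 p = z) by (unfold cayley_inv; rewrite Ep1, Ep2; field; auto).
  assert (J := rhp_julia _ _ _ _ p HM Hp).
  assert (EF2 : F2 p = (f2 z * (2 / ((p + 1) * (p + 1))) * (2 / ((p + 1) * (p + 1))) - 4 * f1 z / ((p + 1) * (p + 1) * (p + 1)))%C).
  { assert (Np := rhp_plus_1 p Hp). apply (cder_unique (fun p => f1 (cayley_inv 1 p) * (2 / ((p + 1) * (p + 1))))%C p). apply HM; auto.
    eapply cder_eq. apply cder_mult. apply (cder_comp (cayley_inv 1) f1). apply cder_cayley_inv; auto. rewrite Ecay. apply Hf2; auto.
    apply (cder_mult (fun _ => 2%C) (fun p => / ((p + 1) * (p + 1)))%C). apply cder_const.
    apply (cder_inv (fun p => (p + 1) * (p + 1))%C). apply cder_mult; apply cder_plus; try apply cder_id; apply cder_const.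
    apply Cmult_neq_0; auto. cbv beta. rewrite Ecay. field. auto. }
  cbv beta in J. rewrite Ecay in J.
  match type of J with _ * Cmod ?S ^ 2 <= _ => set (S0 := S) in * end.
  assert (ES : S0 = ((f2 z * (1 - z) * (1 - z) - 2 * (1 - z) * f1 z) / (2 * f1 z))%C).
  { unfold S0. rewrite EF2, Ep1. field. auto. }
  assert (L := log_der_half p S0 Hp J). rewrite Ep1, Ep2, ES in L.
  replace (2 * z / (1 - z) * (2 / (1 - z) * ((f2 z * (1 - z) * (1 - z) - 2 * (1 - z) * f1 z) / (2 * f1 z)) - 1))%C
    with (RtoC 2 * (z * ((f2 z * (1 - z) - 3 * f1 z) / ((1 - z) * f1 z))))%C in L by (field; auto).
  rewrite Re_scal in L. lra.
Qed.

Lemma right_max_derivative (phi : R -> R) (l r : R) : 0 < r -> is_derive phi 0 l -> (forall t, 0 < t < r -> phi t <= phi 0) -> l <= 0.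
Proof.
  intros Hr H Hm. apply Rnot_lt_le. intro Hl. destruct (real_der_est phi 0 l H (l / 2) ltac:(lra)) as [d [Hd A]].
  pose proof (Rmin_l d r). pose proof (Rmin_r d r). assert (0 < Rmin d r) by (apply Rmin_glb_lt; auto).
  specialize (A (Rmin d r / 2)). rewrite Rabs_pos_eq in A by lra. specialize (A ltac:(lra)). rewrite Rplus_0_l in A.
  specialize (Hm (Rmin d r / 2) ltac:(lra)). unfold Rabs in A; destruct Rcase_abs in A; nra.
Qed.

(* Jack's lemma: at a point z0 of least modulus with |k - 1| = 1 the Schwarz lemma on
   |z| < |z0|, differentiated in the direction - z0 w/(1+w) with w = k(z0) - 1, gives
   Re (z0 k'/k) >= 1/2. *)
Lemma jack (k k1 : C -> C) : analytic unit_disc k -> (forall z, unit_disc z -> cder k z (k1 z)) -> k 0%C = 1%C ->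
  (forall z, unit_disc z -> k z <> 0%C) -> (forall z, unit_disc z -> Re (z * (k1 z / k z))%C < 1 / 2) ->
  forall z, unit_disc z -> Cmod (k z - 1)%C <= Cmod z.
Proof.
  intros Hk Hd H0 Hnz Hre. set (w := fun z => (k z - 1)%C).
  assert (Hw : analytic unit_disc w) by (intros n; apply hol_minus; auto; apply hol_const).
  assert (Hwc : forall z, unit_disc z -> ccont w z) by (intros; apply (Hw O); auto).
  assert (Hw0 : w 0%C = 0%C) by (unfold w; rewrite H0; ring).
  assert (Hlt : forall z, unit_disc z -> Cmod (w z) < 1).
  { intros z1 Hz1. apply Rnot_le_lt. intro Hge. assert (Hz1' := Hz1). unfold unit_disc in Hz1'.
    destruct (compact_max (fun z => Cmod z <= Cmod z1 /\ 1 <= Cmod (w z)) (fun z => - Cmod z) z1) as [z0 [[Hz0 Hz0w] Hmin]].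
    - split; auto. lra.
    - exists (Cmod z1). tauto.
    - intros s l Hs Hl.
      assert (Hle : Cmod l <= Cmod z1). { eapply is_lim_seq_le_const; [|apply cvg_Cmod; apply Hl]. intros n. apply Hs. }
      split; auto. eapply is_lim_seq_ge_const; [|apply cvg_Cmod; apply cvg_cont; [apply Hwc|apply Hl]]. intros n. apply Hs. unfold unit_disc; lra.
    - intros s l _ _ Hl. apply (is_lim_seq_opp _ (Cmod l)). apply cvg_Cmod; auto.
    - assert (Uz0 : unit_disc z0) by (unfold unit_disc; lra).
      assert (Hz0n : 0 < Cmod z0). { apply Cmod_gt_0. intros ->. rewrite Hw0, Cmod_0 in Hz0w. lra. }
      assert (Hin : forall x, unit_disc x -> unit_disc (z0 * x)%C /\ Cmod (z0 * x)%C < Cmod z0).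
      { intros x Hx. unfold unit_disc in *. rewrite Cmod_mult. pose proof (Cmod_ge_0 x). split; nra. }
      assert (SW : forall x, unit_disc x -> Cmod (w (z0 * x)%C) <= Cmod x).
      { apply (schwarz (fun x => w (z0 * x)%C)).
        - apply hol_comp with (V := unit_disc) (h := w); auto. apply Hin. apply hol_mult. apply hol_const. apply hol_id.
        - intros x Hx. left. apply Rnot_le_lt. intro Q. destruct (Hin x Hx) as [_ A]. specialize (Hmin (z0 * x)%C). simpl in Hmin. 
          specialize (Hmin ltac:(split; auto; lra)). lra.
        - rewrite Cmult_0_r. auto. }
      assert (Hw1 : Cmod (w z0) = 1).
      { apply Rle_antisym; auto.
        assert (L : cvg (fun n => z0 * RtoC (1 - / (INR n + 2)))%C (z0 * 1)%C).
        { apply cvg_mult. apply cvg_const. intros eps He. destruct (archimed_cor1 eps He) as [N [HN HN0]]. exists N. intros n Hn.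
          rewrite <- RtoC_minus, Cmod_R. replace (1 - / (INR n + 2) - 1) with (- / (INR n + 2)) by ring. rewrite Rabs_Ropp, Rabs_pos_eq.
          eapply Rle_lt_trans; [|apply HN]. apply Rinv_le_contravar. apply lt_0_INR; auto. apply le_INR in Hn. lra.
          left. apply Rinv_0_lt_compat. pose proof (pos_INR n). lra. }
        rewrite Cmult_1_r in L. eapply is_lim_seq_le_const; [|apply cvg_Cmod; apply cvg_cont; [apply Hwc; auto|apply L]].
        intros n. cbv beta. pose proof (pos_INR n). assert (Q : 0 < / (INR n + 2) < 1). { split. apply Rinv_0_lt_compat; lra. rewrite <- Rinv_1. apply Rinv_lt_contravar; lra. }
        assert (Qm : Cmod (RtoC (1 - / (INR n + 2))) = 1 - / (INR n + 2)) by (rewrite Cmod_R, Rabs_pos_eq; lra).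
        eapply Rle_trans. apply SW. unfold unit_disc. lra. lra. }
      specialize (Hnz z0 Uz0). specialize (Hre z0 Uz0).
      assert (Ek : k z0 = (1 + w z0)%C) by (unfold w; ring).
      set (v := w z0) in *. set (zt := (v / k z0)%C).
      (* v/(1+v) lies on the line Re = 1/2 whenever |v| = 1; hence 1 - t zt is in the disc for small
         t > 0. *)
      assert (Hzt : Re zt = 1 / 2).
      { assert (P : 0 < Cmod (k z0) ^ 2) by (apply pow_lt; apply Cmod_gt_0; auto).
        apply Rmult_eq_reg_r with (Cmod (k z0) ^ 2); [|lra].
        assert (Hv2 : fst v ^ 2 + snd v ^ 2 = 1) by (rewrite <- Cmod_sqr, Hw1; ring).
        unfold zt. rewrite Ek in *. rewrite Cmod_sqr in *. unfold Re, Cdiv, Cinv in *. simpl in *. field_simplify; nra. }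
      (* [SW] at the point 1 - t zt says phi t <= 0 = phi 0 for small t > 0. The resulting phi'(0)
         <= 0 reads 1 <= 2 Re (z0 k'/k), because Cconj v zt = 1/k(z0). *)
      set (phi := fun t : R => Cmod (w (z0 + RtoC t * - (z0 * zt))%C) ^ 2 - Cmod (1 + RtoC t * - zt)%C ^ 2).
      set (l := 2 * Re (Cconj v * (k1 z0 * - (z0 * zt)))%C - 2 * Re (- zt)%C).
      assert (Hl : l <= 0).
      { assert (Hzp : 0 < Cmod zt ^ 2).
        { apply pow_lt. apply Cmod_gt_0. intro E. rewrite E in Hzt. unfold Re in Hzt; simpl in Hzt; lra. }
        apply right_max_derivative with phi (/ Cmod zt ^ 2). apply Rinv_0_lt_compat; auto.
        - unfold phi, l. apply @is_derive_minus.
          + evar_last. apply (sq_path_derive w k1). eapply cder_eq. apply cder_plus. apply Hd. replace (z0 + RtoC 0 * - (z0 * zt))%C with z0 by ring. auto. apply cder_const. ring.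
            replace (z0 + RtoC 0 * - (z0 * zt))%C with z0 by ring. fold v. set (c := (k1 z0 * - (z0 * zt))%C). unfold Re; simpl; ring.
          + evar_last. apply (sq_path_derive (fun x => x) (fun _ => 1%C)). apply cder_id.
            replace (1 + RtoC 0 * - zt)%C with (RtoC 1) by ring. rewrite Cmult_1_l. unfold Re; simpl; ring.
        - intros t Ht. unfold phi. replace (z0 + RtoC 0 * - (z0 * zt))%C with z0 by ring. fold v. rewrite Hw1.
          replace (1 + RtoC 0 * - zt)%C with (RtoC 1) by ring. rewrite Cmod_1.
          assert (Ux : unit_disc (1 + RtoC t * - zt)%C).
          { assert (Q : Cmod (1 + RtoC t * - zt)%C ^ 2 = 1 - 2 * t * Re zt + t ^ 2 * Cmod zt ^ 2) by (rewrite !Cmod_sqr; unfold Re; simpl; ring).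
            rewrite Hzt in Q. assert (t * Cmod zt ^ 2 < 1). { apply Rlt_le_trans with (/ Cmod zt ^ 2 * Cmod zt ^ 2). apply Rmult_lt_compat_r; lra. rewrite Rinv_l; lra. }
            unfold unit_disc. pose proof (Cmod_ge_0 (1 + RtoC t * - zt)%C). nra. }
          specialize (SW _ Ux). replace (z0 * (1 + RtoC t * - zt))%C with (z0 + RtoC t * - (z0 * zt))%C in SW by ring.
          assert (Cmod (w (z0 + RtoC t * - (z0 * zt))%C) ^ 2 <= Cmod (1 + RtoC t * - zt)%C ^ 2). { apply pow_incr. split; auto. apply Cmod_ge_0. } lra. }
      unfold l in Hl. rewrite Re_opp, Hzt in Hl.
      assert (Hvv : (Cconj v * v = 1)%C). { rewrite Cmult_comm, <- Cmod2_conj, Hw1. f_equal. ring. }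
      replace (Cconj v * (k1 z0 * - (z0 * zt)))%C with (- ((Cconj v * v) * (z0 * (k1 z0 / k z0))))%C in Hl by (unfold zt; field; auto).
      rewrite Hvv, Cmult_1_l, Re_opp in Hl. lra. }
  apply (schwarz w); auto. intros z Hz. left. auto.
Qed.

(** * The refined bound for alpha = 2 *)

Lemma taylor_tail (a : nat -> C) (g : C -> C) : taylor a g ->
  exists h, taylor (fun n => a (S n)) h /\ forall z, unit_disc z -> (g z = a O + z * h z)%C.
Proof.
  intros Hg. destruct (disc_summable_taylor (fun n => a (S n))) as [h Hh].
  { intros r Hr. destruct (taylor_disc_summable _ _ Hg r Hr) as [M [HM H]]. exists (M / r). split. apply Rdiv_le_0_compat; lra.
    intros n. specialize (H (S n)). simpl in H. apply Rmult_le_reg_r with r. lra. unfold Rdiv. rewrite (Rmult_assoc M), Rinv_l by lra. lra. }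
  exists h. split; auto. intros z Hz. apply cvg_unique with (fun n => taylor_sum a z (S n)).
  - apply (cvg_sub (taylor_sum a z) _ S); auto.
  - apply cvg_ext with (fun n => a O + z * taylor_sum (fun n => a (S n)) z n)%C.
    + intros n. unfold taylor_sum. rewrite csum_S. simpl. rewrite <- csum_scal. f_equal. ring. apply csum_ext. intros; ring.
    + apply cvg_plus. apply cvg_const. apply cvg_mult; auto. apply cvg_const.
Qed.

Lemma csum_diff (a : nat -> C) (n : nat) : csum (fun i => a i - shift a i)%C (S n) = a n.
Proof.
  induction n. simpl. ring. rewrite csum_last, IHn. simpl. ring.
Qed.

Lemma csum_one_plus (u : nat -> C) (n : nat) :
  csum (fun i => 1 + csum u i)%C (S n) = (RtoC (INR (S n)) + csum (fun j => csum u (S j)) n)%C.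
Proof.
  rewrite csum_plus, (csum_S (csum u)). simpl (csum u 0). rewrite Cplus_0_l. f_equal.
  generalize (S n). intros m. induction m. auto. rewrite csum_last, IHm, S_INR, RtoC_plus. auto.
Qed.

Lemma rsum_INR (n : nat) : rsum INR (S n) = INR n * (INR n + 1) / 2.
Proof. induction n. simpl. field. change (rsum INR (S (S n))) with (rsum INR (S n) + INR (S n)). rewrite IHn, S_INR. field. Qed.

(** Dividing a series by 1-z is partial summation, so the levels [c], [b] and [deriv_coef a] undo
    the three factors of k = (1-z)^3 f' = 1 + z phi. The term 1 contributes (n+1)(n+2)/2 to the n-th
    coefficient of f', and phi at most 0 + 1 + ... + n = n(n+1)/2 by the Fejer bound; division by
    n+1 gives the centre and the radius for a_(n+1). *)
Lemma coef_bound_2 (f f1 : C -> C) (a : nat -> C) : concave_map f f1 -> taylor (deriv_coef a) f1 ->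
  forall n, Cmod (a (S n) - RtoC ((INR n + 2) / 2))%C <= INR n / 2.
Proof.
  intros HC Hf1 n. destruct (disc_map_der f f1 HC) as [f2 [Hf2 [Af1 HR]]].
  assert (Hnz := concave_map_der_neq_0 f f1 HC). assert (H10 : f1 0%C = 1%C) by apply HC.
  set (k := fun z => ((1 - z) * ((1 - z) * ((1 - z) * f1 z)))%C).
  set (b := fun n => (deriv_coef a n - shift (deriv_coef a) n)%C). set (c := fun n => (b n - shift b n)%C).
  set (kc := fun n => (c n - shift c n)%C).
  assert (Hk : taylor kc k). { apply taylor_minus_shift. apply taylor_minus_shift. apply taylor_minus_shift. auto. }
  assert (HJ : forall z, unit_disc z -> Cmod (k z - 1)%C <= Cmod z).
  { apply (jack k (fun z => (1 - z) * (1 - z) * (f2 z * (1 - z) - 3 * f1 z))%C).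
    - eapply taylor_analytic; eauto.
    - intros z Hz. unfold k. assert (D1 : cder (fun z => 1 - z)%C z (- (1))%C).
      { eapply cder_eq. apply cder_plus. apply cder_const. apply cder_opp. apply cder_id. ring. }
      eapply cder_eq. apply cder_mult. apply D1. apply cder_mult. apply D1. apply cder_mult. apply D1. apply Hf2; auto. cbv beta. ring.
    - unfold k. rewrite H10. ring.
    - intros z Hz. assert (N1 := one_minus_neq_0 z Hz). unfold k. repeat apply Cmult_neq_0; auto.
    - intros z Hz. assert (N1 := one_minus_neq_0 z Hz). specialize (Hnz z Hz). specialize (HR z Hz).
      replace ((1 - z) * (1 - z) * (f2 z * (1 - z) - 3 * f1 z) / k z)%C with ((f2 z * (1 - z) - 3 * f1 z) / ((1 - z) * f1 z))%C; auto.
      unfold k. field. auto. }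
  destruct (taylor_tail kc k Hk) as [phi [Hphi Ek]].
  assert (Hkc0 : kc O = 1%C). { rewrite <- (taylor_at_0 _ _ Hk). unfold k. rewrite H10. ring. }
  set (ph := fun n => kc (S n)) in *.
  assert (HF : forall m, Cmod (csum (fun j => csum ph (S j)) m) <= INR m).
  { intros m. apply fejer with phi; auto. intros z Hz Hn. specialize (HJ z Hz). rewrite Ek, Hkc0 in HJ by auto.
    replace (1 + z * phi z - 1)%C with (z * phi z)%C in HJ by ring. rewrite Cmod_mult in HJ.
    assert (0 < Cmod z) by (apply Cmod_gt_0; auto). nra. }
  assert (Ec : forall m, c m = (1 + csum ph m)%C).
  { intros m. rewrite <- (csum_diff c m). fold kc. rewrite csum_S, Hkc0. auto. }
  assert (Eb : forall m, b m = (RtoC (INR (S m)) + csum (fun j => csum ph (S j)) m)%C).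
  { intros m. rewrite <- (csum_diff b m). fold c. rewrite (csum_ext _ (fun i => 1 + csum ph i)%C) by auto. apply csum_one_plus. }
  assert (Ed : deriv_coef a n = (RtoC (INR (S n) * (INR n + 2) / 2) + csum (fun i => csum (fun j => csum ph (S j)) i) (S n))%C).
  { rewrite <- (csum_diff (deriv_coef a) n). fold b. rewrite (csum_ext _ (fun i => RtoC (INR (S i)) + csum (fun j => csum ph (S j)) i)%C) by auto.
    rewrite csum_plus. f_equal. rewrite csum_RtoC. f_equal.
    assert (E : forall m, rsum (fun i => INR (S i)) m = rsum INR (S m)). { intros m. rewrite rsum_S. simpl. ring. }
    rewrite E, rsum_INR, S_INR. field. }
  assert (HnP : 0 < INR (S n)) by (apply lt_0_INR; lia).
  assert (HnC : RtoC (INR (S n)) <> 0%C) by (intro E; apply RtoC_inj in E; lra).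
  apply Rmult_le_reg_l with (INR (S n)); auto.
  replace (INR (S n) * Cmod (a (S n) - RtoC ((INR n + 2) / 2))%C) with (Cmod (csum (fun i => csum (fun j => csum ph (S j)) i) (S n))).
  - eapply Rle_trans. apply Cmod_csum with (b := INR). intros; apply HF. rewrite rsum_INR, S_INR. lra.
  - rewrite <- (Rabs_pos_eq (INR (S n))) by lra. rewrite <- Cmod_R, <- Cmod_mult. f_equal.
    transitivity (deriv_coef a n - RtoC (INR (S n) * (INR n + 2) / 2))%C. rewrite Ed. ring.
    unfold deriv_coef, Rdiv. rewrite !RtoC_mult. ring.
Qed.

(** Derivatives of all orders are read off the given power series, and f'(0) = 1 off its coefficient
    of degree 1. *)
Lemma CO_concave_map (alpha : R) (f : C -> C) (a : nat -> C) : CO alpha f -> a 1%nat = RtoC 1 -> expands_on_disc f a ->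
  exists f1, concave_map f f1 /\ taylor (deriv_coef a) f1.
Proof.
  intros [_ [Hi [Hc [Hinf [H0 _]]]]] H1 He. apply expands_taylor in He.
  destruct (taylor_der_exists a f He) as [f1 [Hf1 Hd]]. exists f1. split; auto.
  split; [|split; [|split; [|split; [|split; [|split]]]]]; auto.
  - eapply taylor_analytic; eauto.
  - intros M. assert (Q : Rbar_locally p_infty (fun x => M < x)) by (exists M; auto).
    specialize (Hinf _ Q). unfold filtermap, within in Hinf. destruct Hinf as [eps H]. exists eps. split. apply cond_pos.
    intros z Hz Hd1. apply H; auto. split.
    + change (Rabs (fst z - 1) < eps). eapply Rle_lt_trans; [|apply Hd1]. apply (Re_le_Cmod (z - 1)%C).
    + change (Rabs (snd z - 0) < eps). eapply Rle_lt_trans; [|apply Hd1]. apply (Im_le_Cmod (z - 1)%C).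
  - rewrite (taylor_at_0 _ _ Hf1). unfold deriv_coef. rewrite H1. simpl. ring.
Qed.

Lemma cder_is_derive (f : C -> C) (z d : C) : cder f z d -> @is_derive C_AbsRing C_NormedModule f z d.
Proof.
  intros H. split.
  - apply (@is_linear_scal_l C_AbsRing C_NormedModule).
  - intros x Hx.
    apply (@is_filter_lim_locally_unique C_AbsRing (AbsRing_NormedModule C_AbsRing)) in Hx. subst x.
    intros eps. destruct (H eps (cond_pos eps)) as [r [Hr Hw]]. exists (mkposreal r Hr). intros y Hy.
    change (Cmod (f y - f z - (y - z) * d)%C <= eps * Cmod (y - z)%C). rewrite (Cmult_comm (y - z)%C). apply Hw. apply Hy.
Qed.

(** * Sharpness *)

(** One extremal function for every n: its coefficients from degree 1 on are all 1, at distance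
    (n-1)/2 from (n+1)/2. *)
Definition half_plane_map (z : C) : C := (z / (1 - z))%C.
Definition half_plane_map_coef (n : nat) : C := match n with O => RtoC 0 | S _ => RtoC 1 end.

Lemma taylor_half_plane_map : taylor half_plane_map_coef half_plane_map.
Proof.
  intros z Hz. assert (N1 := one_minus_neq_0 z Hz).
  assert (E : forall n, (taylor_sum half_plane_map_coef z (S n) - half_plane_map z = - (z * z ^ n) / (1 - z))%C).
  { intros n. unfold half_plane_map. induction n. unfold taylor_sum; simpl. field. auto.
    change (taylor_sum half_plane_map_coef z (S (S n))) with (taylor_sum half_plane_map_coef z (S n) + 1 * z ^ S n)%C.
    replace (taylor_sum half_plane_map_coef z (S n) + 1 * z ^ S n - z / (1 - z))%C with ((taylor_sum half_plane_map_coef z (S n) - z / (1 - z)) + z ^ S n)%C by ring.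
    rewrite IHn. simpl. field. auto. }
  assert (P : 0 < Cmod (1 - z)%C) by (apply Cmod_gt_0; auto). pose proof (Cmod_ge_0 z). unfold unit_disc in Hz.
  intros eps He. destruct (pow_small (Cmod z) (/ Cmod (1 - z)%C) eps ltac:(lra) He) as [N HN].
  exists (S N). intros n Hn. destruct n as [|n]; [lia|]. rewrite E, Cmod_div, Cmod_opp, Cmod_mult, Cmod_pow by auto.
  eapply Rle_lt_trans; [|apply HN]. unfold Rdiv. rewrite Rmult_comm. apply Rmult_le_compat_l. left; apply Rinv_0_lt_compat; auto.
  replace n with (N + (n - N))%nat by lia. rewrite pow_add.
  assert (0 <= Cmod z ^ N) by (apply pow_le; auto). assert (0 <= Cmod z ^ (n - N) <= 1).
  { split. apply pow_le; auto. rewrite <- (pow1 (n - N)). apply pow_incr. lra. }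
  replace (Cmod z ^ N) with (1 * (Cmod z ^ N * 1)) at 2 by ring. apply Rmult_le_compat; try lra.
  apply Rmult_le_pos; lra. apply Rmult_le_compat_l; lra.
Qed.

(** The inverse is w/(1+w), and |1+w|^2 - |w|^2 = 1 + 2 Re w decides whether it lies in the disc. *)
Lemma image_half_plane_map (w : C) : image unit_disc half_plane_map w <-> - (1 / 2) < Re w.
Proof.
  assert (Id : forall w, Cmod (1 + w)%C ^ 2 - Cmod w ^ 2 = 1 + 2 * Re w) by (intros; rewrite !Cmod_sqr; unfold Re; simpl; ring).
  split.
  - intros [z [Hz <-]]. assert (N1 := one_minus_neq_0 z Hz). specialize (Id (half_plane_map z)).
    assert (E1 : (1 + half_plane_map z = / (1 - z))%C) by (unfold half_plane_map; field; auto).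
    rewrite E1 in Id. unfold half_plane_map in Id at 1. unfold Cdiv in Id. rewrite Cmod_mult, Cmod_inv in Id by auto.
    assert (P : 0 < / Cmod (1 - z)%C) by (apply Rinv_0_lt_compat; apply Cmod_gt_0; auto).
    unfold unit_disc in Hz. pose proof (Cmod_ge_0 z).
    assert (Q1 : 0 < 1 - Cmod z ^ 2) by (clear - Hz H; nra).
    assert (Q2 := Rmult_lt_0_compat _ _ (pow_lt _ 2 P) Q1).
    rewrite Rpow_mult_distr in Id. lra.
  - intros Hw. assert (N1 : (1 + w)%C <> 0%C). { apply Re_pos_neq_0. rewrite Re_plus. unfold Re in *; simpl; lra. }
    exists (w / (1 + w))%C. split.
    + unfold unit_disc. rewrite Cmod_div by auto. assert (P : 0 < Cmod (1 + w)%C) by (apply Cmod_gt_0; auto).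
      apply Rmult_lt_reg_r with (Cmod (1 + w)%C); auto. unfold Rdiv. rewrite Rmult_assoc, Rinv_l, Rmult_1_r, Rmult_1_l by lra.
      apply Cmod_lt_of_sqr. specialize (Id w). lra.
    + unfold half_plane_map. replace (1 - w / (1 + w))%C with (/ (1 + w))%C by (field; auto). field. auto.
Qed.

Lemma complement_half_plane_map (w : C) : complement (image unit_disc half_plane_map) w <-> Re w <= - (1 / 2).
Proof. unfold complement. rewrite image_half_plane_map. split; lra. Qed.

(** The recession cone of the closed half-plane is Re v <= 0, with trace the arc from PI/2 to 3
    PI/2; the opening angle is PI. *)
Lemma opening_half_plane_map : opening_angle_at_infinity (image unit_disc half_plane_map) <= PI * 2.
Proof.
  unfold opening_angle_at_infinity. pose proof PI_RGT_0 as HPI.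
  set (V := recession_cone (complement (image unit_disc half_plane_map))).
  assert (HV : forall v, V v <-> Re v <= 0).
  { intros v. split.
    - intros Hv. apply Rnot_lt_le. intro Hp. specialize (Hv (RtoC (-1)) (/ Re v)).
      rewrite !complement_half_plane_map, Re_plus, Re_scal, Re_RtoC, Rinv_l in Hv by lra.
      assert (0 < / Re v) by (apply Rinv_0_lt_compat; auto). specialize (Hv ltac:(lra) ltac:(lra)). lra.
    - intros Hv x t Hx Ht. rewrite complement_half_plane_map in *. rewrite Re_plus, Re_scal. nra. }
  assert (E : cone_angle V = 1 * (3 * (PI / 2) - PI / 2)).
  { unfold cone_angle. apply RInt_step; try lra.
    - intros x Hx. destruct excluded_middle_informative as [Q|]; auto. apply HV in Q. simpl in Q.
      assert (0 < cos x) by (apply cos_gt_0; lra). unfold Re in Q; simpl in Q. lra.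
    - intros x Hx. destruct excluded_middle_informative as [|Q]; auto. exfalso. apply Q. apply HV. simpl. apply cos_le_0; lra.
    - intros x Hx. destruct excluded_middle_informative as [Q|]; auto. apply HV in Q. simpl in Q.
      assert (0 < cos (x - 2 * PI)) by (apply cos_gt_0; lra). rewrite cos_minus, cos_2PI, sin_2PI in H. unfold Re in Q; simpl in Q. lra. }
  rewrite E. lra.
Qed.

Lemma CO_half_plane_map : CO 2 half_plane_map.
Proof.
  destruct (taylor_der_exists _ _ taylor_half_plane_map) as [g [Hg Hd]].
  split; [|split; [|split; [|split; [|split; [|split]]]]].
  - intros z Hz. exists (g z). apply cder_is_derive. auto.
  - intros z w Hz Hw E. assert (N1 := one_minus_neq_0 z Hz). assert (N2 := one_minus_neq_0 w Hw). unfold half_plane_map in E.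
    assert (E1 : (/ (1 - z) = / (1 - w))%C).
    { replace (/ (1 - z))%C with (1 + z / (1 - z))%C by (field; auto). rewrite E. field. auto. }
    replace z with (1 - / / (1 - z))%C by (field; auto). rewrite E1. field. auto.
  - intros x y t Hx Hy Ht. rewrite complement_half_plane_map in *. rewrite Re_plus, !Re_scal. nra.
  - intros P [M HM]. unfold filtermap, within.
    set (B := Rabs M + 1). pose proof (Rabs_pos M). pose proof (Rle_abs M).
    (* Neighbourhoods are products of intervals: two coordinates within 1/(8B) give |1-z| < 1/(4B)
       <= 1/4, hence |z| > 1/2 and |z|/|1-z| > B. *)
    assert (He : 0 < / (8 * B)) by (apply Rinv_0_lt_compat; unfold B; lra).
    exists (mkposreal _ He). intros z [H1 H2] Hz. apply HM.
    change (Rabs (fst z - 1) < / (8 * B)) in H1. change (Rabs (snd z - 0) < / (8 * B)) in H2.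
    assert (N1 := one_minus_neq_0 z Hz). assert (P1 : 0 < Cmod (1 - z)%C) by (apply Cmod_gt_0; auto).
    assert (Hs : Cmod (1 - z)%C < / (4 * B)).
    { rewrite Cmod_sub_sym. eapply Rle_lt_trans. apply Cmod_le_abs. simpl. replace (snd z + - 0) with (snd z - 0) by ring.
      replace (fst z + - (1)) with (fst z - 1) by ring. replace (/ (4 * B)) with (/ (8 * B) + / (8 * B)) by (field; unfold B; lra). lra. }
    assert (HB : / (4 * B) <= / 4). { apply Rinv_le_contravar; unfold B; lra. }
    assert (Hz2 : / 2 < Cmod z). { pose proof (Cmod_triangle (1 - z)%C z). replace (1 - z + z)%C with (RtoC 1) in H3 by ring. rewrite Cmod_1 in H3. lra. }
    unfold half_plane_map. rewrite Cmod_div by auto.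
    apply Rmult_lt_reg_r with (Cmod (1 - z)%C); auto. unfold Rdiv. rewrite Rmult_assoc, Rinv_l, Rmult_1_r by lra.
    apply Rle_lt_trans with (B * / (4 * B)).
    + apply Rle_trans with (B * Cmod (1 - z)%C). apply Rmult_le_compat_r; unfold B; lra. apply Rmult_le_compat_l; unfold B in *; lra.
    + replace (B * / (4 * B)) with (/ 4) by (field; unfold B; lra). lra.
  - unfold half_plane_map. field.
  - apply cder_is_derive. replace (RtoC 1) with (g 0%C). apply Hd. apply unit_disc_0.
    rewrite (taylor_at_0 _ _ Hg). unfold deriv_coef. simpl. ring.
  - apply opening_half_plane_map.
Qed.

Theorem corollary4 :
  (forall (alpha : R) (f : C -> C) (a : nat -> C) (A : nat -> R),
     1 < alpha <= 2 ->
     CO alpha f ->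
     a 0%nat = RtoC 0 -> a 1%nat = RtoC 1 -> expands_on_disc f a ->
     is_half_plane_power_coeffs alpha A ->
     forall n : nat, (2 <= n)%nat ->
       Cmod (a n) <= 1 / (2 * alpha) * A n)
  /\
  (forall (f : C -> C) (a : nat -> C),
     CO 2 f ->
     a 0%nat = RtoC 0 -> a 1%nat = RtoC 1 -> expands_on_disc f a ->
     forall n : nat, (2 <= n)%nat ->
       Cmod (a n - RtoC ((INR n + 1) / 2))%C <= (INR n - 1) / 2)
  /\
  (forall n : nat, (2 <= n)%nat ->
     exists (f : C -> C) (a : nat -> C),
       CO 2 f /\
       a 0%nat = RtoC 0 /\ a 1%nat = RtoC 1 /\ expands_on_disc f a /\
       Cmod (a n - RtoC ((INR n + 1) / 2))%C = (INR n - 1) / 2).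
Proof.
  split; [|split].
  - intros alpha f a A Ha HCO _ H1 He HA n Hn. destruct (CO_concave_map alpha f a HCO H1 He) as [f1 [HC Hf1]].
    apply (coef_bound_half_plane f f1 a A alpha); auto. apply HCO. lia.
  - intros f a HCO _ H1 He n Hn. destruct (CO_concave_map 2 f a HCO H1 He) as [f1 [HC Hf1]].
    destruct n as [|n]; [lia|]. rewrite S_INR. replace (INR n + 1 + 1) with (INR n + 2) by ring. replace (INR n + 1 - 1) with (INR n) by ring.
    apply (coef_bound_2 f f1); auto.
  - intros n Hn. exists half_plane_map, half_plane_map_coef. split; [|split; [|split; [|split]]]; auto.
    + apply CO_half_plane_map.
    + apply expands_taylor. apply taylor_half_plane_map.
    + destruct n as [|n]; [lia|]. simpl half_plane_map_coef. rewrite <- RtoC_minus, Cmod_R, Rabs_left1. field.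
      apply le_INR in Hn. simpl (INR 2) in Hn. lra.
Qed.
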